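(* Let $D\subset\mathbb{C}^n$ be a strongly $\alpha$-regular domain, let $K\subset D$ be a compact set, and let $\psi:K\to\mathbb{R}$ be a Hölder continuous function with $\psi<0$ on $K$ which admits a negative $\alpha$-subharmonic extension to $D$ (some $\widetilde\psi\in\alpha\text{-}sh(D)$ with $\widetilde\psi<0$ on $D$ and $\widetilde\psi|_K=\psi$). Then $\omega_\alpha(\cdot,K,D,\psi)$ is Hölder continuous in $D$ if and only if there exist constants $C>0$ and $0<\lambda\le1$ and a neighborhood $V$ of $K$ such that \[ |\omega_\alpha(z,K,D,\psi)-\psi(w)|\le C\,(\operatorname{dist}(z,K))^{\lambda} \] for every $z\in V\cap D$ and every point $w\in K$ with $|z-w|=\operatorname{dist}(z,K)$.
   Context: Fix a closed, strictly positive differential form $\alpha$ of bidegree $(n-1,n-1)$ with $C^1$ coefficients on an open subset of $\mathbb{C}^n$ containing all sets considered. Let $d=\partial+\bar\partial$, $d^c=(\bar\partial-\partial)/(4i)$. For an open set $\Omega$, $u\in L^1_{loc}(\Omega)$ is $\alpha$-subharmonic ($u\in\alpha\text{-}sh(\Omega)$) if it is strongly upper semicontinuous (upper semicontinuous, and for every $z^0\in\Omega$ and every set $A$ of full Lebesgue measure near $z^0$, $\limsup_{z\to z^0,z\in A}u(z)=u(z^0)$) and $\int u\,\alpha\wedge dd^c\omega\ge0$ for every nonnegative test function $\omega$; $u\equiv-\infty$ is also allowed. $u$ is strictly $\alpha$-subharmonic in $\Omega$ if for every $G\Subset\Omega$ there is $\varepsilon>0$ with $u-\varepsilon|z|^2\in\alpha\text{-}sh(G)$.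 A bounded domain $D$ is strongly $\alpha$-regular if there exist a neighborhood $D^+$ of $\overline D$ and $\rho\in\alpha\text{-}sh(D^+)\cap C^2(D^+)$, strictly $\alpha$-subharmonic in $D^+$, with $\rho<0$ on $D$ and $\rho(z)\to0$ as $z\to\partial D$. For $E\subset D$ and bounded $\psi$ on $E$ with $\sup_E\psi<0$, $\mathcal U(E,D,\psi)$ is the class of $u\in\alpha\text{-}sh(D)$ with $u<0$ on $D$ and $u\le\psi$ on $E$, and $\omega_\alpha(z,E,D,\psi)=\sup\{u(z):u\in\mathcal U(E,D,\psi)\}$. *)

(* Defs.v *)
From HB Require Import structures.
From mathcomp Require Import all_boot all_order all_algebra.
From mathcomp Require Import all_classical all_reals all_analysis measurable_realfun.
From mathcomp Require Import complex.
Import Order.TTheory GRing.Theory Num.Theory.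
Import numFieldNormedType.Exports.

Set Implicit Arguments.
Unset Strict Implicit.
Unset Printing Implicit Defensive.

Local Open Scope classical_set_scope.
Local Open Scope ring_scope.

(** * The space C^n, in real coordinates.
    A point z = (z_1,...,z_n) of C^n, z_j = x_j + i y_j, is represented by
    the real row vector  (x_1,...,x_n, y_1,...,y_n) : 'rV[R]_(n + n).       *)

Notation pt R n := ('rV[R]_(n + n)) (only parsing).

Section Alpha.
Variable R : realType.

Definition xi n (j : 'I_n) : 'I_(n + n) := lshift n j.
Definition yi n (j : 'I_n) : 'I_(n + n) := rshift n j.

Definition sqnorm n (z : pt R n) : R := \sum_(i < n + n) (z 0 i) ^+ 2.
Definition enorm n (z : pt R n) : R := Num.sqrt (sqnorm z).

Definition dist n (z : pt R n) (K : set (pt R n)) : R :=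
  inf [set enorm (z - w) | w in K].

Definition pd n (a : 'I_(n + n)) (f : pt R n -> R) : pt R n -> R :=
  fun p => 'D_(delta_mx 0 a : pt R n) f p.

Definition iter_pd n (s : seq 'I_(n + n)) (f : pt R n -> R) : pt R n -> R :=
  foldr (@pd n) f s.

Definition Ck n (k : nat) (U : set (pt R n)) (f : pt R n -> R) : Prop :=
  (forall s : seq 'I_(n + n), (size s < k)%N ->
     forall a p, U p -> derivable (iter_pd s f) p (delta_mx 0 a : pt R n)) /\
  (forall s : seq 'I_(n + n), (size s <= k)%N ->
     forall p, U p -> (iter_pd s f x @[x --> p] --> iter_pd s f p)).

Definition smooth n (f : pt R n -> R) : Prop := forall k, Ck k setT f.

Definition test_fun n (Omega : set (pt R n)) (f : pt R n -> R) : Prop :=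
  smooth f /\ (forall p, 0 <= f p) /\
  exists C : set (pt R n), [/\ compact C, C `<=` Omega & forall p, ~ C p -> f p = 0].

Local Open Scope complex_scope.

Definition pdC n (a : 'I_(n + n)) (g : pt R n -> R[i]) : pt R n -> R[i] :=
  fun p => (pd a (fun q => complex.Re (g q)) p) +i* (pd a (fun q => complex.Im (g q)) p).

Definition dz n (j : 'I_n) (g : pt R n -> R[i]) : pt R n -> R[i] :=
  fun p => (pdC (xi j) g p - 'i * pdC (yi j) g p) / 2%:R.
Definition dzb n (j : 'I_n) (g : pt R n -> R[i]) : pt R n -> R[i] :=
  fun p => (pdC (xi j) g p + 'i * pdC (yi j) g p) / 2%:R.

(** ** The form alpha.
    A (n-1,n-1)-form alpha on C^n is encoded by its coefficient matrix
    a : pt R n -> 'M[R[i]]_n, defined by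
        alpha /\ (i/2) dz_j /\ dzbar_k = a_{jk} dV     (dV = Lebesgue volume form).
    Then, for a (1,1)-form beta = (i/2) sum_{jk} b_{jk} dz_j /\ dzbar_k,
        alpha /\ beta = (sum_{jk} a_{jk} b_{jk}) dV,
    and for a C^2 function w,
        alpha /\ dd^c w = c * (sum_{jk} a_{jk} d^2 w/dz_j dzbar_k) dV ,  c > 0. *)

Definition coef_form (n : nat) := pt R n -> 'M[R[i]]_n.

Definition form_C1 n (U : set (pt R n)) (a : coef_form n) : Prop :=
  forall j k, Ck 1 U (fun p => complex.Re (a p j k)) /\ Ck 1 U (fun p => complex.Im (a p j k)).

(* d alpha = 0 on U, written in coefficients:
   (d alpha = 0  <=>  sum_j d a_{jk}/dz_j = 0 for all k  and
                      sum_k d a_{jk}/dzbar_k = 0 for all j) *)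
Definition form_closed n (U : set (pt R n)) (a : coef_form n) : Prop :=
  forall p, U p ->
    (forall k : 'I_n, \sum_(j < n) dz j (fun q => a q j k) p = 0) /\
    (forall j : 'I_n, \sum_(k < n) dzb k (fun q => a q j k) p = 0).

(* alpha strictly positive on U: alpha /\ beta > 0 for every nonzero positive
   (1,1)-form beta; equivalently (rank-one beta's) the (complex) number
   sum_{jk} a_{jk}(p) xi_j conj(xi_k) is real and > 0 for every xi <> 0. *)
Definition form_strictly_positive n (U : set (pt R n)) (a : coef_form n) : Prop :=
  forall p, U p -> forall v : 'rV[R[i]]_n, v != 0 ->
    0 < \sum_(j < n) \sum_(k < n) a p j k * v 0 j * (v 0 k)^*.

(* The density of alpha /\ dd^c w with respect to Lebesgue measure
   (up to the fixed positive normalising constant):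
   L_a w = sum_{jk} a_{jk} d^2 w / dz_j dzbar_k  (real since a is hermitian) *)
Definition Lop n (a : coef_form n) (w : pt R n -> R) : pt R n -> R :=
  fun p => complex.Re (\sum_(j < n) \sum_(k < n)
                 a p j k * dz j (dzb k (fun q => (w q)%:C)) p).

Local Close Scope complex_scope.

Local Open Scope ereal_scope.

(* iterated Lebesgue integral over R^m (by Fubini-Tonelli this is the Lebesgue
   integral on R^m for nonnegative or integrable Borel functions) *)
Fixpoint iint (m : nat) : ('rV[R]_m -> \bar R) -> \bar R :=
  match m with
  | 0%N => fun f => f 0%R
  | k.+1 => fun f =>
      \int[lebesgue_measure]_x iint (fun v : 'rV[R]_k => f (row_mx (@const_mx R 1 1 x) v))
  end.

Definition borel n (A : set (pt R n)) : Prop := <<s [set B : set (pt R n) | open B] >> A.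

Definition borel_fun n (D : set (pt R n)) (f : pt R n -> \bar R) : Prop :=
  forall B : set (\bar R), measurable B -> borel (D `&` f @^-1` B).

Definition leb_int n (f : pt R n -> \bar R) : \bar R := iint f.

Definition null_borel n (N : set (pt R n)) : Prop :=
  borel N /\ leb_int (fun p => (\1_N p)%:E) = 0.

Definition full_measure_near n (A : set (pt R n)) (z0 : pt R n) : Prop :=
  exists V N, [/\ nbhs z0 V, null_borel N & V `\` N `<=` A].

Definition L1loc n (Omega : set (pt R n)) (u : pt R n -> \bar R) : Prop :=
  borel_fun Omega u /\
  forall C : set (pt R n), compact C -> C `<=` Omega ->
    leb_int (fun p => (\1_C p)%:E * `|u p|) < +oo.

Definition usc n (Omega : set (pt R n)) (u : pt R n -> \bar R) : Prop :=
  forall z0, Omega z0 -> u z0 < +oo /\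
    forall M : R, u z0 < M%:E -> \forall z \near z0, u z < M%:E.

Definition strongly_usc n (Omega : set (pt R n)) (u : pt R n -> \bar R) : Prop :=
  usc Omega u /\
  forall z0, Omega z0 -> forall A : set (pt R n), full_measure_near A z0 ->
    (* limsup_{z -> z0, z in A} u z = u z0  (the inequality <= is given by usc) *)
    forall M : R, M%:E < u z0 -> forall r : R, (0 < r)%R ->
      exists z, [/\ A z, (enorm (z - z0) < r)%R & M%:E < u z].

Definition alpha_sh n (a : coef_form n) (Omega : set (pt R n)) (u : pt R n -> \bar R)
  : Prop :=
  (forall z, Omega z -> u z = -oo) \/
  [/\ L1loc Omega u, strongly_usc Omega u &
      forall w : pt R n -> R, test_fun Omega w ->
        0 <= leb_int (fun p => if `[< Omega p >] then u p * (Lop a w p)%:E else 0)].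

Definition rel_compact_open n (G Omega : set (pt R n)) : Prop :=
  [/\ open G, compact (closure G) & closure G `<=` Omega].

Definition strictly_alpha_sh n (a : coef_form n) (Omega : set (pt R n))
  (u : pt R n -> \bar R) : Prop :=
  forall G, rel_compact_open G Omega ->
    exists eps : R, (0 < eps)%R /\
      alpha_sh a G (fun z => u z - (eps * sqnorm z)%:E).

Definition bounded_domain n (D : set (pt R n)) : Prop :=
  [/\ open D, connected D, D !=set0 & exists M : R, forall z, D z -> (enorm z <= M)%R].

(* strongly alpha-regular domain; U is the open set on which alpha lives *)
Definition strongly_alpha_regular n (a : coef_form n) (U D : set (pt R n)) : Prop :=
  bounded_domain D /\
  exists (Dp : set (pt R n)) (rho : pt R n -> R),
    [/\ open Dp, closure D `<=` Dp & Dp `<=` U] /\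
    [/\ Ck 2 Dp rho, alpha_sh a Dp (fun z => (rho z)%:E),
        strictly_alpha_sh a Dp (fun z => (rho z)%:E),
        (forall z, D z -> (rho z < 0)%R) &
        forall zeta, closure D zeta -> ~ D zeta ->
          forall e : R, (0 < e)%R -> exists d : R, (0 < d)%R /\
            forall z, D z -> (enorm (z - zeta) < d)%R -> (`|rho z| < e)%R].

Definition U_class n (a : coef_form n) (E D : set (pt R n)) (psi : pt R n -> R)
  (u : pt R n -> \bar R) : Prop :=
  [/\ alpha_sh a D u, (forall z, D z -> u z < 0) &
      forall z, E z -> u z <= (psi z)%:E].

Definition omega_alpha n (a : coef_form n) (E D : set (pt R n)) (psi : pt R n -> R)
  (z : pt R n) : \bar R :=
  ereal_sup [set u z | u in U_class a E D psi].

Definition holder_real n (S : set (pt R n)) (f : pt R n -> R) : Prop :=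
  exists C lam : R, [/\ (0 < C)%R, (0 < lam <= 1)%R &
    forall z w, S z -> S w -> (`|f z - f w| <= C * enorm (z - w) `^ lam)%R].

Definition holder_ereal n (S : set (pt R n)) (f : pt R n -> \bar R) : Prop :=
  (forall z, S z -> f z \is a fin_num) /\
  exists C lam : R, [/\ (0 < C)%R, (0 < lam <= 1)%R &
    forall z w, S z -> S w -> `|f z - f w| <= (C * enorm (z - w) `^ lam)%:E].

End Alpha.

(* Main.v *)
Require Import Defs.
From HB Require Import structures.
From mathcomp Require Import all_boot all_order all_algebra.
From mathcomp Require Import all_classical all_reals all_analysis measurable_realfun.
From mathcomp Require Import complex ring lra zify.
Import Order.TTheory GRing.Theory Num.Theory.
Import numFieldNormedType.Exports.
Local Open Scope classical_set_scope.
Local Open Scope ring_scope.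
Set Implicit Arguments.
Unset Strict Implicit.
Unset Printing Implicit Defensive.

(** Alpha-subharmonic functions are weak subsolutions of L = sum S_ij d_i d_j with S of class C^1 and divergence-free rows, so L is self-adjoint. Freezing S at z in a truncated fundamental solution F(<S(z)^-1 (y-z), y-z>) gives a parametrix whose error kernel has size |y-z|^(1-m), m = 2n. Pairing u with it bounds u(z) by weighted means of u; adding the pairing to u gives a larger subsolution, changed only near z, that is bounded below by such means. Iterating 2m times removes the singularity, so competitors can be raised inside a ball off K: this is a Harnack inequality for sup omega - omega, hence oscillation decay and scale-invariant interior Hölder bounds. Near the boundary of D a multiple of rho lies below omega, near K the hypothesis applies; for the rest compare |z-w| with the squared distance of z to K and to the complement of D. *)

Local Notation sqrt := Num.sqrt.
Local Notation measT := (measurable_fun setT).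
Local Notation EFinP := measurable_EFinP.
Local Notation measT_comp := measurableT_comp.

Local Ltac pos := solve [rewrite ?posrE ?nnegrE ?lee_fin ?lte_fin; repeat first [done | exact: sqrtr_ge0 | exact: normr_ge0
  | exact: expR_gt0 | exact: powR_ge0 | apply: mulr_gt0 | apply: mulr_ge0 | apply: exprn_gt0 | apply: exprn_ge0
  | rewrite invr_gt0 | rewrite invr_ge0 | apply: addr_gt0 | apply: addr_ge0 | apply: ltr_wpDl | rewrite sqrtr_gt0 | apply: ltW]].

(** The obstacle is that the coefficients are only of class C^1: convolution does not preserve
    subsolutions of an operator with variable coefficients, so every inequality is proved weakly,
    against smooth potentials averaged over their pole, and read off almost everywhere afterwards.
    Cutting the kernel off at distance about 1/K with the flat profile e^(-1/t) creates a
    nonnegative term with a factor K, which dominates the error made by freezing the coefficients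
    once K is large; hence the unregularised error kernel has a sign and only nonpositive functions
    need to be paired with it. Freezing at the pole yields the mean inequality, but to show that u
    plus the pairing is again a subsolution the operator must act in the pole variable, so there the
    matrix is frozen at the other variable. The two kinds of kernel are compared by shifting K by a
    fixed amount. The Harnack inequality is not taken from a Dirichlet problem: it holds because the
    envelope dominates each raised competitor. *)

Lemma measurable_int2 (R : realType) d1 d2 (T1 : measurableType d1) (T2 : measurableType d2)
 (m2 : {sigma_finite_measure set T2 -> \bar R}) (f : T1*T2 -> \bar R) :
 measT f -> measT (fun t=> \int[m2]_y f (t, y))%E.
Proof.
move=> mf.
have h1 := @measurable_fun_fubini_tonelli_F _ _ _ _ _ m2 (f^\+)%E (measurable_funepos mf) (funepos_ge0 f).
have h2 := @measurable_fun_fubini_tonelli_F _ _ _ _ _ m2 (f^\-)%E (measurable_funeneg mf) (funeneg_ge0 f).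
have := emeasurable_funB h1 h2; congr measurable_fun.
apply/funext=> t; rewrite [RHS]integralE; congr (_-_)%E.
 by apply: eq_integral=> y _; rewrite !funeposE.
by apply: eq_integral=> y _; rewrite !funenegE.
Qed.

(** * Lebesgue measure on row vectors, matched with the iterated integral [iint] *)

Section BorelRV.
Variable (R : realType).
Definition opens (m : nat) : set (set 'rV[R]_m) := [set B | open B].
Arguments opens : clear implicits.

(** The canonical sigma-algebra is literally the one generated by the open sets, so [measurable] and
    [borel] are convertible and hypotheses pass freely from one to the other. *)
HB.instance Definition _ (m : nat) := @isMeasurable.Build (sigma_display (opens m))
 'rV[R]_m <<s opens m >> (@sigma_algebra0 _ setT (opens m)) (@sigma_algebraC _ (opens m))
 (@sigma_algebra_bigcup _ setT (opens m)).

Lemma open_meas (m : nat) (A : set 'rV[R]_m) : open A -> measurable A.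
Proof. by move=> oA; apply: sub_sigma_algebra. Qed.

Lemma ball_rVE (m : nat) (c x : 'rV[R]_m) (r : R) : 0 < r ->
 ball c r x <-> forall i, `|c 0 i-x 0 i| < r.
Proof.
move=> r0; split=> [[_ h] i|h]; first exact: (h 0 i).
by split=> // i j; rewrite ord1; exact: h.
Qed.

(** A countable base of sup-norm balls with rational data, indexed by all natural numbers; an index
    that codes nothing stands for the empty set. Countability arguments, for measurability and for
    almost everywhere statements, run over this family. *)
Definition ratcube (m : nat) (k : nat) : set 'rV[R]_m :=
 if (unpickle k : option ('rV[rat]_m*rat)) is Some cr
 then ball (map_mx ratr cr.1 : 'rV[R]_m) (ratr cr.2) else set0.

Lemma ratcube_open (m k : nat) : open (@ratcube m k).
Proof.
rewrite /ratcube; case: unpickle=> [[c r]|]; last exact: open0.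
have [r0|r0] := ltP 0 (ratr r : R); first exact: ball_open.
suff -> : ball (map_mx ratr c : 'rV[R]_m) (ratr r) = set0 by [].
by apply/seteqP; split=> // x [/=]; rewrite ltNge r0.
Qed.

Lemma rat_dense_rV (m : nat) (x : 'rV[R]_m) (r : R) : 0 < r ->
 exists c : 'rV[rat]_m, ball x r (map_mx ratr c).
Proof.
move=> r0.
have h i : exists q : rat, `|x 0 i-ratr q| < r.
 have : (x 0 i-r < x 0 i+r) by lra.
 move=> /rat_in_itvoo [q]; rewrite in_itv /= => /andP[h1 h2]; exists q.
 by rewrite ltr_norml; apply/andP; split; lra.
exists (\row_i (sval (cid (h i)))).
by apply/ball_rVE=> // i; rewrite !mxE; case: cid.
Qed.

Lemma open_ratcubes (m : nat) (U : set 'rV[R]_m) : open U ->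
 U = \bigcup_(k in [set k | @ratcube m k `<=` U]) @ratcube m k.
Proof.
move=> oU; apply/seteqP; split=> [x Ux|x [k /= h]]; last exact: h.
have /nbhs_ballP[e /= e0 he] : nbhs x U by exact: open_nbhs_nbhs.
have e20 : 0 < e/2 by lra.
have /rat_in_itvoo[q] : (e/4 < e/2) by lra.
rewrite in_itv /= => /andP[q1 q2].
have q0 : 0 < (ratr q : R) by lra.
have [c hc] := @rat_dense_rV m x _ q0.
exists (pickle (c, q)); rewrite /= /ratcube pickleK; last exact: ball_sym.
move=> y hy; apply: he; have := ball_triangle hc hy; apply: le_ball; lra.
Qed.

Lemma meas_coords d (T : measurableType d) (m : nat) (f : T -> 'rV[R]_m) :
 (forall i, measT (fun t=> f t 0 i)) -> measT f.
Proof.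
move=> mf.
have mball c r : measurable (f @^-1` (ball c r)).
 have [r0|r0] := ltP 0 r; last first.
 suff -> : f @^-1` ball c r = set0 by [].
 by apply/seteqP; split=> // x [/=]; rewrite ltNge r0.
 have -> : f @^-1` ball c r = \bigcap_(i in [set: 'I_m]) [set t | `|c 0 i-f t 0 i| < r].
 apply/seteqP; split=> t /=; first by move/(ball_rVE _ _ r0)=> h i _; exact: h.
 by move=> h; apply/ball_rVE=> // i; exact: h.
 apply: fin_bigcap_measurable; first exact: finite_finset.
 move=> i _.
 have := measurable_fun_ltr (measT_comp (@normr_measurable R setT) (measurable_funB (@measurable_cst _ _ T R setT (c 0 i)) (mf i))) (@measurable_cst _ _ T R setT r).
 move=> /(_ measurableT [set true] I); rewrite setTI; congr measurable.
apply: (@measurability _ _ _ _ _ _ (opens m))=> // _ [U oU <-].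
rewrite setTI (open_ratcubes oU) preimage_bigcup.
apply: bigcup_measurable=> k _; rewrite /ratcube; case: unpickle=> [[c r]|].
 exact: mball.
by rewrite preimage_set0.
Qed.

Lemma cont_meas (m : nat) (f : 'rV[R]_m -> R) :
 continuous f -> measT f.
Proof.
move=> /continuousP cf; apply: (measurability _ (RGenOpens.measurableE R)).
move=> _ [_ [a [b ->] <-]]; rewrite setTI; apply: open_meas.
exact/cf/interval_open.
Qed.

(** Countably many boxes of rational cubes exhaust an open set of the product. This puts open sets
    into the product sigma-algebra and makes jointly continuous kernels admissible for Fubini. *)
Lemma open_meas2 (m k : nat) (W : set ('rV[R]_m*'rV[R]_k)) :
 open W -> measurable W.
Proof.
move=> oW.
have -> : W = \bigcup_(i in [set ij | @ratcube m ij.1 `*` @ratcube k ij.2 `<=` W])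
 (@ratcube m i.1 `*` @ratcube k i.2).
 apply/seteqP; split=> [[x y] Wxy|x [i /= h]]; last exact: h.
 have [[A B] /= [nA nB] AB] : nbhs (x, y) W by exact: open_nbhs_nbhs.
 have /= := open_ratcubes (open_interior A); have /= := open_ratcubes (open_interior B).
 move=> hB hA.
 have : A° x by [].
 rewrite hA=> -[i /= hi xi].
 have : B° y by [].
 rewrite hB=> -[j /= hj yj].
 exists (i, j)=> //= -[a b] /= [ai bj]; apply: AB; split=> /=.
 exact: (@interior_subset _ A _ (hi _ ai)).
 exact: (@interior_subset _ B _ (hj _ bj)).
rewrite (_ : bigcup _ _ = \bigcup_(n in [set: nat])
 (if (unpickle n : option (nat * nat)) is Some i then
 if `[< @ratcube m i.1 `*` @ratcube k i.2 `<=` W >] then @ratcube m i.1 `*` @ratcube k i.2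
 else set0 else set0)).
 apply: bigcup_measurable=> n _; case: (unpickle n : option (nat * nat))=> [i|//].
 by case: asboolP=> // _; apply: measurableX; apply: open_meas; exact: ratcube_open.
apply/seteqP; split=> [x [i /= hi xi]|x [n _ /=]].
 by exists (pickle i)=> //=; rewrite pickleK; case: asboolP.
by case: (unpickle n : option (nat * nat))=> [i|//]; case: asboolP=> // h xi; exists i.
Qed.

Lemma cont_meas2 (m k : nat) (f : 'rV[R]_m*'rV[R]_k -> R) :
 continuous f -> measT f.
Proof.
move=> /continuousP cf; apply: (measurability _ (RGenOpens.measurableE R)).
move=> _ [_ [a [b ->] <-]]; rewrite setTI; apply: open_meas2.
exact/cf/interval_open.
Qed.

Lemma measurable_coord (m : nat) (i : 'I_m) : measT (fun x : 'rV[R]_m=> x 0 i).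
Proof. by apply: cont_meas=> x; exact: coord_continuous. Qed.

Lemma cont_measV (m k : nat) (f : 'rV[R]_m -> 'rV[R]_k) :
 continuous f -> measT f.
Proof.
move=> /continuousP cf; apply: (@measurability _ _ _ _ _ _ (opens k))=> // _ [U oU <-].
by rewrite setTI; apply: open_meas; exact: cf.
Qed.

(** Splits off the head coordinate, in the order in which [iint] integrates. *)
Definition consrv (k : nat) (p : measurableTypeR R*'rV[R]_k) : 'rV[R]_k.+1 :=
 row_mx (@const_mx R 1 1 p.1) p.2.
Definition unconsrv (k : nat) (v : 'rV[R]_k.+1) : measurableTypeR R*'rV[R]_k :=
 (v 0 0, @rsubmx R 1 1 k v).

Lemma consrv0 (k : nat) (p : measurableTypeR R*'rV[R]_k) : consrv p 0 0 = p.1.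
Proof.
rewrite mxE; case: splitP=> [j _|j /= h]; first by rewrite mxE.
pos.
Qed.

Lemma consrvS (k : nat) (p : measurableTypeR R*'rV[R]_k) (j : 'I_k) : consrv p 0 (lift ord0 j) = p.2 0 j.
Proof.
rewrite mxE; case: splitP=> [i|i /= h]; first by rewrite ord1.
by congr (p.2 _ _); apply/val_inj; move: h; rewrite /bump=> -[].
Qed.

Lemma unconsrv2 (k : nat) (v : 'rV[R]_k.+1) (j : 'I_k) : (unconsrv v).2 0 j = v 0 (lift ord0 j).
Proof. by rewrite mxE; congr (v _ _); apply/val_inj. Qed.

Lemma consrvK (k : nat) : cancel (@consrv k) (@unconsrv k).
Proof.
move=> [x v]; rewrite [LHS]surjective_pairing; congr pair; first exact: consrv0.
by apply/rowP=> j; rewrite unconsrv2 consrvS.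
Qed.

Lemma unconsrvK (k : nat) : cancel (@unconsrv k) (@consrv k).
Proof.
move=> v; apply/rowP=> i; case: (unliftP ord0 i)=> [j ->|->].
 by rewrite consrvS unconsrv2.
by rewrite consrv0.
Qed.

Lemma measurable_consrv (k : nat) : measT (@consrv k).
Proof.
apply: meas_coords=> i; case: (unliftP ord0 i)=> [j ->|->].
 rewrite (_ : (fun _=> _) = (fun v : 'rV[R]_k=> v 0 j) \o snd).
 by apply: measT_comp=> //; exact: measurable_coord.
 by apply/funext=> p /=; rewrite consrvS.
rewrite (_ : (fun _=> _) = fst); first exact: measurable_fst.
by apply/funext=> p /=; rewrite consrv0.
Qed.

Lemma measurable_unconsrv (k : nat) : measT (@unconsrv k).
Proof.
apply: measurable_fun_pair; first exact: measurable_coord.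
apply: meas_coords=> i.
rewrite (_ : (fun _=> _) = (fun v : 'rV[R]_k.+1=> v 0 (lift ord0 i))).
 exact: measurable_coord.
by apply/funext=> v; exact: unconsrv2.
Qed.

Section step.
Variables (k : nat) (mu : {sigma_finite_measure set 'rV[R]_k -> \bar R}).
Local Open Scope ereal_scope.
Let mu1 : {sigma_finite_measure set (measurableTypeR R) -> \bar R} := lebesgue_measure.
Let nu : {measure set (measurableTypeR R*'rV[R]_k)%type -> \bar R} := (mu1 \x mu).
Definition stepm (A : set 'rV[R]_k.+1) : \bar R := nu (@consrv k @^-1` A).

Let mpre (A : set 'rV[R]_k.+1) : measurable A -> measurable (@consrv k @^-1` A).
Proof. by move=> mA; rewrite -[X in measurable X]setTI; exact: measurable_consrv. Qed.
Let stepm0 : stepm set0 = 0.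
Proof. pos. Qed.
Let stepm_ge0 A : 0 <= stepm A.
Proof. exact: measure_ge0. Qed.
Let stepm_sa : semi_sigma_additive stepm.
Proof.
move=> F mF tF mUF; rewrite /stepm preimage_bigcup.
apply: measure_semi_sigma_additive.
- by move=> n; exact: mpre.
- apply/trivIsetP=> /= i j _ _ ij; rewrite -preimage_setI.
 by move/trivIsetP : tF=> /(_ _ _ _ _ ij) ->//; rewrite preimage_set0.
- by rewrite -preimage_bigcup; exact: mpre.
Qed.

HB.instance Definition _ := isMeasure.Build _ _ _ stepm stepm0 stepm_ge0 stepm_sa.

Let stepm_sf : sigma_finite setT stepm.
Proof.
have /sigma_finiteP[F [TF ndF Foo]] := sigma_finiteT mu1.
have /sigma_finiteP[G [TG ndG Goo]] := sigma_finiteT mu.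
exists (fun i=> @unconsrv k @^-1` (F i `*` G i)).
 rewrite -preimage_bigcup; apply/seteqP; split=> // v _ /=.
 have [n _ Fn] : (\bigcup_i F i) (unconsrv v).1 by rewrite -TF.
 have [n' _ Gn] : (\bigcup_i G i) (unconsrv v).2 by rewrite -TG.
 exists (maxn n n')=> //; split=> /=.
 by move: Fn; exact/subsetPset/ndF/leq_maxl.
 by move: Gn; exact/subsetPset/ndG/leq_maxr.
move=> i; have [? ?] := Foo i; have [? ?] := Goo i; split.
 by rewrite -[X in measurable X]setTI; apply: measurable_unconsrv=> //; exact: measurableX.
rewrite /stepm (_ : _ @^-1` _ = F i `*` G i); last first.
 by apply/seteqP; split=> x; rewrite /preimage /mkset consrvK.
rewrite -[nu _]/((mu1 \x mu) (F i `*` G i)) product_measure1E//.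
by rewrite lte_mul_pinfty// ge0_fin_numE.
Qed.

HB.instance Definition _ := Measure_isSigmaFinite.Build _ _ _ stepm stepm_sf.

Lemma stepm_integral (f : 'rV[R]_k.+1 -> \bar R) : measT f ->
 (forall x, 0 <= f x) ->
 \int[stepm]_x f x = \int[lebesgue_measure]_x \int[mu]_v f (consrv (x, v)).
Proof.
move=> mf f0.
transitivity (\int[nu]_p (f \o @consrv k) p).
 have := @ge0_integral_pushforward _ _ _ _ _ _ (@measurable_consrv k) nu setT f measurableT mf (fun y _=> f0 y).
 rewrite preimage_setT=> <-.
 apply: eq_measure_integral; last by []; exact: measurable_consrv.
rewrite (@fubini_tonelli1 _ _ _ _ _ mu1 mu (f \o @consrv k)) //.
 by apply: measT_comp=> //; exact: measurable_consrv.
by move=> x; exact: f0.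
Qed.

Lemma stepm_integralR (f : 'rV[R]_k.+1 -> \bar R) : stepm.-integrable setT f ->
 {ae lebesgue_measure, forall x : R, mu.-integrable setT (fun v=> f (consrv (x, v)))} /\
 \int[stepm]_x f x = \int[lebesgue_measure]_x \int[mu]_v f (consrv (x, v)).
Proof.
move=> intf.
have mf : measT f by exact: measurable_int intf.
have intf' : (mu1 \x mu).-integrable setT (f \o @consrv k).
 apply/integrableP; split.
 by apply: measT_comp=> //; exact: measurable_consrv.
 move/integrableP: intf=> [_]; congr (_ < _).
 have := @ge0_integral_pushforward _ _ _ _ _ _ (@measurable_consrv k) nu setT (abse \o f) measurableT (measT_comp (@abse_measurable R setT) mf) (fun y _=> abse_ge0 (f y)).
 rewrite preimage_setT=> <-.
 apply: eq_measure_integral; last by []; exact: measurable_consrv.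
split; first exact: (ae_integrable1 intf').
transitivity (\int[nu]_p (f \o @consrv k) p).
 have := @integral_pushforward _ _ _ _ _ _ (@measurable_consrv k) nu setT f mf.
 rewrite preimage_setT=> /(_ intf' measurableT) <-.
 apply: eq_measure_integral; last by []; exact: measurable_consrv.
by rewrite -(integral12_prod_meas1 intf').
Qed.
End step.

(** Dimension 0 carries the Dirac mass because [iint] evaluates there at the only point;
    sigma-finiteness is kept in the type since the next product requires it. *)
Fixpoint lebn (m : nat) : {sigma_finite_measure set 'rV[R]_m -> \bar R} :=
 match m with
 | 0=> dirac (0 : 'rV[R]_0)
 | k.+1=> stepm (lebn k)
 end.

Lemma rV0_all (f : 'rV[R]_0) : f = 0.
Proof. by apply/rowP=> -[]. Qed.

Lemma measurable_consrv1 (m : nat) (x : R) : measT (fun v : 'rV[R]_m=> consrv (x, v)).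
Proof.
by apply: (measT_comp (@measurable_consrv m)); exact: measurable_pair1.
Qed.

Lemma iintE_ge0 (m : nat) (f : 'rV[R]_m -> \bar R) : measT f ->
 (forall x, (0 <= f x)%E) -> iint f = (\int[lebn m]_x f x)%E.
Proof.
elim: m f=> [|m IH] f mf f0 /=.
 by rewrite integral_dirac// diracT mul1e.
rewrite stepm_integral //; apply: eq_integral=> x _; rewrite IH //.
exact: (measT_comp mf (@measurable_consrv1 m x)).
Qed.

Lemma measurable_iint d (T : measurableType d) (m : nat) (f : T*'rV[R]_m -> \bar R) :
 measT f -> measT (fun t=> iint (fun v=> f (t, v))).
Proof.
elim: m d T f=> [|m IH] d T f mf /=.
 by apply: (measT_comp mf); exact: measurable_pair2.
pose g (p : T * measurableTypeR R) := iint (fun v=> f (p.1, consrv (p.2, v))).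
have mg : measT g.
 apply: (IH _ (T * measurableTypeR R)%type (fun q=> f (q.1.1, consrv (q.1.2, q.2)))).
 apply: (measT_comp mf); apply: measurable_fun_pair.
 exact: (measT_comp measurable_fst measurable_fst).
 apply: (measT_comp (@measurable_consrv m)); apply: measurable_fun_pair=> //.
 exact: (measT_comp measurable_snd measurable_fst).
exact: (measurable_int2 lebesgue_measure mg).
Qed.

(** For a signed integrand Fubini gives integrable sections for almost every head coordinate only,
    so the induction hypothesis identifies the inner integrals a.e.; this is why the iterated
    integral has to be known measurable beforehand. *)
Lemma iintE (m : nat) (f : 'rV[R]_m -> \bar R) : (lebn m).-integrable setT f ->
 iint f = (\int[lebn m]_x f x)%E.
Proof.
elim: m f=> [|m IH] f intf.
 by rewrite /= integral_dirac// ?diracT ?mul1e //; exact: measurable_int intf.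
have [h1 h2] := @stepm_integralR m (lebn m) f intf.
rewrite -[lebn m.+1]/(stepm (lebn m) : {sigma_finite_measure set _ -> \bar R}) h2 /=.
have mf : measT f by exact: measurable_int intf.
have mf' : measT (fun q : measurableTypeR R*'rV[R]_m=> f (consrv q)).
 by apply: (measT_comp mf); exact: measurable_consrv.
apply: ae_eq_integral=> //.
- exact: (measurable_iint mf').
- exact: (measurable_int2 (lebn m) mf').
- case: h1=> N [mN N0 sub]; exists N; split=> // x /= h; apply: sub=> /= hx; apply: h=> _; exact: IH.
Qed.
End BorelRV.
Section leb1.
Variable R : realType.
Local Open Scope ereal_scope.
Notation leb := (@lebesgue_measure R).

(** The scaled image measure agrees with Lebesgue measure on half-open intervals, which determine
    it. *)
Lemma lebesgue_affine (t c : R) (f : R -> \bar R) : (0 < t)%R -> measT f ->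
 (forall x, 0 <= f x) ->
 \int[leb]_x f x = t%:E*\int[leb]_x f (t*x+c)%R.
Proof.
move=> t0 mf f0.
pose h (x : measurableTypeR R) : measurableTypeR R := (t*x+c)%R.
have mh : measT h.
 apply: continuous_measurable_fun=> x; apply: cvgD; last exact: cvg_cst.
 by apply: cvgM; [exact: cvg_cst|exact: cvg_id].
have mpre A : measurable A -> measurable (h @^-1` A).
 by move=> mA; rewrite -[X in measurable X]setTI; exact: mh.
have tp : (0 <= t)%R by exact: ltW.
pose nu := mscale (NngNum tp) (pushforward leb h).
have nuE : forall A : set R, measurable A -> leb A = nu mh A.
 move=> A mA; apply: lebesgue_measure_unique=> // _ [[a b]] _ <-.
 rewrite -[RHS]/(t%:E * leb (h @^-1` `]a, b]%classic)).
 have -> : h @^-1` `]a, b]%classic = `]((a-c)/t)%R, ((b-c)/t)%R]%classic.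
 apply/seteqP; split=> x; rewrite /h /= !in_itv /= ltr_pdivrMr// ler_pdivlMr// => /andP[h1 h2];
 lra.
 rewrite !lebesgue_measure_itv /= !lte_fin ltr_pM2r ?invr_gt0// ltrD2r.
 case: ifPn=> _; last by rewrite mule0.
 rewrite -!EFinB -EFinM; congr EFin; field; exact: lt0r_neq0.
rewrite (eq_measure_integral (nu mh)); last by move=> A mA _; exact: nuE.
rewrite ge0_integral_mscale //; congr (_*_).
have := @ge0_integral_pushforward _ _ _ _ _ _ mh leb setT f measurableT mf (fun y _=> f0 y).
pos.
Qed.
End leb1.

Section API.
Variable R : realType.

Lemma consrvD m (x y : R) (v w : 'rV[R]_m) : consrv (x+y, v+w) = consrv (x, v)+consrv (y, w).
Proof.
by apply/rowP=> i; rewrite !mxE; case: splitP=> j _; rewrite !mxE.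
Qed.

Lemma consrvZ m (t x : R) (v : 'rV[R]_m) : consrv (t*x, t *: v) = t *: consrv (x, v).
Proof.
by apply/rowP=> i; rewrite !mxE; case: splitP=> j _; rewrite !mxE.
Qed.

Lemma cont_affine m (t : R) (c : 'rV[R]_m) : continuous (fun x : 'rV[R]_m=> t *: x+c).
Proof.
move=> x; apply: (@continuousD _ _ _ (fun x : 'rV[R]_m=> t *: x) (fun=> c)).
 by apply: continuousZr; exact: cvg_id.
exact: cst_continuous.
Qed.

Lemma lebn_affine m (t : R) (c : 'rV[R]_m) (f : 'rV[R]_m -> \bar R) : 0 < t ->
 measT f -> (forall x, 0 <= f x)%E ->
 (\int[lebn R m]_x f x = (t^+m)%:E*\int[lebn R m]_x f (t *: x+c)%R)%E.
Proof.
move=> t0; elim: m c f=> [|m IH] c f mf f0;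
 have mg := measT_comp mf (cont_measV (@cont_affine _ t c)).
 rewrite /= !integral_dirac// ?diracT ?mul1e ?expr0 ?mul1e.
 by rewrite (rV0_all (t *: 0+c)).
have -> := @stepm_integral R m (lebn R m) f mf f0.
have -> := @stepm_integral R m (lebn R m) _ mg (fun x=> f0 _).
set c0 := (unconsrv c).1; set c1 := (unconsrv c).2.
have mf2 : measT (fun q : measurableTypeR R*'rV[R]_m=> f (consrv q)).
 by apply: (measT_comp mf); exact: measurable_consrv.
rewrite (lebesgue_affine c0 t0); first last.
- by move=> x; apply: integral_ge0.
- exact: (measurable_int2 (lebn R m) mf2).
rewrite exprS EFinM -muleA; congr (_*_)%E.
have mf3 : measT (fun q : measurableTypeR R*'rV[R]_m=> f (t *: (consrv q)+c)).
 by apply: (measT_comp mg); exact: measurable_consrv.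
rewrite -ge0_integralZl//; first last.
- pos.
- by move=> x _; apply: integral_ge0=> v _; exact: f0.
- exact: (measurable_int2 (lebn R m) mf3).
apply: eq_integral=> x _.
rewrite (IH c1); first last.
- pos.
- exact: (measT_comp mf (@measurable_consrv1 R m _)).
congr (_*_)%E; apply: eq_integral=> v _; congr f.
by rewrite consrvD consrvZ; congr (_+_); exact: unconsrvK.
Qed.

Lemma lebn_shift m (c : 'rV[R]_m) (f : 'rV[R]_m -> \bar R) :
 measT f -> (forall x, 0 <= f x)%E ->
 (\int[lebn R m]_x f (x+c)%R = \int[lebn R m]_x f x)%E.
Proof.
move=> mf f0; rewrite (lebn_affine c ltr01 mf f0) expr1n mul1e.
by apply: eq_integral=> x _; rewrite scale1r.
Qed.

Lemma ball_consrv m (r : R) : 0 < r -> @consrv R m @^-1` (ball 0 r) =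
 `](- r)%R, r[%classic `*` ball (0 : 'rV[R]_m) r.
Proof.
move=> r0; apply/seteqP; split=> [[x v]|[x v]] /=.
 move=> /(ball_rVE _ _ r0) h; split.
 by have := h ord0; rewrite consrv0 mxE sub0r normrN ltr_norml.
 by apply/(ball_rVE _ _ r0)=> i; have := h (lift ord0 i); rewrite consrvS !mxE.
move=> [xr /(ball_rVE _ _ r0) h]; apply/(ball_rVE _ _ r0)=> i.
case: (unliftP ord0 i)=> [j ->|->].
 by rewrite consrvS; have := h j; rewrite !mxE.
by rewrite consrv0 mxE /= sub0r normrN ltr_norml; move: xr; rewrite in_itv.
Qed.

Lemma lebn_ball0 m (r : R) : 0 < r -> lebn R m (ball 0 r) = ((2*r)^+m)%:E.
Proof.
move=> r0; elim: m=> [|m IH].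
 by rewrite /= diracE expr0 mem_set //; exact: ballxx.
rewrite -[LHS]/((lebesgue_measure \x lebn R m)%E (@consrv R m @^-1` (ball 0 r))) ball_consrv//.
rewrite product_measure1E//; last by apply: open_meas; exact: ball_open.
have L : lebesgue_measure `](- r)%R, r[%classic = (2*r)%:E.
 by rewrite lebesgue_measure_itv /= lte_fin ifT; [rewrite -EFinD; congr EFin; lra|lra].
by rewrite [X in (X*_)%E]L [X in (_*X)%E]IH exprS.
Qed.

Lemma lebn_ball m (c : 'rV[R]_m) (r : R) : 0 < r -> lebn R m (ball c r) = ((2*r)^+m)%:E.
Proof.
move=> r0; rewrite -(lebn_ball0 _ r0).
have mb z : measurable (ball (z : 'rV[R]_m) r) by apply: open_meas; exact: ball_open.
have E z : lebn R m (ball z r) = (\int[lebn R m]_x (\1_(ball z r) x)%:E)%E.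
 by rewrite integral_indic; [rewrite setIT|exact: measurableT|exact: mb].
rewrite (E c) (E 0) -(lebn_shift c).
- apply: eq_integral=> x _; rewrite !indicE.
 have H : ball c r (x+c) <-> ball 0 r x.
 split=> /(ball_rVE _ _ r0) h; apply/(ball_rVE _ _ r0)=> i;
 by have := h i; rewrite !mxE opprD addrCA addrN addr0 ?sub0r.
 have [hx|hx] := pselect (ball 0 r x).
 by rewrite (mem_set hx) (mem_set (H.2 hx)).
 by rewrite (memNset hx) memNset // => /H.
- by apply/EFinP; exact: measurable_indic.
- pos.
Qed.

Section fixm.
Variable m : nat.
Notation V := 'rV[R]_m.
Notation mu := (lebn R m).

Definition Itg (f : V -> R) : Prop := mu.-integrable setT (EFin \o f).
(** A real number even when the integral is not finite: the value is then 0. Identities for [Int]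
    therefore ask for integrability, or split cases with [Int_nitg]. *)
Definition Int (f : V -> R) : R := \int[mu]_x f x.

Lemma Itg_meas f : Itg f -> measT f.
Proof. by move=> h; apply/EFinP; exact: measurable_int h. Qed.

Lemma Itg_le (f g : V -> R) : measT f -> Itg g -> (forall x, `|f x| <= g x) -> Itg f.
Proof.
move=> mf ig h; apply: (le_integrable measurableT _ _ ig).
 exact/EFinP.
by move=> x _; rewrite lee_fin (le_trans (h x)) // ler_norm.
Qed.

Lemma ItgP f : Itg f <-> measT f /\ (\int[mu]_x (`|f x|)%:E < +oo)%E.
Proof.
split.
 by move=> h; split; [exact: Itg_meas|move/integrableP: h=> []].
by move=> [mf h]; apply/integrableP; split=> //; exact/EFinP.
Qed.

Lemma Itg_abs f : Itg f -> Itg (fun x=> `|f x|).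
Proof. by move=> h; have := integrable_abse h. Qed.

Lemma ItgD f g : Itg f -> Itg g -> Itg (fun x=> f x+g x).
Proof.
by move=> hf hg; have := integrableD measurableT hf hg; apply: eq_integrable=> // x _.
Qed.

Lemma ItgB f g : Itg f -> Itg g -> Itg (fun x=> f x-g x).
Proof.
by move=> hf hg; have := integrableB measurableT hf hg; apply: eq_integrable=> // x _.
Qed.

Lemma ItgZ c f : Itg f -> Itg (fun x=> c*f x).
Proof.
by move=> hf; have := integrableZl measurableT c hf; apply: eq_integrable=> // x _.
Qed.

Lemma Itg0 : Itg (fun=> 0).
Proof. exact: integrable0. Qed.

Lemma Itg_sum (I : Type) (s : seq I) (F : I -> V -> R) :
 (forall i, Itg (F i)) -> Itg (fun x=> \sum_(i <- s) F i x).
Proof.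
move=> h; elim: s=> [|i s IH].
 by under eq_fun do rewrite big_nil; exact: Itg0.
by under eq_fun do rewrite big_cons; exact: ItgD.
Qed.

Lemma Int_EFin f : Itg f -> (\int[mu]_x (f x)%:E)%E = (Int f)%:E.
Proof. by move=> h; rewrite /Int /Rintegral fineK //; exact: integrable_fin_num. Qed.

Lemma IntD f g : Itg f -> Itg g -> Int (fun x=> f x+g x) = Int f+Int g.
Proof. by move=> hf hg; rewrite /Int RintegralD. Qed.

Lemma IntB f g : Itg f -> Itg g -> Int (fun x=> f x-g x) = Int f-Int g.
Proof. by move=> hf hg; rewrite /Int RintegralB. Qed.

Lemma IntZ c f : Itg f -> Int (fun x=> c*f x) = c*Int f.
Proof. by move=> hf; rewrite /Int RintegralZl. Qed.

Lemma eq_Int f g : (forall x, f x = g x) -> Int f = Int g.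
Proof. by move=> h; congr Int; apply/funext. Qed.

Lemma Int0 : Int (fun=> 0) = 0.
Proof. by rewrite /Int /Rintegral integral0. Qed.

Lemma Int_sum (I : Type) (s : seq I) (F : I -> V -> R) :
 (forall i, Itg (F i)) -> Int (fun x=> \sum_(i <- s) F i x) = \sum_(i <- s) Int (F i).
Proof.
move=> h; elim: s=> [|i s IH].
 by rewrite big_nil -[RHS]Int0; apply: eq_Int=> x; rewrite big_nil.
rewrite big_cons -IH -IntD //; last exact: Itg_sum.
by apply: eq_Int=> x; rewrite big_cons.
Qed.

Lemma Int_ge0 f : (forall x, 0 <= f x) -> 0 <= Int f.
Proof. by move=> h; apply: Rintegral_ge0. Qed.

Lemma Int_le f g : Itg f -> Itg g -> (forall x, f x <= g x) -> Int f <= Int g.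
Proof. by move=> hf hg h; apply: le_Rintegral. Qed.

Lemma Int_abs f : Itg f -> `|Int f| <= Int (fun x=> `|f x|).
Proof. by move=> hf; apply: le_normr_Rintegral. Qed.

Lemma Itg_supp (f : V -> R) (c r : R) : measT f -> 0 < r -> (forall x, `|f x| <= c) ->
 (forall x, r <= `|x| -> f x = 0) -> Itg f.
Proof.
move=> mf r0 fc f0.
have mb : measurable (ball (0 : V) r) by apply: open_meas; exact: ball_open.
have c0 : 0 <= c by exact: le_trans (fc 0).
apply: (@Itg_le _ (fun x=> c*\1_(ball (0 : V) r) x))=> //.
 apply: ItgZ; apply/ItgP; split; first exact: measurable_indic.
 rewrite (_ : (fun x=> _) = (fun x=> (\1_(ball (0 : V) r) x)%:E)); last first.
 by apply/funext=> x; rewrite ger0_norm.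
 by rewrite integral_indic// setIT [X in (X < _)%E](lebn_ball (0 : V) r0) ltry.
move=> x; rewrite indicE; case: (ltP `|x| r)=> h.
 by rewrite mem_set ?mulr1 //; rewrite -ball_normE /= sub0r normrN.
by rewrite f0// normr0 mulr_ge0.
Qed.

Lemma Int_shift (c : V) (f : V -> R) : measT f -> Int (fun x=> f (x+c)) = Int f.
Proof.
move=> mf; rewrite /Int /Rintegral; congr fine.
have mf' : measT (EFin \o f) by exact/EFinP.
rewrite integralE [RHS]integralE; congr (_-_)%E.
 rewrite -(lebn_shift c (measurable_funepos mf') (funepos_ge0 _)).
 by apply: eq_integral=> x _; rewrite !funeposE.
rewrite -(lebn_shift c (measurable_funeneg mf') (funeneg_ge0 _)).
by apply: eq_integral=> x _; rewrite !funenegE.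
Qed.

Lemma Itg_shift (c : V) (f : V -> R) : Itg f -> Itg (fun x=> f (x+c)).
Proof.
move=> /ItgP[mf h]; apply/ItgP; split.
 rewrite (_ : (fun _=> _) = (fun x=> f (1 *: x+c))).
 exact: (measT_comp mf (cont_measV (@cont_affine m 1 c))).
 by apply/funext=> x; rewrite scale1r.
rewrite (lebn_shift c (f := fun x=> (`|f x|)%:E)) //.
by apply/EFinP; exact: measT_comp.
Qed.

Lemma Int_dct (f : nat -> V -> R) (g h : V -> R) :
 (forall n, measT (f n)) -> Itg h ->
 (forall n x, `|f n x| <= h x) -> {ae mu, forall x, f n x @[n --> \oo] --> g x} ->
 measT g ->
 Itg g /\ Int (f n) @[n --> \oo] --> Int g.
Proof.
move=> mf ih fh fg mg.
have [] := @dominated_convergence _ _ _ mu setT measurableT (fun n x=> (f n x)%:E) (EFin \o g) (EFin \o h).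
- by move=> n; apply/EFinP.
- exact/EFinP.
- case: fg=> N [mN N0 sub]; exists N; split=> // x /= hx; apply: sub=> /= H; apply: hx=> _.
 by apply/fine_cvgP; split; [exact: nearW|exact: H].
- exact: ih.
- by apply: aeW=> x n _; rewrite lee_fin.
move=> ig _ hc; split=> //.
by move: hc; rewrite [X in _ --> X -> _](Int_EFin ig)=> /fine_cvg.
Qed.
End fixm.

(** Sections that are not integrable occur on a null set of parameters only, where the inner [Int]
    takes its default value; the three conclusions are insensitive to it. *)
Lemma Int_fubini m k (F : 'rV[R]_m*'rV[R]_k -> R) : measT F ->
 (\int[lebn R m]_x \int[lebn R k]_y (`|F (x, y)|)%:E < +oo)%E ->
 [/\ Itg (fun x=> Int (fun y=> F (x, y))), Itg (fun y=> Int (fun x=> F (x, y))) &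
 Int (fun x=> Int (fun y=> F (x, y))) = Int (fun y=> Int (fun x=> F (x, y)))].
Proof.
move=> mF hF.
have mF' : measT (EFin \o F) by exact/EFinP.
have iF : (lebn R m \x lebn R k)%E.-integrable setT (EFin \o F).
 exact/(integrable12ltyP _ _ mF').
have h1 : {ae lebn R m, forall x, (\int[lebn R k]_y (F (x, y))%:E)%E = (Int (fun y=> F (x, y)))%:E}.
 case: (ae_integrable1 iF)=> N [mN N0 sub]; exists N; split=> // x /= hx; apply: sub=> /= H; apply: hx.
 exact: Int_EFin.
have h2 : {ae lebn R k, forall y, (\int[lebn R m]_x (F (x, y))%:E)%E = (Int (fun x=> F (x, y)))%:E}.
 case: (ae_integrable2 iF)=> N [mN N0 sub]; exists N; split=> // x /= hx; apply: sub=> /= H; apply: hx.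
 exact: Int_EFin.
have m1 : measT (fun x=> Int (fun y=> F (x, y))).
 exact: (measT_comp (@fine_measurable R setT measurableT) (measurable_fubini_F iF)).
have m2 : measT (fun y=> Int (fun x=> F (x, y))).
 exact: (measT_comp (@fine_measurable R setT measurableT) (measurable_fubini_G iF)).
have mA : measT (fun p=> (`|F p|)%:E).
 by apply/EFinP; exact: measT_comp.
have mA0 p : (0 <= (`|F p|)%:E)%E by [].
have hI d (T : measurableType d) (mu : {measure set T -> \bar R}) (g : T -> R) : measT g ->
 ((`|fine (\int[mu]_x (g x)%:E)|)%:E <= \int[mu]_x (`|g x|)%:E)%E.
 move=> mg; apply: (@le_trans _ _ (`|\int[mu]_x (g x)%:E|)%E).
 by case: (\int[mu]_x _)%E=> [r| |] //=; rewrite ?leey.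
 by apply: (le_trans (le_abse_integral mu measurableT _))=> //; exact/EFinP.
have I1 : Itg (fun x=> Int (fun y=> F (x, y))).
 apply/ItgP; split=> //; apply: le_lt_trans hF; apply: ge0_le_integral=> //.
 - by apply/EFinP; exact: measT_comp.
 - exact: (measurable_int2 (lebn R k) mA).
 - by move=> x _; apply: hI; apply: (measT_comp mF); exact: measurable_pair1.
have I2 : Itg (fun y=> Int (fun x=> F (x, y))).
 apply/ItgP; split=> //; move: hF.
 rewrite (@fubini_tonelli _ _ _ _ R (lebn R m) (lebn R k) (fun p=> (`|F p|)%:E) mA mA0)=> hF.
 apply: le_lt_trans hF; apply: ge0_le_integral=> //.
 - by apply/EFinP; exact: measT_comp.
 - have H := @measurable_fun_fubini_tonelli_G _ _ _ _ R (lebn R m) (fun p=> (`|F p|)%:E) mA mA0.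
 exact: H.
 - by move=> x _; apply: hI; apply: (measT_comp mF); exact: measurable_pair2.
split=> //; apply: EFin_inj; rewrite -!Int_EFin //.
transitivity (\int[lebn R m]_x \int[lebn R k]_y (F (x, y))%:E)%E.
 apply: ae_eq_integral=> //; first exact/EFinP.
 exact: measurable_fubini_F iF.
 by case: h1=> N [mN N0 sub]; exists N; split=> // x /= hx; apply: sub=> /= H; apply: hx=> _; rewrite H.
rewrite (Fubini iF); apply: ae_eq_integral=> //; last first.
- by case: h2=> N [mN N0 sub]; exists N; split=> // x /= hx; apply: sub=> /= H; apply: hx=> _; rewrite H.
- exact/EFinP.
- exact: measurable_fubini_G iF.
Qed.
End API.

Local Notation "'AE' x , P" := {ae lebn _ _, forall x, P} (at level 200, x name).

(** * Directional derivatives and smooth families of functions *)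

Section DirDeriv.
Variables (R : realType) (V : normedModType R).

Lemma is_deriveP (f : V -> R) p v d :
 is_derive p v f d <-> h^-1 *: (f (h *: v+p)-f p) @[h --> 0^'] --> d.
Proof.
split; first by move=> [h1 <-].
by move=> h; split; [apply/cvg_ex; exists d|apply: cvg_lim].
Qed.
End DirDeriv.

Section DirDeriv2.
Variables (R : realType) (V : normedModType R).

Lemma is_derive_line (f : V -> R) (p v : V) (d : R) :
 is_derive p v f d <-> is_derive (0 : R) (1 : R) (fun h : R=> f (h *: v+p)) d.
Proof.
have E : (fun h : R=> h^-1 *: (f (h *: v+p)-f p)) =
 (fun h : R=> h^-1 *: (f ((h *: (1 : R)+0) *: v+p)-f ((0 : R) *: v+p))).
 by apply/funext=> x; rewrite addr0 scale0r add0r [_%:A]mulr1.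
split=> h; apply/is_deriveP; have := proj1 (is_deriveP _ _ _ _) h; first by rewrite E.
by rewrite -E.
Qed.

Lemma is_derive_comp1 (phi : R -> R) (f : V -> R) (p v : V) (a b : R) :
 is_derive (f p : R) (1 : R) phi a -> is_derive p v f b ->
 is_derive p v (fun q=> phi (f q)) (a*b).
Proof.
move=> hphi /is_derive_line hf; apply/is_derive_line.
have h0 : is_derive (f ((0 : R) *: v+p)) (1 : R) phi a by rewrite scale0r add0r.
exact: (@is_derive1_comp R phi (fun h : R=> f (h *: v+p)) 0 a b h0 hf).
Qed.
End DirDeriv2.

Section Smooth1.
Variable R : realType.

(** Smoothness as membership in some class of continuous functions that is stable under
    differentiation on [O]. A proof exhibits such a class, so no induction on the order of the
    derivative is needed. *)
Definition smooth1 (O : set R) (phi : R -> R) := exists Q : (R -> R) -> Prop,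
 Q phi /\ forall g, Q g -> (forall t, O t -> {for t, continuous g}) /\
 exists2 g', Q g' & forall t : R, O t -> is_derive (t : R) (1 : R) g (g' t).

Lemma smooth1_cont O phi t : smooth1 O phi -> O t -> {for t, continuous phi}.
Proof. by move=> [Q [Qphi h]] Ot; have [+ _] := h _ Qphi; exact. Qed.

Lemma smooth1_derive O phi : smooth1 O phi ->
 exists2 phi', smooth1 O phi' & forall t : R, O t -> is_derive (t : R) (1 : R) phi (phi' t).
Proof.
move=> [Q [Qphi h]]; have [_ [phi' Qphi' hd]] := h _ Qphi.
by exists phi'=> //; exists Q.
Qed.

Lemma smooth1_prim (O : set R) (phi dphi : R -> R) :
 (forall t : R, O t -> is_derive (t : R) (1 : R) phi (dphi t)) ->
 smooth1 O dphi -> smooth1 O phi.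
Proof.
move=> hd [Q [Qd h]]; exists (fun g=> Q g \/ g = phi); split; first by right.
move=> g [Qg|->].
 by have [h1 [g' Qg' h2]] := h _ Qg; split=> //; exists g'=> //; left.
split; last by exists dphi=> //; left.
move=> t Ot; apply: differentiable_continuous; apply/derivable1_diffP.
by have [] := hd t Ot.
Qed.
End Smooth1.

Section PSM.
Variables (R : realType) (V : normedModType R) (E O : set V) (X : topologicalType).
Implicit Types xi g h : X -> V -> R.

Definition jcont xi := forall x p, O p -> {for (x, p), continuous (fun q : X*V=> xi q.1 q.2)}.

(** The same device for families indexed by a parameter, with joint continuity. Joint continuity
    provides the bounds on compact sets for differentiating under an integral, and the measurability
    for Fubini. *)
Definition psm xi := exists P : (X -> V -> R) -> Prop, P xi /\
 forall g, P g -> jcont g /\ forall v, E v -> exists2 g', P g' &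
 forall x p, O p -> is_derive p v (g x) (g' x p).

(** By the Leibniz and chain rules a derivative is again built from members by sums, products and
    compositions. So the generated class is stable once the derivatives of the generators lie in it,
    and one induction, [psm_gen], gives all closure properties. *)
Inductive gen (B : (X -> V -> R) -> Prop) : (X -> V -> R) -> Prop :=
| gen_base g : B g -> gen B g
| gen_cst c : gen B (fun _ _=> c)
| gen_add g h : gen B g -> gen B h -> gen B (fun x p=> g x p+h x p)
| gen_mul g h : gen B g -> gen B h -> gen B (fun x p=> g x p*h x p)
| gen_comp (O1 : set R) (phi : R -> R) g : smooth1 O1 phi -> gen B g ->
 (forall x p, O p -> O1 (g x p)) -> gen B (fun x p=> phi (g x p)).

Lemma psm_gen (B : (X -> V -> R) -> Prop) :
 (forall g, B g -> jcont g /\ forall v, E v -> exists2 g', gen B g' &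
 forall x p, O p -> is_derive p v (g x) (g' x p)) ->
 forall g, gen B g -> psm g.
Proof.
move=> hB g0 hg0; exists (gen B); split=> // g {g0 hg0}.
elim=> {g} [g Bg|c|g h _ [cg dg] _ [ch dh]|g h Gg [cg dg] Gh [ch dh]|O1 phi g sphi Gg [cg dg] gO].
- exact: hB.
- split; first by move=> x p Op; exact: cst_continuous.
 move=> v Ev; exists (fun _ _=> 0); first exact: gen_cst.
 by move=> x p _; exact: is_derive_cst.
- split; first by move=> x p Op; apply: continuousD; [exact: cg|exact: ch].
 move=> v Ev; have [g' Gg' hg'] := dg v Ev; have [h' Gh' hh'] := dh v Ev.
 exists (fun x p=> g' x p+h' x p); first exact: gen_add.
 by move=> x p Op; have := hg' x p Op; have := hh' x p Op=> ? ?; apply: is_deriveD.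
- split; first by move=> x p Op; apply: continuousM; [exact: cg|exact: ch].
 move=> v Ev; have [g' Gg' hg'] := dg v Ev; have [h' Gh' hh'] := dh v Ev.
 exists (fun x p=> g x p*h' x p+h x p*g' x p).
 by apply: gen_add; apply: gen_mul.
 by move=> x p Op; have := hg' x p Op; have := hh' x p Op=> ? ?; apply: is_deriveM.
- have [phi' sphi' hphi'] := smooth1_derive sphi; split.
 move=> x p Op; apply: (@continuous_comp _ _ _ (fun q : X*V=> g q.1 q.2) phi).
 exact: cg.
 by apply: (smooth1_cont sphi); exact: gO.
 move=> v Ev; have [g' Gg' hg'] := dg v Ev.
 exists (fun x p=> phi' (g x p)*g' x p).
 by apply: gen_mul=> //; apply: (@gen_comp _ O1).
 move=> x p Op; apply: is_derive_comp1; last exact: hg'.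
 by apply: hphi'; exact: gO.
Qed.

Lemma psm_jcont xi : psm xi -> jcont xi.
Proof. by move=> [P [Pxi h]]; have [] := h _ Pxi. Qed.

Lemma psm_derive xi v : psm xi -> E v ->
 exists2 xi', psm xi' & forall x p, O p -> is_derive p v (xi x) (xi' x p).
Proof.
move=> [P [Pxi h]] Ev; have [_ /(_ v Ev) [xi' Pxi' h']] := h _ Pxi.
by exists xi'=> //; exists P.
Qed.

Lemma psm_gen_psm g : gen psm g -> psm g.
Proof.
apply: psm_gen=> {}g pg; split; first exact: psm_jcont.
move=> v Ev; have [g' pg' h'] := psm_derive pg Ev; exists g'=> //.
exact: gen_base.
Qed.

Lemma psm_cst c : psm (fun _ _=> c).
Proof. exact/psm_gen_psm/gen_cst. Qed.

Lemma psm_add g h : psm g -> psm h -> psm (fun x p=> g x p+h x p).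
Proof. by move=> pg ph; apply/psm_gen_psm/gen_add; apply: gen_base. Qed.

Lemma psm_mul g h : psm g -> psm h -> psm (fun x p=> g x p*h x p).
Proof. by move=> pg ph; apply/psm_gen_psm/gen_mul; apply: gen_base. Qed.

Lemma psm_opp g : psm g -> psm (fun x p=> - g x p).
Proof.
move=> pg; rewrite (_ : (fun x p=> _) = (fun x p=> (-1)*g x p)).
 by apply: psm_mul=> //; exact: psm_cst.
by apply/funext=> x; apply/funext=> p; rewrite mulN1r.
Qed.

Lemma psm_sub g h : psm g -> psm h -> psm (fun x p=> g x p-h x p).
Proof. by move=> pg ph; apply: psm_add=> //; exact: psm_opp. Qed.

Lemma psm_comp O1 phi g : smooth1 O1 phi -> psm g -> (forall x p, O p -> O1 (g x p)) ->
 psm (fun x p=> phi (g x p)).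
Proof. by move=> sp pg gO; apply/psm_gen_psm; apply: (gen_comp sp)=> //; exact: gen_base. Qed.

Lemma psm_sum (J : Type) (s : seq J) (F : J -> X -> V -> R) :
 (forall j, psm (F j)) -> psm (fun x p=> \sum_(j <- s) F j x p).
Proof.
move=> h; elim: s=> [|j s IH].
 rewrite (_ : (fun x p=> _) = (fun _ _=> 0)); first exact: psm_cst.
 by apply/funext=> x; apply/funext=> p; rewrite big_nil.
rewrite (_ : (fun x p=> _) = (fun x p=> F j x p + \sum_(j <- s) F j x p)).
 exact: psm_add.
by apply/funext=> x; apply/funext=> p; rewrite big_cons.
Qed.

Lemma psm_param (f : X -> R) : continuous f -> psm (fun x _=> f x).
Proof.
move=> cf; exists (fun g=> g = (fun x _=> f x) \/ g = (fun _ _=> 0)); split; first by left.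
move=> g [->|->]; split.
- move=> x p _; apply: (@continuous_comp _ _ _ (fun q : X*V=> q.1) f); last exact: cf.
 exact: cvg_fst.
- by move=> v Ev; exists (fun _ _=> 0); [right|move=> x p _; exact: is_derive_cst].
- by move=> x p _; exact: cst_continuous.
- by move=> v Ev; exists (fun _ _=> 0); [right|move=> x p _; exact: is_derive_cst].
Qed.
End PSM.

Section Smooth1Ex.
Variable R : realType.

Definition pos : set R := [set t | 0 < t].

Lemma is_derive_invn (t : R) k : 0 < t ->
 is_derive (t : R) (1 : R) (fun x : R=> x ^- k) (- k%:R*t ^- k.+1).
Proof.
move=> t0; have tn0 : t != 0 by exact: lt0r_neq0.
have h1 : is_derive (t : R) (1 : R) (fun x : R=> x^+k) ((k%:R*t^+k.-1) *: (1 : R)).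
 rewrite (_ : (fun x : R=> x^+k) = (id : R -> R)^+k); last by apply/funext=> x; rewrite exprfctE.
 exact: (is_deriveX k (is_derive_id t (1 : R))).
have tk0 : t^+k != 0 by exact: expf_neq0.
have h2 := @is_deriveV R (fun x=> x^+k) t _ 1 tk0 h1.
apply: (is_derive_eq h2); case: k {h1 h2} tk0=> [|k] tk0 /=.
 by rewrite mul0r scale0r scaler0 oppr0 mul0r.
have T0 : t^+k != 0 by exact: expf_neq0.
rewrite /GRing.scale /= mulr1 !exprS expr0 mulr1; move: (k.+1%:R : R) (t^+k : R) T0=> N T T0; field.
by rewrite T0 tn0.
Qed.

Lemma is_derive_continuous (f : R -> R) (t d : R) : is_derive (t : R) (1 : R) f d -> {for t, continuous f}.
Proof. by move=> [h _]; apply: differentiable_continuous; apply/derivable1_diffP. Qed.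

Lemma smooth1_invn k : smooth1 pos (fun t=> t ^- k).
Proof.
exists (fun g=> exists (c : R) k, g = (fun t=> c*t ^- k)); split.
 by exists 1, k; apply/funext=> t; rewrite mul1r.
move=> _ [c [{}k ->]].
have hd (t : R) : pos t ->
 is_derive (t : R) (1 : R) (fun t : R=> c*t ^- k) (c * - k%:R*t ^- k.+1).
 move=> t0; have h := @is_deriveZ _ _ _ (fun x : R=> x ^- k) c t 1 _ (is_derive_invn k t0).
 by apply: (is_derive_eq h); rewrite /GRing.scale /= mulrA.
split; last by exists (fun t=> c * - k%:R*t ^- k.+1)=> //; exists (c * - k%:R), k.+1.
by move=> t t0; apply: is_derive_continuous (hd t t0).
Qed.

Lemma smooth1_sqrt : smooth1 pos (@Num.sqrt R).
Proof.
exists (fun g=> exists (c : R) k, g = (fun t=> c*(t ^- k*sqrt t))); split.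
 by exists 1, 0%N; apply/funext=> t; rewrite mul1r invr1 mul1r.
move=> _ [c [k ->]].
have hd (t : R) : pos t ->
 is_derive (t : R) (1 : R) (fun t : R=> c*(t ^- k*sqrt t))
 (c*(2^-1-k%:R)*(t ^- k.+1*sqrt t)).
 move=> t0; have h1 := is_derive_invn k t0; have h2 := is_derive1_sqrt t0.
 have h3 := is_deriveM h1 h2.
 have h := @is_deriveZ _ _ _ ((fun x : R=> x ^- k)*sqrt) c t 1 _ h3.
 apply: (is_derive_eq h); rewrite /GRing.scale /=.
 have s0 : 0 < sqrt t by rewrite sqrtr_gt0.
 have E : sqrt t^+2 = t by rewrite sqr_sqrtr // ltW.
 move: s0 E {t0 h1 h2 h3 h}; move: (sqrt t : R)=> s s0; move: (s : R) s0=> {}s s0 <-.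
 rewrite [(s^+2)^+k.+1]exprS; set T := (s^+2)^+k; field.
 by rewrite !lt0r_neq0 // !exprn_gt0.
split; last by exists (fun t=> c*(2^-1-k%:R)*(t ^- k.+1*sqrt t))=> //; exists (c*(2^-1-k%:R)), k.+1.
by move=> t t0; apply: is_derive_continuous (hd t t0).
Qed.

(** The flat function e^(-1/t) with a pole factor: the derivative of [bt 0] is [bt 2], and
    differentiation stays in the span of the [bt k]. *)
Definition bt (k : nat) (t : R) : R := if 0 < t then t ^- k*expR (- t^-1) else 0.

Lemma bt_ge0 k t : 0 <= bt k t.
Proof.
by rewrite /bt; case: ifP=> // t0; rewrite mulr_ge0 // invr_ge0 exprn_ge0 // ltW.
Qed.

(** The Taylor term of degree k+2 of the exponential beats the pole of order k and leaves a factor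
    t^2, so the difference quotient at 0 vanishes. *)
Lemma bt_small k t : bt k t <= (k.+2)`!%:R*t^+2.
Proof.
rewrite /bt; case: ifP=> t0; last by rewrite mulr_ge0 ?sqr_ge0.
have h : t^-1^+k.+2/(k.+2)`!%:R <= expR t^-1.
 apply: le_trans (expR_ge1Dxn k.+1 _); last pos.
 lra.
have f0 : 0 < (k.+2)`!%:R :> R by [].
rewrite expRN ler_pdivrMr ?expR_gt0 // -ler_pdivrMl; last pos.
apply: le_trans h; rewrite le_eqVlt; apply/orP; left; apply/eqP.
rewrite -addn2 exprD !exprVn; field.
by rewrite !lt0r_neq0 // exprn_gt0.
Qed.

Lemma is_derive_bt k (t : R) : is_derive (t : R) (1 : R) (bt k) (- k%:R*bt k.+1 t+bt k.+2 t).
Proof.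
have [t0|t0|<-] := ltgtP 0 t.
- have h1 := is_derive_invn k t0.
 have h2 : is_derive (t : R) (1 : R) (fun x : R=> expR (- x^-1)) (expR (- t^-1)*t ^- 2).
 apply: (@is_derive1_comp R expR (fun x=> - x^-1)).
 have h3 := is_deriveN (is_derive_invn 1 t0).
 by apply: (is_derive_eq h3); rewrite mulN1r opprK.
 have h3 := is_deriveM h1 h2.
 have : is_derive (t : R) (1 : R) ((fun x : R=> x ^- k)*(fun x=> expR (- x^-1)))
 (- k%:R*bt k.+1 t+bt k.+2 t).
 apply: (is_derive_eq h3); rewrite /bt t0 /GRing.scale /= !exprS; field.
 by rewrite !lt0r_neq0 // exprn_gt0.
 apply: near_eq_is_derive; near=> x; rewrite /bt ifT //.
 by near: x; exact: lt_nbhsr.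
- have -> : - k%:R*bt k.+1 t+bt k.+2 t = 0 by rewrite /bt !ltNge (ltW t0) /= mulr0 addr0.
 have : is_derive (t : R) (1 : R) (fun _ : R=> 0 : R) 0 by exact: is_derive_cst.
 apply: near_eq_is_derive; near=> x; rewrite /bt ifF //; apply/negbTE; rewrite -leNgt ltW //.
 by near: x; exact: lt_nbhsl.
- have -> : - k%:R*bt k.+1 0+bt k.+2 0 = 0 by rewrite /bt ltxx mulr0 addr0.
 apply/is_deriveP; apply/cvgrPdist_le=> e e0 /=.
 have b0 : bt k 0 = 0 by rewrite /bt ltxx.
 set C : R := (k.+2)`!%:R; have C0 : 0 < C by rewrite ltr0n fact_gt0.
 near=> h; rewrite b0 subr0 addr0 [h%:A]mulr1 sub0r normrN normrM normfV.
 have hn0 : 0 < `|h| by rewrite normr_gt0; near: h; exact: nbhs_dnbhs_neq.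
 rewrite ler_pdivrMl // ger0_norm ?bt_ge0 // (le_trans (bt_small _ _)) // -/C.
 rewrite -[h^+2]real_normK ?num_real // expr2 mulrCA ler_pM2l //.
 rewrite -ler_pdivlMl // mulrC.
 near: h; apply: dnbhs0_le; rewrite divr_gt0 //.
Unshelve. all: end_near. Qed.

Lemma smooth1_bt k : smooth1 setT (bt k).
Proof.
exists (fun g=> exists (r : seq (R * nat)), g = fun t=> \sum_(i <- r) i.1*bt i.2 t); split.
 by exists [:: (1, k)]; apply/funext=> t; rewrite big_seq1 mul1r.
move=> _ [r ->].
have hd (t : R) : is_derive (t : R) (1 : R) (fun t=> \sum_(i <- r) i.1*bt i.2 t)
 (\sum_(i <- r) i.1*(- i.2%:R*bt i.2.+1 t+bt i.2.+2 t)).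
 elim: r=> [|i r IH].
 rewrite big_nil; under eq_fun do rewrite big_nil; exact: is_derive_cst.
 rewrite big_cons; under eq_fun do rewrite big_cons.
 apply: is_deriveD; exact: (is_deriveZ i.1 (is_derive_bt i.2 t)).
split; first by move=> t _; apply: is_derive_continuous (hd t).
exists (fun t=> \sum_(i <- r) i.1*(- i.2%:R*bt i.2.+1 t+bt i.2.+2 t))=> //.
exists (flatten [seq [:: (- i.1 * i.2%:R, i.2.+1); (i.1, i.2.+2)] | i <- r]).
apply/funext=> t; rewrite big_flatten big_map; apply: eq_bigr=> i _.
by rewrite big_cons big_seq1 /=; ring.
Qed.
End Smooth1Ex.

(** * Smooth families on row vectors and derivatives of parameter integrals *)

Section RVsmooth.
Variable R : realType.

Lemma cont_pairr (X Y : topologicalType) (x : X) : continuous (fun y : Y=> (x, y)).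
Proof. by move=> y; apply: cvg_pair=> //=; exact: cvg_cst. Qed.

Lemma cont_pairl (X Y : topologicalType) (y : Y) : continuous (fun x : X=> (x, y)).
Proof. by move=> x; apply: cvg_pair=> //=; exact: cvg_cst. Qed.

Definition dirs m : set 'rV[R]_m := [set v | exists a : 'I_m, v = delta_mx 0 a].
Definition psmv m (X : topologicalType) (xi : X -> 'rV[R]_m -> R) := psm (@dirs m) setT xi.

Lemma psmv_coord m (X : topologicalType) (i : 'I_m) : psmv (fun (_ : X) (p : 'rV[R]_m)=> p 0 i).
Proof.
exists (fun g=> g = (fun (_ : X) (p : 'rV[R]_m)=> p 0 i) \/ exists c : R, g = (fun _ _=> c)); split; first by left.
move=> g [->|[c ->]]; split.
- move=> x p _; apply: (@continuous_comp _ _ _ (fun q : X*'rV[R]_m=> q.2) (fun p : 'rV[R]_m=> p 0 i)).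
 exact: cvg_snd.
 exact: coord_continuous.
- move=> v _; exists (fun _ _=> v 0 i); first by right; exists (v 0 i).
 move=> x p _; apply/is_deriveP; apply/cvgrPdist_le=> e e0 /=; near=> h.
 have h0 : h != 0 by near: h; exact: nbhs_dnbhs_neq.
 rewrite !mxE addrK [h^-1 *: _]mulrA mulVf // mul1r subrr normr0; exact: ltW.
- by move=> x p _; exact: cst_continuous.
- move=> v _; exists (fun _ _=> 0); first by right; exists 0.
 by move=> x p _; exact: is_derive_cst.
Unshelve. all: end_near. Qed.

Lemma psmv_smooth n (X : topologicalType) (xi : X -> pt R n -> R) x : psmv xi -> smooth (xi x).
Proof.
move=> [P [Pxi h]].
have hs s : exists2 g, P g & iter_pd s (xi x) = g x.
 elim: s=> [|a s [g Pg hg]]; first by exists xi.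
 have [_ /(_ (delta_mx 0 a)) [|g' Pg' hg']] := h _ Pg; first by exists a.
 exists g'=> //; rewrite /= hg; apply/funext=> p; rewrite /pd.
 by have [_ ->] := hg' x p I.
move=> k; split.
 move=> s _ a p _; have [g Pg ->] := hs s.
 have [_ /(_ (delta_mx 0 a)) [|g' Pg' hg']] := h _ Pg; first by exists a.
 by have [] := hg' x p I.
move=> s _ p _; have [g Pg ->] := hs s.
have [cg _] := h _ Pg; have := cg x p I.
move=> hc; apply: (@continuous_comp _ _ _ (fun s : pt R n=> (x, s)) (fun q : X * pt R n=> g q.1 q.2) p)=> //.
exact: cont_pairr.
Qed.

Lemma smooth_psmv n (X : topologicalType) (w : pt R n -> R) : smooth w -> psmv (fun _ : X=> w).
Proof.
move=> sw; exists (fun g=> exists s, g = fun _=> iter_pd s w); split; first by exists [::].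
move=> _ [s ->]; split.
 move=> x p _; apply: (@continuous_comp _ _ _ (fun q : X * pt R n=> q.2) (iter_pd s w)).
 exact: cvg_snd.
 by have [_ /(_ s (leqnn _) p I)] := sw (size s).
move=> v [a ->]; exists (fun _=> iter_pd (a :: s) w); first by exists (a :: s).
move=> x p _; split=> //.
by have [/(_ s (ltnSn _) a p I)] := sw (size s).+1.
Qed.

Lemma psmv_continuous m (X : topologicalType) (xi : X -> 'rV[R]_m -> R) :
 psmv xi -> continuous (fun q : X*'rV[R]_m=> xi q.1 q.2).
Proof. by move=> h [x p]; exact: (psm_jcont h). Qed.

Lemma cont_slice (X Y : topologicalType) (f : X*Y -> R) : continuous f ->
 (forall y, continuous (fun x=> f (x, y))) /\ (forall x, continuous (fun y=> f (x, y))).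
Proof.
move=> cf; split=> [y x|x y].
 exact: (@continuous_comp X (X*Y)%type R (fun s=> (s, y)) f x (@cont_pairl X Y y x) (cf (x, y))).
exact: (@continuous_comp Y (X*Y)%type R (fun s=> (x, s)) f y (@cont_pairr X Y x y) (cf (x, y))).
Qed.

Lemma compact_cball m (c : 'rV[R]_m) r : compact [set x | `|c-x| <= r].
Proof.
apply: bounded_closed_compact.
 exists (`|c| + `|r|); split=> //= M hM x /= hx.
 have -> : x = c-(c-x) by rewrite opprB addrC subrK.
 apply: (le_trans (ler_normB _ _)); have := ler_norm r; lra.
have -> : [set x | `|c-x| <= r] = (fun x=> `|c-x|) @^-1` [set t | t <= r] by [].
apply: closed_comp; last exact: closed_le.
move=> x _; apply: (@continuous_comp _ _ _ (fun x : 'rV[R]_m=> c-x) (fun x : 'rV[R]_m=> `|x|)).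
 by apply: continuousB; [exact: cst_continuous|exact: cvg_id].
exact: norm_continuous.
Qed.

Lemma cont_bounded2 m k (f : 'rV[R]_m*'rV[R]_k -> R) r : continuous f ->
 exists C, forall x y, `|x| <= r -> `|y| <= r -> `|f (x, y)| <= C.
Proof.
move=> cf.
have cK : compact ([set x : 'rV[R]_m | `|0-x| <= r] `*` [set x : 'rV[R]_k | `|0-x| <= r]).
 by apply: compact_setX; exact: compact_cball.
have := continuous_compact (continuous_subspaceT cf) cK.
move=> /compact_bounded [M [_ hM]].
exists (M+1)=> x y hx hy; apply: (hM (M+1)); first lra.
by exists (x, y)=> //; split; rewrite /= sub0r normrN.
Qed.

(** Dominated convergence speaks of sequences, so continuity of parameter integrals is tested on
    sequences; restricting them to distance 1 keeps everything in one compact set. *)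
Lemma seq_continuous m (f : 'rV[R]_m -> R) (y : 'rV[R]_m) :
 (forall u : nat -> 'rV[R]_m, u n @[n --> \oo] --> y -> (forall n, `|u n-y| <= 1) ->
 f (u n) @[n --> \oo] --> f y) -> {for y, continuous f}.
Proof.
move=> h; apply: contrapT=> /cvgrPdist_lt H.
apply: H=> e e0; apply: contrapT=> hn.
have H n : exists u, `|u-y| < (n.+1%:R)^-1 /\ e <= `|f y-f u|.
 apply: contrapT=> hu; apply: hn.
 have n0 : 0 < (n.+1%:R)^-1 :> R by [].
 apply/nbhs_ballP; exists (n.+1%:R)^-1=> //= x hx /=.
 rewrite ltNge; apply/negP=> ex; apply: hu; exists x; split=> //.
 by rewrite distrC; move: hx; rewrite -ball_normE.
pose u n := sval (cid (H n)).
have hu n : `|u n-y| < (n.+1%:R)^-1 /\ e <= `|f y-f (u n)| by exact: svalP (cid (H n)).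
have cu : u n @[n --> \oo] --> y.
 apply/cvgrPdist_lt=> d d0; near=> n; rewrite distrC; apply: (lt_trans (hu n).1).
 by near: n; exact: near_infty_natSinv_lt (PosNum d0).
have := h u cu; have hb n : `|u n-y| <= 1.
 by apply: (le_trans (ltW (hu n).1)); rewrite invf_le1 // ler1n.
move=> /(_ hb) /cvgrPdist_lt /(_ e e0) [N _ /(_ N (leqnn _))] /=.
by have [_] := hu N; rewrite leNgt=> /negP.
Unshelve. all: end_near. Qed.

Lemma psmv_meas m k (xi : 'rV[R]_k -> 'rV[R]_m -> R) (y : 'rV[R]_m) : psmv xi ->
 measT (fun z=> xi z y).
Proof.
move=> /psmv_continuous /cont_slice [h _].
exact: cont_meas (h y).
Qed.

Section IntParam.
Variables (m k : nat) (g : 'rV[R]_k -> R) (r : R) (ig : Itg g) (g0 : forall z, r <= `|z| -> g z = 0).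

Lemma Itg_param (xi : 'rV[R]_k -> 'rV[R]_m -> R) y : psmv xi -> Itg (fun z=> g z*xi z y).
Proof.
move=> px; have [C hC] := cont_bounded2 (`|r| + `|y|) (psmv_continuous px).
apply: (@Itg_le _ _ _ (fun z=> C * `|g z|)).
- by apply: measurable_funM; [exact: Itg_meas|exact: psmv_meas].
- by apply: ItgZ; exact: Itg_abs.
move=> z; rewrite normrM mulrC; have [rz|rz] := leP r `|z|; first by rewrite g0 // normr0 !mulr0.
rewrite ler_wpM2r //; apply: hC; last by rewrite lerDr.
by rewrite (le_trans (ltW rz)) // (le_trans (ler_norm _)) // lerDl.
Qed.

(** Along the line through [p] the claim concerns one real variable. The weight vanishes beyond
    radius [r], so the differentiated integrand is bounded by its maximum on a compact set times the
    weight. *)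
Lemma is_derive_int (xi xi' : 'rV[R]_k -> 'rV[R]_m -> R) v : psmv xi -> psmv xi' ->
 (forall z p, is_derive p v (xi z) (xi' z p)) -> forall p,
 is_derive p v (fun y=> Int (fun z=> g z*xi z y)) (Int (fun z=> g z*xi' z p)).
Proof.
move=> px px' hd p; apply/is_derive_line/is_deriveP.
pose f (h : R) (z : 'rV[R]_k) : R := g z*xi z (h *: v+p).
have [C hC] := cont_bounded2 (`|r| + (`|v| + `|p|)) (psmv_continuous px').
have h1 (h : R) z : is_derive (h : R) (1 : R) (f^~ z) (g z*xi' z (h *: v+p)).
 have /is_derive_line /is_deriveP H := hd z (h *: v+p).
 apply: (is_deriveZ (g z))=> //; apply/is_deriveP.
 have E : (fun s : R=> s^-1 *: (xi z ((s *: (1 : R)+h) *: v+p)-xi z (h *: v+p))) =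
 (fun s : R=> s^-1 *: (xi z ((s *: (1 : R)+0) *: v+(h *: v+p))-xi z ((0 : R) *: v+(h *: v+p)))).
 by apply/funext=> t; rewrite addr0 scale0r add0r addrA -scalerDl.
 by rewrite E.
have I0 : [set` `](-1)%R, 1%R[] (0 : R) by rewrite /= in_itv /= ltrN10 ltr01.
have derE h z : partial1of2 f h z = g z*xi' z (h *: v+p).
 by rewrite partial1of2E; have [_ ->] := h1 h z.
pose F (h : R) := Int (fun z=> g z*xi z (h *: v+p)).
have HF : h^-1 *: (F (h+0)-F 0) @[h --> 0^'] --> \int[lebn R k]_z (partial1of2 f 0 z).
 apply: (@cvg_differentiation_under_integral R _ _ (lebn R k) f setT measurableT 0 (-1) 1 I0 _ _ (fun z=> C * `|g z|)).
 - by move=> h _; exact: Itg_param.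
 - pos.
 - by move=> z; rewrite mulr_ge0 //; apply: le_trans (hC 0 0 _ _); rewrite ?normr0.
 - by apply: ItgZ; exact: Itg_abs.
 - move=> h z; rewrite /= in_itv /= => /andP[hl hr] _; rewrite derE normrM mulrC.
 have [rz|rz] := leP r `|z|; first by rewrite g0 // normr0 !mulr0.
 rewrite ler_wpM2r //; apply: hC.
 by rewrite (le_trans (ltW rz)) // (le_trans (ler_norm _)) // lerDl.
 apply: (le_trans (ler_normD _ _)); rewrite normrZ.
 have : `|h| * `|v| <= `|v| by rewrite ler_piMl // ltW // ltr_norml hl.
 by have := normr_ge0 r; lra.
rewrite (_ : Int (fun z=> g z*xi' z p) = \int[lebn R k]_z (partial1of2 f 0 z)); last first.
 by apply: eq_Rintegral=> z _; rewrite derE scale0r add0r.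
rewrite (_ : (fun h : R=> _) = (fun h : R=> h^-1 *: (F (h+0)-F 0))) //.
by apply/funext=> h; rewrite [h%:A]mulr1.
Qed.

Lemma psmv_int (X : topologicalType) (xi : 'rV[R]_k -> 'rV[R]_m -> R) : psmv xi ->
 psmv (fun (_ : X) y=> Int (fun z=> g z*xi z y)).
Proof.
move=> px; exists (fun G=> exists2 xi, psmv xi & G = (fun _ y=> Int (fun z=> g z*xi z y))).
split; first by exists xi.
move=> _ [{}xi {}px ->]; split.
 move=> x p _.
 apply: (@continuous_comp _ _ _ (fun q : X*'rV[R]_m=> q.2) (fun y=> Int (fun z=> g z*xi z y))).
 exact: cvg_snd.
 apply: seq_continuous=> u cu hu /=.
 have [C hC] := cont_bounded2 (`|r| + (`|p| + 1)) (psmv_continuous px).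
 apply: (proj2 (@Int_dct R k (fun n z=> g z*xi z (u n)) (fun z=> g z*xi z p) (fun z=> C * `|g z|) _ _ _ _ _)).
 - by move=> n; apply: measurable_funM; [exact: Itg_meas|exact: psmv_meas].
 - by apply: ItgZ; exact: Itg_abs.
 - move=> n z; rewrite normrM mulrC; have [rz|rz] := leP r `|z|; first by rewrite g0 // normr0 !mulr0.
 rewrite ler_wpM2r //; apply: hC.
 by rewrite (le_trans (ltW rz)) // (le_trans (ler_norm _)) // lerDl.
 have -> : u n = p+(u n-p) by rewrite addrC subrK.
 by apply: (le_trans (ler_normD _ _)); have := hu n; have := normr_ge0 r; lra.
 - apply: aeW=> z /=; apply: cvgM; first exact: cvg_cst.
 have [_ /(_ z p)] := cont_slice (psmv_continuous px).
 by move=> h; exact: cvg_comp cu h.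
 - by apply: measurable_funM; [exact: Itg_meas|exact: psmv_meas].
move=> v Ev; have [xi' px' hd] := psm_derive px Ev.
exists (fun _ y=> Int (fun z=> g z*xi' z y)); first by exists xi'.
by move=> _ p _; apply: is_derive_int=> // z q; exact: hd.
Qed.
End IntParam.

Lemma psmv_pd n (X : topologicalType) (xi : X -> pt R n -> R) a : psmv xi ->
 psmv (fun x=> pd a (xi x)) /\ forall x p, is_derive p (delta_mx 0 a : pt R n) (xi x) (pd a (xi x) p).
Proof.
move=> px; have [|xi' px' hd] := psm_derive px (v := delta_mx 0 a); first by exists a.
have E : (fun x=> pd a (xi x)) = xi'.
 by apply/funext=> x; apply/funext=> p; rewrite /pd; have [_ ->] := hd x p I.
by rewrite E; split=> // x p; rewrite -[pd a (xi x)]/((fun x=> pd a (xi x)) x) E; exact: hd.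
Qed.

Lemma pd_int n k (g : 'rV[R]_k -> R) (r : R) (xi : 'rV[R]_k -> pt R n -> R) a : Itg g ->
 (forall z, r <= `|z| -> g z = 0) -> psmv xi ->
 pd a (fun y=> Int (fun z=> g z*xi z y)) = (fun y=> Int (fun z=> g z * pd a (xi z) y)).
Proof.
move=> ig g0 px; have [px' hd] := psmv_pd a px.
apply/funext=> p; rewrite /pd.
by have [_ ->] := @is_derive_int _ _ g r ig g0 xi (fun x=> pd a (xi x)) (delta_mx 0 a) px px' hd p.
Qed.
End RVsmooth.

(** * The operator in real coordinates *)

Section RealForm.
Variables (R : realType) (n : nat).
Notation m := (n+n)%N.
Notation V := (pt R n).
Implicit Types (a : coef_form R n) (w : V -> R).

Definition qf k (M : 'M[R]_k) (x y : 'rV[R]_k) : R := \sum_i \sum_j M i j*x 0 i*y 0 j.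

(** Blocks, signs and the factor 1/4 come from 4 d^2/dz_j dzbar_k = (dx_j dx_k + dy_j dy_k) + i
    (dx_j dy_k - dy_j dx_k), multiplied by a_jk and reduced to the real part. *)
Definition Smx a (p : V) : 'M[R]_m :=
 block_mx (\matrix_(j, k) (complex.Re (a p j k)/4)) (\matrix_(j, k) (- complex.Im (a p j k)/4))
 (\matrix_(j, k) (complex.Im (a p j k)/4)) (\matrix_(j, k) (complex.Re (a p j k)/4)).

Definition LS (S : V -> 'M[R]_m) w (p : V) : R := \sum_i \sum_j S p i j * pd i (pd j w) p.

Lemma sum_split (F : 'I_m -> R) : \sum_i F i = \sum_(j < n) F (xi j) + \sum_(j < n) F (yi j).
Proof. by rewrite big_split_ord. Qed.

Lemma SmxE a p j k : [/\ Smx a p (xi j) (xi k) = complex.Re (a p j k)/4,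
 Smx a p (xi j) (yi k) = - complex.Im (a p j k)/4,
 Smx a p (yi j) (xi k) = complex.Im (a p j k)/4 &
 Smx a p (yi j) (yi k) = complex.Re (a p j k)/4].
Proof.
by rewrite block_mxEul block_mxEur block_mxEdl block_mxEdr !mxE.
Qed.

Lemma Smx_sum a p (d : 'I_m -> 'I_m -> R) : \sum_i \sum_j Smx a p i j * d i j =
 \sum_(j < n) \sum_(k < n) (complex.Re (a p j k)/4*(d (xi j) (xi k)+d (yi j) (yi k))
 - complex.Im (a p j k)/4*(d (xi j) (yi k)-d (yi j) (xi k))).
Proof.
rewrite sum_split -big_split /=; apply: eq_bigr=> j _.
rewrite !sum_split -!big_split /=; apply: eq_bigr=> k _.
have [-> -> -> ->] := SmxE a p j k; ring.
Qed.

Lemma pd_eq i (f g : V -> R) p : (forall q, f q = g q) -> pd i f p = pd i g p.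
Proof. by move=> h; congr (pd i _ p); apply/funext. Qed.

Lemma smooth_pd w i : smooth w -> smooth (pd i w).
Proof.
move=> sw; have [h _] := psmv_pd i (smooth_psmv R^o sw).
exact: (psmv_smooth (0 : R^o) h).
Qed.

Lemma smooth_is_derive w i p : smooth w -> is_derive p (delta_mx 0 i : V) w (pd i w p).
Proof. by move=> sw; have [_ /(_ 0 p)] := psmv_pd i (smooth_psmv R^o sw). Qed.

Lemma pd_scale w i (c : R) p : smooth w -> pd i (fun q=> w q/c) p = pd i w p/c.
Proof.
move=> sw; have [_ h] := is_deriveZ c^-1 (smooth_is_derive i p sw).
rewrite [RHS]mulrC; transitivity (pd i (c^-1 \*: w) p); last exact: h.
by apply: pd_eq=> q; rewrite mulrC.
Qed.

Lemma complex_inv2 : (2%:R : R[i])^-1 = ((2^-1 : R) +i* 0)%C.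
Proof. by rewrite -[RHS]/((2^-1 : R)%:C)%C fmorphV rmorph_nat. Qed.

Lemma Re_coef (z : R[i]) (A B C D : R) :
 complex.Re (z*(((A/2 +i* (B/2))%C - 'i*(C/2 +i* (D/2))%C)*(2^-1 +i* 0)%C)) =
 complex.Re z/4*(A+D)-complex.Im z/4*(B-C).
Proof. by case: z=> u v; rewrite /=; field. Qed.

Lemma LopE a w p : smooth w -> Lop a w p = LS (Smx a) w p.
Proof.
move=> sw.
have pd0 i q : pd i (fun _ : V=> 0 : R) q = 0.
 by rewrite /pd; exact: derive_cst.
have dzbE k : dzb k (fun q=> ((w q)%:C)%C) = (fun q=> ((pd (xi k) w q/2) +i* (pd (yi k) w q/2))%C).
 apply/funext=> q; rewrite /dzb /pdC /=.
 have -> : pd (xi k) (fun _ : V=> 0 : R) q = 0 by [].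
 have -> : pd (yi k) (fun _ : V=> 0 : R) q = 0 by [].
 rewrite -[RHS]/(_ +i* _)%C.
 rewrite complex_inv2.
 by simpc; rewrite ?(mulr0, mul0r, subr0, addr0, add0r).
rewrite /Lop /LS Smx_sum raddf_sum /=.
apply: eq_bigr=> j _; rewrite raddf_sum /=; apply: eq_bigr=> k _.
rewrite dzbE /dz /pdC /=.
 have s1 := smooth_pd (xi k) sw; have s2 := smooth_pd (yi k) sw.
 rewrite !pd_scale //.
 rewrite complex_inv2.
exact: Re_coef.
Qed.

Lemma qf_split a p (x : V) : qf (Smx a p) x x =
 \sum_(j < n) \sum_(k < n) (complex.Re (a p j k)/4*(x 0 (xi j)*x 0 (xi k)+x 0 (yi j)*x 0 (yi k))
 - complex.Im (a p j k)/4*(x 0 (xi j)*x 0 (yi k)-x 0 (yi j)*x 0 (xi k))).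
Proof.
rewrite -(Smx_sum a p (fun i j=> x 0 i*x 0 j)).
by apply: eq_bigr=> i _; apply: eq_bigr=> j _; rewrite mulrA.
Qed.

(** A positive element of [R[i]] is real. Testing with v_j = x_j - i y_j therefore gives two facts:
    the real part is four times the quadratic form of [Smx], and the imaginary part vanishes. The
    second is the source of the symmetry of [Smx]. *)
Lemma form_real (U : set V) a p (x : V) : form_strictly_positive U a -> U p -> x != 0 ->
 0 < qf (Smx a p) x x /\
 \sum_(j < n) \sum_(k < n) (complex.Im (a p j k)*(x 0 (xi j)*x 0 (xi k)+x 0 (yi j)*x 0 (yi k))
 + complex.Re (a p j k)*(x 0 (xi j)*x 0 (yi k)-x 0 (yi j)*x 0 (xi k))) = 0.
Proof.
move=> fp Up x0.
pose v : 'rV[R[i]]_n := \row_j (x 0 (xi j) -i* x 0 (yi j))%C.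
have v0 : v != 0.
 apply: contra x0=> /eqP v0; apply/eqP/rowP=> i; rewrite mxE.
 case: (split_ordP i)=> j ->.
 by have := congr1 (fun u : 'rV_n=> complex.Re (u 0 j)) v0; rewrite !mxE.
 by have := congr1 (fun u : 'rV_n=> complex.Im (u 0 j)) v0; rewrite !mxE /= => /eqP; rewrite oppr_eq0=> /eqP.
have := fp p Up v v0; rewrite ltcE /= => /andP[/eqP h1 h2].
split.
 move: h2; rewrite raddf_sum /= => h2; rewrite qf_split.
 have -> : \sum_(j < n) \sum_(k < n) (complex.Re (a p j k)/4*(x 0 (xi j)*x 0 (xi k)+x 0 (yi j)*x 0 (yi k))
 - complex.Im (a p j k)/4*(x 0 (xi j)*x 0 (yi k)-x 0 (yi j)*x 0 (xi k))) =
 (\sum_(j < n) complex.Re (\sum_(k < n) a p j k * v 0 j*(v 0 k)^*)%C)/4; last pos.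
 rewrite mulr_suml; apply: eq_bigr=> j _; rewrite raddf_sum mulr_suml; apply: eq_bigr=> k _.
 by rewrite !mxE /=; case: (a p j k)=> s t /=; simpc=> /=; field.
move: h1; rewrite raddf_sum /= => h1; rewrite -[RHS]h1.
apply: eq_bigr=> j _; rewrite raddf_sum; apply: eq_bigr=> k _.
by rewrite !mxE /=; case: (a p j k)=> s t /=; simpc=> /=; ring.
Qed.
End RealForm.

(** * Uniform ellipticity on the domain *)

Section Elliptic.
Variables (R : realType) (n : nat).
Notation m := (n+n)%N.
Notation V := (pt R n).
Implicit Types (a : coef_form R n).

(** All bounds are merged into one constant [L]. Lipschitz bounds are asked only within a sup-norm
    ball contained in [D], because [D] need not be convex. *)
Record elliptic (D : set V) (S T : V -> 'M[R]_m) (L : R) : Prop := Elliptic {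
 el_open : open D;
 el_L : 1 <= L;
 el_sym : forall p i j, D p -> S p i j = S p j i;
 el_cont : forall p i j, D p -> {for p, continuous (fun q=> S q i j)};
 el_der : forall p i j k, D p -> derivable (fun q=> S q i j) p (delta_mx 0 k : V);
 el_dcont : forall p i j k, D p -> {for p, continuous (pd k (fun q=> S q i j))};
 el_div : forall p j, D p -> \sum_i pd i (fun q=> S q i j) p = 0;
 el_Sb : forall p i j, D p -> `|S p i j| <= L;
 el_Tb : forall p i j, D p -> `|T p i j| <= L;
 el_inv : forall p, D p -> S p *m T p = 1%:M;
 el_Tsym : forall p i j, D p -> T p i j = T p j i;
 el_Tpos : forall p (x : V), D p -> `|x|^+2 <= L*qf (T p) x x;
 el_Slip : forall p r p' i j, ball p r `<=` D -> ball p r p' -> `|S p i j-S p' i j| <= L * `|p-p'|;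
 el_Tlip : forall p r p' i j, ball p r `<=` D -> ball p r p' -> `|T p i j-T p' i j| <= L * `|p-p'|
}.

Lemma derive1_bound (g g' : R -> R) (h B : R) :
 (forall s, `|s| <= `|h| -> is_derive (s : R) (1 : R) g (g' s)) ->
 (forall s, `|s| <= `|h| -> `|g' s| <= B) -> `|g h-g 0| <= B * `|h|.
Proof.
move=> gd gb.
have cg s : `|s| <= `|h| -> {for s, continuous g}.
 by move=> /gd; exact: is_derive_continuous.
have [h0|h0|->] := ltgtP h 0; last by rewrite subrr !normr0 mulr0.
- have [||c] := @MVT R g g' _ _ h0.
 + move=> x; rewrite in_itv /= => /andP[h1 h2]; apply: gd.
 by rewrite !ltr0_norm //; lra.
 + apply: continuous_in_subspaceT=> x; rewrite inE /= in_itv /= => /andP[h1 h2]; apply: cg.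
 by rewrite (ltr0_norm h0) ler0_norm //; lra.
 rewrite in_itv /= => /andP[h1 h2] E.
 rewrite distrC E normrM sub0r normrN ler_wpM2r //; apply: gb.
 by rewrite !ltr0_norm //; lra.
- have [||c] := @MVT R g g' _ _ h0.
 + move=> x; rewrite in_itv /= => /andP[h1 h2]; apply: gd.
 by rewrite !gtr0_norm //; lra.
 + apply: continuous_in_subspaceT=> x; rewrite inE /= in_itv /= => /andP[h1 h2]; apply: cg.
 by rewrite (gtr0_norm h0) ger0_norm //; lra.
 rewrite in_itv /= => /andP[h1 h2] E.
 rewrite E normrM subr0 ler_wpM2r //; apply: gb.
 by rewrite !gtr0_norm //; lra.
Qed.

Lemma coord_norm k (x : 'rV[R]_k) i : `|x 0 i| <= `|x|.
Proof. by rewrite [leRHS]/Num.norm /= mx_normrE; apply/bigmax_geP; right=> /=; exists (0, i). Qed.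

Lemma norm_le_coord k (x : 'rV[R]_k) (c : R) : 0 <= c -> (forall i, `|x 0 i| <= c) -> `|x| <= c.
Proof.
move=> c0 h; rewrite [leLHS]/Num.norm /= mx_normrE; apply/bigmax_leP; split=> // -[i j] _ /=.
by rewrite (ord1 i).
Qed.

(** Coordinates are changed one at a time. A sup-norm ball is a cube, so the intermediate points
    stay inside, and the mean value theorem for partial derivatives is enough. *)
Lemma lip_cube (f : V -> R) (p p' : V) (r B : R) : 0 <= B ->
 (forall q i, ball p r q -> derivable f q (delta_mx 0 i : V) /\ `|pd i f q| <= B) ->
 ball p r p' -> `|f p-f p'| <= m%:R*B * `|p-p'|.
Proof.
move=> B0 hf hp'.
have r0 : 0 < r by case: hp'.
have dp i : `|p 0 i-p' 0 i| <= `|p-p'| by have := coord_norm (p-p') i; rewrite !mxE.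
pose q (k : nat) : V := \row_i (if (i < k)%N then p' 0 i else p 0 i).
have q0 : q 0%N = p by apply/rowP=> i; rewrite mxE.
have qm : q m = p' by apply/rowP=> i; rewrite mxE ltn_ord.
have step k : (k <= m)%N -> `|f p-f (q k)| <= k%:R*(B * `|p-p'|).
 elim: k=> [_|k IH km]; first by rewrite q0 subrr normr0 mul0r.
 apply: (le_trans (ler_distD (f (q k)) _ _)).
 rewrite -natr1 mulrDl mul1r lerD //; first by apply: IH; exact: ltnW.
 pose i := Ordinal km; pose h := p' 0 i-p 0 i.
 pose g (s : R) := f (s *: (delta_mx 0 i : V)+q k).
 have qE : q k.+1 = h *: (delta_mx 0 i : V)+q k.
 apply/rowP=> j; rewrite !mxE /= ltnS leq_eqVlt.
 have [->|ji] := eqVneq j i; first by rewrite !eqxx ltnn mulr1 subrK.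
 rewrite eq_sym in ji; rewrite /= (negbTE (_ : (j : nat) != k)) /=; last by apply: contra ji=> /eqP e; apply/eqP/val_inj.
 lra.
 have inb s : `|s| <= `|h| -> ball p r (s *: (delta_mx 0 i : V)+q k).
 move=> sh; apply/ball_rVE=> // j.
 have hj := (ball_rVE _ _ r0).1 hp' j; rewrite !mxE /=.
 have [->|ji] := eqVneq j i; last first.
 by rewrite mulr0 add0r; case: ifP=> // _; rewrite subrr normr0.
 rewrite ltnn mulr1 opprD addrCA subrr addr0 normrN (le_lt_trans sh) //.
 by rewrite /h distrC; exact: (ball_rVE _ _ r0).1 hp' i.
 have gd s : `|s| <= `|h| -> is_derive (s : R) (1 : R) g (pd i f (s *: (delta_mx 0 i : V)+q k)).
 move=> /inb sb; have [df _] := hf _ i sb.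
 have /is_derive_line/is_deriveP := derivableP df.
 move=> H; apply/is_deriveP; move: H.
 have E : (fun t : R=> t^-1 *: (g (t *: (1 : R)+s)-g s)) =
 (fun t : R=> t^-1 *: (f ((t *: (1 : R)+0) *: (delta_mx 0 i : V)+(s *: (delta_mx 0 i : V)+q k))-f ((0 : R) *: (delta_mx 0 i : V)+(s *: (delta_mx 0 i : V)+q k)))).
 by apply/funext=> t; rewrite addr0 scale0r add0r addrA -scalerDl.
 by rewrite E.
 have := derive1_bound gd (fun s sh=> (hf _ i (inb s sh)).2).
 rewrite /g scale0r add0r -qE distrC=> H; apply: (le_trans H).
 by rewrite ler_wpM2l // distrC.
by have := step m (leqnn _); rewrite qm mulrA.
Qed.

Lemma cpt_bounded (W : topologicalType) (A : set W) (f : W -> R) : compact A ->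
 (forall x, A x -> {for x, continuous f}) -> exists2 C, 0 < C & forall x, A x -> `|f x| <= C.
Proof.
move=> cA cf.
have cs : {within A, continuous f} by apply: continuous_in_subspaceT=> x; rewrite inE; exact: cf.
have /compact_bounded [M [_ hM]] := continuous_compact cs cA.
exists (`|M| + 1); first pos.
move=> x Ax; apply: (hM (`|M| + 1)); last pos.
by rewrite ltr_pwDr // ler_norm.
Qed.

Lemma cpt_boundedF (W : topologicalType) (A : set W) (J : finType) (f : J -> W -> R) : compact A ->
 (forall j x, A x -> {for x, continuous (f j)}) ->
 exists2 C, 0 < C & forall j x, A x -> `|f j x| <= C.
Proof.
move=> cA cf; have h j := cpt_bounded cA (cf j).
pose C j := sval (cid2 (h j)).
have hC j : 0 < C j /\ forall x, A x -> `|f j x| <= C j by rewrite /C; case: cid2.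
exists (1 + \sum_j C j).
 by rewrite ltr_pwDl // sumr_ge0 // => j _; exact: ltW (hC j).1.
move=> j x Ax; apply: (le_trans ((hC j).2 x Ax)); rewrite (bigD1 j) //= addrCA lerDl.
by rewrite addr_ge0 // sumr_ge0 // => i _; exact: ltW (hC i).1.
Qed.

Lemma qfZ k (M : 'M[R]_k) (x y : 'rV[R]_k) (s t : R) : qf M (s *: x) (t *: y) = s*t*qf M x y.
Proof.
rewrite /qf mulr_sumr; apply: eq_bigr=> i _; rewrite mulr_sumr; apply: eq_bigr=> j _.
by rewrite !mxE; ring.
Qed.

Lemma qf_bound k (M : 'M[R]_k) (x y : 'rV[R]_k) (B : R) : (forall i j, `|M i j| <= B) ->
 `|qf M x y| <= k%:R^+2*B * `|x| * `|y|.
Proof.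
move=> hM; apply: (le_trans (ler_norm_sum _ _ _)).
have -> : k%:R^+2*B * `|x| * `|y| = \sum_(i < k) \sum_(j < k) (B * `|x| * `|y|).
 rewrite sumr_const card_ord -[RHS]mulr_natl sumr_const card_ord -[X in _ = _*X]mulr_natl.
 lra.
apply: ler_sum=> i _; apply: (le_trans (ler_norm_sum _ _ _)); apply: ler_sum=> j _.
rewrite !normrM ler_pM ?mulr_ge0 ?ler_pM ?hM ?coord_norm //.
Qed.

Lemma qf_mul k (M : 'M[R]_k) (x y : 'rV[R]_k) : qf M x y = (x *m M *m y^T) 0 0.
Proof.
rewrite /qf mxE; under [RHS]eq_bigr do rewrite mxE mulr_suml.
rewrite exchange_big; apply: eq_bigr=> i _; apply: eq_bigr=> j _.
by rewrite mxE; ring.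
Qed.

Lemma near_continuous (W : topologicalType) (g h : W -> R) (p : W) :
 (\forall q \near p, g q = h q) -> {for p, continuous h} -> {for p, continuous g}.
Proof.
move=> gh ch; have e := nbhs_singleton gh.
suff : g @ p --> g p by [].
rewrite e; apply: cvg_trans ch; apply: near_eq_cvg.
by apply: filterS gh=> q ->.
Qed.

Lemma Smx_entry a i j : exists c : R, exists2 f : V -> R, forall U, form_C1 U a -> Ck 1 U f &
 forall q, Smx a q i j = c*f q.
Proof.
case: (split_ordP i)=> k ->; case: (split_ordP j)=> l ->.
- exists (4^-1), (fun p=> complex.Re (a p k l))=> [U /(_ k l) []//|q].
 by have [] := SmxE a q k l; rewrite /xi=> -> _ _ _; rewrite mulrC.
- exists (- 4^-1), (fun p=> complex.Im (a p k l))=> [U /(_ k l) []//|q].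
 by have [] := SmxE a q k l; rewrite /xi /yi=> _ -> _ _; rewrite mulNr mulrC mulNr.
- exists (4^-1), (fun p=> complex.Im (a p k l))=> [U /(_ k l) []//|q].
 by have [] := SmxE a q k l; rewrite /xi /yi=> _ _ -> _; rewrite mulrC.
- exists (4^-1), (fun p=> complex.Re (a p k l))=> [U /(_ k l) []//|q].
 by have [] := SmxE a q k l; rewrite /xi /yi=> _ _ _ ->; rewrite mulrC.
Qed.

Lemma Ck1P (U : set V) (f : V -> R) : Ck 1 U f -> forall p, U p ->
 [/\ {for p, continuous f}, forall i, derivable f p (delta_mx 0 i : V) &
 forall i, {for p, continuous (pd i f)}].
Proof.
move=> [h1 h2] p Up; split.
- exact: (h2 [::]).
- by move=> i; exact: (h1 [::]).
- by move=> i; exact: (h2 [:: i]).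
Qed.

Lemma pd_scale' (f : V -> R) (c : R) i p : derivable f p (delta_mx 0 i : V) ->
 pd i (fun q=> c*f q) p = c * pd i f p.
Proof. by move=> /derivableP h; have [_] := is_deriveZ c h. Qed.

Lemma Smx_C1 (U : set V) a : open U -> form_C1 U a -> forall p i j, U p ->
 [/\ {for p, continuous (fun q=> Smx a q i j)},
 forall k, derivable (fun q=> Smx a q i j) p (delta_mx 0 k : V) &
 forall k, {for p, continuous (pd k (fun q=> Smx a q i j))}].
Proof.
move=> oU aC1 p i j Up; have [c [f /(_ U aC1) fC E]] := Smx_entry a i j.
rewrite (_ : (fun q=> _) = (fun q=> c*f q)); last exact/funext.
have [c1 c2 c3] := Ck1P fC Up; split.
- by apply: continuousM=> //; exact: cst_continuous.
- by move=> k; exact: derivableZ.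
- move=> k; apply: (@near_continuous _ _ (fun q=> c * pd k f q)); last first.
 by apply: continuousM=> //; exact: cst_continuous.
 have : \forall q \near p, U q by exact: open_nbhs_nbhs.
 apply: filterS=> q Uq; apply: pd_scale'.
 by have [] := Ck1P fC Uq.
Qed.

Lemma Re_dz (A B C D : R) :
 complex.Re (((A +i* B)%C - 'i*(C +i* D)%C)/2%:R) = (A+D)/2 /\
 complex.Im (((A +i* B)%C - 'i*(C +i* D)%C)/2%:R) = (B-C)/2.
Proof. by rewrite complex_inv2 /=; split; field. Qed.

(** For an x-index [j] the sum is half the real part of the first closedness relation, for a y-index
    minus half its imaginary part. *)
Lemma Smx_div (U : set V) a : form_C1 U a -> form_closed U a -> forall p j, U p ->
 \sum_i pd i (fun q=> Smx a q i j) p = 0.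
Proof.
move=> aC1 acl p j Up; have [h _] := acl p Up.
have dR k l i : derivable (fun q=> complex.Re (a q k l)) p (delta_mx 0 i : V).
 by have [fC _] := aC1 k l; have [] := Ck1P fC Up.
have dI k l i : derivable (fun q=> complex.Im (a q k l)) p (delta_mx 0 i : V).
 by have [_ fC] := aC1 k l; have [] := Ck1P fC Up.
case: (split_ordP j)=> l ->.
 transitivity ((\sum_(k < n) complex.Re (dz k (fun q=> a q k l) p))/2); last first.
 by have /(congr1 (@complex.Re R)) := h l; rewrite raddf_sum /= => ->; rewrite mul0r.
 rewrite sum_split -big_split mulr_suml; apply: eq_bigr=> k _; rewrite -[LHS]/(_+_).
 rewrite {1}/dz (Re_dz (pd (xi k) (fun q=> complex.Re (a q k l)) p) (pd (xi k) (fun q=> complex.Im (a q k l)) p)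
 (pd (yi k) (fun q=> complex.Re (a q k l)) p) (pd (yi k) (fun q=> complex.Im (a q k l)) p)).1.
 rewrite [X in X+_](pd_eq _ _ (g := fun q=> 4^-1*complex.Re (a q k l))); last first.
 by move=> q; have [-> _ _ _] := SmxE a q k l; rewrite mulrC.
 rewrite [X in _+X](pd_eq _ _ (g := fun q=> 4^-1*complex.Im (a q k l))); last first.
 by move=> q; have [_ _ -> _] := SmxE a q k l; rewrite mulrC.
 by rewrite !pd_scale' //; field.
transitivity (- (\sum_(k < n) complex.Im (dz k (fun q=> a q k l) p))/2); last first.
 by have /(congr1 (@complex.Im R)) := h l; rewrite raddf_sum /= => ->; rewrite oppr0 mul0r.
rewrite sum_split -big_split -sumrN mulr_suml; apply: eq_bigr=> k _; rewrite -[LHS]/(_+_).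
rewrite {1}/dz (Re_dz (pd (xi k) (fun q=> complex.Re (a q k l)) p) (pd (xi k) (fun q=> complex.Im (a q k l)) p)
 (pd (yi k) (fun q=> complex.Re (a q k l)) p) (pd (yi k) (fun q=> complex.Im (a q k l)) p)).2.
rewrite [X in X+_](pd_eq _ _ (g := fun q=> (- 4^-1)*complex.Im (a q k l))); last first.
 by move=> q; have [_ -> _ _] := SmxE a q k l; rewrite mulNr mulrC mulNr.
rewrite [X in _+X](pd_eq _ _ (g := fun q=> 4^-1*complex.Re (a q k l))); last first.
 by move=> q; have [_ _ _ ->] := SmxE a q k l; rewrite mulrC.
by rewrite !pd_scale' //; field.
Qed.

Lemma qf_delta k (M : 'M[R]_k) i j : qf M (delta_mx 0 i) (delta_mx 0 j) = M i j.
Proof.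
rewrite /qf (bigD1 i) //= [X in _+X]big1 ?addr0; last first.
 move=> l li; apply: big1=> l' _; rewrite !mxE eqxx /= (negbTE li).
 by rewrite mulr0 mul0r.
rewrite (bigD1 j) //= big1 ?addr0; last first.
 by move=> l lj; rewrite !mxE (negbTE lj) mulr0.
by rewrite !mxE !eqxx !mulr1.
Qed.

Lemma qfD k (M : 'M[R]_k) (x y z : 'rV[R]_k) :
 qf M (x+y) z = qf M x z+qf M y z /\ qf M z (x+y) = qf M z x+qf M z y.
Proof.
rewrite /qf -!big_split; split; apply: eq_bigr=> i _; rewrite -big_split; apply: eq_bigr=> j _;
by rewrite !mxE /=; ring.
Qed.

Lemma qf0_anti k (M : 'M[R]_k) : (forall x, qf M x x = 0) -> forall i j, M i j = - M j i.
Proof.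
move=> h i j; have := h (delta_mx 0 i+delta_mx 0 j).
rewrite (qfD M _ _ _).1 !(qfD M _ _ _).2 !h add0r addr0 !qf_delta=> /eqP.
lra.
Qed.

(** The imaginary part found to vanish in [form_real] is itself a quadratic form, with matrix [M]. A
    matrix whose quadratic form is zero is antisymmetric, and for the blocks of [M] this says that
    [a] is hermitian. *)
Lemma Smx_sym (U : set V) a : form_strictly_positive U a -> forall p i j, U p ->
 Smx a p i j = Smx a p j i.
Proof.
move=> apos p i j Up.
pose M : 'M[R]_m := block_mx (\matrix_(j, k) complex.Im (a p j k)) (\matrix_(j, k) complex.Re (a p j k))
 (- \matrix_(j, k) complex.Re (a p j k)) (\matrix_(j, k) complex.Im (a p j k)).
have hM x : qf M x x = 0.
 have [->|x0] := eqVneq x 0; first by rewrite /qf big1 // => k _; rewrite big1 // => l _; rewrite !mxE mulr0.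
 rewrite -[RHS](form_real apos Up x0).2 /qf sum_split -big_split /=; apply: eq_bigr=> k _.
 rewrite !sum_split -!big_split /=; apply: eq_bigr=> l _.
 by rewrite /M /xi /yi block_mxEul block_mxEur block_mxEdl block_mxEdr !mxE; ring.
have anti := qf0_anti hM.
have hI k l : complex.Im (a p k l) = - complex.Im (a p l k).
 by have := anti (xi k) (xi l); rewrite !block_mxEul !mxE.
have hR k l : complex.Re (a p k l) = complex.Re (a p l k).
 by have := anti (xi k) (yi l); rewrite block_mxEur block_mxEdl !mxE opprK.
case: (split_ordP i)=> k ->; case: (split_ordP j)=> l ->.
- by have [-> _ _ _] := SmxE a p k l; have [-> _ _ _] := SmxE a p l k; rewrite hR.
- by have [_ -> _ _] := SmxE a p k l; have [_ _ -> _] := SmxE a p l k; rewrite hI opprK.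
- by have [_ _ -> _] := SmxE a p k l; have [_ -> _ _] := SmxE a p l k; rewrite hI.
- by have [_ _ _ ->] := SmxE a p k l; have [_ _ _ ->] := SmxE a p l k; rewrite hR.
Qed.

Lemma qfM k (M : 'M[R]_k) (x y : 'rV[R]_k) : qf M x y = \sum_j (x *m M) 0 j*y 0 j.
Proof. by rewrite qf_mul mxE; apply: eq_bigr=> j _; rewrite [y^T _ _]mxE. Qed.

Lemma sum_le_const k (F : 'I_k -> R) (c : R) : (forall i, F i <= c) -> \sum_i F i <= k%:R*c.
Proof. move=> h; apply: (@le_trans _ _ (\sum_(i < k) c)); first exact: ler_sum.
by rewrite sumr_const card_ord mulr_natl. Qed.

Lemma mulmx_norm k (M : 'M[R]_k) (x : 'rV[R]_k) (B : R) : (forall i j, `|M i j| <= B) ->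
 `|x *m M| <= k%:R*B * `|x|.
Proof.
case: k M x=> [|k] M x hM; first by rewrite mul0r mul0r; apply: norm_le_coord=> // -[].
have B0 : 0 <= B by apply: le_trans (hM ord0 ord0).
apply: norm_le_coord=> [|j]; first pos.
rewrite mxE; apply: (le_trans (ler_norm_sum _ _ _)).
rewrite -mulrA; apply: sum_le_const=> i.
by rewrite normrM mulrC ler_pM ?coord_norm.
Qed.

Lemma continuous_sum (W : topologicalType) (J : Type) (s : seq J) (F : J -> W -> R) (w : W) :
 (forall j, {for w, continuous (F j)}) -> {for w, continuous (fun x=> \sum_(j <- s) F j x)}.
Proof.
move=> cF; elim: s=> [|j s IH].
 rewrite (_ : (fun x=> _) = (fun=> 0)); last by apply/funext=> x; rewrite big_nil.
 exact: cst_continuous.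
rewrite (_ : (fun x=> _) = (fun x=> F j x + \sum_(j <- s) F j x)); last by apply/funext=> x; rewrite big_cons.
exact: continuousD.
Qed.

(** The reciprocal of the form is continuous on the compact product of [A] with the unit sphere,
    hence bounded; homogeneity does the rest. *)
Lemma qf_pos_compact (A : set V) (S : V -> 'M[R]_m) : (0 < n)%N -> compact A ->
 (forall p i j, A p -> {for p, continuous (fun q=> S q i j)}) ->
 (forall p x, A p -> x != 0 -> 0 < qf (S p) x x) ->
 exists2 l, 0 < l & forall p x, A p -> `|x|^+2 <= l*qf (S p) x x.
Proof.
move=> n0 cA cS pS.
have cSph : compact [set x : V | `|x| = 1].
 apply: (@subclosed_compact _ _ [set x : V | `|x| <= 1]).
 - have -> : [set x : V | `|x| = 1] = (@Num.norm R V) @^-1` [set 1] by [].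
 by apply: closed_comp=> [x _|]; [exact: norm_continuous|exact: closed_eq].
 - by have := @compact_cball R _ (0 : V) 1; congr (compact _); apply/seteqP; split=> x /=; rewrite ?sub0r ?normrN.
 - by move=> x /= ->.
have c2 := compact_setX cA cSph.
have [|l l0 hl] := @cpt_bounded _ _ (fun z : V*V=> (qf (S z.1) z.2 z.2)^-1) c2; last first.
 exists l=> // p x Ap.
 have [->|x0] := eqVneq x 0; first by rewrite normr0 expr0n /= /qf big1 ?mulr0 // => i _; rewrite big1 // => j _; rewrite !mxE mulr0.
 have xn : 0 < `|x| by rewrite normr_gt0.
 have := hl (p, `|x|^-1 *: x).
 rewrite /= qfZ=> /(_ _); rewrite normrZ normfV normr_id mulVf ?gt_eqF // => /(_ (conj Ap erefl)).
 have q0 := pS p x Ap x0.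
 rewrite normfV ger0_norm; last pos.
 rewrite -invfM -expr2 invfM invrK=> h.
 by rewrite -ler_pdivrMr // mulrC; move: h; rewrite mulrC.
move=> [p x] [/= Ap x1].
have x0 : x != 0 by rewrite -normr_gt0 x1.
apply: continuousV; first by rewrite gt_eqF // pS.
apply: continuous_sum=> i; apply: continuous_sum=> j.
have cx k : {for (p, x), continuous (fun z : V*V=> z.2 0 k)}.
 apply: (@continuous_comp _ _ _ snd (fun y : V=> y 0 k)); first exact: cvg_snd.
 exact: coord_continuous.
apply: continuousM=> //; apply: continuousM=> //.
by apply: (@continuous_comp _ _ _ fst (fun y : V=> S y i j)); [exact: cvg_fst|exact: cS].
Qed.

Lemma norm_le_enorm (x : V) : `|x| <= enorm x.
Proof.
apply: norm_le_coord; first exact: sqrtr_ge0.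
move=> i; rewrite -sqrtr_sqr /enorm ler_wsqrtr // /sqnorm (bigD1 i) //= lerDl.
by rewrite sumr_ge0 // => j _; rewrite sqr_ge0.
Qed.

Lemma bounded_closure_compact (D : set V) : (exists M, forall z, D z -> enorm z <= M) -> compact (closure D).
Proof.
move=> [M hM]; apply: bounded_closed_compact; last exact: closed_closure.
exists M; split; first exact: num_real.
move=> N MN x clx.
have cN : closed [set y : V | `|y| <= N].
 by apply: (@closed_comp _ _ (@Num.norm R V) [set t | t <= N])=> [y _|]; [exact: norm_continuous|exact: closed_le].
suff : closure [set y : V | `|y| <= N] x by rewrite -(closure_id _).1.
by apply: closure_subset clx=> y Dy; exact: (le_trans (norm_le_enorm _) (ltW (le_lt_trans (hM y Dy) MN))).
Qed.

Lemma smx_elliptic (U D : set V) a : (0 < n)%N -> open D -> open U -> closure D `<=` U ->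
 (exists M, forall z, D z -> enorm z <= M) ->
 form_C1 U a -> form_closed U a -> form_strictly_positive U a ->
 exists L, elliptic D (Smx a) (fun p=> invmx (Smx a p)) L.
Proof.
move=> n0 oD oU clD bdD aC1 acl apos.
have DU : D `<=` U by apply: subset_trans clD; exact: subset_closure.
have cD := bounded_closure_compact bdD.
have [C1 C10 hC1] := @cpt_boundedF _ _ _ (fun (ij : 'I_m*'I_m) q=> Smx a q ij.1 ij.2) cD
 (fun ij x Dx=> let: And3 h _ _ := Smx_C1 oU aC1 ij.1 ij.2 (clD _ Dx) in h).
have [C2 C20 hC2] := @cpt_boundedF _ _ _ (fun (ij : 'I_m*'I_m*'I_m)=> pd ij.2 (fun q=> Smx a q ij.1.1 ij.1.2)) cD
 (fun ij x Dx=> let: And3 _ _ h := Smx_C1 oU aC1 ij.1.1 ij.1.2 (clD _ Dx) in h ij.2).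
have pS p x : U p -> x != 0 -> 0 < qf (Smx a p) x x.
 by move=> Up x0; exact: (form_real apos Up x0).1.
have [l l0 hl] := qf_pos_compact n0 cD (fun p i j Dp=> let: And3 h _ _ := Smx_C1 oU aC1 i j (clD _ Dp) in h)
 (fun p x Dp=> pS p x (clD _ Dp)).
pose T p := invmx (Smx a p).
have uS p : D p -> Smx a p \in unitmx.
 move=> /DU Up; rewrite -row_free_unit; apply: inj_row_free=> v v0; apply/eqP/negPn/negP=> vn.
 by have := pS p v Up vn; rewrite qf_mul v0 mul0mx mxE ltxx.
have TS p : D p -> T p *m Smx a p = 1%:M by move=> /uS; exact: mulVmx.
have ST p : D p -> Smx a p *m T p = 1%:M by move=> /uS; exact: mulmxV.
have Sb p i j : D p -> `|Smx a p i j| <= C1.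
 by move=> Dp; exact: (hC1 (i, j) p (subset_closure Dp)).
have Tb p i j : D p -> `|T p i j| <= l * m%:R.
 move=> Dp; pose y : V := delta_mx 0 i; pose x := y *m T p.
 have -> : T p i j = x 0 j by rewrite /x -rowE mxE.
 apply: (le_trans (coord_norm _ _)).
 have h := hl p x (subset_closure Dp).
 have y1 k : `|y 0 k| <= 1 by rewrite mxE /=; case: eqP=> _; rewrite ?normr0 ?normr1.
 have h2 : qf (Smx a p) x x <= m%:R * `|x|.
 rewrite qfM [x *m _](_ : _ = y); last by rewrite -mulmxA TS // mulmx1.
 apply: le_trans (ler_norm _) _; apply: le_trans (ler_norm_sum _ _ _) _.
 by apply: sum_le_const=> k; rewrite normrM -[leRHS]mul1r ler_pM ?coord_norm.
 have [->|x0] := eqVneq x 0; first by rewrite normr0 mulr_ge0 // ltW.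
 have xn : 0 < `|x| by rewrite normr_gt0.
 rewrite -(ler_pM2r xn) -expr2 (le_trans h) // -mulrA ler_pM2l //.
have Tsym p i j : D p -> T p i j = T p j i.
 move=> Dp; suff E : T p = (T p)^T by rewrite {1}E mxE.
 rewrite /T trmx_inv; congr invmx; apply/matrixP=> k l'.
 by rewrite [RHS]mxE; apply: (Smx_sym apos); exact: DU.
have Slip p r p' i j : ball p r `<=` D -> ball p r p' ->
 `|Smx a p i j-Smx a p' i j| <= m%:R*C2 * `|p-p'|.
 move=> bD bp; apply: (lip_cube (f := fun q=> Smx a q i j) (ltW C20) _ bp)=> q k bq.
 have Dq := bD _ bq; have [_ h _] := Smx_C1 oU aC1 i j (DU _ Dq); split; first exact: h.
 exact: (hC2 (i, j, k) q (subset_closure Dq)).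
pose L := 1+(C1+l * m%:R+l*(m%:R*C1)^+2+m%:R*C2+m%:R^+2*(l * m%:R)^+2*(m%:R*C2)).
have m0 : 0 <= m%:R :> R by [].
have [a1 a2] : 0 <= l * m%:R /\ 0 <= l*(m%:R*C1)^+2 by split; repeat (apply: mulr_ge0 || apply: exprn_ge0)=> //; exact: ltW.
have [a3 a4] : 0 <= m%:R*C2 /\ 0 <= m%:R^+2*(l * m%:R)^+2*(m%:R*C2) by split; repeat (apply: mulr_ge0 || apply: exprn_ge0)=> //; exact: ltW.
exists L; split=> //.
- by rewrite /L lerDl; lra.
- by move=> p i j /DU; exact: (Smx_sym apos).
- by move=> p i j /DU Up; have [] := Smx_C1 oU aC1 i j Up.
- by move=> p i j k /DU Up; have [_ h _] := Smx_C1 oU aC1 i j Up; exact: h.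
- by move=> p i j k /DU Up; have [_ _ h] := Smx_C1 oU aC1 i j Up; exact: h.
- by move=> p j /DU; exact: (Smx_div aC1 acl).
- by move=> p i j Dp; apply: (le_trans (Sb p i j Dp)); rewrite /L; lra.
- by move=> p i j Dp; apply: (le_trans (Tb p i j Dp)); rewrite /L; lra.
(* The form of the inverse at [x] equals the form of [Smx] at y = x T, and x = y S bounds |x| by
   |y|; so positivity of [Smx] at [y] transfers. *)
- move=> p x Dp; pose y := x *m T p.
 have xE : x = y *m Smx a p by rewrite -mulmxA TS // mulmx1.
 have -> : qf (invmx (Smx a p)) x x = qf (Smx a p) y y.
 rewrite !qf_mul -[in x *m _ *m _]/(T p) -/y {1}xE trmx_mul -mulmxA; congr ((_ *m (_ *m _)) 0 0).
 by apply/matrixP=> k l'; rewrite mxE (Smx_sym apos) //; exact: DU.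
 have h := hl p y (subset_closure Dp).
 have h2 : `|x| <= m%:R*C1 * `|y| by rewrite {1}xE; apply: mulmx_norm=> i j; exact: Sb.
 have q0 : 0 <= qf (Smx a p) y y by rewrite -(pmulr_rge0 _ l0); apply: le_trans h; rewrite exprn_ge0.
 apply: (@le_trans _ _ (l*(m%:R*C1)^+2*qf (Smx a p) y y)); last by apply: ler_wpM2r=> //; rewrite /L; lra.
 rewrite mulrAC mulrC.
 apply: (@le_trans _ _ ((m%:R*C1)^+2 * `|y|^+2)); last by rewrite ler_wpM2l ?exprn_ge0 // mulr_ge0 // ltW.
 by rewrite -exprMn lerXn2r ?nnegrE ?mulr_ge0 // ltW.
- move=> p r p' i j bD bp; apply: (le_trans (Slip p r p' i j bD bp)); apply: ler_wpM2r=> //; rewrite /L; lra.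
- move=> p r p' i j bD bp.
 have r0 : 0 < r by case: bp.
 have Dp : D p by apply: bD; exact: ballxx.
 have Dp' := bD _ bp.
 (* Resolvent identity: the difference of the inverses is T p (S p' - S p) T p'. *)
 have -> : invmx (Smx a p) i j - invmx (Smx a p') i j = (T p *m (Smx a p'-Smx a p) *m T p') i j.
 by rewrite mulmxBr mulmxBl TS // mul1mx -mulmxA ST // mulmx1 !mxE.
 have TB := Tb p' _ j Dp'.
 rewrite mxE; apply: le_trans (ler_norm_sum _ _ _) _.
 apply: (@le_trans _ _ (m%:R^+2*(l * m%:R)^+2*(m%:R*C2) * `|p-p'|)); last by apply: ler_wpM2r=> //; rewrite /L; lra.
 have -> : m%:R^+2*(l * m%:R)^+2*(m%:R*C2) * `|p-p'| =
 m%:R*(m%:R*((l * m%:R)*(m%:R*C2 * `|p-p'|)*(l * m%:R))).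
 lra.
 apply: sum_le_const=> k; rewrite normrM mulrA.
 apply: ler_pM=> //.
 rewrite mxE; apply: le_trans (ler_norm_sum _ _ _) _; apply: sum_le_const=> k'.
 rewrite normrM; apply: ler_pM=> //; first exact: Tb.
 by rewrite [X in `|X|]mxE [X in _+X]mxE distrC; exact: (Slip _ r).
Qed.
End Elliptic.

(** * Integration by parts and self-adjointness *)

Section Parts.
Variables (R : realType) (n : nat).
Notation m := (n+n)%N.
Notation V := (pt R n).

Definition supp k (C : set 'rV[R]_k) (f : 'rV[R]_k -> R) := forall p, ~ C p -> f p = 0.

Lemma compact_near k (C : set 'rV[R]_k) p : compact C -> ~ C p -> \forall q \near p, ~ C q.
Proof.
move=> cC Cp; have /closed_openC oC := compact_closed (@norm_hausdorff _ _) cC.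
exact: open_nbhs_nbhs.
Qed.

Lemma compact_box k (C : set 'rV[R]_k) : compact C -> exists2 r, 0 < r & forall p, C p -> `|p| <= r.
Proof.
move=> /compact_bounded [M [_ hM]]; exists (`|M| + 1); first pos.
by apply: hM; rewrite ltr_pwDr // ler_norm.
Qed.

Lemma pd_near i (f g : V -> R) p : (\forall q \near p, f q = g q) -> pd i f p = pd i g p.
Proof. by move=> h; exact: near_eq_derive. Qed.

Lemma pd0 i (p : V) : pd i (fun=> 0 : R) p = 0.
Proof. exact: derive_cst. Qed.

Lemma supp_pd C (f : V -> R) i : compact C -> supp C f -> supp C (pd i f).
Proof.
move=> cC sf p h; rewrite (@pd_near i f (fun=> 0)) ?pd0 //.
by apply: filterS (compact_near cC h)=> q /sf.
Qed.

Lemma contD (W : topologicalType) (F G : W -> R) : continuous F -> continuous G -> continuous (fun p=> F p+G p).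
Proof. by move=> cF cG p; apply: (@continuousD _ _ _ F G); [exact: cF|exact: cG]. Qed.

Lemma contB (W : topologicalType) (F G : W -> R) : continuous F -> continuous G -> continuous (fun p=> F p-G p).
Proof. by move=> cF cG p; apply: (@continuousB _ _ _ F G); [exact: cF|exact: cG]. Qed.

Lemma contM (W : topologicalType) (F G : W -> R) : continuous F -> continuous G -> continuous (fun p=> F p*G p).
Proof. by move=> cF cG p; apply: (@continuousM _ _ F G); [exact: cF|exact: cG]. Qed.

Lemma smooth_cont (w : V -> R) : smooth w -> continuous w.
Proof. by move=> sw p; exact: ((sw 0%N).2 [::] isT p I). Qed.

Lemma ballP k (c x : 'rV[R]_k) (r : R) : ball c r x <-> `|c-x| < r.
Proof. by rewrite -ball_normE. Qed.

Lemma cont_Itg k (F : 'rV[R]_k -> R) (C : set 'rV[R]_k) : compact C -> continuous F -> supp C F -> Itg F.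
Proof.
move=> cC cF F0; have [B B0 hB] := cpt_bounded cC (fun x _=> cF x).
have [r r0 hr] := compact_box cC.
apply: (@Itg_supp _ _ _ B (r+1)).
- exact: cont_meas.
- by lra.
- by move=> p; have [/hB//|/F0 ->] := pselect (C p); rewrite normr0 ltW.
- by move=> p h; apply: F0=> /hr; lra.
Qed.

(** The integral of a translate of [g] does not depend on the translation, and differentiating it
    along the i-th axis under the integral produces [Int g']. *)
Lemma Int_pd0 (g g' : V -> R) (C : set V) i : compact C -> continuous g -> continuous g' ->
 (forall p, is_derive p (delta_mx 0 i : V) g (g' p)) -> supp C g ->
 Int g' = 0.
Proof.
move=> cC cg cg' hd g0; pose v : V := delta_mx 0 i.
have g'0 : supp C g'.
 by move=> p h; have [_ <-] := hd p; exact: (supp_pd i cC g0).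
have [C0 C00 hC0] := cpt_bounded cC (fun x _=> cg' x).
have hC p : `|g' p| <= C0.
 by have [/hC0//|/g'0 ->] := pselect (C p); rewrite normr0 ltW.
have [r r0 hr] := compact_box cC.
have ig : Itg g by exact: cont_Itg cg g0.
pose f (h : R) (z : V) : R := g (z+h *: v).
have h1 (h : R) z : is_derive (h : R) (1 : R) (f^~ z) (g' (z+h *: v)).
 have /is_derive_line /is_deriveP H := hd (z+h *: v).
 apply/is_deriveP; move: H.
 have E : (fun s : R=> s^-1 *: (f (s *: (1 : R)+h) z-f h z)) =
 (fun s : R=> s^-1 *: (g ((s *: (1 : R)+0) *: v+(z+h *: v))-g ((0 : R) *: v+(z+h *: v)))).
 by apply/funext=> t; rewrite addr0 scale0r add0r addrCA -scalerDl.
 by rewrite E.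
have I0 : [set` `](-1)%R, 1%R[] (0 : R) by rewrite /= in_itv /= ltrN10 ltr01.
have derE h z : partial1of2 f h z = g' (z+h *: v).
 by rewrite partial1of2E; have [_ ->] := h1 h z.
pose F (h : R) := Int (f h).
have FE h : F h = Int g by rewrite /F /f Int_shift //; exact: Itg_meas ig.
have v1 : `|v| <= 1.
 by apply: norm_le_coord=> // k; rewrite mxE /=; case: eqP=> _; rewrite ?normr0 ?normr1.
have HF : h^-1 *: (F (h+0)-F 0) @[h --> 0^'] --> \int[lebn R m]_z (partial1of2 f 0 z).
 apply: (@cvg_differentiation_under_integral R _ _ (lebn R m) f setT measurableT 0 (-1) 1 I0 _ _
 (fun z=> C0*\1_(ball (0 : V) (r+2)) z)).
 - by move=> h _; exact: Itg_shift.
 - pos.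
 - by move=> z; rewrite mulr_ge0 // ltW.
 - apply: (@Itg_supp _ _ _ C0 (r+2)).
 + apply: measurable_funM; first exact: measurable_cst.
 by apply: measurable_indic; apply: open_meas; exact: ball_open.
 + by lra.
 + by move=> p; rewrite indicE; case: (_ \in _); rewrite ?mulr1 ?mulr0 ?ger0_norm // ltW.
 + move=> p h; rewrite indicE memNset ?mulr0 //= => /ballP.
 by rewrite sub0r normrN ltNge h.
 - move=> h z; rewrite /= in_itv /= => /andP[hl hr'] _; rewrite derE.
 have [zin|zout] := ltP `|z| (r+2).
 rewrite indicE mem_set ?mulr1 //.
 by apply/ballP; rewrite sub0r normrN.
 rewrite g'0; first by rewrite normr0 mulr_ge0 // ltW.
 move=> /hr; have : `|h *: v| <= 1.
 by rewrite normrZ -[leRHS]mulr1 ler_pM // ltW // ltr_norml hl.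
 by have := lerB_normD z (h *: v); lra.
have : (fun h : R=> h^-1 *: (F (h+0)-F 0)) @ 0^' --> (0 : R).
 rewrite (_ : (fun h : R=> _) = (fun=> 0 : R)); first exact: cvg_cst.
 by apply/funext=> h; rewrite !FE subrr scaler0.
move=> /(cvg_unique (@norm_hausdorff _ R^o) HF) H; rewrite -H.
by apply: eq_Rintegral=> z _; rewrite derE scale0r addr0.
Qed.

Section Ell.
Variables (D : set V) (S T : V -> 'M[R]_m) (L : R) (eL : elliptic D S T L).

Lemma LS_supp C w : compact C -> supp C w -> supp C (LS S w).
Proof.
move=> cC s0 p h; rewrite /LS big1 // => i _; rewrite big1 // => j _.
by rewrite (supp_pd i cC (supp_pd j cC s0)) // mulr0.
Qed.

Lemma compact_cont C (F : V -> R) : compact C -> supp C F ->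
 (forall p, C p -> {for p, continuous F}) -> continuous F.
Proof.
move=> cC F0 cF p; have [/cF//|pout] := pselect (C p).
apply: (@near_continuous _ _ _ (fun=> 0)); last exact: cst_continuous.
by apply: filterS (compact_near cC pout)=> q /F0.
Qed.

Lemma LS_cont C w : compact C -> C `<=` D -> smooth w -> supp C w -> continuous (LS S w).
Proof.
move=> cC CD sw s0; apply: (compact_cont cC); first exact: LS_supp.
move=> p Cp; apply: continuous_sum=> i; apply: continuous_sum=> j; apply: continuousM.
 by apply: (el_cont eL); exact: CD.
by apply: smooth_cont; exact: smooth_pd (smooth_pd _ sw).
Qed.

Lemma LS_selfadj C (f w : V -> R) : compact C -> C `<=` D -> smooth f -> smooth w -> supp C w ->
 Int (fun p=> f p*LS S w p) = Int (fun p=> w p*LS S f p).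
Proof.
move=> cC cD sf sw s0.
have s1 j : supp C (pd j w) by exact: supp_pd.
have s2 i j : supp C (pd i (pd j w)) by apply: supp_pd=> //; exact: s1.
pose h j p := f p * pd j w p-w p * pd j f p.
pose h' i j p := (pd i f p * pd j w p+f p * pd i (pd j w) p)-(pd i w p * pd j f p+w p * pd i (pd j f) p).
have hder i j p : is_derive p (delta_mx 0 i : V) (h j) (h' i j p).
 have d1 := smooth_is_derive i p sf; have d2 := smooth_is_derive i p sw.
 have d3 := smooth_is_derive i p (smooth_pd j sf); have d4 := smooth_is_derive i p (smooth_pd j sw).
 have d5 := is_deriveM d1 d4; have d6 := is_deriveM d2 d3.
 apply: (is_derive_eq (is_deriveB d5 d6)).
 rewrite /h'; move: (f p) (w p) (pd i f p) (pd j w p) (pd i w p) (pd j f p) (pd i (pd j w) p) (pd i (pd j f) p)=> b1 b2 a1 a2 a3 a4 a5 a6.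
 by rewrite /GRing.scale /=; ring.
have h0 j : supp C (h j).
 by move=> p o; rewrite /h s1 // s0 // mulr0 mul0r subrr.
have h'0 i j : supp C (h' i j).
 by move=> p o; rewrite /h' !s1 // s2 // s0 // !(mulr0, mul0r) subrr.
pose g i p := \sum_j S p i j*h j p.
pose g' i p := \sum_j (S p i j*h' i j p+h j p * pd i (fun q=> S q i j) p).
have gder i p : is_derive p (delta_mx 0 i : V) (g i) (g' i p).
 have [pin|pout] := pselect (C p); last first.
 apply: (@near_eq_is_derive _ _ _ (fun=> 0)).
 by apply: filterS (compact_near cC pout)=> q qo; rewrite /g big1 // => j _; rewrite h0 // mulr0.
 rewrite (_ : g' i p = 0); first exact: is_derive_cst.
 by rewrite /g' big1 // => j _; rewrite h0 // h'0 // mulr0 mul0r addr0.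
 have -> : g i = \sum_j (fun q=> S q i j*h j q) by apply/funext=> q; rewrite fct_sumE.
 apply: is_derive_sum=> j.
 have d1 : is_derive p (delta_mx 0 i : V) (fun q=> S q i j) (pd i (fun q=> S q i j) p).
 by apply: derivableP; apply: (el_der eL); exact: cD.
 exact: (is_deriveM d1 (hder i j p)).
have ch j : continuous (h j).
 by apply: contB; apply: contM; apply: smooth_cont=> //; exact: smooth_pd.
have ch' i j : continuous (h' i j).
 by apply: contB; apply: contD; apply: contM; apply: smooth_cont=> //; do ?exact: smooth_pd; exact: smooth_pd (smooth_pd _ _).
have cl := compact_cont cC.
have cg i : continuous (g i).
 apply: cl=> [p o|p pin]; first by rewrite /g big1 // => j _; rewrite h0 // mulr0.
 apply: continuous_sum=> j; apply: continuousM; last exact: ch.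
 by apply: (el_cont eL); exact: cD.
have cg' i : continuous (g' i).
 apply: cl=> [p o|p pin]; first by rewrite /g' big1 // => j _; rewrite h0 // h'0 // mulr0 mul0r addr0.
 apply: continuous_sum=> j; apply: continuousD; apply: continuousM; [|exact: ch'|exact: ch|].
 by apply: (el_cont eL); exact: cD.
 by apply: (el_dcont eL); exact: cD.
have Ig i : Int (g' i) = 0.
 apply: (@Int_pd0 (g i) (g' i) C i cC (cg i) (cg' i) (gder i)).
 by move=> p o; rewrite /g big1 // => j _; rewrite h0 // mulr0.
have cI F : continuous F -> supp C F -> Itg F by exact: cont_Itg.
have wE := LS_supp cC s0.
have cw := LS_cont cC cD sw s0.
apply/eqP; rewrite -subr_eq0 -IntB; last 2 first.
- apply: cI; last by move=> p /wE ->; rewrite mulr0.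
 by move=> p; apply: continuousM; [exact: smooth_cont|exact: cw].
- apply: cI; last by move=> p /s0 ->; rewrite mul0r.
 apply: cl=> [p /s0 ->|p pin]; first lra.
 apply: continuousM; first exact: smooth_cont.
 apply: continuous_sum=> i; apply: continuous_sum=> j; apply: continuousM.
 by apply: (el_cont eL); exact: cD.
 by apply: smooth_cont; exact: smooth_pd (smooth_pd _ sf).
have E p : f p*LS S w p-w p*LS S f p = \sum_i g' i p.
 have [pin|pout] := pselect (C p); last first.
 rewrite wE // s0 // mulr0 mul0r subrr big1 // => i _.
 by rewrite /g' big1 // => j _; rewrite h0 // h'0 // mulr0 mul0r addr0.
 have Dp := cD p pin.
 rewrite /g'; under [RHS]eq_bigr do rewrite big_split /=.
 rewrite big_split /= [X in _ = _+X](_ : _ = 0) ?addr0; last first.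
 rewrite exchange_big big1 // => j _; rewrite -mulr_sumr.
 by rewrite (el_div eL) // mulr0.
 rewrite /LS !mulr_sumr -sumrB.
 have sym2 : \sum_i \sum_j S p i j*(pd i f p * pd j w p-pd i w p * pd j f p) = 0.
 set Z := LHS; suff : Z = - Z by move/eqP; rewrite -addr_eq0 -mulr2n mulrn_eq0=> /eqP.
 rewrite {1}/Z exchange_big /= /Z -sumrN; apply: eq_bigr=> i _.
 rewrite -sumrN; apply: eq_bigr=> j _; rewrite (el_sym eL _ _ Dp).
 by move: (pd i f p) (pd j w p) (pd i w p) (pd j f p)=> a1 a2 a3 a4; ring.
 rewrite -[LHS]addr0 -[X in _+X = _]sym2 -big_split; apply: eq_bigr=> i _ /=.
 rewrite !mulr_sumr -sumrB -big_split; apply: eq_bigr=> j _ /=.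
 rewrite /h'.
 move: (pd i f p) (pd j w p) (pd i w p) (pd j f p) (pd i (pd j w) p) (pd i (pd j f) p)=> a1 a2 a3 a4 a5 a6; ring.
rewrite (eq_Int E) Int_sum; first by rewrite big1 // => i _; rewrite Ig.
move=> i; apply: cI; first exact: cg'.
by move=> p o; rewrite /g' big1 // => j _; rewrite h0 // h'0 // mulr0 mul0r addr0.
Qed.
End Ell.
End Parts.

(** * The truncated radial profile *)

Section Kernel.
Variables (R : realType) (n : nat) (n0 : (0 < n)%N).

(** Minus the derivative of the profile [FK]. In real dimension 2n the fundamental solution is a
    multiple of q^(1-n), a logarithm for n = 1, with derivative proportional to q^(-n); the factor
    [bt 0] ends the kernel at sqrt s = 1/K. *)
Definition psi (K s : R) : R := s ^- n*bt 0 (1-K*sqrt s).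
Definition dpsi (K s : R) : R := n%:R*s ^- n.+1*bt 0 (1-K*sqrt s)
 + s ^- n*(K*bt 2 (1-K*sqrt s)/(2*sqrt s)).

Lemma psm_smooth1 (O : set R) (g : R -> R) :
 psm (V := R^o) [set 1] O (fun (_ : R) (t : R^o)=> g t) -> smooth1 O g.
Proof.
move=> [P [Pg h]]; exists (fun f=> exists2 xi, P xi & f = xi 0); split.
 by exists (fun (_ : R) (t : R^o)=> g t).
move=> _ [xi /h[cxi dxi] ->]; split.
 move=> t Ot; apply: (@continuous_comp _ _ _ (fun t : R=> (0 : R, t : R^o)) (fun q : R*R^o=> xi q.1 q.2)).
 exact: cont_pairr.
 exact: cxi.
by have [//|xi' Px' hd] := dxi 1; exists (xi' 0); [exists xi'|move=> t Ot; exact: hd].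
Qed.

Lemma smooth1_psi K : smooth1 (@pos R) (psi K).
Proof.
have px : psm (V := R^o) [set 1] (@pos R) (fun (_ : R) (t : R^o)=> t : R).
 exists (fun g=> (g = fun _ t=> t : R) \/ exists c, g = fun _ _=> c); split; first by left.
 move=> g [->|[c ->]]; split.
 - by move=> x p _; exact: cvg_snd.
 - by move=> v ->; exists (fun _ _=> 1)=> [|x p _]; [right; exists 1|exact: is_derive_id].
 - by move=> x p _; exact: cst_continuous.
 - by move=> v _; exists (fun _ _=> 0)=> [|x p _]; [right; exists 0|exact: is_derive_cst].
apply: psm_smooth1; apply: psm_mul.
 by apply: (@psm_comp _ _ _ _ _ _ (fun t : R=> t ^- n) _ (@smooth1_invn R n) px).
apply: (@psm_comp _ _ _ _ _ setT (bt 0) (fun _ (t : R^o)=> 1-K*sqrt t) (@smooth1_bt R 0))=> //; apply: psm_sub; first exact: psm_cst.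
apply: psm_mul; first exact: psm_cst.
by apply: (@psm_comp _ _ _ _ _ _ (@Num.sqrt R) _ (@smooth1_sqrt R) px).
Qed.

Lemma bt_neg k (t : R) : t <= 0 -> bt k t = 0.
Proof. by move=> t0; rewrite /bt ltNge t0. Qed.

Lemma psi0 (K s : R) : 0 < K -> K ^- 2 <= s -> psi K s = 0.
Proof.
move=> K0 Ks; rewrite /psi bt_neg ?mulr0 // subr_le0.
have : sqrt (K ^- 2) <= sqrt s by apply: ler_wsqrtr.
rewrite -exprVn sqrtr_sqr gtr0_norm ?invr_gt0 // => /(ler_wpM2l (ltW K0)).
by rewrite mulfV ?gt_eqF.
Qed.

(** The variable is reflected because the fundamental theorem is applied at the upper end of the
    interval; the lower end is placed at distance 1 beyond the support of [psi]. *)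
Definition FK (K s : R) : R :=
 \int[lebesgue_measure]_(t in [set` `[- (K ^- 2+1), - s]]) psi K (- t).

Lemma FK0 (K s : R) : 0 < K -> K ^- 2 <= s -> FK K s = 0.
Proof.
move=> K0 Ks; rewrite /FK -[RHS](mul0r (fine (lebesgue_measure (`[- (K ^- 2+1), - s] : set R)))).
rewrite -Rintegral_cst //; apply: eq_Rintegral=> t; rewrite inE /= in_itv /= => /andP[_ ts].
by rewrite psi0 // (le_trans Ks) // lerNr.
Qed.

Lemma psi_continuous K (s : R) : 0 < s -> {for s, continuous (psi K)}.
Proof. by move=> s0; exact: smooth1_cont (smooth1_psi K) _. Qed.

Lemma is_derive_FK (K s : R) : 0 < K -> 0 < s -> is_derive (s : R) (1 : R) (FK K) (- psi K s).
Proof.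
move=> K0 s0; have Kp : 0 < K ^- 2 by rewrite invr_gt0 exprn_gt0.
have [sb|sb] := ltP s (K ^- 2+1); last first.
 apply: (@near_eq_is_derive _ _ _ (fun=> 0)).
 have : \forall q \near s, K ^- 2 < q by apply: (cvgr_gt s (@cvg_id _ (nbhs s))); lra.
 by apply: filterS=> q /ltW/FK0 ->.
 by rewrite psi0 // ?oppr0; [exact: is_derive_cst|lra].
pose g (t : R) := psi K (- t); pose b := K ^- 2+1.
have su : - s < - (s/2) by lra.
have [|||d1 d2] := @continuous_FTC1_closed R g (- b) (- s) (- (s/2)) su.
- apply: continuous_compact_integrable; first exact: segment_compact.
 apply: continuous_in_subspaceT=> t; rewrite inE /= in_itv /= => /andP[_ t2].
 apply: (@continuous_comp _ _ _ (fun t : R=> - t) (psi K)); first by apply: continuousN; exact: cvg_id.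
 by apply: psi_continuous; lra.
- by rewrite ltrN2.
- apply: (@continuous_comp _ _ _ (fun t : R=> - t) (psi K)); first by apply: continuousN; exact: cvg_id.
 by rewrite opprK; exact: psi_continuous.
have := derivableP d1; rewrite -derive1E d2=> H.
have H2 : is_derive (s : R) (1 : R) (fun x : R=> - x) (-1) by apply: is_deriveNid.
by apply: (is_derive_eq (is_derive_comp1 H H2)); rewrite /g opprK mulrN1.
Qed.

Lemma smooth1_FK K : 0 < K -> smooth1 (@pos R) (FK K).
Proof.
move=> K0; apply: (@smooth1_prim _ _ _ (fun t=> - psi K t)); first by move=> t t0; exact: is_derive_FK.
have [Q [Qp h]] := smooth1_psi K.
exists (fun g=> exists2 f, Q f & g = (fun t=> - f t)); split; first by exists (psi K).
move=> _ [f /h[cf [f' Qf' df]] ->]; split.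
 by move=> t Ot; apply: continuousN; exact: cf.
by exists (fun t=> - f' t)=> [|t Ot]; [exists f'|exact: is_deriveN (df t Ot)].
Qed.

Lemma is_derive_psi (K s : R) : 0 < s -> is_derive (s : R) (1 : R) (psi K) (- dpsi K s).
Proof.
move=> s0; have r0 : 0 < sqrt s by rewrite sqrtr_gt0.
have h1 := is_derive_invn n s0.
have h2 : is_derive (s : R) (1 : R) (fun x : R=> 1-K*sqrt x) (- (K*(2*sqrt s)^-1)).
 have h := is_deriveB (is_derive_cst (1 : R) s (1 : R)) (is_deriveZ K (is_derive1_sqrt s0)).
 by apply: (is_derive_eq h); rewrite sub0r.
have h3 := @is_derive_comp1 _ _ (bt 0) (fun x : R=> 1-K*sqrt x) s 1 _ _ (is_derive_bt 0 (1-K*sqrt s)) h2.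
apply: (is_derive_eq (is_deriveM h1 h3)).
rewrite /dpsi /GRing.scale /= oppr0 mul0r add0r.
set B0 := bt 0 _; set B2 := bt 2 _; rewrite invfM.
move: r0 {h1 h2 h3}; move: (sqrt s) (s ^- n.+1) (s ^- n)=> r p q r0.
lra.
Qed.

(* Comparison by monotonicity: to bound [FK] it suffices to compare derivatives. *)
Lemma pos_of_derive (f f' : R -> R) (b : R) :
 (forall s : R, 0 < s -> s <= b -> is_derive (s : R) (1 : R) f (f' s)) ->
 (forall s, 0 < s -> s <= b -> f' s <= 0) -> 0 <= f b -> forall s, 0 < s -> s <= b -> 0 <= f s.
Proof.
move=> hd hn fb s s0; rewrite le_eqVlt=> /orP[/eqP->//|sb].
have [||c] := @MVT R f f' _ _ sb.
- by move=> x; rewrite in_itv /= => /andP[h1 h2]; apply: hd; lra.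
- apply: continuous_in_subspaceT=> x; rewrite inE /= in_itv /= => /andP[h1 h2].
 by apply: (is_derive_continuous (d := f' x)); apply: hd; lra.
rewrite in_itv /= => /andP[h1 h2] E.
have := hn c; move=> /(_ _ _); rewrite (lt_trans s0 h1) (ltW h2)=> /(_ isT isT) fc.
have : f' c*(b-s) <= 0 by rewrite mulr_le0_ge0 //; lra.
by lra.
Qed.

Lemma psi_ge0 K s : 0 <= s -> 0 <= psi K s.
Proof. by move=> s0; rewrite mulr_ge0 ?bt_ge0 // invr_ge0 exprn_ge0. Qed.

Lemma FK_ge0 K s : 0 < K -> 0 < s -> 0 <= FK K s.
Proof.
move=> K0 s0; have [/FK0 ->//|sK] := leP (K ^- 2) s.
apply: (@pos_of_derive _ (fun t=> - psi K t) (K ^- 2))=> //; last exact: ltW.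
- by move=> t t0 _; exact: is_derive_FK.
- by move=> t t0 _; rewrite oppr_le0 psi_ge0 // ltW.
- by rewrite FK0.
Qed.

Lemma FK_decr K s t : 0 < K -> 0 < s -> s <= t -> FK K t <= FK K s.
Proof.
move=> K0 s0 st.
rewrite -subr_ge0; apply: (@pos_of_derive (fun s=> FK K s-FK K t) (fun s=> - psi K s-0) t)=> //.
- move=> x x0 _; apply: is_deriveB; first exact: is_derive_FK.
- by move=> x x0 _; rewrite subr0 oppr_le0 psi_ge0 // ltW.
- lra.
Qed.

Lemma bt_le1 (t : R) : bt 0 t <= 1.
Proof.
rewrite /bt; case: ifP=> // t0; rewrite expr0 invr1 mul1r.
by rewrite -expR0 ler_expR oppr_le0 invr_ge0 ltW.
Qed.

(** On the support sqrt s <= 1/K, so a factor sqrt s of the natural size s^(1-n) is traded for 1/K.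
    This 1/K makes the potentials small for large [K], and the loss of half a power treats the
    logarithm of n = 1 along with the rest. *)
Lemma FK_bound K s : 0 < K -> 0 < s -> FK K s <= 2*K^-1*(s ^- n*sqrt s).
Proof.
move=> K0 s0; have nn : 0 <= 2*K^-1*(s ^- n*sqrt s).
 pos.
have [/FK0 ->//|sK] := leP (K ^- 2) s.
rewrite -subr_ge0.
pose f' (t : R) : R := 2*K^-1*(t ^- n*(2*sqrt t)^-1+sqrt t*(- n%:R*t ^- n.+1)) - - psi K t.
pose F (s : R) : R := 2*K^-1*(s ^- n*sqrt s)-FK K s.
rewrite -[X in 0 <= X]/(F s); apply: (@pos_of_derive F f' (K ^- 2) _ _ _ _ s0 (ltW sK)).
- move=> t t0 _; have h := is_deriveM (is_derive_invn n t0) (is_derive1_sqrt t0).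
 exact: (is_deriveB (is_deriveZ (2*K^-1) h) (is_derive_FK K0 t0)).
- move=> t t0 tK; have r0 : 0 < sqrt t by rewrite sqrtr_gt0.
 have E : sqrt t^+2 = t by rewrite sqr_sqrtr // ltW.
 have rK : sqrt t <= K^-1.
 by rewrite -[leRHS]gtr0_norm ?invr_gt0 // -sqrtr_sqr exprVn ler_wsqrtr.
 have p1 : psi K t <= t ^- n.
 by rewrite -[leRHS]mulr1 ler_wpM2l ?bt_le1 // invr_ge0 exprn_ge0 // ltW.
 rewrite /f' opprK.
 have tn : 0 < t ^- n by rewrite invr_gt0 exprn_gt0.
 have -> : 2*K^-1*(t ^- n*(2*sqrt t)^-1+sqrt t*(- n%:R*t ^- n.+1)) =
 - (t ^- n*(K^-1/sqrt t)*(2 * n%:R-1)).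
 have tE : t^-1 = (sqrt t^+2)^-1 by rewrite E.
 rewrite exprS !invfM tE; move: r0 {E tE rK p1 tn f' nn}; move: (sqrt t) (t ^- n)=> r T r0.
 by field; rewrite !gt_eqF.
 have n1 : (1 : R) <= n%:R by rewrite ler1n.
 have k1 : 1 <= K^-1/sqrt t by rewrite ler_pdivlMr // mul1r.
 apply: (@le_trans _ _ (- (t ^- n*(K^-1/sqrt t)*(2 * n%:R-1))+t ^- n)); first lra.
 rewrite addrC subr_le0 -[leLHS]mulr1 -mulrA ler_wpM2l ?(ltW tn) //.
 by rewrite -[leLHS]mulr1 ler_pM //; lra.
- have K2 : 0 <= K^-1 by rewrite invr_ge0 ltW.
 have K3 : 0 <= K ^- 2 ^- n by rewrite invr_ge0 exprn_ge0 // ltW // invr_gt0 exprn_gt0.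
 by rewrite /F FK0 // subr0; repeat (apply: mulr_ge0=> //); exact: sqrtr_ge0.
Qed.
End Kernel.

(** * Pointwise estimates for the regularised kernel *)

Section KernelEst.
Variables (R : realType) (n : nat) (n0 : (0 < n)%N).
Notation m := (n+n)%N.
Notation V := (pt R n).

Lemma bt02 (t : R) : t <= 1 -> bt 0 t <= bt 2 t.
Proof.
move=> t1; rewrite /bt; case: ifP=> // t0; rewrite expr0 invr1 ler_wpM2r ?expR_ge0 //.
by rewrite invf_ge1 ?exprn_gt0 // exprn_ile1 // ltW.
Qed.

Lemma bt2_le (t : R) : t <= 1 -> bt 2 t <= 24.
Proof.
move=> t1; have [t0|t0] := leP t 0; first by rewrite bt_neg.
apply: (le_trans (bt_small 2 t)); rewrite -[leRHS]mulr1 ler_pM // ?exprn_ge0 ?(ltW t0) //.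
by rewrite exprn_ile1 // ltW.
Qed.

(** The smoothed point mass that appears when the pole of the kernel is removed by replacing q with
    q + e^2. *)
Definition phis (q e : R) (K : R) : R := 
 let s := q+e^+2 in 2 * m%:R*e^+2*s ^- n.+1*bt 0 (1-K*sqrt s).
(** The operator on the radial kernel, with [A] for the trace of S T and [B] for the form of [S] at
    T x. For exactly matching matrices these are m and q. *)
Definition lval (K s A B : R) : R := - (2*A * psi n K s)+4*B * dpsi n K s.

(** For A = m and B = q, [lval] plus [phis] is the nonnegative truncation term 2K s^(-n) (q/sqrt s)
    times [bt 2]. Errors of relative size C2 sqrt s come with [bt 0], at most [bt 2], and without
    the factor K, so K >= 8 C2 (1+m) lets the truncation term win where s <= 2q. Elsewhere e^2 >
    s/2, and [phis] absorbs the error at the price of the factor 1 + 8 C2 e. *)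
Lemma ker_est (C2 K q e A B : R) : let s := q+e^+2 in let sg := sqrt s in
 1 <= C2 -> 8*C2*(1+m%:R) <= K -> 0 <= q -> 0 < s -> `|A-m%:R| <= C2*sg ->
 `|B-q| <= C2*sg*q ->
 [/\ `|lval K s A B+phis q e K| <= (2*C2*(1+m%:R)+48*(1+C2))*K*(s ^- n*sg),
 s <= 2*q -> K/4*(s ^- n*sg)*bt 2 (1-K*sg) <= lval K s A B+phis q e K &
 0 <= e -> - ((1+8*C2*e) * phis q e K) <= lval K s A B].
Proof.
move=> s sg C1 Kb q0 s0 hA hB.
have C20 : 0 <= C2 by lra.
have K1 : 1 <= K by have := mulr_ge0 C20 (ler0n R m); lra.
have K0 : 0 <= K by exact: le_trans ler01 K1.
have sg0 : 0 < sg by rewrite sqrtr_gt0.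
have sgE : sg^+2 = s by rewrite sqr_sqrtr // ltW.
have sn : 0 < s ^- n by rewrite invr_gt0 exprn_gt0.
have lvalE : lval K s A B+phis q e K = s ^- n*(- 2*(A-m%:R)*bt 0 (1-K*sg)
 + 2 * m%:R*bt 0 (1-K*sg)*((B-q)/s)+2*K*bt 2 (1-K*sg)*(B/sg)).
 rewrite /lval /phis -/s /psi /dpsi -/sg exprS invfM natrD.
 have -> : e^+2 = s-q by rewrite addrAC subrr add0r.
 move: (bt 0 _) (bt 2 _) (s ^- n)=> b0 b2 T; move: sg0 s0=> {hA hB sgE sn}; clearbody sg s=> sg0 s0.
 by field; rewrite !gt_eqF.
have big : 1 <= K*sg -> bt 0 (1-K*sg) = 0 /\ bt 2 (1-K*sg) = 0.
 by move=> h; rewrite !bt_neg //; lra.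

have small : K*sg < 1 -> [/\ sg <= 1, C2*sg <= 8^-1 & 0 <= B].
 move=> h; have a1 : sg <= 1.
 have : sg <= K*sg by rewrite ler_peMl // ltW.
 by lra.
 have a2 : 8*(C2*sg) <= 1.
 apply: le_trans (ltW h); rewrite mulrA ler_wpM2r ?(ltW sg0) //.
 apply: le_trans Kb; rewrite ler_peMr //; first by lra.
 by rewrite lerDl.
 split=> //; first by lra.
 have : C2*sg*q <= q by rewrite ler_piMl //; lra.
 by move: hB; rewrite ler_norml=> /andP[h1 _]; lra.
have t1 : 1-K*sg <= 1.
 by rewrite gerBl mulr_ge0 // ltW.

have rel : `|(B-q)/s| <= C2*sg.
 rewrite normrM normfV (gtr0_norm s0) ler_pdivrMr //.
 apply: (le_trans hB); rewrite ler_wpM2l //; first pos.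
 by rewrite lerDl sqr_ge0.
have ker_abs : `|lval K s A B+phis q e K| <= (2*C2*(1+m%:R)+48*(1+C2))*K*(s ^- n*sg).
 rewrite lvalE normrM (gtr0_norm sn) [leRHS]mulrCA ler_pM2l //.
 have rhs0 : 0 <= (2*C2*(1+m%:R)+48*(1+C2))*K*sg.
 have h : 0 <= C2 * m%:R by rewrite mulr_ge0.
 by apply: mulr_ge0; [apply: mulr_ge0; [lra|exact: K0]|exact: ltW].
 have [/big[-> ->]|/small[a1 a2 B0]] := leP 1 (K*sg).
 by rewrite !(mulr0, mul0r) !addr0 normr0.
 have b0 := bt_ge0 0 (1-K*sg); have b1 := bt_le1 (1-K*sg).
 have b20 := bt_ge0 2 (1-K*sg); have b2 := bt2_le t1.
 have m0 : 0 <= m%:R :> R by [].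
 move: (bt 0 _) (bt 2 _) b0 b1 b20 b2=> x y b0 b1 b20 b2.
 apply: le_trans (ler_normD _ _) _; apply: (@le_trans _ _ ((2*(C2*sg)+2 * m%:R*(C2*sg))+2*K*24*((1+C2)*sg))).
 apply: lerD.
 apply: le_trans (ler_normD _ _) _; apply: lerD.
 have h1 : `|(A-m%:R)*x| <= C2*sg.
 by rewrite normrM (ger0_norm b0); apply: le_trans hA; rewrite ler_piMr.
 by rewrite -mulrA normrM normrN (ger0_norm (ler0n R 2)) ler_pM2l.
 have h2 : `|x*((B-q)/s)| <= C2*sg.
 by rewrite normrM (ger0_norm b0); apply: le_trans rel; rewrite ler_piMl.
 have m20 : 0 <= 2 * m%:R :> R by [].
 by rewrite -mulrA normrM (ger0_norm m20) ler_wpM2l.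
 rewrite ger0_norm; last pos.
 have K20 : 0 <= 2*K by rewrite mulr_ge0.
 have Bs : 0 <= B/sg by rewrite divr_ge0 // ltW.
 apply: ler_pM=> //; [exact: mulr_ge0|exact: ler_wpM2l|].
 rewrite ler_pdivrMr // -mulrA -expr2 sgE.
 have : B <= q+C2*sg*q by move: hB; rewrite ler_norml=> /andP[_]; lra.
 have : C2*sg*q <= C2*q.
 by rewrite ler_wpM2r // -[leRHS]mulr1 ler_wpM2l //; lra.
 have : (1+C2)*q <= (1+C2)*s by rewrite ler_wpM2l //; [lra|rewrite /s lerDl sqr_ge0].
 by lra.
 have -> : 2*(C2*sg)+2 * m%:R*(C2*sg) = 2*C2*(1+m%:R)*sg by ring.
 have -> : (2*C2*(1+m%:R)+48*(1+C2))*K*sg =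
 2*C2*(1+m%:R)*(K*sg)+2*K*24*((1+C2)*sg) by ring.
 rewrite lerD2r ler_wpM2l //; last by rewrite ler_peMl // ltW.
 pos.
have err : - (2*C2*(1+m%:R))*sg*bt 0 (1-K*sg) <= 
 - 2*(A-m%:R)*bt 0 (1-K*sg)+2 * m%:R*bt 0 (1-K*sg)*((B-q)/s).
 have -> : - 2*(A-m%:R)*bt 0 (1-K*sg)+2 * m%:R*bt 0 (1-K*sg)*((B-q)/s) =
 (- 2*(A-m%:R)+2 * m%:R*((B-q)/s))*bt 0 (1-K*sg) by ring.
 rewrite ler_wpM2r ?bt_ge0 //.
 have h1 : A-m%:R <= C2*sg by apply: le_trans (ler_norm _) hA.
 have h2 : - (C2*sg) <= (B-q)/s by move: rel; rewrite ler_norml=> /andP[].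
 have : m%:R * - (C2*sg) <= m%:R*((B-q)/s) by rewrite ler_wpM2l.
 by lra.
have ker_low : s <= 2*q -> K/4*(s ^- n*sg)*bt 2 (1-K*sg) <= lval K s A B+phis q e K.
 move=> sq; rewrite lvalE [leLHS](_ : _ = s ^- n*(K/4*sg*bt 2 (1-K*sg))); last by ring.
 rewrite ler_pM2l //.
 have [/big[-> ->]|/small[a1 a2 B0]] := leP 1 (K*sg); first by rewrite !(mulr0, mul0r) !addr0.
 have h1 := err; have h2 := bt02 t1; have b20 := bt_ge0 2 (1-K*sg).
 have hB2 : s/4 <= B.
 have : C2*sg*q <= 8^-1*q by rewrite ler_wpM2r.
 by move: hB; rewrite ler_norml=> /andP[h _]; lra.
 have h3 : sg/4 <= B/sg by rewrite ler_pdivlMr // mulrAC -expr2 sgE.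
 have h4 : 2*K*bt 2 (1-K*sg)*(sg/4) <= 2*K*bt 2 (1-K*sg)*(B/sg).
 by rewrite ler_wpM2l // !mulr_ge0.
 have h5 : 2*C2*(1+m%:R)*sg*bt 0 (1-K*sg) <= K/4*sg*bt 2 (1-K*sg).
 apply: ler_pM; rewrite ?bt_ge0 //; last first.
 by rewrite ler_wpM2r ?(ltW sg0) //; lra.
 rewrite mulr_ge0 ?(ltW sg0) // mulr_ge0 //; first by lra.
 move: h1 h4 h5; move: (bt 2 _) (bt 0 _) (B/sg) ((B-q)/s)=> x y u v; lra.
have ker_all : 0 <= e -> - ((1+8*C2*e) * phis q e K) <= lval K s A B.
 move=> e0; have p0 : 0 <= phis q e K.
 rewrite /phis -/s; apply: mulr_ge0; last exact: bt_ge0.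
 apply: mulr_ge0; last by rewrite invr_ge0 exprn_ge0 // ltW.
 pos.
 have [sq|sq] := leP s (2*q).
 have h := ker_low sq.
 have h1 : 0 <= K/4*(s ^- n*sg)*bt 2 (1-K*sg).
 rewrite mulr_ge0 ?bt_ge0 // mulr_ge0 //; first by move: K1; lra.
 by rewrite mulr_ge0 // ltW.
 have h2 : 0 <= 8*C2*e * phis q e K by rewrite mulr_ge0 // mulr_ge0 // mulr_ge0.
 by lra.
 suff : - (8*C2*e * phis q e K) <= lval K s A B+phis q e K by lra.
 rewrite lvalE.
 have [/big[b0 b2]|/small[a1 a2 B0]] := leP 1 (K*sg).
 have -> : phis q e K = 0 by rewrite /phis b0 mulr0.
 by rewrite b0 b2 !(mulr0, mul0r) !addr0 mulr0 oppr0.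
 have h1 := err.
 have h3 : 0 <= 2*K*bt 2 (1-K*sg)*(B/sg).
 by rewrite !mulr_ge0 ?bt_ge0 ?invr_ge0 ?(ltW sg0) //; move: K1; lra.
 have -> : phis q e K = s ^- n*(2 * m%:R*(e^+2/s)*bt 0 (1-K*sg)).
 by rewrite /phis -/s -/sg (exprS s) invfM; ring.
 rewrite mulrCA -mulrN ler_pM2l //.
 have es : sg/2 <= e.
 rewrite -(@ler_pXn2r _ 2) ?nnegrE // ?divr_ge0 ?ltW // expr_div_n sgE.
 have : s = q+e^+2 by []. 
 by lra.
 have e2 : 2^-1 <= e^+2/s.
 rewrite ler_pdivlMr //; have : s = q+e^+2 by []. 
 by lra.
 suff : 2*C2*(1+m%:R)*sg*bt 0 (1-K*sg) <= 8*C2*e*(2 * m%:R*(e^+2/s)*bt 0 (1-K*sg)) by lra.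
 rewrite !mulrA ler_wpM2r ?bt_ge0 //.
 have m1 : 1 <= m%:R :> R by rewrite ler1n addn_gt0 n0.
 rewrite [leRHS](_ : _ = 8*C2*(2 * m%:R)*(e*(e^+2/s))); last by ring.
 have h6 : sg/2*2^-1 <= e*(e^+2/s) by rewrite ler_pM // ?divr_ge0 ?(ltW sg0).
 have h7 : 8*C2*(2 * m%:R)*(sg/2*2^-1) <= 8*C2*(2 * m%:R)*(e*(e^+2/s)).
 by rewrite ler_wpM2l // !mulr_ge0.
 apply: le_trans h7; rewrite [leRHS](_ : _ = 2*C2*(2 * m%:R)*sg); last by field.
 by rewrite ler_wpM2r ?(ltW sg0) // ler_wpM2l //; lra.
pos.
Qed.

Lemma bt0_exp (a b : R) : 0 < a -> a <= b -> b <= 1 -> (1+(b-a))*bt 0 a <= bt 0 b.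
Proof.
move=> a0 ab b1; have b0 : 0 < b by lra.
rewrite /bt a0 b0 !expr0 invr1 !mul1r.
have -> : - b^-1 = - a^-1+(a^-1-b^-1) by ring.
rewrite expRD mulrC ler_wpM2l ?expR_ge0 //; apply: (le_trans (expR_ge1Dx (b-a))); rewrite ler_expR.
have -> : a^-1-b^-1 = (b-a)*(a*b)^-1 by field; rewrite !gt_eqF.
rewrite ler_peMr ?subr_ge0 // invf_ge1 ?mulr_gt0 //.
by rewrite mulr_ile1 ?(ltW a0) ?(ltW b0) //; lra.
Qed.

(** A larger truncation constant pays for a perturbation of the argument by 1 + C sqrt s and of the
    value by 1 - C sqrt s. By [bt0_exp] a gap d in the profile gains a factor 1 + d, and the
    increment C + 2(n+1)C yields a gap of twice the n+1 first-order losses. Derivatives are compared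
    downwards from K'^(-2), where the left kernel vanishes. *)
Lemma FK_compare (C K K' s1 s2 : R) : 0 <= C -> 0 < K -> K+(C+2 * n.+1%:R*C) <= K' ->
 0 < s1 -> 0 < s2 -> s2 <= s1*(1+C*sqrt s1) -> C*sqrt s1 <= 1 ->
 FK n K' s1 <= (1-C*sqrt s1)*FK n K s2.
Proof.
move=> C0 K0 KK s10 s20 ss cs; have n1 : (1 : R) <= n%:R by rewrite ler1n.
have c0 : 0 <= n.+1%:R*C by rewrite mulr_ge0.
have K'0 : 0 < K' by lra.
pose g (s : R) : R := s*(1+C*sqrt s).
apply: (@le_trans _ _ ((1-C*sqrt s1)*FK n K (g s1))); last first.
 by rewrite ler_wpM2l ?subr_ge0 //; exact: FK_decr.
have [sb|sb] := leP (K' ^- 2) s1.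
 rewrite FK0 // mulr_ge0 ?subr_ge0 //; apply: FK_ge0=> //.
 by rewrite mulr_gt0 // ltr_wpDr // mulr_ge0 //.
have cK (s : R) : 0 < s -> s <= K' ^- 2 -> K'*sqrt s <= 1.
 move=> s0 sb'; have : sqrt s <= sqrt (K' ^- 2) by apply: ler_wsqrtr.
 rewrite -exprVn sqrtr_sqr gtr0_norm ?invr_gt0 // => /(ler_wpM2l (ltW K'0)).
 by rewrite mulfV ?gt_eqF.
rewrite -subr_ge0.
pose F (s : R) : R := (1-C*sqrt s)*FK n K (g s)-FK n K' s.
pose g' (s : R) : R := s*(C*(2*sqrt s)^-1)+(1+C*sqrt s).
pose F' (s : R) : R := ((1-C*sqrt s)*(- psi n K (g s)*g' s)+FK n K (g s) * - (C*(2*sqrt s)^-1)) - - psi n K' s.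
have g0 (s : R) : 0 < s -> 0 < g s.
 by move=> s0; rewrite mulr_gt0 // ltr_wpDr // mulr_ge0 //.
rewrite -[X in 0 <= X]/(F s1); apply: (@pos_of_derive _ F F' (K' ^- 2) _ _ _ _ s10 (ltW sb)).
- move=> s s0 _.
 have h2 : is_derive (s : R) (1 : R) (fun x : R=> 1-C*sqrt x) (- (C*(2*sqrt s)^-1)).
 have h := is_deriveB (is_derive_cst (1 : R) s (1 : R)) (is_deriveZ C (is_derive1_sqrt s0)).
 by apply: (is_derive_eq h); rewrite sub0r.
 have h1 : is_derive (s : R) (1 : R) (fun x : R=> 1+C*sqrt x) (C*(2*sqrt s)^-1).
 have h := is_deriveD (is_derive_cst (1 : R) s (1 : R)) (is_deriveZ C (is_derive1_sqrt s0)).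
 by apply: (is_derive_eq h); rewrite add0r.
 have h3 : is_derive (s : R) (1 : R) g (g' s).
 apply: (is_derive_eq (is_deriveM (is_derive_id s (1 : R)) h1)).
 by rewrite /GRing.scale /= mulr1.
 have h4 := @is_derive_comp1 _ _ (FK n K) g s 1 _ _ (is_derive_FK n K0 (g0 s s0)) h3.
 exact: (is_deriveB (is_deriveM h2 h4) (is_derive_FK n K'0 s0)).
- move=> s s0 sb'; have := cK s s0 sb'; rewrite /F' opprK.
 have sg0 : 0 < sqrt s by rewrite sqrtr_gt0.
 have sgE : sqrt s^+2 = s by rewrite sqr_sqrtr // ltW.
 have Fg := FK_ge0 n K0 (g0 s s0).
 have gE : sqrt (g s) = sqrt s*sqrt (1+C*sqrt s) by rewrite sqrtrM // ltW.
 have g'E : g' s = 1+3/2*(C*sqrt s).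
 rewrite /g' -{1}sgE; move: sg0; move: (sqrt s)=> u u0; field; rewrite gt_eqF //.
 rewrite g'E; set u := sqrt s in sg0 sgE gE * => Ku.
 have Au : (C+2*(n.+1%:R*C))*u <= 1.
 apply: le_trans Ku; rewrite ler_wpM2r ?(ltW sg0) //; lra.
 have Cu : 0 <= C*u by rewrite mulr_ge0 // ltW.
 have nCu : n%:R*(C*u)+C*u = n.+1%:R*C*u by rewrite -natr1; ring.
 have nC0 : 0 <= n%:R*(C*u) by rewrite mulr_ge0.
 have cu : n%:R*(C*u)+C*u <= 2^-1 by rewrite nCu; lra.
 have P1 : 0 <= FK n K (g s)*(C/(2*u)) by rewrite mulr_ge0 // divr_ge0 // mulr_ge0 // ltW.
 suff : psi n K' s <= (1-C*u)*(psi n K (g s)*(1+3/2*(C*u))) by lra.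
 rewrite /psi gE -/u.
 have r1 : sqrt (1+C*u) <= 1+C*u.
 have r0 := sqrtr_ge0 (1+C*u).
 rewrite -(@ler_pXn2r _ 2) ?nnegrE //; last by lra.
 rewrite sqr_sqrtr; last by lra.
 by rewrite expr2 ler_peMr //; lra.
 have [a0|a0] := leP (1-K'*u) 0.
 rewrite (bt_neg _ a0) mulr0; apply: mulr_ge0; first by lra.
 apply: mulr_ge0; last by lra.
 by rewrite mulr_ge0 ?bt_ge0 // invr_ge0 exprn_ge0 // ltW // g0.
 set b := 1-K*(u*sqrt (1+C*u)).
 have KCu : K*u <= 1 by apply: le_trans Ku; rewrite ler_wpM2r ?(ltW sg0) //; lra.
 have hb : 2*(n%:R*(C*u)+C*u) <= b-(1-K'*u).
 have e1 : K*(u*sqrt (1+C*u)) <= K*(u*(1+C*u)).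
 by rewrite ler_wpM2l ?(ltW K0) // ler_wpM2l // ltW.
 have e2 : K*u*(C*u) <= C*u by rewrite ler_piMl.
 have e3 : (K+(C+2 * n.+1%:R*C))*u <= K'*u by rewrite ler_wpM2r // ltW.
 rewrite nCu /b; lra.
 have ab : 1-K'*u <= b by lra.
 have b1 : b <= 1 by rewrite /b gerBl mulr_ge0 ?(ltW K0) // mulr_ge0 ?sqrtr_ge0 // ltW.
 have hx := bt0_exp a0 ab b1.
 have B0 := bt_ge0 0 (1-K'*u).
 have gn : s ^- n*(1-n%:R*(C*u)) <= g s ^- n.
 rewrite /g -/u exprMn invfM ler_wpM2l ?invr_ge0 ?exprn_ge0 ?(ltW s0) //.
 have Bern : forall k, (1-k%:R*(C*u))*(1+C*u)^+k <= 1.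
 elim=> [|k IH]; first by rewrite mul0r mulr1.
 apply: le_trans IH; rewrite (exprS (1+C*u) k) [leLHS]mulrA; apply: ler_wpM2r; first by rewrite exprn_ge0 //; lra.
 rewrite -natr1; have : 0 <= k%:R*(C*u)*(C*u) by rewrite mulr_ge0 // mulr_ge0.
 have : 0 <= C*u*(C*u) by rewrite mulr_ge0.
 by lra.
 by rewrite -[leRHS]mul1r ler_pdivlMr ?Bern // exprn_gt0 //; lra.
 have sn : 0 <= s ^- n by rewrite invr_ge0 exprn_ge0 // ltW.
 apply: (@le_trans _ _ ((1-C*u)*((s ^- n*(1-n%:R*(C*u))*((1+2*(n%:R*(C*u)+C*u))*bt 0 (1-K'*u)))*(1+3/2*(C*u))))).
 have -> : (1-C*u)*((s ^- n*(1-n%:R*(C*u))*((1+2*(n%:R*(C*u)+C*u))*bt 0 (1-K'*u)))*(1+3/2*(C*u)))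
 = (((1-C*u)*(1+3/2*(C*u)))*((1-n%:R*(C*u))*(1+2*(n%:R*(C*u)+C*u))))*(s ^- n*bt 0 (1-K'*u)) by ring.
 rewrite ler_peMl ?mulr_ge0 //.
 set c := C*u; set d := n%:R*c; rewrite -/c -/d in cu Cu nC0.
 have cd : c <= d by rewrite ler_peMl.
 have q1 : 1 <= (1-c)*(1+3/2*c).
 have : 0 <= c*(4^-1-c) by rewrite mulr_ge0 // subr_ge0; lra.
 lra.
 have q2 : 1 <= (1-d)*(1+2*(d+c)).
 have : 0 <= d*(2^-1-(d+c)) by rewrite mulr_ge0 // subr_ge0.
 lra.
 by rewrite -[leLHS]mulr1 ler_pM.
 rewrite ler_wpM2l ?subr_ge0 //; first by lra.
 rewrite ler_wpM2r //; first by lra.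
 apply: ler_pM=> //; first by rewrite mulr_ge0 //; lra.
 by rewrite mulr_ge0 //; lra.
 apply: le_trans hx; rewrite ler_wpM2r //; lra.
- rewrite /F (@FK0 R n K' (K' ^- 2)) // subr0 mulr_ge0 //; last by apply: FK_ge0=> //; apply: g0; rewrite invr_gt0 exprn_gt0.
 rewrite -exprVn sqrtr_sqr gtr0_norm ?invr_gt0 // subr_ge0 ler_pdivrMr // mul1r; lra.
Qed.
End KernelEst.

(** * The operator applied to a kernel with frozen matrix *)

Section Frozen.
Variables (R : realType) (n : nat) (n0 : (0 < n)%N).
Notation m := (n+n)%N.
Notation V := (pt R n).

Definition mv (M : 'M[R]_m) (x : V) (i : 'I_m) : R := \sum_j M i j*x 0 j.
Definition hk (K e : R) (T0 : 'M[R]_m) (z y : V) : R := FK n K (qf T0 (y-z) (y-z)+e^+2).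

Lemma qf_mv (M : 'M[R]_m) (x y : V) : qf M x y = \sum_i x 0 i * mv M y i.
Proof. by apply: eq_bigr=> i _; rewrite mulr_sumr; apply: eq_bigr=> j _; ring. Qed.

Lemma is_derive_coord (i k : 'I_m) (p : V) : is_derive p (delta_mx 0 i : V) (fun q : V=> q 0 k) ((i == k)%:R).
Proof.
apply/is_derive_line.
have -> : (fun h : R=> (h *: (delta_mx 0 i : V)+p) 0 k) = (fun h : R=> h*(i == k)%:R+p 0 k).
 by apply/funext=> h; rewrite !mxE eq_sym.
have h := is_deriveD (is_deriveZ ((i == k)%:R : R) (is_derive_id (0 : R) (1 : R))) (is_derive_cst (p 0 k) (0 : R) (1 : R)).
rewrite (_ : (fun h : R=> _) = (((i == k)%:R : R) \*: (id : R -> R)+cst (p 0 k))); last first.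
 by apply/funext=> t /=; rewrite mulrC.
by apply: (is_derive_eq h); rewrite /GRing.scale /= addr0 mulr1.
Qed.

Lemma is_derive_qf (T0 : 'M[R]_m) (z p : V) i : (forall i j, T0 i j = T0 j i) ->
 is_derive p (delta_mx 0 i : V) (fun q : V=> qf T0 (q-z) (q-z)) (2 * mv T0 (p-z) i).
Proof.
move=> sT.
have d1 k : is_derive p (delta_mx 0 i : V) (fun q : V=> (q-z) 0 k) ((i == k)%:R).
 have h := is_deriveB (is_derive_coord i k p) (is_derive_cst (z 0 k) p (delta_mx 0 i : V)).
 rewrite subr0 in h; rewrite (_ : (fun q : V=> _) = ((fun q : V=> q 0 k)-cst (z 0 k))) //.
 by apply/funext=> q; rewrite !mxE.
have d2 k : is_derive p (delta_mx 0 i : V) (fun q : V=> mv T0 (q-z) k) (T0 k i).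
 rewrite (_ : (fun q : V=> _) = \sum_j (T0 k j \*: (fun q : V=> (q-z) 0 j))); last first.
 by apply/funext=> q; rewrite fct_sumE.
 have h := is_derive_sum (fun j=> is_deriveZ (T0 k j) (d1 j)).
 apply: (is_derive_eq h); rewrite (bigD1 i) //= eqxx big1 ?addr0; last first.
 by move=> j ji; rewrite eq_sym (negbTE ji) scaler0.
 by rewrite /GRing.scale /= mulr1.
rewrite (_ : (fun q : V=> _) = \sum_k ((fun q : V=> (q-z) 0 k)*(fun q : V=> mv T0 (q-z) k))); last first.
 by apply/funext=> q; rewrite qf_mv fct_sumE.
apply: (is_derive_eq (is_derive_sum (fun k=> is_deriveM (d1 k) (d2 k)))).
rewrite big_split /= [X in _+X](bigD1 i) //= [X in _+(_+X)]big1 ?addr0; last first.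
 by move=> k ki; rewrite eq_sym (negbTE ki) scaler0.
rewrite eqxx /GRing.scale /= mulr1 mulr2n mulrDl mul1r; congr (_+_).
by apply: eq_bigr=> k _; rewrite mulrC sT.
Qed.

Lemma psmv_qf (X : topologicalType) (T0 : X -> 'M[R]_m) (z : X -> V) :
 (forall i j, continuous (fun x=> T0 x i j)) -> (forall i, continuous (fun x=> z x 0 i)) ->
 psmv (fun x y=> qf (T0 x) (y-z x) (y-z x)).
Proof.
move=> cT cz.
have pc k : psmv (fun x (y : V)=> (y-z x) 0 k).
 rewrite (_ : (fun x y=> _) = (fun x (y : V)=> y 0 k-z x 0 k)); last first.
 by apply/funext=> x; apply/funext=> y; rewrite !mxE.
 by apply: psm_sub; [exact: psmv_coord|exact: psm_param (cz k)].
apply: psm_sum=> i; apply: psm_sum=> j; apply: psm_mul; last exact: pc.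
by apply: psm_mul; [exact: psm_param (cT i j)|exact: pc].
Qed.

Lemma psmv_hk (X : topologicalType) (K e : R) (T0 : X -> 'M[R]_m) (z : X -> V) : 0 < K -> 0 < e ->
 (forall i j, continuous (fun x=> T0 x i j)) -> (forall i, continuous (fun x=> z x 0 i)) ->
 (forall x v, 0 <= qf (T0 x) v v) ->
 psmv (fun x=> hk K e (T0 x) (z x)).
Proof.
move=> K0 e0 cT cz pT.
apply: (@psm_comp _ _ _ _ _ _ (FK n K) _ (smooth1_FK n K0)).
 by apply: psm_add; [exact: psmv_qf|exact: psm_cst].
by move=> x y _; rewrite /pos /= ltr_wpDl // exprn_gt0.
Qed.

Lemma smooth_hk (K e : R) (T0 : 'M[R]_m) (z : V) : 0 < K -> 0 < e -> (forall v, 0 <= qf T0 v v) ->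
 smooth (hk K e T0 z).
Proof.
move=> K0 e0 pT; apply: (@psmv_smooth _ _ R^o (fun _=> hk K e T0 z) 0).
by apply: psmv_hk=> // *; exact: cst_continuous.
Qed.

Definition trA (S T0 : 'M[R]_m) : R := \sum_i \sum_j S i j*T0 i j.
Definition trB (S T0 : 'M[R]_m) (x : V) : R := \sum_i \sum_j S i j*(mv T0 x i * mv T0 x j).

Lemma LS_hk (S : V -> 'M[R]_m) (K e : R) (T0 : 'M[R]_m) (z y : V) : 0 < K -> 0 < e ->
 (forall i j, T0 i j = T0 j i) -> (forall v, 0 <= qf T0 v v) ->
 LS S (hk K e T0 z) y =
 lval n K (qf T0 (y-z) (y-z)+e^+2) (trA (S y) T0) (trB (S y) T0 (y-z)).
Proof.
move=> K0 e0 sT pT.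
pose q (y : V) := qf T0 (y-z) (y-z)+e^+2.
have qp p : 0 < q p by rewrite ltr_wpDl // exprn_gt0.
have dq i p : is_derive p (delta_mx 0 i : V) q (2 * mv T0 (p-z) i).
 have h := is_deriveD (is_derive_qf z p i sT) (is_derive_cst (e^+2) p (delta_mx 0 i : V)).
 by apply: (is_derive_eq h); rewrite addr0.
have d1 j : pd j (hk K e T0 z) = (fun p=> (- psi n K (q p))*(2 * mv T0 (p-z) j)).
 apply/funext=> p; have [_] := @is_derive_comp1 _ _ (FK n K) q p _ _ _ (is_derive_FK n K0 (qp p)) (dq j p).
 exact.
have d2 i j : pd i (pd j (hk K e T0 z)) y =
 - psi n K (q y)*(2*T0 i j)+4 * dpsi n K (q y)*(mv T0 (y-z) i * mv T0 (y-z) j).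
 rewrite d1.
 have h1 := @is_derive_comp1 _ _ (psi n K) q y _ _ _ (is_derive_psi n K (qp y)) (dq i y).
 have h2 : is_derive y (delta_mx 0 i : V) (fun q : V=> 2 * mv T0 (q-z) j) (2*T0 i j).
 have dc k : is_derive y (delta_mx 0 i : V) (fun q : V=> (q-z) 0 k) ((i == k)%:R).
 have h := is_deriveB (is_derive_coord i k y) (is_derive_cst (z 0 k) y (delta_mx 0 i : V)).
 rewrite subr0 in h; rewrite (_ : (fun q : V=> _) = ((fun q : V=> q 0 k)-cst (z 0 k))) //.
 by apply/funext=> q'; rewrite !mxE.
 rewrite (_ : (fun q : V=> _) = 2 \*: \sum_k (T0 j k \*: (fun q : V=> (q-z) 0 k))); last first.
 by apply/funext=> q'; rewrite fct_sumE.
 apply: (is_derive_eq (is_deriveZ (2 : R) (is_derive_sum (fun k=> is_deriveZ (T0 j k) (dc k))))).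
 rewrite (bigD1 i) //= eqxx big1 ?addr0; last first.
 by move=> k ki; rewrite eq_sym (negbTE ki) scaler0.
 by rewrite /GRing.scale /= mulr1 sT.
 have [_ h3] := is_deriveM (is_deriveN h1) h2.
 transitivity ((- psi n K (q y)) *: (2*T0 i j)+(2 * mv T0 (y-z) j) *: (- (- dpsi n K (q y)*(2 * mv T0 (y-z) i)))).
 exact: h3.
 move: (psi n K (q y)) (dpsi n K (q y)) (mv T0 (y-z) i) (mv T0 (y-z) j) (T0 i j)=> a b c d f.
 by rewrite /GRing.scale /=; ring.
transitivity (trA (S y) T0*(- (2 * psi n K (q y)))+trB (S y) T0 (y-z)*(4 * dpsi n K (q y))); last first.
 by rewrite /lval -/(q y); ring.
rewrite /trA /trB !mulr_suml -big_split; apply: eq_bigr=> i _ /=.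
rewrite !mulr_suml -big_split; apply: eq_bigr=> j _ /=; rewrite d2.
move: (psi n K (q y)) (dpsi n K (q y)) (mv T0 (y-z) i) (mv T0 (y-z) j) (T0 i j) (S y i j)=> a b c d f g.
by ring.
Qed.

Lemma mv_bound (T0 : 'M[R]_m) (x : V) (B : R) i : (forall i j, `|T0 i j| <= B) -> `|mv T0 x i| <= m%:R*(B * `|x|).
Proof.
move=> hT; apply: le_trans (ler_norm_sum _ _ _) _; apply: sum_le_const=> j.
by rewrite normrM ler_pM ?coord_norm.
Qed.

(** With E = S (T0 - T1) one has S T0 = 1 + E, so both deviations are linear in E: its trace, and
    the pairing of T0 x with E x. Positivity of [T0] bounds |x|^2 by the form, which makes the
    second error relative. *)
Lemma tr_est (S T0 T1 : 'M[R]_m) (x : V) (L d : R) : S *m T1 = 1%:M ->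
 (forall i j, T0 i j = T0 j i) -> (forall i j, `|S i j| <= L) -> (forall i j, `|T0 i j| <= L) ->
 (forall i j, `|T0 i j-T1 i j| <= d) -> `|x|^+2 <= L*qf T0 x x ->
 `|trA S T0-m%:R| <= m%:R^+2*(L * d) /\
 `|trB S T0 x-qf T0 x x| <= m%:R^+4*L^+3 * d*qf T0 x x.
Proof.
move=> ST sT bS bT bd hx.
have i0 : 'I_m by rewrite -(prednK (_ : 0 < m)%N) ?addn_gt0 ?n0 //; exact: ord0.
have L0 : 0 <= L by apply: le_trans (bS i0 i0).
have d0 : 0 <= d by apply: le_trans (bd i0 i0).
pose E i k := \sum_j S i j*(T0 j k-T1 j k).
have STk i k : \sum_j S i j*T0 j k = (i == k)%:R+E i k.
 have := congr1 (fun M : 'M[R]_m=> M i k) ST; rewrite !mxE=> <-.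
 by rewrite -big_split /=; apply: eq_bigr=> j _; ring.
have bE i k : `|E i k| <= m%:R*(L * d).
 apply: le_trans (ler_norm_sum _ _ _) _; apply: sum_le_const=> j.
 by rewrite normrM ler_pM.
split.
 have -> : trA S T0-m%:R = \sum_i E i i.
 have -> : trA S T0 = \sum_i ((i == i)%:R+E i i).
 by apply: eq_bigr=> i _; rewrite -STk; apply: eq_bigr=> j _; rewrite sT.
 have e1 : \sum_(i < m) ((i == i)%:R : R) = m%:R.
 by under eq_bigr do rewrite eqxx; rewrite sumr_const card_ord.
 by rewrite big_split e1 addrAC subrr add0r.
 rewrite expr2 -mulrA; apply: le_trans (ler_norm_sum _ _ _) _.
 by apply: sum_le_const=> i; exact: bE.
have -> : trB S T0 x-qf T0 x x = \sum_i \sum_k mv T0 x i*E i k*x 0 k.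
 have -> : trB S T0 x = \sum_i mv T0 x i*\sum_k ((i == k)%:R+E i k)*x 0 k.
 apply: eq_bigr=> i _; rewrite mulr_sumr.
 under [RHS]eq_bigr do rewrite -STk mulr_suml mulr_sumr.
 rewrite exchange_big; apply: eq_bigr=> j _ /=.
 rewrite {2}/mv !mulr_sumr; apply: eq_bigr=> k _.
 lra.
 rewrite qf_mv -sumrB; apply: eq_bigr=> i _.
 under eq_bigr do rewrite mulrDl.
 have e2 : \sum_(k < m) (i == k)%:R*x 0 k = x 0 i.
 rewrite (bigD1 i) //= eqxx mul1r big1 ?addr0 // => k ki.
 by rewrite eq_sym (negbTE ki) mul0r.
 rewrite big_split /= e2 mulrDr [X in X+_-_]mulrC addrAC subrr add0r mulr_sumr.
 by apply: eq_bigr=> k _; rewrite mulrA.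
have hh : m%:R*(m%:R*(m%:R*(L * `|x|)*(m%:R*(L * d)) * `|x|)) <= m%:R^+4*L^+3 * d*qf T0 x x.
 have -> : m%:R*(m%:R*(m%:R*(L * `|x|)*(m%:R*(L * d)) * `|x|)) = m%:R^+4*L^+2 * d * `|x|^+2.
 lra.
 have -> : m%:R^+4*L^+3 * d*qf T0 x x = m%:R^+4*L^+2 * d*(L*qf T0 x x) by ring.
 by rewrite ler_wpM2l // !mulr_ge0 //.
apply: le_trans hh; apply: le_trans (ler_norm_sum _ _ _) _; apply: sum_le_const=> i.
apply: le_trans (ler_norm_sum _ _ _) _; apply: sum_le_const=> k.
rewrite !normrM; apply: ler_pM; rewrite ?mulr_ge0 ?coord_norm //.
by apply: ler_pM=> //; exact: mv_bound.
Qed.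

(** [tr_est] is used with d = L(|x| + e), where |x| and e are at most L sqrt s. This gives 2 m^4 L^5
    sqrt s, doubled once more for room. *)
Definition C2 (L : R) : R := 4 * m%:R^+4*L^+5.
Definition phik (K e : R) (T0 : 'M[R]_m) (x : V) : R := phis n (qf T0 x x) e K.
Definition kerk (K e : R) (S T0 : 'M[R]_m) (x : V) : R :=
 lval n K (qf T0 x x+e^+2) (trA S T0) (trB S T0 x)+phik K e T0 x.

Lemma kerk_est (S T0 T1 : 'M[R]_m) (x : V) (L K e : R) : 1 <= L -> S *m T1 = 1%:M ->
 (forall i j, T0 i j = T0 j i) -> (forall i j, `|S i j| <= L) -> (forall i j, `|T0 i j| <= L) ->
 (forall i j, `|T0 i j-T1 i j| <= L*(`|x| + e)) -> `|x|^+2 <= L*qf T0 x x ->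
 8*C2 L*(1+m%:R) <= K -> 0 <= e -> let s := qf T0 x x+e^+2 in 0 < s ->
 [/\ `|kerk K e S T0 x| <= (2*C2 L*(1+m%:R)+48*(1+C2 L))*K*(s ^- n*sqrt s),
 s <= 2*qf T0 x x -> K/4*(s ^- n*sqrt s)*bt 2 (1-K*sqrt s) <= kerk K e S T0 x &
 - ((1+8*C2 L*e) * phik K e T0 x) <= kerk K e S T0 x-phik K e T0 x].
Proof.
move=> L1 ST sT bS bT bd hx hK e0 s s0.
have [hA hB] := tr_est ST sT bS bT bd hx.
have L0 : 0 <= L by lra.
have m1 : 1 <= m%:R :> R by rewrite ler1n addn_gt0 n0.
have m0 : 0 <= m%:R :> R by lra.
have q0 : 0 <= qf T0 x x.
 have := le_trans (exprn_ge0 2 (normr_ge0 x)) hx; rewrite pmulr_rge0 //; lra.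
have sg0 : 0 < sqrt s by rewrite sqrtr_gt0.
have sgE : sqrt s^+2 = s by rewrite sqr_sqrtr // ltW.
have xs : `|x| <= L*sqrt s.
 rewrite -(@ler_pXn2r _ 2) ?nnegrE // ?mulr_ge0 ?(ltW sg0) // exprMn sgE.
 apply: le_trans hx _; apply: ler_pM=> //; first by rewrite expr2 ler_peMl.
 by rewrite /s lerDl sqr_ge0.
have es : e <= L*sqrt s.
 apply: (@le_trans _ _ (sqrt s)); last by rewrite ler_peMl // ltW.
 rewrite -(@ler_pXn2r _ 2) ?nnegrE // ?(ltW sg0) // sgE.
 by rewrite /s lerDr.
have dd : L*(`|x| + e) <= 2*L^+2*sqrt s.
 have -> : 2*L^+2*sqrt s = L*(L*sqrt s+L*sqrt s) by ring.
 by rewrite ler_wpM2l // lerD.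
have d0 : 0 <= L*(`|x| + e) by rewrite mulr_ge0 // addr_ge0.
have p1 k : 1 <= m%:R^+k :> R by rewrite exprn_ege1.
have l1 k : 1 <= L^+k by rewrite exprn_ege1.
have c1 : 1 <= C2 L.
 rewrite /C2 -[leLHS]mulr1 ler_pM // -[leLHS]mulr1 ler_pM //; lra.
have cc : m%:R^+4*L^+3*(L*(`|x| + e)) <= C2 L*sqrt s.
 apply: (@le_trans _ _ (m%:R^+4*L^+3*(2*L^+2*sqrt s))).
 by rewrite ler_wpM2l // mulr_ge0 // exprn_ge0.
 have -> : C2 L*sqrt s = m%:R^+4*L^+3*(2*L^+2*sqrt s)*2 by rewrite /C2; ring.
 by rewrite ler_peMr ?ler1n // !mulr_ge0 ?exprn_ge0 // ltW.
have [] := @ker_est R n n0 (C2 L) K (qf T0 x x) e (trA S T0) (trB S T0 x) c1 hK q0 s0.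
- apply: (le_trans hA); apply: le_trans cc.
 have -> : m%:R^+4*L^+3*(L*(`|x| + e)) = m%:R^+2*(L*(L*(`|x| + e)))*(m%:R^+2*L^+2) by ring.
 have p2 : 0 <= m%:R^+2*(L*(L*(`|x| + e))) by rewrite mulr_ge0 ?exprn_ge0 // mulr_ge0.
 apply: ler_peMr=> //.
 by rewrite -[leLHS]mulr1 ler_pM.
- by apply: (le_trans hB); rewrite ler_wpM2r.
move=> h1 h2 h3; split=> //.
by rewrite /kerk addrK; exact: h3.
Qed.
End Frozen.

(** * Integrability of radial functions *)

Section Radial.
Variables (R : realType) (m : nat) (m0 : (0 < m)%N).
Notation V := 'rV[R]_m.

(** A sum of step functions on cubes dominates f, and their masses are explicit and geometrically
    summable. This takes the place of polar coordinates. *)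
Lemma layer_cake (f : V -> R) (a r : nat -> R) (c : R) : measT f ->
 (forall x, 0 <= f x) -> (forall j, 0 <= a j) -> (forall j, 0 < r j) ->
 (forall x, f x = 0 \/ exists2 j, f x <= a j & `|x| < r j) ->
 (forall j, a j*(2*r j)^+m <= c/(2 ^ j.+1)%:R) -> Itg f /\ Int f <= c.
Proof.
move=> mf f0 a0 r0 hf hc.
pose g (j : nat) (x : V) : \bar R := (a j*\1_(ball (0 : V) (r j)) x)%:E.
have mb j : measurable (ball (0 : V) (r j)) by apply: open_meas; exact: ball_open.
have mg j : measT (g j).
 by apply/EFinP; apply: measurable_funM; [exact: measurable_cst|exact: measurable_indic].
have g0 j x : (0 <= g j x)%E by rewrite lee_fin mulr_ge0.
have fg x : ((f x)%:E <= \sum_(j <oo) g j x)%E.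
 have [->|[j fa xr]] := hf x; first exact: nneseries_ge0.
 apply: (@le_trans _ _ (\sum_(0 <= i < j.+1) g i x)%E); last by apply: nneseries_lim_ge.
 rewrite big_nat_recr //= -[leLHS]add0e; apply: leeD; first by apply: sume_ge0=> *; exact: g0.
 rewrite lee_fin indicE mem_set ?mulr1 //; apply/ballP.
 by rewrite sub0r normrN.
have c0 : 0 <= c.
 have := le_trans (mulr_ge0 (a0 0%N) (exprn_ge0 m (mulr_ge0 (ler0n R 2) (ltW (r0 0%N))))) (hc 0%N).
 lra.
have I : (\int[lebn R m]_x (f x)%:E <= c%:E)%E.
 apply: (@le_trans _ _ (\int[lebn R m]_x (\sum_(j <oo) g j x))%E).
 apply: ge0_le_integral=> //.
 - by move=> x _; rewrite lee_fin.
 - exact/EFinP.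
 - by apply: ge0_emeasurable_sum=> // k x _ _; exact: g0.
 rewrite integral_nneseries //; apply: le_trans (epsilon_trick0 xpredT c0).
 apply: lee_nneseries=> [j _ _|j _]; first exact: integral_ge0.
 rewrite [leLHS](_ : _ = (a j)%:E*\int[lebn R m]_x (\1_(ball (0 : V) (r j)) x)%:E)%E; last first.
 rewrite -ge0_integralZl_EFin //.
 by apply/EFinP; exact: measurable_indic.
 rewrite integral_indic // setIT.
 apply: (@le_trans _ _ ((a j)%:E*((2*r j)^+m)%:E)%E); last pos.
 by rewrite le_eqVlt; apply/orP; left; apply/eqP; congr (_*_)%E; exact: lebn_ball.
have If : Itg f.
 apply/ItgP; split=> //; apply: le_lt_trans (ltry c); apply: le_trans I.
 by under eq_integral do rewrite ger0_norm //.
by split=> //; rewrite -lee_fin -Int_EFin.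
Qed.

(** The function |x|^(1/2-m), cut at [rho]. Orders are integer powers of sqrt |x| throughout, so
    half-integer exponents need no real powers; at the origin the convention 0^-1 = 0 gives the
    value 0. *)
Definition gk (rho : R) (x : V) : R := if `|x| < rho then sqrt `|x| ^- (m+m).-1 else 0.

Lemma measurable_invn (k : nat) (f : V -> R) : (0 < k)%N -> measT f ->
 (forall x, 0 <= f x) -> measT (fun x=> f x ^- k).
Proof.
move=> k0 mf f0; rewrite (_ : (fun x=> _) = (fun x=> powR (f x) (- k%:R))); last first.
 by apply/funext=> x; rewrite powRN powR_mulrn.
by apply: (@measT_comp _ _ _ _ _ _ (fun t : R=> powR t (- k%:R)) _ f); [exact: measurable_powR|].
Qed.

Lemma sqrtn_cont : continuous (fun x : V=> sqrt `|x|).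
Proof.
move=> x; apply: (@continuous_comp _ _ _ (fun x : V=> `|x|) (@Num.sqrt R)); first exact: norm_continuous.
exact: sqrt_continuous.
Qed.

Lemma gk_ge0 rho x : 0 <= gk rho x.
Proof. by rewrite /gk; case: ifP=> // _; rewrite sqrtr_ge0. Qed.

Lemma measurable_normlt rho : measT (fun x : V=> `|x| < rho).
Proof.
apply: (measurable_fun_bool true)=> /=; rewrite setTI; apply: open_meas.
rewrite (_ : _ @^-1` _ = (fun x : V=> `|x|) @^-1` [set t | t < rho]).
 by apply: open_comp=> [x _|]; [exact: norm_continuous|exact: open_lt].
pos.
Qed.

Lemma measurable_gk rho : measT (gk rho).
Proof.
apply: measurable_fun_ifT; [exact: measurable_normlt| |exact: measurable_cst].
apply: measurable_invn=> [||x]; [by case: (m) m0=> // k _; rewrite addnS| |exact: sqrtr_ge0].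
by apply: cont_meas; exact: sqrtn_cont.
Qed.

Lemma gk_itg rho : 0 < rho -> Itg (gk rho) /\ Int (gk rho) <= 2^+(3 * m)*sqrt rho.
Proof.
move=> rho0; have s0 : 0 < sqrt rho by rewrite sqrtr_gt0.
have sE : sqrt rho^+2 = rho by rewrite sqr_sqrtr // ltW.
pose u j := sqrt rho/2^+j.
have u0 j : 0 < u j by rewrite divr_gt0 //.
have uS j : u j.+1 = u j/2 by rewrite /u exprS invfM; ring.
apply: (@layer_cake _ (fun j=> u j.+1 ^- (m+m).-1) (fun j=> u j^+2)).
- exact: measurable_gk.
- exact: gk_ge0.
- by move=> j; rewrite invr_ge0 exprn_ge0 // ltW.
- by move=> j; rewrite exprn_gt0.
- move=> x; have [xr|xr] := ltP `|x| rho; last by left; rewrite /gk ltNge xr.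
 have [->|x0] := eqVneq x 0.
 left; rewrite /gk normr0 rho0 sqrtr0 expr0n; case: (m) m0=> // k _.
 by rewrite addnS invr0.
 right; have xp : 0 < sqrt `|x| by rewrite sqrtr_gt0 normr_gt0.
 have xE : sqrt `|x|^+2 = `|x| by rewrite sqr_sqrtr.
 have ex : exists j, u j.+1 <= sqrt `|x|.
 have h := archi_boundP (ltW (divr_gt0 s0 xp)).
 exists (Num.bound (sqrt rho/sqrt `|x|)); set k := Num.bound _ in h *.
 rewrite /u ler_pdivrMr ?exprn_gt0 // mulrC -ler_pdivrMr //; apply: (le_trans (ltW h)).
 by rewrite -natrX ler_nat; apply: leq_trans (ltnW (ltn_expl k (isT : (1 < 2)%N))) _; rewrite leq_exp2l.
 case: (ex_minnP ex)=> j hj hmin; exists j.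
 rewrite /gk xr lef_pV2 ?posrE ?exprn_gt0 //.
 by rewrite lerXn2r ?nnegrE // ltW.
 rewrite -xE ltrXn2r ?nnegrE ?(ltW xp) ?(ltW (u0 j)) //.
 case: j hj hmin=> [|j] hj hmin; first by rewrite /u divr1 ltr_sqrt.
 by rewrite ltNge; apply/negP=> /hmin; rewrite ltnn.
- move=> j; rewrite (exprMn _ 2 (u j^+2)) -(exprM (u j)) natrX.
 have mm : (2 * m)%N = (m+m).-1.+1 by rewrite prednK ?addn_gt0 ?m0 // mul2n addnn.
 rewrite mm (exprS (u j)) uS.
 have -> : (u j/2) ^- (m+m).-1 = u j ^- (m+m).-1*2^+(m+m).-1.
 by rewrite (exprMn _ (u j)) invfM exprVn invrK.
 rewrite le_eqVlt; apply/orP; left; apply/eqP.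
 have uj : u j^+(m+m).-1 != 0 by rewrite expf_neq0 // gt_eqF.
 rewrite (_ : 2^+(3 * m) = 2^+(m+m).-1*2*2^+m :> R); last first.
 by rewrite -exprSr -mm -exprD; congr (_^+_); rewrite -mulSnr.
 have -> : sqrt rho = u j*2^+j by rewrite divfK //.
 have e2 : 2^+j != 0 :> R by [].
 rewrite (exprS 2 j); move: uj e2; move: (2^+j)=> E; move: (u j^+(m+m).-1) (2^+(m+m).-1) (2^+m) (u j)=> A B C u' A0 E0.
 by field; rewrite E0.
Qed.

Lemma contV (W : topologicalType) (F : W -> R) : continuous F -> (forall x, F x != 0) ->
 continuous (fun x=> (F x)^-1).
Proof. by move=> cF F0 x; apply: (@continuousV _ _ F); [exact: F0|exact: cF]. Qed.

Lemma contX (W : topologicalType) (F : W -> R) k : continuous F -> continuous (fun x=> F x^+k).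
Proof.
move=> cF x; apply: (@continuous_comp _ _ _ F (fun t : R=> t^+k)); first exact: cF.
exact: exprn_continuous.
Qed.

(** Decays like |x|^(-m-1): it dominates the rescaled point mass together with its first moment,
    uniformly in e. *)
Definition dom (x : V) : R := (1 + `|x|)/(1 + `|x|^+2)^+(m./2).+1.

Lemma dom_ge0 x : 0 <= dom x.
Proof. pos. Qed.

Lemma dom_itg : ~~ odd m -> Itg dom.
Proof.
move=> om; have mE : m = (m./2+m./2)%N by rewrite addnn -[LHS]odd_double_half (negbTE om).
have m2 : (0 < m./2)%N by move: m0; rewrite {1}mE; case: (m./2).
have dp (x : V) : 0 < (1 + `|x|^+2) by [].
have [] // := @layer_cake dom (fun j=> 2*2 ^- (j * m.+1)) (fun j=> 2^+j.+1) (4*4^+m).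
- apply: cont_meas.
 have cn : continuous (fun x : V=> `|x|) by exact: norm_continuous.
 have c1 : continuous (fun _ : V=> 1 : R) by move=> x; exact: cst_continuous.
 apply: (contM (contD c1 cn)); apply: contV; first exact: contX (contD c1 (contX cn)).
 pos.
- exact: dom_ge0.
- move=> x; right.
 have ex : exists j, `|x| < 2^+j.+1.
 have h := archi_boundP (normr_ge0 x); exists (Num.bound `|x|); set k := Num.bound _ in h *.
 apply: (lt_le_trans h); rewrite -natrX ler_nat.
 by apply: leq_trans (ltnW (ltn_expl k (isT : (1 < 2)%N))) _; rewrite leq_exp2l.
 case: (ex_minnP ex)=> j hj hmin; exists j=> //.
 have p1 : 1 <= 1 + `|x|^+2 by rewrite lerDl.
 have x1 : `|x| <= 1 + `|x|^+2.
 by have := sqr_ge0 (`|x| - 1); rewrite sqrrB1; lra.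
 case: j hj hmin=> [|j] hj hmin.
 rewrite mul0n expr0 invr1 mulr1 /dom ler_pdivrMr ?exprn_gt0 //.
 apply: (@le_trans _ _ (2*(1 + `|x|^+2))); first by lra.
 by rewrite ler_wpM2l // (exprS (1 + `|x|^+2)) ler_peMr ?exprn_ege1 //.
 have xj : 2^+j.+1 <= `|x| by rewrite leNgt; apply/negP=> /hmin; rewrite ltnn.
 have x2 : 1 <= `|x| by apply: le_trans xj; rewrite exprn_ege1 // ler1n.
 have xp : 0 < `|x| by lra.
 apply: (@le_trans _ _ (2 * `|x| ^- m.+1)); last first.
 rewrite ler_wpM2l // lef_pV2 ?posrE ?exprn_gt0 // exprM.
 by rewrite lerXn2r ?nnegrE.
 rewrite /dom ler_pdivrMr ?exprn_gt0 // -mulrA.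
 have : `|x|^+m.+2 <= (1 + `|x|^+2)^+(m./2).+1.
 rewrite (_ : m.+2 = (2*(m./2).+1)%N); last by rewrite mulnS mul2n -addnn -mE.
 by rewrite exprM lerXn2r ?nnegrE // lerDr.
 rewrite exprS -ler_pdivlMl ?exprn_gt0 // => h.
 suff : `|x| <= `|x| ^- m.+1*(1 + `|x|^+2)^+(m./2).+1 by lra.
 by rewrite ler_pdivlMl ?exprn_gt0 // -exprSr; move: h; rewrite -ler_pdivlMl // mulrC=> h; rewrite exprS.
- move=> j; rewrite mulnS addnC exprD exprM natrX exprS mulrA (_ : 2*2 = 4); last by ring.
 rewrite (exprMn _ 4 (2^+j)) le_eqVlt; apply/orP; left; apply/eqP.
 have A0 : 2^+j != 0 :> R by [].
 have B0 : (2^+j)^+m != 0 :> R by [].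
 move: ((2 : R)^+j) A0 B0=> A A0; move: (A^+m) (4^+m)=> B C B0.
 by field; rewrite A0.
Qed.
End Radial.

(** * Kernels for coefficients defined on the whole space *)

Section GlobalKernel.
Variables (R : realType) (n : nat) (n0 : (0 < n)%N).
Notation m := (n+n)%N.
Notation V := (pt R n).

(** What survives of [elliptic] when the coefficients are extended from a cube by [clamp]: bounds
    and continuity, but no derivatives of [S]. Self-adjointness is supplied as a separate hypothesis
    where it enters. *)
Record gell (S T : V -> 'M[R]_m) (L : R) : Prop := Gell {
 ge_L : 1 <= L;
 ge_Sc : forall i j, continuous (fun q=> S q i j);
 ge_Sb : forall p i j, `|S p i j| <= L;
 ge_Tb : forall p i j, `|T p i j| <= L;
 ge_inv : forall p, S p *m T p = 1%:M;
 ge_Tsym : forall p i j, T p i j = T p j i;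
 ge_Tpos : forall p (x : V), `|x|^+2 <= L*qf (T p) x x;
 ge_Tlip : forall p p' i j, `|T p i j-T p' i j| <= L * `|p-p'|
}.

Variables (S T : V -> 'M[R]_m) (L : R) (G : gell S T L).

Definition Pk (K e : R) (z y : V) : R := kerk K e (S y) (T z) (y-z).
Definition Fk (K e : R) (z y : V) : R := phik K e (T z) (y-z).
Definition sk (e : R) (z y : V) : R := qf (T z) (y-z) (y-z)+e^+2.

Lemma lip_cont (k : nat) (f : 'rV[R]_k -> R) (C : R) : (forall p p', `|f p-f p'| <= C * `|p-p'|) -> continuous f.
Proof.
move=> hl p; suff : f @ p --> f p by [].
apply/(@cvgrPdist_lt _ _ _ (nbhs (p : 'rV[R]_k)) _ f (f p))=> e e0.
have C0 : 0 <= `|C| + 1 by [].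
have : \forall q \near p, `|p-q| < e/(`|C| + 1).
 have d0 : 0 < e/(`|C| + 1) by rewrite divr_gt0 //.
 by apply: filterS (nbhsx_ballx p _ d0)=> q /ballP.
apply: filterS=> q h; apply: (le_lt_trans (hl p q)).
apply: (@le_lt_trans _ _ ((`|C| + 1) * `|p-q|)).
 by rewrite ler_wpM2r // (le_trans (ler_norm _)) // lerDl.
by rewrite mulrC -ltr_pdivlMr //.
Qed.

Lemma ge_Tc i j : continuous (fun q=> T q i j).
Proof. by apply: (@lip_cont _ _ L)=> p p'; exact: (ge_Tlip G). Qed.

Lemma ge_L0 : 0 <= L. Proof. by apply: le_trans (ge_L G). Qed.

Lemma ge_Tge0 p x : 0 <= qf (T p) x x.
Proof.
have := le_trans (exprn_ge0 2 (normr_ge0 x)) (ge_Tpos G p x).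
by rewrite pmulr_rge0 // (lt_le_trans ltr01 (ge_L G)).
Qed.

Lemma sk_gt0 e z y : y != z -> 0 < sk e z y.
Proof.
move=> yz; rewrite /sk ltr_pwDl ?sqr_ge0 //.
have x0 : 0 < `|y-z|^+2 by rewrite exprn_gt0 // normr_gt0 subr_eq0.
have := lt_le_trans x0 (ge_Tpos G z (y-z)).
by rewrite pmulr_rgt0 // (lt_le_trans ltr01 (ge_L G)).
Qed.

Lemma sk_gt0e e z y : 0 < e -> 0 < sk e z y.
Proof. by move=> e0; rewrite ltr_wpDl ?exprn_gt0 // ge_Tge0. Qed.

Lemma LS_H K e z y : 0 < K -> 0 < e -> LS S (hk K e (T z) z) y = Pk K e z y-Fk K e z y.
Proof.
move=> K0 e0; rewrite LS_hk //; last by move=> v; exact: ge_Tge0.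
 by rewrite addrK.
exact: (ge_Tsym G).
Qed.

Lemma dpsi_continuous K (s : R) : 0 < s -> {for s, continuous (dpsi n K)}.
Proof.
move=> s0; have [psi' sp hp] := smooth1_derive (smooth1_psi n K).
apply: (@near_continuous _ _ _ (fun t=> - psi' t)); last first.
 by apply: continuousN; exact: smooth1_cont sp s0.
have : \forall t \near s, 0 < t by exact: (cvgr_gt s (@cvg_id _ (nbhs s))).
apply: filterS=> t t0; have [_ e1] := hp t t0; have [_ e2] := is_derive_psi n K t0.
lra.
Qed.
Let W := (R*(V*V))%type.

Let cz k : continuous (fun p : W=> (p.2.2-p.2.1) 0 k).
Proof.
rewrite (_ : (fun p : W=> _) = (fun p : W=> p.2.2 0 k-p.2.1 0 k)); last by apply/funext=> p; rewrite !mxE.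
have c2 : continuous (fun p : W=> p.2.2 0 k).
 move=> p; apply: (@continuous_comp _ _ _ (fun p : W=> p.2) (fun q : V*V=> q.2 0 k)); first exact: cvg_snd.
 apply: (@continuous_comp _ _ _ (fun q : V*V=> q.2) (fun q : V=> q 0 k)); first exact: cvg_snd.
 exact: coord_continuous.
have c1 : continuous (fun p : W=> p.2.1 0 k).
 move=> p; apply: (@continuous_comp _ _ _ (fun p : W=> p.2) (fun q : V*V=> q.1 0 k)); first exact: cvg_snd.
 apply: (@continuous_comp _ _ _ (fun q : V*V=> q.1) (fun q : V=> q 0 k)); first exact: cvg_fst.
 exact: coord_continuous.
exact: contB.
Qed.
Let cT i j : continuous (fun p : W=> T p.2.1 i j).
Proof.
move=> p; apply: (@continuous_comp _ _ _ (fun p : W=> p.2) (fun q : V*V=> T q.1 i j)); first exact: cvg_snd.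
by apply: (@continuous_comp _ _ _ (fun q : V*V=> q.1) (fun q : V=> T q i j)); [exact: cvg_fst|exact: ge_Tc].
Qed.
Let cS i j : continuous (fun p : W=> S p.2.2 i j).
Proof.
move=> p; apply: (@continuous_comp _ _ _ (fun p : W=> p.2) (fun q : V*V=> S q.2 i j)); first exact: cvg_snd.
by apply: (@continuous_comp _ _ _ (fun q : V*V=> q.2) (fun q : V=> S q i j)); [exact: cvg_snd|exact: (ge_Sc G)].
Qed.

Lemma contSum (X : topologicalType) (J : Type) (s : seq J) (F : J -> X -> R) :
 (forall j, continuous (F j)) -> continuous (fun x=> \sum_(j <- s) F j x).
Proof. by move=> cF x; apply: continuous_sum=> j; exact: cF. Qed.
Let cs : continuous (fun p : W=> sk p.1 p.2.1 p.2.2).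
Proof.
apply: contD; last first.
 by apply: contX=> p; exact: cvg_fst.
apply: (@contSum _ _ _ (fun i (p : W)=> \sum_j T p.2.1 i j*(p.2.2-p.2.1) 0 i*(p.2.2-p.2.1) 0 j))=> i.
apply: (@contSum _ _ _ (fun j (p : W)=> T p.2.1 i j*(p.2.2-p.2.1) 0 i*(p.2.2-p.2.1) 0 j))=> j.
exact: (@contM _ _ _ _ (@contM _ _ _ _ (@cT i j) (@cz i)) (@cz j)).
Qed.
Let csc (phi : R -> R) p : {for sk p.1 p.2.1 p.2.2, continuous phi} ->
 {for p, continuous (fun p : W=> phi (sk p.1 p.2.1 p.2.2))}.
Proof. by move=> c; apply: (@continuous_comp _ _ _ (fun p : W=> sk p.1 p.2.1 p.2.2) phi); [exact: cs|]. Qed.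
Let cbt K : continuous (fun s : R=> bt 0 (1-K*sqrt s)).
Proof.
move=> s; apply: (@continuous_comp _ _ _ (fun s : R=> 1-K*sqrt s) (bt 0)).
 by apply: (contB (F := fun=> 1)); [move=> t; exact: cst_continuous|apply: (contM (F := fun=> K))=> t; [exact: cst_continuous|exact: sqrt_continuous]].
exact: is_derive_continuous (is_derive_bt 0 _).
Qed.

Lemma Fk_cont K (p : R*(V*V)) : 0 < sk p.1 p.2.1 p.2.2 ->
 {for p, continuous (fun p : R*(V*V)=> Fk K p.1 p.2.1 p.2.2)}.
Proof.
move=> s0.
apply: (@continuousM _ _ (fun p : W=> 2 * m%:R * p.1^+2*sk p.1 p.2.1 p.2.2 ^- n.+1)
 (fun p : W=> bt 0 (1-K*sqrt (sk p.1 p.2.1 p.2.2)))).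
 apply: (@continuousM _ _ (fun p : W=> 2 * m%:R * p.1^+2) (fun p : W=> sk p.1 p.2.1 p.2.2 ^- n.+1)).
 apply: (contM (F := fun=> 2 * m%:R))=> [q|]; first exact: cst_continuous.
 by apply: contX=> q; exact: cvg_fst.
 by apply: (csc (phi := fun s=> s ^- n.+1)); exact: smooth1_cont (@smooth1_invn R n.+1) s0.
by apply: (csc (phi := fun s=> bt 0 (1-K*sqrt s))); exact: cbt.
Qed.

Lemma Pk_cont K (p : R*(V*V)) : 0 < sk p.1 p.2.1 p.2.2 ->
 {for p, continuous (fun p : R*(V*V)=> Pk K p.1 p.2.1 p.2.2)}.
Proof.
move=> s0.
have cmv i : continuous (fun p : W=> mv (T p.2.1) (p.2.2-p.2.1) i).
 by apply: (@contSum _ _ _ (fun j (p : W)=> T p.2.1 i j*(p.2.2-p.2.1) 0 j))=> j; exact: (@contM _ _ _ _ (@cT i j) (@cz j)).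
have cA : continuous (fun p : W=> trA (S p.2.2) (T p.2.1)).
 apply: (@contSum _ _ _ (fun i (p : W)=> \sum_j S p.2.2 i j*T p.2.1 i j))=> i.
 by apply: (@contSum _ _ _ (fun j (p : W)=> S p.2.2 i j*T p.2.1 i j))=> j; exact: (@contM _ _ _ _ (@cS i j) (@cT i j)).
have cB : continuous (fun p : W=> trB (S p.2.2) (T p.2.1) (p.2.2-p.2.1)).
 apply: (@contSum _ _ _ (fun i (p : W)=> \sum_j S p.2.2 i j*(mv (T p.2.1) (p.2.2-p.2.1) i * mv (T p.2.1) (p.2.2-p.2.1) j)))=> i.
 apply: (@contSum _ _ _ (fun j (p : W)=> S p.2.2 i j*(mv (T p.2.1) (p.2.2-p.2.1) i * mv (T p.2.1) (p.2.2-p.2.1) j)))=> j.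
 exact: (@contM _ _ _ _ (@cS i j) (@contM _ _ _ _ (cmv i) (cmv j))).
apply: (@continuousD _ _ _ (fun p : W=> lval n K (sk p.1 p.2.1 p.2.2) (trA (S p.2.2) (T p.2.1)) (trB (S p.2.2) (T p.2.1) (p.2.2-p.2.1)))
 (fun p : W=> Fk K p.1 p.2.1 p.2.2)); last exact: Fk_cont.
apply: (@continuousD _ _ _ (fun p : W=> - (2*trA (S p.2.2) (T p.2.1) * psi n K (sk p.1 p.2.1 p.2.2)))
 (fun p : W=> 4*trB (S p.2.2) (T p.2.1) (p.2.2-p.2.1) * dpsi n K (sk p.1 p.2.1 p.2.2))).
 apply: continuousN; apply: (@continuousM _ _ (fun p : W=> 2*trA (S p.2.2) (T p.2.1)) (fun p : W=> psi n K (sk p.1 p.2.1 p.2.2))).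
 by apply: (contM (F := fun=> 2))=> // q; exact: cst_continuous.
 by apply: csc; exact: psi_continuous.
apply: (@continuousM _ _ (fun p : W=> 4*trB (S p.2.2) (T p.2.1) (p.2.2-p.2.1)) (fun p : W=> dpsi n K (sk p.1 p.2.1 p.2.2))).
 by apply: (contM (F := fun=> 4))=> // q; exact: cst_continuous.
by apply: csc; exact: dpsi_continuous.
Qed.

Lemma Pk_cvg K (e_ : nat -> R) (z_ : nat -> V) e z y : e_ j @[j --> \oo] --> e -> z_ j @[j --> \oo] --> z ->
 0 < sk e z y -> Pk K (e_ j) (z_ j) y @[j --> \oo] --> Pk K e z y.
Proof.
move=> he hz s0.
have h : (e_ j, (z_ j, y)) @[j --> \oo] --> (e, (z, y)).
 have hy : (fun=> y) j @[j --> \oo] --> y by exact: cvg_cst.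
 exact: (cvg_pair he (cvg_pair hz hy)).
exact: (cvg_comp _ _ h (@Pk_cont K (e, (z, y)) s0)).
Qed.

Lemma Pk_cont2 K e : 0 < e -> continuous (fun q : V*V=> Pk K e q.1 q.2).
Proof.
move=> e0 q; apply: (@continuous_comp _ _ _ (fun q : V*V=> (e, q)) (fun p : W=> Pk K p.1 p.2.1 p.2.2)).
 exact: cont_pairr.
by apply: Pk_cont; exact: sk_gt0e.
Qed.

Lemma Fk_cont2 K e : 0 < e -> continuous (fun q : V*V=> Fk K e q.1 q.2).
Proof.
move=> e0 q; apply: (@continuous_comp _ _ _ (fun q : V*V=> (e, q)) (fun p : W=> Fk K p.1 p.2.1 p.2.2)).
 exact: cont_pairr.
by apply: Fk_cont; exact: sk_gt0e.
Qed.

Definition K0 : R := 8*C2 n L*(1+m%:R).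
Definition Cp : R := (2*C2 n L*(1+m%:R)+48*(1+C2 n L))*L^+m.-1.

(** At the pole the trace is exactly m and the point mass cancels. For e = 0 the value is the
    convention 0^-1 = 0; it keeps bounds and limits in e valid on the diagonal. *)
Lemma Pk_diag K e z : 0 <= e -> Pk K e z z = 0.
Proof.
move=> e0; have x0 : `|0 : V|^+2 <= L*qf (T z) 0 0 by rewrite normr0 expr0n mulr_ge0 ?ge_L0 ?ge_Tge0.
have [h1 _] := tr_est n0 (ge_inv G z) (ge_Tsym G z) (ge_Sb G z) (ge_Tb G z) (fun i j=> (le_trans (ge_Tlip G z z i j) (lexx _))) x0.
have q0 : qf (T z) 0 0 = 0 by rewrite /qf big1 // => i _; rewrite big1 // => j _; rewrite !mxE mulr0.
have B0 : trB (S z) (T z) 0 = 0.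
 have mv0 i : mv (T z) 0 i = 0 by rewrite /mv big1 // => j _; rewrite mxE mulr0.
 by rewrite /trB big1 // => i _; rewrite big1 // => j _; rewrite !mv0 !mulr0.
have A0 : trA (S z) (T z) = m%:R.
 by move: h1; rewrite subrr normr0 !mulr0 normr_le0 subr_eq0=> /eqP.
rewrite /Pk /kerk /lval /phik /phis subrr B0 A0 q0 add0r mulr0 mul0r addr0 /psi.
have [->|e1] := eqVneq e 0; first by rewrite expr0n !mulr0 !mul0r expr0n gtn_eqF // invr0 mul0r mulr0 oppr0 addr0.
rewrite (exprS (e^+2)) invfM; move: (e^+2 ^- n) (bt 0 _)=> t b.
by field.
Qed.

Lemma sn_pow (s : R) : 0 < s -> s ^- n*sqrt s = sqrt s ^- m.-1.
Proof.
move=> s0; have r0 : 0 < sqrt s by rewrite sqrtr_gt0.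
have E : sqrt s^+2 = s by rewrite sqr_sqrtr // ltW.
rewrite -{1}E -exprM mul2n -addnn -[in LHS](prednK (_ : 0 < m)%N) ?addn_gt0 ?n0 // exprS invfM.
by rewrite mulrC mulrA mulfV ?mul1r // gt_eqF.
Qed.

Lemma skL e z y : `|y-z| <= L*sqrt (sk e z y).
Proof.
have s0 : 0 <= sk e z y by rewrite addr_ge0 ?sqr_ge0 ?ge_Tge0.
rewrite -(@ler_pXn2r _ 2) ?nnegrE ?mulr_ge0 ?sqrtr_ge0 ?ge_L0 // exprMn sqr_sqrtr //.
apply: (le_trans (ge_Tpos G z (y-z))); rewrite expr2 -mulrA ler_wpM2l ?ge_L0 //.
apply: (@le_trans _ _ (sk e z y)); first by rewrite lerDl sqr_ge0.
by rewrite ler_peMl // (ge_L G).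
Qed.

Lemma K0_ge : L <= K0 /\ 1 <= K0.
Proof.
have L1 := ge_L G; have m1 : 1 <= m%:R :> R by rewrite ler1n addn_gt0 n0.
have h : L <= K0.
 rewrite /K0 /C2; have e1 : 1 <= m%:R^+4 :> R by rewrite exprn_ege1.
 have e2 : L <= L^+5 by rewrite exprS ler_peMr ?ge_L0 // exprn_ege1.
 have e3 : L <= m%:R^+4*L^+5.
 by rewrite -[leLHS]mul1r ler_pM // ge_L0.
 have -> : 8*(4 * m%:R^+4*L^+5)*(1+m%:R) = (m%:R^+4*L^+5)*(32*(1+m%:R)) by ring.
 rewrite -[leLHS]mulr1 ler_pM ?ge_L0 //; lra.
lra.
Qed.

Section withK.
Variable K : R.
Hypothesis KK : K0 <= K.

Let Kp : 0 < K. Proof. by apply: lt_le_trans KK; apply: lt_le_trans ltr01 K0_ge.2. Qed.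

Lemma Pk_est e z y : 0 <= e -> 0 < sk e z y ->
 [/\ `|Pk K e z y| <= (2*C2 n L*(1+m%:R)+48*(1+C2 n L))*K*(sk e z y ^- n*sqrt (sk e z y)),
 sk e z y <= 2*qf (T z) (y-z) (y-z) ->
 K/4*(sk e z y ^- n*sqrt (sk e z y))*bt 2 (1-K*sqrt (sk e z y)) <= Pk K e z y &
 - ((1+8*C2 n L*e)*Fk K e z y) <= Pk K e z y-Fk K e z y].
Proof.
move=> e0 s0; apply: (@kerk_est R n n0 (S y) (T z) (T y) (y-z) L K e)=> //; first exact: (ge_L G).
- exact: (ge_inv G).
- exact: (ge_Tsym G).
- exact: (ge_Sb G).
- exact: (ge_Tb G).
- move=> i j; apply: (le_trans (ge_Tlip G z y i j)); rewrite ler_wpM2l ?ge_L0 // distrC lerDl //.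
- exact: (ge_Tpos G).
Qed.

Lemma sk_big e z y : L/K <= `|y-z| -> 1 <= K*sqrt (sk e z y).
Proof.
move=> h; have := le_trans h (skL e z y); rewrite ler_pdivrMr //.
have Lp : 0 < L by apply: lt_le_trans ltr01 (ge_L G).
by rewrite -mulrA ler_pMr // mulrC.
Qed.

Lemma Pk_bound e z y : 0 <= e -> `|Pk K e z y| <= Cp*K*gk (L/K) (y-z).
Proof.
move=> e0.
have [->|yz] := eqVneq y z.
 have h1 : 0 <= Cp*K.
 rewrite mulr_ge0 ?(ltW Kp) // /Cp mulr_ge0 ?exprn_ge0 ?ge_L0 //.
 have c0 : 0 <= C2 n L by rewrite !mulr_ge0 ?ge_L0.
 pos.
 by rewrite Pk_diag // normr0 mulr_ge0 // gk_ge0.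
have s0 := sk_gt0 e yz; have [h _ _] := Pk_est e0 s0.
have [xr|xr] := ltP `|y-z| (L/K); last first.
 have big := sk_big e xr.
 have t0 : 1-K*sqrt (sk e z y) <= 0 by lra.
 rewrite /gk ltNge xr /= mulr0 /Pk /kerk /lval /phik /phis /psi /dpsi.
 by rewrite !bt_neg // !(mulr0, mul0r, oppr0, addr0) normr0.
apply: (le_trans h); rewrite sn_pow // /gk xr /Cp.
have x0 : 0 < `|y-z| by rewrite normr_gt0 subr_eq0.
have r0 : 0 < sqrt `|y-z| by rewrite sqrtr_gt0.
have E : sqrt `|y-z|^+2 = `|y-z| by rewrite sqr_sqrtr //.
have sg0 : 0 < sqrt (sk e z y) by rewrite sqrtr_gt0.
have x1 : `|y-z| <= 1.
 apply: (le_trans (ltW xr)); rewrite ler_pdivrMr // mul1r.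
 exact: le_trans K0_ge.1 KK.
have r1 : sqrt `|y-z| <= 1 by rewrite -sqrtr1 ler_wsqrtr.
have c0 : 0 <= C2 n L by rewrite !mulr_ge0 ?ge_L0.
set A := 2*C2 n L*(1+m%:R)+48*(1+C2 n L).
have A0 : 0 <= A.
 pos.
have -> : A*L^+m.-1*K*sqrt `|y-z| ^- (m+m).-1 = A*K*(L^+m.-1*sqrt `|y-z| ^- (m+m).-1) by ring.
rewrite ler_wpM2l ?mulr_ge0 ?(ltW Kp) //.
have h1 : `|y-z|^+m.-1 <= L^+m.-1*sqrt (sk e z y)^+m.-1.
 by rewrite -exprMn lerXn2r ?nnegrE ?mulr_ge0 ?ge_L0 // skL.
apply: (@le_trans _ _ (L^+m.-1 * `|y-z| ^- m.-1)).
 by rewrite -[leLHS]mul1r ler_pdivlMr ?exprn_gt0 // mulrAC ler_pdivrMr ?exprn_gt0 // mul1r.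
rewrite ler_wpM2l ?exprn_ge0 ?ge_L0 // lef_pV2 ?posrE ?exprn_gt0 // -{2}E -exprM.
have -> : (m+m).-1 = (2 * m.-1).+1.
 have m1 : (0 < m)%N by rewrite addn_gt0 n0.
 by rewrite mul2n -addnn -[in LHS](prednK m1) addnS.
by rewrite exprS ler_piMl //.
Qed.

(** For e = 0 the region s <= 2q of [ker_est] is the whole space. The sign obtained here is what
    lets the pairing with a nonpositive function be estimated. *)
Lemma Pk0_ge0 z y : 0 <= Pk K 0 z y.
Proof.
have [->|yz] := eqVneq y z; first by rewrite Pk_diag.
have s0 := sk_gt0 0 yz; have [_ h _] := Pk_est (lexx 0) s0.
apply: le_trans (h _); last first.
 by rewrite /sk expr0n addr0 ler_peMl ?ge_Tge0 // ler1n.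
rewrite mulr_ge0 ?bt_ge0 // mulr_ge0 ?divr_ge0 ?(ltW Kp) // mulr_ge0 ?sqrtr_ge0 //.
by rewrite invr_ge0 exprn_ge0 // ltW.
Qed.

Lemma measurable_Pk0 : measT (fun q : V*V=> Pk K 0 q.1 q.2).
Proof.
pose D : set (V*V) := [set q | q.2-q.1 != 0].
have oD : open D.
 have c : continuous (fun q : V*V=> `|q.2-q.1|).
 move=> q; apply: (@continuous_comp _ _ _ (fun q : V*V=> q.2-q.1) (fun x : V=> `|x|)); last exact: norm_continuous.
 by apply: continuousB; [exact: cvg_snd|exact: cvg_fst].
 rewrite (_ : D = (fun q : V*V=> `|q.2-q.1|) @^-1` [set t | 0 < t]); last first.
 by apply/seteqP; split=> q /=; rewrite normr_gt0.
 by apply: open_comp=> [q _|]; [exact: c|exact: open_gt].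
have mD := open_meas2 oD.
apply: (@measurable_fun_cvg _ _ _ _ (fun j q=> Pk K (j.+1%:R^-1) q.1 q.2*\1_D q)).
 move=> j; apply: measurable_funM; last exact: measurable_indic.
 by apply: cont_meas2; apply: Pk_cont2; rewrite invr_gt0.
move=> [z y] _ /=.
have [yz|yz] := eqVneq y z.
 rewrite yz Pk_diag // (_ : (fun j : nat=> _) = (fun=> 0)); first exact: cvg_cst.
 by apply/funext=> j; rewrite Pk_diag ?mul0r //.
rewrite indicE mem_set; last by rewrite /D /= subr_eq0.
rewrite (_ : (fun j : nat=> _) = (fun j=> Pk K j.+1%:R^-1 ((fun=> z) j) y)); last by apply/funext=> j; rewrite mulr1.
apply: Pk_cvg; [|exact: cvg_cst|exact: sk_gt0].
exact: cvg_harmonic.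
Qed.
End withK.
End GlobalKernel.

(** * The mass of the point source *)

Section Kappa.
Variables (R : realType) (n : nat) (n0 : (0 < n)%N).
Notation m := (n+n)%N.
Notation V := (pt R n).

Lemma Int_affine k (t : R) (c : 'rV[R]_k) (f : 'rV[R]_k -> R) : 0 < t -> measT f ->
 (forall x, 0 <= f x) -> Itg (fun x=> f (t *: x+c)) ->
 Itg f /\ Int f = t^+k*Int (fun x=> f (t *: x+c)).
Proof.
move=> t0 mf f0 If.
have E : (\int[lebn R k]_x (f x)%:E = (t^+k*Int (fun x=> f (t *: x+c)))%:E)%E.
 rewrite (lebn_affine c t0) //; first by rewrite Int_EFin //.
 exact/EFinP.
have If' : Itg f.
 apply/ItgP; split=> //.
 have -> : (fun x=> (`|f x|)%:E) = (fun x=> (f x)%:E) by apply/funext=> x; rewrite ger0_norm.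
 by rewrite E ltry.
by split=> //; apply: EFin_inj; rewrite -Int_EFin.
Qed.

Definition posl (L : R) (T0 : 'M[R]_m) := forall x : V, `|x|^+2 <= L*qf T0 x x.

Definition rq (T0 : 'M[R]_m) (x : V) : R := 2 * m%:R*(1+qf T0 x x) ^- n.+1.
(** The limit for e -> 0 of the integral of the source: after the substitution x -> e x the argument
    of the cut-off tends to 1, whence the factor [bt 0 1]. *)
Definition kap (T0 : 'M[R]_m) : R := bt 0 1*Int (rq T0).
Definition rphi (K e : R) (T0 : 'M[R]_m) (x : V) : R :=
 rq T0 x*bt 0 (1-K*(e*sqrt (1+qf T0 x x))).

Lemma qf_ge0 L T0 x : 0 < L -> posl L T0 -> 0 <= qf T0 x x.
Proof. by move=> L0 h; have := le_trans (exprn_ge0 2 (normr_ge0 x)) (h x); rewrite pmulr_rge0. Qed.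

Lemma cont_qf T0 : continuous (fun x : V=> qf T0 x x).
Proof.
apply: (@contSum R V _ _ (fun i (x : V)=> \sum_j T0 i j*x 0 i*x 0 j))=> i.
apply: (@contSum R V _ _ (fun j (x : V)=> T0 i j*x 0 i*x 0 j))=> j.
have cc k : continuous (fun x : V=> x 0 k) by exact: coord_continuous.
apply: (@contM _ _ (fun x : V=> T0 i j*x 0 i))=> //.
by apply: (@contM _ _ (fun x : V=> T0 i j))=> // x; exact: cst_continuous.
Qed.

Lemma rq_dom L T0 x : 1 <= L -> posl L T0 -> 0 <= rq T0 x /\ rq T0 x*(1 + `|x|) <= 2 * m%:R*L^+n.+1 * dom x.
Proof.
move=> L1 pT; have L0 : 0 < L by lra.
have q0 := qf_ge0 x L0 pT.
have p : 0 < 1+qf T0 x x by lra.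
have r0 : 0 <= rq T0 x by rewrite ?mulr_ge0 // invr_ge0 exprn_ge0 // ltW.
split=> //; rewrite /rq /dom.
have -> : (m./2).+1 = n.+1 by rewrite addnn doubleK.
have d0 : 0 < 1 + `|x|^+2 by [].
have h : (1 + `|x|^+2)^+n.+1 <= L^+n.+1*(1+qf T0 x x)^+n.+1.
 rewrite -exprMn lerXn2r ?nnegrE ?mulr_ge0 ?(ltW d0) ?(ltW p) ?(ltW L0) //.
 by have := pT x; lra.
have -> : 2 * m%:R*L^+n.+1*((1 + `|x|)/(1 + `|x|^+2)^+n.+1) = 2 * m%:R*(L^+n.+1/(1 + `|x|^+2)^+n.+1)*(1 + `|x|) by ring.
rewrite ler_wpM2r ?addr_ge0 // ler_wpM2l ?mulr_ge0 //.
by rewrite -[leLHS]mul1r ler_pdivrMr ?exprn_gt0 // mulrAC ler_pdivlMr // mul1r.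
Qed.

Lemma cont_rq L T0 : 0 < L -> posl L T0 -> continuous (rq T0).
Proof.
move=> L0 pT; apply: (@contM _ _ (fun x : V=> 2 * m%:R)); first by move=> x; exact: cst_continuous.
apply: contV; last first.
 move=> x; rewrite expf_neq0 // gt_eqF //.
 by have := qf_ge0 x L0 pT; lra.
apply: contX; apply: (@contD _ _ (fun x : V=> 1)); first by move=> x; exact: cst_continuous.
exact: cont_qf.
Qed.

Lemma even_m : ~~ odd m. Proof. by rewrite addnn odd_double. Qed.
Lemma m_gt0 : (0 < m)%N. Proof. by rewrite addn_gt0 n0. Qed.

Lemma rq_itg L T0 : 1 <= L -> posl L T0 -> Itg (fun x=> rq T0 x*(1 + `|x|)) /\ Itg (rq T0).
Proof.
move=> L1 pT; have L0 : 0 < L by lra.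
have Id := ItgZ (2 * m%:R*L^+n.+1) (@dom_itg R m m_gt0 even_m).
have crq := cont_rq L0 pT.
have cn : continuous (fun x : V=> 1 + `|x|).
 by apply: (@contD _ _ (fun x : V=> 1))=> [x|]; [exact: cst_continuous|exact: norm_continuous].
split; apply: (@Itg_le _ _ _ (fun x=> 2 * m%:R*L^+n.+1 * dom x))=> //.
- by apply: cont_meas; exact: contM.
- move=> x; have [r0 h] := rq_dom x L1 pT.
 by rewrite ger0_norm // mulr_ge0 //.
- exact: cont_meas.
- move=> x; have [r0 h] := rq_dom x L1 pT.
 by rewrite ger0_norm //; apply: le_trans h; rewrite ler_peMr // lerDl.
Qed.

Lemma bt1_gt0 : 0 < bt 0 1 :> R.
Proof. by rewrite /bt ltr01 invr1 mul1r. Qed.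

Lemma bt_le_bt1 (t : R) : t <= 1 -> bt 0 t <= bt 0 1.
Proof.
move=> t1; rewrite {1}/bt; case: ifP=> [t0|_]; last exact: ltW bt1_gt0.
by rewrite /bt ltr01 !invr1 !mul1r ler_expR lerN2 invf_ge1.
Qed.

Definition kmax (L : R) : R := 2 * m%:R*L^+n.+1*Int (@dom R m).
Definition kmin (L : R) : R := bt 0 1*(2 * m%:R*(1+m%:R^+2*L) ^- n.+1*2^+m).

Lemma Int_dom_ge0 : 0 <= Int (@dom R m).
Proof. by apply: Int_ge0=> x; exact: dom_ge0. Qed.

Lemma kap_le L T0 : 1 <= L -> posl L T0 -> kap T0 <= kmax L /\ Int (fun x=> rq T0 x*(1 + `|x|)) <= kmax L.
Proof.
move=> L1 pT; have [I1 I2] := rq_itg L1 pT.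
have Id := ItgZ (2 * m%:R*L^+n.+1) (@dom_itg R m m_gt0 even_m).
have h2 : Int (fun x=> rq T0 x*(1 + `|x|)) <= kmax L.
 rewrite /kmax -IntZ; last exact: (@dom_itg R m m_gt0 even_m).
 by apply: Int_le=> // x; exact: (rq_dom x L1 pT).2.
split=> //; apply: le_trans h2; rewrite /kap.
apply: (@le_trans _ _ (Int (rq T0))).
 by rewrite ler_piMl ?bt_le1 // Int_ge0 // => x; exact: (rq_dom x L1 pT).1.
by apply: Int_le=> // x; rewrite ler_peMr ?lerDl // (rq_dom x L1 pT).1.
Qed.

Lemma kmin_gt0 L : 0 <= L -> 0 < kmin L.
Proof.
move=> L0; rewrite /kmin mulr_gt0 ?bt1_gt0 // mulr_gt0 ?exprn_gt0 //.
rewrite mulr_gt0 ?mulr_gt0 ?ltr0n ?m_gt0 // invr_gt0 exprn_gt0 //.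
by rewrite ltr_wpDr // mulr_ge0 //.
Qed.

Lemma kap_ge L T0 : 1 <= L -> posl L T0 -> (forall i j, `|T0 i j| <= L) -> kmin L <= kap T0.
Proof.
move=> L1 pT bT; have [_ I2] := rq_itg L1 pT; have L0 : 0 < L by lra.
rewrite /kmin /kap ler_wpM2l ?(ltW bt1_gt0) //.
set c := 2 * m%:R*_.
have c0 : 0 <= c.
 rewrite mulr_ge0 ?mulr_ge0 // invr_ge0 exprn_ge0 // addr_ge0 // mulr_ge0 ?exprn_ge0 //.
 exact: ltW.
have mb : measurable (ball (0 : V) 1) by apply: open_meas; exact: ball_open.
pose f (x : V) : R := c*\1_(ball (0 : V) 1) x.
have If : Itg f.
 apply: (@Itg_supp _ _ _ c 1)=> //.
 - by apply: measurable_funM; [exact: measurable_cst|exact: measurable_indic].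
 - by move=> x; rewrite /f indicE; case: (_ \in _); rewrite ?mulr1 ?mulr0 ger0_norm.
 - move=> x x1; rewrite /f indicE memNset ?mulr0 // => /ballP.
 by rewrite sub0r normrN ltNge x1.
have <- : Int f = c*2^+m.
 apply: EFin_inj; rewrite -Int_EFin //.
 transitivity (c%:E*\int[lebn R m]_x (\1_(ball (0 : V) 1) x)%:E)%E.
 rewrite -ge0_integralZl_EFin //.
 by apply/EFinP; exact: measurable_indic.
 rewrite integral_indic // setIT [RHS]EFinM; congr (_*_)%E.
 by have := lebn_ball (0 : V) (@ltr01 R); rewrite mulr1.
apply: Int_le=> // x; have [r0 _] := rq_dom x L1 pT.
rewrite /f indicE; case: (boolP (x \in _))=> [|_]; rewrite ?mulr1 ?mulr0 //.
rewrite inE=> /ballP; rewrite sub0r normrN=> x1.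
rewrite /c /rq ler_wpM2l ?mulr_ge0 // lef_pV2 ?posrE ?exprn_gt0 //; last 2 first.
- by rewrite ltr_wpDr // mulr_ge0 // ltW.
- by have := qf_ge0 x L0 pT; lra.
rewrite lerXn2r ?nnegrE ?addr_ge0 ?(qf_ge0 x L0 pT) ?mulr_ge0 ?exprn_ge0 ?(ltW L0) //.
rewrite lerD2l; apply: le_trans (ler_norm _) _; apply: le_trans (qf_bound _ _ bT) _.
rewrite -mulrA ler_piMr ?mulr_ge0 ?exprn_ge0 ?(ltW L0) //.
by rewrite mulr_ile1 // ltW.
Qed.

Lemma kap_cmp L T1 T2 d : 1 <= L -> posl L T1 -> posl L T2 -> 0 <= d ->
 (forall x, qf T1 x x <= (1+d)*qf T2 x x) -> kap T2 <= (1+d)^+n.+1*kap T1.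
Proof.
move=> L1 p1 p2 d0 h; have L0 : 0 < L by lra.
have [_ I1] := rq_itg L1 p1; have [_ I2] := rq_itg L1 p2.
rewrite /kap mulrCA ler_wpM2l ?(ltW bt1_gt0) // -IntZ //.
apply: Int_le=> //; first exact: ItgZ.
move=> x; rewrite /rq mulrCA ler_wpM2l ?mulr_ge0 //.
have q1 := qf_ge0 x L0 p1; have q2 := qf_ge0 x L0 p2.
have e0 : 0 < 1+d by lra.
rewrite -[leLHS]mul1r ler_pdivrMr; last by rewrite exprn_gt0 //; lra.
rewrite mulrAC ler_pdivlMr; last by rewrite exprn_gt0 //; lra.
rewrite mul1r -exprMn lerXn2r ?nnegrE ?mulr_ge0 //; do ?lra.
by have := h x; lra.
Qed.

Lemma qf_near L (T1 T2 : 'M[R]_m) d x : 0 < L -> posl L T2 -> (forall i j, `|T1 i j-T2 i j| <= d) ->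
 qf T1 x x <= (1+m%:R^+2 * d*L)*qf T2 x x.
Proof.
move=> L0 p2 h; have q2 := qf_ge0 x L0 p2.
have d0 : 0 <= d.
 have i0 : 'I_m by exact: Ordinal m_gt0.
 exact: le_trans (h i0 i0).
have -> : qf T1 x x = qf (T1-T2) x x+qf T2 x x.
 rewrite /qf -big_split; apply: eq_bigr=> i _; rewrite -big_split; apply: eq_bigr=> j _ /=.
 by rewrite !mxE; ring.
rewrite mulrDl mul1r addrC lerD2l.
have hb : forall i j, `|(T1-T2) i j| <= d by move=> i j; rewrite !mxE.
apply: le_trans (ler_norm _) _; apply: le_trans (qf_bound _ _ hb) _.
by rewrite -[leLHS]mulrA -[leRHS]mulrA ler_wpM2l ?mulr_ge0 ?p2.
Qed.

Lemma phik_scale K e T0 x : 0 < e -> 0 <= qf T0 x x -> e^+m * phik K e T0 (e *: x) = rphi K e T0 x.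
Proof.
move=> e0 q0; rewrite /phik /phis /rphi /rq qfZ.
have -> : e*e*qf T0 x x+e^+2 = e^+2*(1+qf T0 x x) by ring.
rewrite sqrtrM ?exprn_ge0 ?(ltW e0) // sqrtr_sqr (gtr0_norm e0).
rewrite exprMn invfM (exprS (e^+2)) invfM -exprM mul2n -addnn.
have e2 : e^+2 != 0 by rewrite expf_neq0 // gt_eqF.
have em : e^+m != 0 by rewrite expf_neq0 // gt_eqF.
move: e2 em; move: (e^+2) (e^+m) ((1+qf T0 x x) ^- n.+1) (bt 0 _)=> a b c d a0 b0.
by field; rewrite b0.
Qed.

Lemma phik_opp K e (T0 : 'M[R]_m) (x : V) : phik K e T0 (- x) = phik K e T0 x.
Proof.
rewrite /phik; congr phis; rewrite /qf; apply: eq_bigr=> i _; apply: eq_bigr=> j _.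
by rewrite !mxE; ring.
Qed.

Lemma rphi_le K e L T0 x : 0 <= K -> 0 <= e -> 1 <= L -> posl L T0 ->
 0 <= rphi K e T0 x <= bt 0 1*rq T0 x.
Proof.
move=> K0 e0 L1 pT; have [r0 _] := rq_dom x L1 pT.
rewrite /rphi mulr_ge0 ?bt_ge0 //= mulrC ler_wpM2r // bt_le_bt1 //.
by rewrite gerBl !mulr_ge0.
Qed.

Lemma phik_ge0 K e L T0 x : 0 < L -> posl L T0 -> 0 <= phik K e T0 x.
Proof.
move=> L0 pT; rewrite /phik /phis; apply: mulr_ge0; last exact: bt_ge0.
apply: mulr_ge0; first by apply: mulr_ge0; [exact: mulr_ge0|exact: sqr_ge0].
by rewrite invr_ge0 exprn_ge0 // addr_ge0 ?sqr_ge0 // (qf_ge0 x L0 pT).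
Qed.

Section PhiLimit.
Variables (S T : V -> 'M[R]_m) (L : R) (G : gell S T L).

Lemma ge_posl z : posl L (T z). Proof. by move=> x; exact: (ge_Tpos G). Qed.

Lemma Fk_Int K e (g : V -> R) (B : R) y : 0 <= K -> 0 < e -> continuous g -> (forall z, 0 <= g z <= B) ->
 let h x := g (e *: x+y)*rphi K e (T (e *: x+y)) x in
 [/\ Itg (fun z=> g z*Fk T K e z y), Itg h, Int (fun z=> g z*Fk T K e z y) = Int h &
 forall x, 0 <= h x <= B*(2 * m%:R*L^+n.+1 * dom x)].
Proof.
move=> K0 e0 cg gB h; have L1 := ge_L G; have L0 : 0 < L by lra.
have hb x : 0 <= h x <= B*(2 * m%:R*L^+n.+1 * dom x).
 have /andP[g0 g1] := gB (e *: x+y).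
 have /andP[r0 r1] := rphi_le x K0 (ltW e0) L1 (@ge_posl (e *: x+y)).
 rewrite /h mulr_ge0 //= ler_pM //; apply: le_trans r1 _.
 have [q0 q1] := rq_dom x L1 (@ge_posl (e *: x+y)).
 apply: le_trans q1; rewrite mulrC ler_wpM2l //; apply: le_trans (bt_le1 1) _.
 by rewrite lerDl.
have cF : continuous (fun z=> g z*Fk T K e z y).
 apply: contM=> //; have /cont_slice[c1 _] := @Fk_cont2 R n S T L G K e e0.
 exact: (c1 y).
have F0 z : 0 <= g z*Fk T K e z y.
 have /andP[g0 g1] := gB z; rewrite mulr_ge0 //.
 exact: (@phik_ge0 K e L (T z) (y-z) L0 (@ge_posl z)).
have hE x : e^+m*(g (e *: x+y)*Fk T K e (e *: x+y) y) = h x.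
 rewrite mulrCA /Fk opprD addrCA subrr addr0 phik_opp phik_scale //.
 exact: (qf_ge0 x L0 (@ge_posl _)).
have em : e^+m != 0 by rewrite expf_neq0 // gt_eqF.
have ch : continuous h.
 rewrite (_ : h = (fun x=> e^+m*(g (e *: x+y)*Fk T K e (e *: x+y) y))); last by apply/funext=> x; rewrite hE.
 apply: (@contM _ _ (fun x : V=> e^+m)); first by move=> x; exact: cst_continuous.
 move=> x; apply: (@continuous_comp _ _ _ (fun x : V=> e *: x+y) (fun z=> g z*Fk T K e z y)).
 exact: cont_affine.
 exact: cF.
have Ih : Itg h.
 apply: (@Itg_le _ _ _ (fun x=> B*(2 * m%:R*L^+n.+1 * dom x))).
 - exact: cont_meas.
 - by apply: ItgZ; apply: ItgZ; exact: (@dom_itg R m m_gt0 even_m).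
 - by move=> x; have /andP[h0 h1] := hb x; rewrite ger0_norm.
have Ih' : Itg (fun x=> g (e *: x+y)*Fk T K e (e *: x+y) y).
 rewrite (_ : (fun x=> _) = (fun x=> (e^+m)^-1*h x)); first exact: ItgZ.
 by apply/funext=> x; rewrite -hE [RHS]mulrA mulVf // mul1r.
have [I1 E1] := @Int_affine _ e y _ e0 (cont_meas cF) F0 Ih'.
split; [exact: I1|exact: Ih| |exact: hb].
by rewrite E1 -(IntZ _ Ih'); apply: eq_Int=> x; exact: hE.
Qed.

Lemma Fk_bound K e (g : V -> R) (B : R) y : 0 <= K -> 0 < e -> continuous g -> (forall z, 0 <= g z <= B) ->
 0 <= Int (fun z=> g z*Fk T K e z y) <= B*kmax L.
Proof.
move=> K0 e0 cg gB; have [I1 I2 -> hb] := Fk_Int y K0 e0 cg gB.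
have Id := @dom_itg R m m_gt0 even_m.
rewrite Int_ge0 //=; last by move=> x; have /andP[] := hb x.
rewrite /kmax -!IntZ //; last exact: ItgZ.
apply: Int_le=> //; first by apply: ItgZ; exact: ItgZ.
by move=> x; have /andP[] := hb x.
Qed.

(** After z = y + e x the matrices frozen at z converge to T y and [dom] dominates. So the source is
    an approximate identity also when integrated over the pole, although its matrix moves with the
    pole. *)
Lemma Fk_cvg K (e_ : nat -> R) (g : V -> R) (B : R) y : 0 <= K -> (forall j, 0 < e_ j) ->
 e_ j @[j --> \oo] --> (0 : R) -> continuous g -> (forall z, 0 <= g z <= B) ->
 Int (fun z=> g z*Fk T K (e_ j) z y) @[j --> \oo] --> g y*kap (T y).
Proof.
move=> K0 ep ec cg gB; have L1 := ge_L G; have L0 : 0 < L by lra.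
have Id := @dom_itg R m m_gt0 even_m.
pose h j (x : V) := g (e_ j *: x+y)*rphi K (e_ j) (T (e_ j *: x+y)) x.
have H j := Fk_Int y K0 (ep j) cg gB.
rewrite (_ : (fun j=> _) = (fun j=> Int (h j))); last first.
 by apply/funext=> j; have [_ _ -> _] := H j.
have -> : g y*kap (T y) = Int (fun x=> g y*(bt 0 1*rq (T y) x)).
 have I2 := (rq_itg L1 (@ge_posl y)).2.
 by rewrite IntZ; [rewrite IntZ|exact: ItgZ].
have mg : measT (fun x=> g y*(bt 0 1*rq (T y) x)).
 by apply: Itg_meas; apply: ItgZ; apply: ItgZ; exact: (rq_itg L1 (@ge_posl y)).2.
apply: (proj2 (@Int_dct _ _ h _ (fun x=> B*(2 * m%:R*L^+n.+1 * dom x)) _ _ _ _ mg)).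
- by move=> j; have [_ /Itg_meas] := H j.
- by apply: ItgZ; exact: ItgZ.
- by move=> j x; have [_ _ _ /(_ x)/andP[h0 h1]] := H j; rewrite ger0_norm.
- apply: aeW=> x.
 have cz : (e_ j *: x+y) @[j --> \oo] --> y.
 rewrite -[X in _ --> X](_ : 0 *: x+y = y); last by rewrite scale0r add0r.
 by apply: cvgD; [apply: cvgZl|exact: cvg_cst].
 have cgz : g (e_ j *: x+y) @[j --> \oo] --> g y by exact: (cvg_comp _ _ cz (cg y)).
 have cq : qf (T (e_ j *: x+y)) x x @[j --> \oo] --> qf (T y) x x.
 have cq0 : continuous (fun z=> qf (T z) x x).
 apply: (@contSum R V _ _ (fun i (z : V)=> \sum_j T z i j*x 0 i*x 0 j))=> i.
 apply: (@contSum R V _ _ (fun j (z : V)=> T z i j*x 0 i*x 0 j))=> j.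
 have c1 (c : R) : continuous (fun z : V=> c) by move=> z; exact: cst_continuous.
 have cTij : continuous (fun z=> T z i j) by move=> z0; exact: (ge_Tc G).
 by apply: (@contM _ _ (fun z : V=> T z i j*x 0 i))=> //; exact: contM.
 exact: (cvg_comp _ _ cz (cq0 y)).
 have c1q : (1+qf (T (e_ j *: x+y)) x x) @[j --> \oo] --> 1+qf (T y) x x.
 by apply: cvgD=> //; exact: cvg_cst.
 have p : 0 < 1+qf (T y) x x by have := qf_ge0 x L0 (@ge_posl y); lra.
 apply: cvgM=> //; rewrite mulrC; apply: cvgM.
 apply: cvgM; first exact: cvg_cst.
 have ci : {for 1+qf (T y) x x, continuous (fun t : R=> t ^- n.+1)}.
 exact: smooth1_cont (@smooth1_invn R n.+1) p.
 exact: (cvg_comp _ _ c1q ci).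
 have cb : {for (1 : R), continuous (@bt R 0)} by exact: is_derive_continuous (is_derive_bt 0 _).
 have carg : 1-K*(e_ j*sqrt (1+qf (T (e_ j *: x+y)) x x)) @[j --> \oo] --> (1 : R).
 rewrite -[X in _ --> X](_ : 1-K*(0*sqrt (1+qf (T y) x x)) = 1); last lra.
 apply: cvgB; first exact: cvg_cst.
 apply: cvgM; first exact: cvg_cst.
 apply: cvgM=> //; exact: (cvg_comp _ _ c1q (@sqrt_continuous R _)).
 exact: (cvg_comp _ _ carg cb).
Qed.
End PhiLimit.

(** The first moment of the source is of order e; it measures the loss when a Lipschitz function is
    replaced by its value at the pole. *)
Lemma phik_Int K e L T0 y : 0 <= K -> 0 < e -> 1 <= L -> posl L T0 ->
 [/\ Itg (fun z=> phik K e T0 (z-y)), Int (fun z=> phik K e T0 (z-y)) <= kap T0,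
 Itg (fun z=> phik K e T0 (z-y) * `|z-y|) &
 Int (fun z=> phik K e T0 (z-y) * `|z-y|) <= kmax L*e].
Proof.
move=> K0 e0 L1 pT; have L0 : 0 < L by lra.
have em : e^+m != 0 by rewrite expf_neq0 // gt_eqF.
have em0 : 0 < e^+m by rewrite exprn_gt0.
have cph : continuous (fun z : V=> phik K e T0 (z-y)).
 have cq : continuous (fun z : V=> qf T0 (z-y) (z-y)+e^+2).
 apply: contD; last by move=> z; exact: cst_continuous.
 move=> z; apply: (@continuous_comp _ _ _ (fun z : V=> z-y) (fun x : V=> qf T0 x x)); last exact: cont_qf.
 by apply: continuousB; [exact: cvg_id|exact: cst_continuous].
 have qp z : 0 < qf T0 (z-y) (z-y)+e^+2.
 by rewrite ltr_wpDl ?exprn_gt0 // (qf_ge0 _ L0 pT).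
 apply: contM.
 apply: (@contM _ _ (fun z : V=> 2 * m%:R*e^+2)); first by move=> z; exact: cst_continuous.
 by apply: contV; [exact: contX|move=> z; rewrite expf_neq0 // gt_eqF].
 move=> z; apply: (@continuous_comp _ _ _ (fun z : V=> 1-K*sqrt (qf T0 (z-y) (z-y)+e^+2)) (bt 0)); last first.
 exact: is_derive_continuous (is_derive_bt 0 _).
 apply: (contB (F := fun=> 1)); first by move=> t; exact: cst_continuous.
 apply: (contM (F := fun=> K)); first by move=> t; exact: cst_continuous.
 move=> t; apply: (@continuous_comp _ _ _ (fun z : V=> qf T0 (z-y) (z-y)+e^+2) (@Num.sqrt R)); first exact: cq.
 exact: sqrt_continuous.
have cn : continuous (fun z : V=> `|z-y|).
 move=> z; apply: (@continuous_comp _ _ _ (fun z : V=> z-y) (fun x : V=> `|x|)); last exact: norm_continuous.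
 by apply: continuousB; [exact: cvg_id|exact: cst_continuous].
have E x : phik K e T0 ((e *: x+y)-y) = (e^+m)^-1*rphi K e T0 x.
 by rewrite addrK -phik_scale ?(qf_ge0 x L0 pT) // mulrA mulVf // mul1r.
have [I1 I2] := rq_itg L1 pT.
have rb x := rphi_le x K0 (ltW e0) L1 pT.
have p0 z : 0 <= phik K e T0 (z-y) by exact: phik_ge0 L0 pT.
have crphi : continuous (rphi K e T0).
 rewrite (_ : rphi K e T0 = (fun x=> e^+m * phik K e T0 ((e *: x+y)-y))); last first.
 by apply/funext=> x; rewrite E mulrA mulfV // mul1r.
 apply: (@contM _ _ (fun x : V=> e^+m)); first by move=> x; exact: cst_continuous.
 move=> x; apply: (@continuous_comp _ _ _ (fun x : V=> e *: x+y) (fun z=> phik K e T0 (z-y))).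
 exact: cont_affine.
 exact: cph.
have Ir : Itg (rphi K e T0).
 apply: (@Itg_le _ _ _ (fun x=> bt 0 1*rq T0 x)); [exact: cont_meas|exact: ItgZ|].
 by move=> x; have /andP[h0 h1] := rb x; rewrite ger0_norm.
have nx : continuous (fun x : V=> `|x|) by exact: norm_continuous.
have Ir1 : Itg (fun x=> rphi K e T0 x * `|x|).
 apply: (@Itg_le _ _ _ (fun x=> rq T0 x*(1 + `|x|)))=> //.
 by apply: cont_meas; exact: contM.
 move=> x; have /andP[h0 h1] := rb x; rewrite normrM normr_id (ger0_norm h0); apply: ler_pM=> //; last lra.
 apply: le_trans h1 _; rewrite ler_piMl ?bt_le1 //; exact: (rq_dom x L1 pT).1.
have J1 : Itg (fun x=> phik K e T0 ((e *: x+y)-y)).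
 by rewrite (_ : (fun x=> _) = (fun x=> (e^+m)^-1*rphi K e T0 x)); [exact: ItgZ|apply/funext=> x; exact: E].
have E2 x : phik K e T0 ((e *: x+y)-y) * `|(e *: x+y)-y| = (e^+m)^-1*(e*(rphi K e T0 x * `|x|)).
 by rewrite E addrK normrZ (gtr0_norm e0); move: `|x| => t; ring.
have J2 : Itg (fun x=> phik K e T0 ((e *: x+y)-y) * `|(e *: x+y)-y|).
 rewrite (_ : (fun x=> _) = (fun x=> (e^+m)^-1*(e*(rphi K e T0 x * `|x|)))); last exact/funext.
 by apply: ItgZ; exact: ItgZ.
have [A1 B1] := Int_affine e0 (cont_meas cph) p0 J1.
have [A2 B2] := @Int_affine _ e y (fun z=> phik K e T0 (z-y) * `|z-y|) e0 (cont_meas (contM cph cn)) (fun z=> mulr_ge0 (p0 z) (normr_ge0 _)) J2.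
split=> //.
 rewrite B1 (eq_Int E) IntZ // mulrA mulfV // mul1r /kap -IntZ //.
 by apply: Int_le=> //; [exact: ItgZ|move=> x; have /andP[] := rb x].
rewrite B2 (eq_Int E2) !IntZ //; last exact: ItgZ.
rewrite mulrA mulfV // mul1r mulrC ler_wpM2r ?(ltW e0) //.
apply: le_trans (kap_le L1 pT).2; apply: Int_le=> // x.
have /andP[h0 h1] := rb x; rewrite ler_pM ?lerDr //.
by apply: le_trans h1 _; rewrite ler_piMl ?bt_le1 //; exact: (rq_dom x L1 pT).1.
Qed.
End Kappa.

(** * From weak to almost everywhere inequalities *)

Section Approx.
Variables (R : realType) (m : nat).
Notation V := 'rV[R]_m.

Definition tent (c : V) (r : R) (x : V) : R := (`|r - `|c-x| | + (r - `|c-x|))/2.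

Lemma cont_tent c r : continuous (tent c r).
Proof.
have cu : continuous (fun x : V=> r - `|c-x|).
 apply: (@contB _ _ (fun x : V=> r)); first by move=> x; exact: cst_continuous.
 move=> x; apply: (@continuous_comp _ _ _ (fun x : V=> c-x) (fun x : V=> `|x|)); last exact: norm_continuous.
 by apply: continuousB; [exact: cst_continuous|exact: cvg_id].
apply: (@contM _ _ (fun x : V=> `|r - `|c-x| | + (r - `|c-x|)) (fun _=> 2^-1)); last first.
 by move=> x; exact: cst_continuous.
apply: contD=> // x.
by apply: (@continuous_comp _ _ _ (fun x : V=> r - `|c-x|) (fun t : R=> `|t|)); [exact: cu|exact: norm_continuous].
Qed.

Lemma tent_in c r x : `|c-x| <= r -> tent c r x = r - `|c-x|.
Proof. by move=> h; rewrite /tent ger0_norm ?subr_ge0 //; field. Qed.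

Lemma tent_out c r x : r <= `|c-x| -> tent c r x = 0.
Proof. by move=> h; rewrite /tent ler0_norm ?subr_le0 // addNr mul0r. Qed.

Lemma tent_bnd c r x : 0 <= r -> 0 <= tent c r x <= r.
Proof.
move=> r0; have [h|h] := leP `|c-x| r; first by rewrite tent_in // subr_ge0 h /= gerBl.
by rewrite tent_out ?lexx //; exact: ltW.
Qed.

Lemma harm_cvg (t : R) : 0 <= t ->
 (j.+1%:R*t)/(1+j.+1%:R*t) @[j --> \oo] --> (if 0 < t then 1 else 0 : R).
Proof.
move=> t0; case: ltP=> [tp|tn]; last first.
 have -> : t = 0 by apply/eqP; rewrite eq_le tn.
 by rewrite (_ : (fun j=> _) = (fun=> 0)); [exact: cvg_cst|apply/funext=> j; rewrite mulr0 mul0r].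
have E : (fun j=> (j.+1%:R*t)/(1+j.+1%:R*t)) = (fun j=> t/(j.+1%:R^-1+t)).
 apply/funext=> j; have j0 : j.+1%:R != 0 :> R by [].
 have a0 : 1+j.+1%:R*t != 0 by rewrite gt_eqF // ltr_wpDr // mulr_ge0.
 have b0 : j.+1%:R^-1+t != 0 by rewrite gt_eqF // ltr_wpDl //.
 apply/eqP; rewrite eqr_div //; apply/eqP.
 by rewrite mulrDr mulrAC mulfV // mul1r; ring.
rewrite E -[X in _ --> X](_ : t/(0+t) = 1); last by rewrite add0r divff // gt_eqF.
apply: cvgM; first exact: cvg_cst.
apply: cvgV; first lra.
apply: cvgD; last exact: cvg_cst.
exact: cvg_harmonic.
Qed.

Section L1.
Variable w : V -> R.
Hypotheses (w0 : forall x, 0 <= w x) (Iw : Itg w).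

(** Approximability of the indicator in L^1(w) by continuous functions with values in [0,1]. Such
    sets form a sigma-algebra containing the cubes, hence comprise all Borel sets; this stands for
    regularity of the measure w dx. *)
Definition apx (A : set V) := measurable A /\ forall d, 0 < d -> exists g : V -> R,
 [/\ continuous g, (forall x, 0 <= g x <= 1) & Int (fun x=> `|\1_A x-g x|*w x) <= d].

Lemma apx_itg (A : set V) (g : V -> R) : measurable A -> measT g -> (forall x, 0 <= g x <= 1) ->
 Itg (fun x=> `|\1_A x-g x|*w x).
Proof.
move=> mA cg g01; apply: (@Itg_le _ _ _ w)=> //.
 apply: measurable_funM; last exact: Itg_meas.
 apply: measT_comp; first exact: normr_measurable.
 by apply: measurable_funB=> //; exact: measurable_indic.
move=> x; rewrite normrM normr_id (ger0_norm (w0 x)) ler_piMl //.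
have /andP[h1 h2] := g01 x; rewrite indicE; case: (_ \in _)=> /=; rewrite ler_norml; lra.
Qed.

Lemma apx_cvg (A : set V) (g : nat -> V -> R) : measurable A -> (forall j, measT (g j)) ->
 (forall j x, 0 <= g j x <= 1) -> (forall x, g j x @[j --> \oo] --> (\1_A x : R)) ->
 forall d, 0 < d -> exists j, Int (fun x=> `|\1_A x-g j x|*w x) <= d.
Proof.
move=> mA mg g01 gA d d0.
have mf j : measT (fun x=> `|\1_A x-g j x|*w x) by apply: Itg_meas; exact: apx_itg.
have hb j x : `| `|\1_A x-g j x|*w x| <= w x.
 rewrite normrM normr_id (ger0_norm (w0 x)) ler_piMl //.
 have /andP[h1 h2] := g01 j x; rewrite indicE; case: (_ \in _)=> /=; rewrite ler_norml; lra.
have hae : AE x, `|\1_A x-g j x|*w x @[j --> \oo] --> (0 : R).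
 apply: aeW=> x; rewrite -[X in _ --> X](mul0r (w x)); apply: cvgM; last exact: cvg_cst.
 rewrite -[X in _ --> X](_ : `|(\1_A x : R) - \1_A x| = 0); last by rewrite subrr normr0.
 by apply: cvg_norm; apply: cvgB; [exact: cvg_cst|exact: gA].
have := proj2 (@Int_dct _ _ (fun j x=> `|\1_A x-g j x|*w x) (fun=> 0) w mf Iw hb hae (measurable_cst _)).
rewrite Int0.
move=> /cvgrPdist_le /(_ d d0) [N _ /(_ N (leqnn N))] /=.
rewrite sub0r normrN=> h; exists N; exact: le_trans (ler_norm _) h.
Qed.

Lemma apx_ball c r : apx (ball c r).
Proof.
have mA : measurable (ball c r) by apply: open_meas; exact: ball_open.
split=> // d d0.
pose g j (x : V) : R := (j.+1%:R*tent c r x)/(1+j.+1%:R*tent c r x).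
have [r0|r0] := leP r 0.
 exists (fun=> 0); split=> [x|x|]; [exact: cst_continuous|lra|].
 rewrite (_ : Int _ = 0) ?ltW // -[RHS](@Int0 R m); apply: eq_Int=> x.
 rewrite indicE memNset ?subrr ?normr0 ?mul0r // => /ballP h.
 by have := normr_ge0 (c-x); lra.
have t0 x : 0 <= tent c r x by have /andP[] := tent_bnd c x (ltW r0).
have g01 j x : 0 <= g j x <= 1.
 have p : 0 <= j.+1%:R*tent c r x by rewrite mulr_ge0.
 by rewrite divr_ge0 ?addr_ge0 //= ler_pdivrMr ?mul1r ?lerDr // ltr_wpDr.
have cg j : continuous (g j).
 have c1 : continuous (fun x=> j.+1%:R*tent c r x).
 by apply: (@contM _ _ (fun x : V=> j.+1%:R)); [move=> x; exact: cst_continuous|exact: cont_tent].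
 apply: contM=> //; apply: contV; first by apply: (@contD _ _ (fun x : V=> 1))=> // x; exact: cst_continuous.
 by move=> x; rewrite gt_eqF // ltr_wpDr // mulr_ge0.
have [||j hj] := @apx_cvg (ball c r) g mA _ g01 _ d d0; last by exists (g j).
 by move=> j; exact: cont_meas.
move=> x; have := harm_cvg (t0 x).
suff -> : (if 0 < tent c r x then 1 else 0 : R) = \1_(ball c r) x by [].
rewrite indicE.
have [h|h] := ltP `|c-x| r.
 by rewrite mem_set ?tent_in ?subr_gt0 ?h //; [exact: ltW|exact/ballP].
by rewrite memNset ?tent_out ?ltxx // => /ballP; rewrite ltNge h.
Qed.

Lemma apx_setC A : apx A -> apx (~` A).
Proof.
move=> [mA hA]; split; first exact: measurableC.
move=> d /hA[g [cg g01 hg]]; exists (fun x=> 1-g x); split.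
- by apply: (@contB _ _ (fun x : V=> 1))=> // x; exact: cst_continuous.
- by move=> x; have := g01 x; lra.
- apply: le_trans hg; rewrite le_eqVlt; apply/orP; left; apply/eqP; apply: eq_Int=> x.
 congr (_*_); rewrite -normrN; congr `|_|; rewrite !indicE in_setC.
 by case: (_ \in _)=> /=; ring.
Qed.

Lemma apx_set0 : apx set0.
Proof.
split=> // d d0; exists (fun=> 0); split=> [x|x|]; [exact: cst_continuous|lra|].
rewrite (_ : Int _ = 0) ?ltW // -[RHS](@Int0 R m); apply: eq_Int=> x.
by rewrite indicE in_set0 subrr normr0 mul0r.
Qed.

Lemma apx_setU A B : apx A -> apx B -> apx (A `|` B).
Proof.
move=> [mA hA] [mB hB]; split; first exact: measurableU.
move=> d d0; have d2 : 0 < d/2 by lra.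
have [g [cg g01 hg]] := hA _ d2; have [g' [cg' g'01 hg']] := hB _ d2.
exists (fun x=> g x+g' x-g x*g' x); split.
- by apply: contB; [exact: contD|exact: contM].
- move=> x; have /andP[a1 a2] := g01 x; have /andP[b1 b2] := g'01 x.
 have : 0 <= (1-g x)*(1-g' x) by rewrite mulr_ge0 // subr_ge0.
 have : 0 <= g x*(1-g' x) by rewrite mulr_ge0 // subr_ge0.
 by lra.
have IA := apx_itg mA (cont_meas cg) g01; have IB := apx_itg mB (cont_meas cg') g'01.
apply: (@le_trans _ _ (Int (fun x=> `|\1_A x-g x|*w x)+Int (fun x=> `|\1_B x-g' x|*w x))); last by lra.
rewrite -IntD //.
have h x : `|\1_(A `|` B) x-(g x+g' x-g x*g' x)|*w x <= `|\1_A x-g x|*w x + `|\1_B x-g' x|*w x.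
 rewrite -mulrDl ler_wpM2r //.
 have /andP[a1 a2] := g01 x; have /andP[b1 b2] := g'01 x.
 have -> : \1_(A `|` B) x-(g x+g' x-g x*g' x) = (\1_A x-g x)*(1 - \1_B x)+(1-g x)*(\1_B x-g' x) :> R.
 by rewrite !indicE in_setU; case: (x \in A); case: (x \in B)=> /=; ring.
 apply: le_trans (ler_normD _ _) _; rewrite !normrM; apply: lerD.
 by rewrite ler_piMr // indicE; case: (_ \in _); rewrite ?subrr ?subr0 ?normr0 ?normr1.
 by rewrite ler_piMl // ler_norml; lra.
apply: Int_le=> //; last exact: ItgD.
apply: (@Itg_le _ _ _ (fun x=> `|\1_A x-g x|*w x + `|\1_B x-g' x|*w x)); last first.
- by move=> x; rewrite ger0_norm ?mulr_ge0.
- exact: ItgD.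
apply: measurable_funM; last exact: Itg_meas.
apply: measT_comp; first exact: normr_measurable.
apply: measurable_funB; first by apply: measurable_indic; exact: measurableU.
by apply: cont_meas; apply: contB; [exact: contD|exact: contM].
Qed.

Lemma apx_bigcup (A : nat -> set V) : (forall k, apx (A k)) -> apx (\bigcup_k A k).
Proof.
move=> hA; have mA k : measurable (A k) by have [] := hA k.
have mU : measurable (\bigcup_k A k) by exact: bigcup_measurable.
split=> // d d0; pose B N := \big[setU/set0]_(k < N) A k.
have aB N : apx (B N).
 elim: N=> [|N IH]; first by rewrite /B big_ord0; exact: apx_set0.
 by rewrite /B big_ord_recr; exact: apx_setU.
have d2 : 0 < d/2 by lra.
have mB N : measurable (B N) by have [] := aB N.
have i01 N x : 0 <= (\1_(B N) x : R) <= 1 by rewrite indicE; case: (_ \in _); rewrite ?lexx ?ler01.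
have mi N : measT (\1_(B N) : V -> R) by [].
have [|N hN] := @apx_cvg _ (fun N x=> \1_(B N) x) mU mi i01 _ _ d2.
 move=> x; rewrite indicE; case: (boolP (x \in _))=> [|]; rewrite ?inE ?notin_setE /=.
 move=> [k _ Akx]; apply: cvg_near_cst; exists k.+1=> // N /= kN.
 rewrite indicE mem_set //; rewrite /B -bigcup_mkord; exists k=> //.
 move=> nx; rewrite (_ : (fun N=> _) = (fun=> 0)); first exact: cvg_cst.
 apply/funext=> N; rewrite indicE memNset // /B -bigcup_mkord=> -[k _ Akx].
 by apply: nx; exists k.
have [_ /(_ _ d2)[g [cg g01 hg]]] := aB N; exists g; split=> //.
have mg := cont_meas cg.
have I1 := apx_itg mU (mi N) (i01 N); have I2 := apx_itg (mB N) mg g01.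
apply: (@le_trans _ _ (Int (fun x=> `|\1_(\bigcup_k A k) x - \1_(B N) x|*w x)+Int (fun x=> `|\1_(B N) x-g x|*w x))); last by lra.
rewrite -IntD //; apply: Int_le; [exact: apx_itg|exact: ItgD|].
by move=> x; rewrite -mulrDl ler_wpM2r // ler_distD.
Qed.

Lemma apx_all (A : set V) : measurable A -> apx A.
Proof.
have sub : <<s @opens R m >> `<=` apx; last by move=> mA; exact: sub.
apply: smallest_sub.
 split; first exact: apx_set0.
 by move=> B aB; rewrite setTD; exact: apx_setC.
 exact: apx_bigcup.
move=> U oU; rewrite (open_ratcubes oU).
rewrite (_ : \bigcup_(k in _) _ = \bigcup_k (if `[< @ratcube R m k `<=` U >] then @ratcube R m k else set0)); last first.
 apply/seteqP; split=> x [k]; rewrite /=.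
 by move=> kU xk; exists k=> //; rewrite (asboolT kU).
 by move=> _; case: asboolP=> // kU xk; exists k.
apply: apx_bigcup=> k; case: asboolP=> _; last exact: apx_set0.
by rewrite /ratcube; case: unpickle=> [[c r]|]; [exact: apx_ball|exact: apx_set0].
Qed.
End L1.

(** Approximate the indicator of the set h < 0 by continuous weights in L^1(|h|): the integral of h
    over that set is then nonnegative, so the set is null. *)
Lemma ae_ge0_of_cont (h : V -> R) : Itg h ->
 (forall g : V -> R, continuous g -> (forall x, 0 <= g x <= 1) -> 0 <= Int (fun x=> g x*h x)) ->
 AE x, 0 <= h x.
Proof.
move=> Ih H; pose A : set V := [set x | h x < 0].
have mh := Itg_meas Ih.
have mA : measurable A.
 rewrite (_ : A = [set: V] `&` h @^-1` [set` `]-oo, 0[]); last first.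
 by apply/seteqP; split=> x /=; rewrite in_itv /=; [move=> ?; split|case].
 by apply: mh=> //; exact: measurable_itv.
have I1 : Itg (fun x=> \1_A x*h x).
 apply: (@Itg_le _ _ _ (fun x=> `|h x|)); last 2 first.
 - exact: Itg_abs.
 - by move=> x; rewrite normrM ler_piMl // indicE; case: (_ \in _); rewrite ?normr1 ?normr0.
 by apply: measurable_funM=> //; exact: measurable_indic.
have P : 0 <= Int (fun x=> \1_A x*h x).
 rewrite leNgt; apply/negP=> neg.
 have d0 : 0 < - Int (fun x=> \1_A x*h x)/2 by lra.
 have [_ /(_ _ d0)[g [cg g01 hg]]] := @apx_all (fun x=> `|h x|) (fun x=> normr_ge0 _) (Itg_abs Ih) A mA.
 have mg := cont_meas cg.
 have I2 := apx_itg (fun x=> normr_ge0 (h x)) (Itg_abs Ih) mA mg g01.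
 have I3 : Itg (fun x=> g x*h x).
 apply: (@Itg_le _ _ _ (fun x=> `|h x|)); [exact: measurable_funM|exact: Itg_abs|].
 by move=> x; have /andP[a b] := g01 x; rewrite normrM ler_piMl // ger0_norm.
 have := H g cg g01.
 have : Int (fun x=> g x*h x) <= Int (fun x=> \1_A x*h x + `|\1_A x-g x| * `|h x|).
 apply: Int_le=> //; first exact: ItgD.
 move=> x; rewrite -lerBlDl -mulrBl; apply: le_trans (ler_norm _) _.
 by rewrite normrM distrC.
 by rewrite IntD //; lra.
have neg x : \1_A x*h x <= 0.
 rewrite indicE; case: (boolP (x \in A))=> [|_]; rewrite ?mul0r // inE /A /= => hx.
 lra.
have Z : (\int[lebn R m]_(x in setT) `|(\1_A x*h x)%:E| = 0)%E.
 have -> : (\int[lebn R m]_(x in setT) `|(\1_A x*h x)%:E| = \int[lebn R m]_x ((- (\1_A x*h x))%:E))%E.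
 by apply: eq_integral=> x _; rewrite -abseN /= ger0_norm // oppr_ge0.
 have I4 : Itg (fun x=> - (\1_A x*h x)).
 by rewrite (_ : (fun x=> _) = (fun x=> (-1)*(\1_A x*h x))); [exact: ItgZ|apply/funext=> x; rewrite mulN1r].
 rewrite Int_EFin //; congr EFin; apply/eqP; rewrite eq_le; apply/andP; split; last first.
 by apply: Int_ge0=> x; rewrite oppr_ge0.
 rewrite (eq_Int (g := fun x=> (-1)*(\1_A x*h x))); last by move=> x; rewrite mulN1r.
 by rewrite IntZ // mulN1r oppr_le0.
have mAh : measurable_fun [set: V] (EFin \o (fun x=> \1_A x*h x)) by apply/EFinP; exact: Itg_meas.
have /(ae_eq_integral_abs (lebn R m) measurableT mAh) := Z.
move=> [N [mN N0 sub]]; exists N; split=> // x /= nx; apply: sub=> /= hx; apply: nx.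
have := hx I; rewrite indicE; case: (boolP (x \in A)); rewrite ?inE ?notin_setE /A /=.
 by move=> hl [] /eqP; rewrite mul1r=> /eqP ->.
lra.
Qed.
End Approx.

(** * Smooth cutoffs and kernels under the integral sign *)

Section Cutoff.
Variable R : realType.

Definition Cb k (c : 'rV[R]_k) (r : R) : set 'rV[R]_k := [set p | `|c-p| <= r].

Lemma psm_prod (V : normedModType R) (E O : set V) (X : topologicalType) (J : Type) (s : seq J) (F : J -> X -> V -> R) :
 (forall j, psm E O (F j)) -> psm E O (fun x p=> \prod_(j <- s) F j x p).
Proof.
move=> pF; elim: s=> [|j s IH].
 rewrite (_ : (fun x p=> _) = (fun _ _=> 1)); first exact: psm_cst.
 by apply/funext=> x; apply/funext=> p; rewrite big_nil.
rewrite (_ : (fun x p=> _) = (fun x p=> F j x p*\prod_(j <- s) F j x p)); first exact: psm_mul.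
by apply/funext=> x; apply/funext=> p; rewrite big_cons.
Qed.

(** Equal to 1 for u <= 1 and to 0 for u >= 4; with u the square of a coordinate over r^2 this is
    the passage from r to 2r. The cutoff is a product over coordinates because the sup norm is not
    smooth. *)
Definition chi (u : R) : R := bt 0 (4-u)*(bt 0 (4-u)+bt 0 (u-1)) ^- 1.
Definition cutoff k (c : 'rV[R]_k) (r : R) (y : 'rV[R]_k) : R :=
 \prod_i chi ((y 0 i-c 0 i)^+2/r^+2).

Lemma bt_gt0 (t : R) : 0 < t -> 0 < bt 0 t.
Proof. by move=> t0; rewrite /bt t0 invr1 mul1r expR_gt0. Qed.

Lemma chi_den (u : R) : 0 < bt 0 (4-u)+bt 0 (u-1).
Proof.
have [h|h] := ltP u 4; first by rewrite ltr_pwDl ?bt_ge0 // bt_gt0 // subr_gt0.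
by rewrite ltr_wpDl ?bt_ge0 // bt_gt0; lra.
Qed.

Lemma chi_bnd u : 0 <= chi u <= 1.
Proof.
have d := chi_den u; rewrite /chi expr1 divr_ge0 ?bt_ge0 ?(ltW d) //=.
by rewrite ler_pdivrMr // mul1r lerDl bt_ge0.
Qed.

Lemma cutoff_bnd k (c : 'rV[R]_k) r y : 0 <= cutoff c r y <= 1.
Proof.
rewrite /cutoff prodr_ge0 /=; last by move=> i _; have /andP[] := chi_bnd ((y 0 i-c 0 i)^+2/r^+2).
by apply: prodr_ile1=> i _; exact: chi_bnd.
Qed.

Lemma cutoff1 k (c : 'rV[R]_k) r y : 0 < r -> `|c-y| <= r -> cutoff c r y = 1.
Proof.
move=> r0 h; rewrite /cutoff big1 // => i _.
have hi : `|y 0 i-c 0 i| <= r by have := coord_norm (c-y) i; rewrite !mxE distrC=> h1; apply: le_trans h.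
have u1 : (y 0 i-c 0 i)^+2/r^+2 <= 1.
 by rewrite ler_pdivrMr ?exprn_gt0 // mul1r -real_normK ?num_real // lerXn2r ?nnegrE // ltW.
rewrite /chi (bt_neg 0 (_ : _-1 <= 0)) ?subr_le0 // addr0 expr1 divff // gt_eqF // bt_gt0 //.
by lra.
Qed.

Lemma cutoff0 k (c : 'rV[R]_k) r y : 0 < r -> 2*r <= `|c-y| -> cutoff c r y = 0.
Proof.
move=> r0 h.
have [i hi] : exists i, 2*r <= `|c 0 i-y 0 i|.
 apply: contrapT=> hn; have : ball c (2*r) y.
 apply/ball_rVE; first pos.
 by move=> i; rewrite ltNge; apply/negP=> hi; apply: hn; exists i.
 by move=> /ballP; rewrite ltNge h.
have u4 : 4 <= (y 0 i-c 0 i)^+2/r^+2.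
 rewrite ler_pdivlMr ?exprn_gt0 // -(real_normK (num_real (y 0 i-c 0 i))) distrC.
 rewrite (_ : 4*r^+2 = (2*r)^+2); last by ring.
 by rewrite lerXn2r ?nnegrE // mulr_ge0 // ltW.
by rewrite /cutoff (bigD1 i) //= /chi (bt_neg 0 (_ : 4-_ <= 0)) ?subr_le0 // mul0r mul0r.
Qed.

Lemma psmv_cutoff k (X : topologicalType) (c : 'rV[R]_k) r : psmv (fun _ : X=> cutoff c r).
Proof.
apply: (@psm_prod _ _ _ X _ _ (fun i _ (y : 'rV[R]_k)=> chi ((y 0 i-c 0 i)^+2/r^+2)))=> i.
have pu : psmv (fun (_ : X) (y : 'rV[R]_k)=> (y 0 i-c 0 i)^+2/r^+2).
 have pc : psmv (fun (_ : X) (y : 'rV[R]_k)=> y 0 i-c 0 i).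
 by apply: psm_sub; [exact: psmv_coord|exact: psm_cst].
 rewrite (_ : (fun _ _=> _) = (fun (_ : X) (y : 'rV[R]_k)=> (y 0 i-c 0 i)*(y 0 i-c 0 i)*(r^+2)^-1)) //.
 by apply: psm_mul; [exact: psm_mul|exact: psm_cst].
have p1 : psmv (fun (_ : X) (y : 'rV[R]_k)=> bt 0 (4-(y 0 i-c 0 i)^+2/r^+2)).
 apply: (@psm_comp _ _ _ _ _ setT (bt 0) _ (@smooth1_bt R 0))=> //.
 by apply: psm_sub=> //; exact: psm_cst.
apply: psm_mul=> //.
apply: (@psm_comp _ _ _ _ _ (@pos R) (fun t : R=> t ^- 1) _ (@smooth1_invn R 1)).
 apply: psm_add=> //; apply: (@psm_comp _ _ _ _ _ setT (bt 0) _ (@smooth1_bt R 0))=> //.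
 by apply: psm_sub=> //; exact: psm_cst.
by move=> x y _; exact: chi_den.
Qed.

Lemma smooth_cutoff n (c : pt R n) r : smooth (cutoff c r).
Proof. exact: (@psmv_smooth _ _ R^o (fun _=> cutoff c r) 0 (psmv_cutoff _ c r)). Qed.

Lemma supp_cutoff k (c : 'rV[R]_k) r : 0 < r -> supp (Cb c (2*r)) (cutoff c r).
Proof. by move=> r0 p /negP; rewrite -ltNge=> /ltW; exact: cutoff0. Qed.

Lemma lebn_point m (y : 'rV[R]_m) : (0 < m)%N -> lebn R m [set y] = 0%E.
Proof.
move=> m0; have my : measurable [set y].
 rewrite (_ : [set y] = \bigcap_k ball y k.+1%:R^-1).
 by apply: bigcap_measurable=> // k _; apply: open_meas; exact: ball_open.
 apply/seteqP; split=> [x -> k _|x hx]; first by apply: ballxx; rewrite invr_gt0.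
 apply/eqP; rewrite eq_sym -subr_eq0 -normr_le0 leNgt; apply/negP=> p.
 have h := archi_boundP (ltW (_ : 0 < `|y-x|^-1)); rewrite invr_gt0 in h.
 have {}h := h p; have := hx (Num.bound `|y-x|^-1) I=> /ballP; rewrite ltNge=> /negP; apply.
 rewrite invf_ple ?posrE // (le_trans (ltW h)) // ler_nat //.
apply/eqP; rewrite -measure_le0; apply/lee_addgt0Pr=> e e0; rewrite add0e.
pose r := Num.min 1 (e/2^+m); have r0 : 0 < r by rewrite lt_min ltr01 divr_gt0 //.
apply: (@le_trans _ _ (lebn R m (ball y r))).
 apply: le_measure; rewrite ?inE //; first by apply: open_meas; exact: ball_open.
 by move=> x ->; exact: ballxx.
rewrite [leLHS](lebn_ball y r0) lee_fin exprMn.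
have r1 : r <= 1 by rewrite ge_min lexx.
have r2 : r <= e/2^+m by rewrite ge_min lexx orbT.
rewrite mulrC -ler_pdivlMr ?exprn_gt0 //; apply: le_trans r2.
by rewrite -(prednK m0) exprS ler_piMr ?(ltW r0) // exprn_ile1 // ltW.
Qed.

Lemma Int_off_point m (y : 'rV[R]_m) (f g : 'rV[R]_m -> R) : (0 < m)%N -> measT f ->
 measT g -> (forall x, x != y -> f x = g x) -> Int f = Int g.
Proof.
move=> m0 mf mg h; rewrite /Int /Rintegral; congr fine; apply: ae_eq_integral=> //.
- exact/EFinP.
- exact/EFinP.
exists [set y]; split; [|exact: lebn_point|].
 rewrite (_ : [set y] = ~` (~` [set y])); last by rewrite setCK.
 apply: measurableC; apply: open_meas; apply: closed_openC.
 exact: (@accessible_closed_set1 _ (hausdorff_accessible (@norm_hausdorff _ _))).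
move=> x /= hx; apply: contrapT=> xy; apply: hx=> _.
by rewrite h //; apply/eqP.
Qed.

Lemma fub_bound m k (F : 'rV[R]_m*'rV[R]_k -> R) (a : 'rV[R]_m -> R) : measT F -> Itg a ->
 (forall x, Itg (fun y=> F (x, y)) /\ Int (fun y=> `|F (x, y)|) <= a x) ->
 (\int[lebn R m]_x \int[lebn R k]_y (`|F (x, y)|)%:E < +oo)%E.
Proof.
move=> mF Ia h.
apply: (@le_lt_trans _ _ (\int[lebn R m]_x (a x)%:E)%E); last by rewrite Int_EFin // ltry.
have E x : (\int[lebn R k]_y (`|F (x, y)|)%:E = (Int (fun y=> `|F (x, y)|))%:E)%E.
 by rewrite Int_EFin //; apply: Itg_abs; have [] := h x.
apply: ge0_le_integral=> //.
- by move=> x _; apply: integral_ge0=> y _; rewrite lee_fin.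
- apply: (@measurable_int2 R _ _ _ _ (lebn R k) (fun q=> (`|F q|)%:E)).
 by apply/EFinP; apply: measT_comp=> //; exact: normr_measurable.
- by apply/EFinP; exact: Itg_meas.
- by move=> x _; rewrite E lee_fin; have [] := h x.
Qed.

Lemma LS_int n (S : pt R n -> 'M[R]_(n+n)) k (g : 'rV[R]_k -> R) (r : R) (xi : 'rV[R]_k -> pt R n -> R) y :
 Itg g -> (forall z, r <= `|z| -> g z = 0) -> psmv xi ->
 LS S (fun y=> Int (fun z=> g z*xi z y)) y = Int (fun z=> g z*LS S (xi z) y).
Proof.
move=> Ig g0 px.
have E i j : pd i (pd j (fun y=> Int (fun z=> g z*xi z y))) y = Int (fun z=> g z * pd i (pd j (xi z)) y).
 have [px' _] := psmv_pd j px.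
 by rewrite (pd_int j Ig g0 px) (pd_int i Ig g0 px').
have I2 i j : Itg (fun z=> g z * pd i (pd j (xi z)) y).
 have [px' _] := psmv_pd j px; have [px'' _] := psmv_pd i px'.
 exact: (Itg_param Ig g0 y px'').
rewrite /LS (eq_Int (g := fun z=> \sum_i \sum_j S y i j*(g z * pd i (pd j (xi z)) y))); last first.
 move=> z; rewrite mulr_sumr; apply: eq_bigr=> i _; rewrite mulr_sumr; apply: eq_bigr=> j _.
 lra.
rewrite Int_sum; last by move=> i; apply: Itg_sum=> j; exact: ItgZ.
apply: eq_bigr=> i _; rewrite Int_sum; last by move=> j; exact: ItgZ.
by apply: eq_bigr=> j _; rewrite IntZ // E.
Qed.
End Cutoff.
Section NonItg.
Variables (R : realType) (m : nat).
Lemma Int_nitg (f : 'rV[R]_m -> R) : measT f -> ~ Itg f -> Int f = 0.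
Proof.
move=> mf nf; rewrite /Int /Rintegral; have [h|] := boolP ((\int[lebn R m]_x (f x)%:E)%E \is a fin_num); last first.
 by case: ((\int[lebn R m]_x (f x)%:E)%E).
exfalso; apply: nf; apply/ItgP; split=> //.
have mE : measT (EFin \o f) by exact/EFinP.
by apply/(abse_integralP _ measurableT mE); rewrite -ge0_fin_numE // abse_fin_num.
Qed.

Lemma Int_scale_ne c (f : 'rV[R]_m -> R) : c != 0 -> measT f -> Int (fun x=> c*f x) = c*Int f.
Proof.
move=> c0 mf; have [h|h] := pselect (Itg f); first exact: IntZ.
rewrite (Int_nitg mf h) mulr0 Int_nitg //; first by apply: measurable_funM.
move=> /(ItgZ c^-1) h'; apply: h; move: h'; rewrite (_ : (fun x=> _) = f) //.
by apply/funext=> x; rewrite mulrA mulVf // mul1r.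
Qed.

Lemma Itg_scaler c (h : 'rV[R]_m -> R) : Itg h -> Itg (fun y=> h y*c).
Proof. by move=> /(ItgZ c); rewrite (_ : (fun x=> _) = (fun y=> h y*c)) //; apply/funext=> y; rewrite mulrC. Qed.

Lemma fub_ae m' k (F : 'rV[R]_m'*'rV[R]_k -> R) : measT F ->
 (\int[lebn R m']_x \int[lebn R k]_y (`|F (x, y)|)%:E < +oo)%E ->
 {ae lebn R k, forall y, Itg (fun x=> F (x, y))}.
Proof.
move=> mF hF.
have mF' : measT (EFin \o F) by exact/EFinP.
have iF : (lebn R m' \x lebn R k)%E.-integrable setT (EFin \o F).
 exact/(integrable12ltyP _ _ mF').
by case: (ae_integrable2 iF)=> N [mN N0 sub]; exists N; split=> // x /= hx; apply: sub=> /= H; apply: hx.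
Qed.

(** The integral in [y] may diverge for exceptional z, where [Int] is 0. [Int] commutes with nonzero
    factors even then, and for g z = 0 both sides vanish, so the exchange holds without
    exception. *)
Lemma fub_kernel (f g : 'rV[R]_m -> R) (P : 'rV[R]_m -> 'rV[R]_m -> R) (B : R) : Itg f -> measT g ->
 measT (fun q : 'rV[R]_m*'rV[R]_m=> P q.1 q.2) ->
 (forall y, Itg (fun z=> g z*P z y) /\ Int (fun z=> `|g z*P z y|) <= B) ->
 [/\ Itg (fun y=> f y*Int (fun z=> g z*P z y)),
 Itg (fun z=> g z*Int (fun y=> f y*P z y)),
 Int (fun y=> f y*Int (fun z=> g z*P z y)) = Int (fun z=> g z*Int (fun y=> f y*P z y)) &
 (AE z, g z != 0 -> Itg (fun y=> f y*P z y))].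
Proof.
move=> If mg mP gP.
pose F (q : 'rV[R]_m*'rV[R]_m) : R := f q.1*(g q.2*P q.2 q.1).
have mf := Itg_meas If.
have mF : measT F.
 apply: measurable_funM; first exact: (measT_comp mf measurable_fst).
 apply: measurable_funM; first exact: (measT_comp mg measurable_snd).
 exact: (measT_comp mP (measurable_fun_pair measurable_snd measurable_fst)).
have B1 y : Itg (fun z=> F (y, z)) /\ Int (fun z=> `|F (y, z)|) <= `|f y|*B.
 have [i1 i3] := gP y.
 split; first exact: (ItgZ (f y) i1).
 rewrite (eq_Int (g := fun z=> `|f y| * `|g z*P z y|)); last by move=> z; rewrite normrM.
 by rewrite (IntZ _ (Itg_abs i1)) ler_wpM2l.
have bF := fub_bound mF (Itg_scaler B (Itg_abs If)) B1.
have [J1 J2 J3] := Int_fubini mF bF.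
have E1 y : Int (fun z=> F (y, z)) = f y*Int (fun z=> g z*P z y).
 by have [i1 _] := gP y; exact: (IntZ (f y) i1).
have E2 z : Int (fun y=> F (y, z)) = g z*Int (fun y=> f y*P z y).
 rewrite /F /=; have [->|g0] := eqVneq (g z) 0.
 by rewrite mul0r -[RHS](@Int0 R m); apply: eq_Int=> y; rewrite mul0r mulr0.
 have mP' : measT (fun y=> f y*P z y).
 by apply: (measurable_funM mf); exact: (measT_comp mP (measurable_pair1 z)).
 rewrite -(Int_scale_ne g0 mP').
 by apply: eq_Int=> y; rewrite mulrCA.
have e1 : (fun y=> Int (fun z=> F (y, z))) = (fun y=> f y*Int (fun z=> g z*P z y)).
 by apply/funext=> y; exact: E1.
have e2 : (fun z=> Int (fun y=> F (y, z))) = (fun z=> g z*Int (fun y=> f y*P z y)).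
 by apply/funext=> z; exact: E2.
split; [by rewrite -e1|by rewrite -e2|by rewrite -e1 -e2|].
have := fub_ae mF bF; apply: filterS=> z Iz g0.
have := ItgZ (g z)^-1 Iz; rewrite (_ : (fun y=> _) = (fun y=> f y*P z y)) //.
by apply/funext=> y; rewrite /F /= mulrCA (mulrA (g z)^-1) mulVf // mul1r.
Qed.

Lemma ratio_cvg (z : 'rV[R]_m) (u k : 'rV[R]_m -> R) (l : R) : u @ z --> (1 : R) ->
 (forall z', l/u z' <= k z' <= u z' * l) -> k @ z --> l.
Proof.
move=> cu h; have nr : \forall z' \near z, l/u z' <= k z' <= u z' * l.
 by apply: (filterS _ (@filterT _ (nbhs z) _))=> z' _; exact: h.
refine (squeeze_cvgr nr _ _).
- rewrite -[X in _ --> X](_ : l/1 = l); last lra.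
 by apply: cvgM; [exact: cvg_cst|apply: cvgV; [rewrite oner_eq0|exact: cu]].
- rewrite -[X in _ --> X](mul1r l).
 by apply: cvgM; [exact: cu|exact: cvg_cst].
Qed.
End NonItg.

(** * Potentials averaged over the pole *)

Section Weak.
Variables (R : realType) (n : nat) (n0 : (0 < n)%N).
Notation m := (n+n)%N.
Notation V := (pt R n).
Variables (S T : V -> 'M[R]_m) (L : R) (G : gell S T L) (K rho : R) (c : V) (f : V -> R) (KK : K0 n L <= K) (rho0 : 0 < rho) (LK : L/K <= rho) (If : Itg f).

Let Kp : 0 < K. Proof. by apply: lt_le_trans KK; apply: lt_le_trans ltr01 (K0_ge n0 G).2. Qed.
Let Lp : 0 < L. Proof. exact: lt_le_trans ltr01 (ge_L G). Qed.
Let LK0 : 0 < L/K. Proof. exact: divr_gt0. Qed.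
Let mp := m_gt0 n0.

Lemma hk0 e z y : L/K <= `|y-z| -> hk K e (T z) z y = 0.
Proof.
move=> h; have := sk_big n0 G KK e h; rewrite /hk -/(sk T e z y)=> h1; apply: FK0=> //.
have s0 : 0 <= sk T e z y by rewrite addr_ge0 ?sqr_ge0 ?(ge_Tge0 G).
rewrite -exprVn -(sqr_sqrtr s0) lerXn2r ?nnegrE ?sqrtr_ge0 ?invr_ge0 ?(ltW Kp) //.
by rewrite -[leLHS]mul1r ler_pdivrMr // mulrC.
Qed.

Lemma hk_ge0 e z y : 0 < e -> 0 <= hk K e (T z) z y.
Proof. by move=> e0; apply: FK_ge0=> //; apply: (sk_gt0e G). Qed.

Lemma hk_psmv e : 0 < e -> psmv (fun z=> hk K e (T z) z).
Proof.
move=> e0; apply: psmv_hk=> //; first by move=> i j x; exact: (ge_Tc G).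
- by move=> i; exact: coord_continuous.
- by move=> x v; exact: (ge_Tge0 G).
Qed.

Definition Cg : R := 2^+(3 * m)*sqrt (L/K).

Lemma gk_sym (r : R) (y z : V) : gk r (y-z) = gk r (z-y).
Proof. by rewrite /gk distrC. Qed.

Lemma gk_z y : Itg (fun z : V=> gk (L/K) (y-z)) /\ Int (fun z : V=> gk (L/K) (y-z)) <= Cg.
Proof.
have [I1 I2] := gk_itg mp LK0.
rewrite (_ : (fun z : V=> _) = (fun z=> gk (L/K) (z+(- y)))); last by apply/funext=> z; rewrite gk_sym.
by split; [exact: Itg_shift|rewrite Int_shift //; exact: Itg_meas].
Qed.

Lemma Pk_meas_y e z : 0 <= e -> measT (Pk S T K e z).
Proof.
rewrite le_eqVlt=> /orP[/eqP <-|e0].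
 have := measurable_Pk0 n0 G K; move=> h.
 exact: (measT_comp h (measurable_pair1 z)).
apply: cont_meas; have /cont_slice[_ c2] := @Pk_cont2 R n S T L G K e e0.
exact: (c2 z).
Qed.

Lemma Pk_meas_z e y : 0 <= e -> measT (fun z=> Pk S T K e z y).
Proof.
rewrite le_eqVlt=> /orP[/eqP <-|e0].
 have := measurable_Pk0 n0 G K; move=> h.
 exact: (measT_comp h (measurable_pair2 y)).
apply: cont_meas; have /cont_slice[c1 _] := @Pk_cont2 R n S T L G K e e0.
exact: (c1 y).
Qed.

Section withg.
Variable g : V -> R.
Hypotheses (cg : continuous g) (g01 : forall x, 0 <= g x <= 1).

Definition gT (z : V) : R := g z*tent c rho z.

Lemma gT_bnd z : 0 <= gT z <= rho.
Proof.
have /andP[a1 a2] := g01 z; have /andP[b1 b2] := tent_bnd c z (ltW rho0).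
by rewrite mulr_ge0 //= -[leRHS]mul1r ler_pM.
Qed.

Lemma gT_cont : continuous gT.
Proof. by apply: contM=> //; exact: cont_tent. Qed.

Lemma gT_out z : rho <= `|c-z| -> gT z = 0.
Proof. by move=> h; rewrite /gT tent_out // mulr0. Qed.

Lemma gT_far z : `|c| + rho <= `|z| -> gT z = 0.
Proof. by move=> h; apply: gT_out; have := lerB_dist z c; rewrite distrC; lra. Qed.

Lemma gT_itg : Itg gT.
Proof.
apply: (@cont_Itg _ _ gT (Cb c rho)); [exact: compact_cball|exact: gT_cont|].
by move=> p /negP; rewrite -ltNge=> /ltW; exact: gT_out.
Qed.

(** Averaging over the pole gives a smooth compactly supported test function whose image under the
    operator stays bounded as e -> 0. Information at individual poles is recovered from the freedom
    in the weight [g]. *)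
Definition We (e : R) (y : V) : R := Int (fun z=> gT z*hk K e (T z) z y).

Lemma We_smooth e : 0 < e -> smooth (We e).
Proof.
move=> e0; have h := @psmv_int R m m gT (`|c| + rho) gT_itg gT_far R^o _ (hk_psmv e0).
exact: (psmv_smooth (0 : R^o) h).
Qed.

Lemma We_ge0 e y : 0 < e -> 0 <= We e y.
Proof.
by move=> e0; apply: Int_ge0=> z; have /andP[h _] := gT_bnd z; rewrite mulr_ge0 // hk_ge0.
Qed.

Lemma We_supp e : supp (Cb c (2*rho)) (We e).
Proof.
move=> y /negP; rewrite -ltNge=> hy; rewrite /We -[RHS](@Int0 R m); apply: eq_Int=> z.
have [h|h] := leP rho `|c-z|; first by rewrite gT_out // mul0r.
rewrite hk0 ?mulr0 //; apply: (le_trans LK).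
have := ler_distD z c y; rewrite [`|z-y|]distrC; lra.
Qed.

Lemma gTP_abs e y : 0 <= e -> Itg (fun z=> gT z*Pk S T K e z y) /\
 Int (fun z=> `|gT z*Pk S T K e z y|) <= rho*(Cp n L*K*Cg).
Proof.
move=> e0; have [I1 I2] := gk_z y.
have bd z : `|gT z*Pk S T K e z y| <= rho*(Cp n L*K*gk (L/K) (y-z)).
 have /andP[a1 a2] := gT_bnd z; rewrite normrM (ger0_norm a1) ler_pM //.
 exact: (Pk_bound n0 G KK z y e0).
have Ib : Itg (fun z : V=> rho*(Cp n L*K*gk (L/K) (y-z))) by apply: ItgZ; exact: ItgZ.
have cp0 : 0 <= Cp n L*K.
 rewrite mulr_ge0 ?(ltW Kp) // /Cp mulr_ge0 ?exprn_ge0 ?(ltW Lp) //.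
 have c0 : 0 <= C2 n L by rewrite !mulr_ge0 ?(ltW Lp).
 pos.
have I3 : Itg (fun z=> gT z*Pk S T K e z y).
 apply: (Itg_le _ Ib bd); apply: measurable_funM; last exact: Pk_meas_z.
 exact: cont_meas gT_cont.
split=> //; apply: (@le_trans _ _ (Int (fun z : V=> rho*(Cp n L*K*gk (L/K) (y-z))))).
 by apply: Int_le=> //; exact: Itg_abs.
rewrite IntZ; last exact: ItgZ.
by rewrite IntZ // ler_wpM2l ?(ltW rho0) // ler_wpM2l.
Qed.

Lemma gTP_itg e y : 0 <= e -> Itg (fun z=> gT z*Pk S T K e z y) /\
 `|Int (fun z=> gT z*Pk S T K e z y)| <= rho*(Cp n L*K*Cg).
Proof. by move=> /(@gTP_abs e y)[I h]; split=> //; apply: le_trans (Int_abs I) h. Qed.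

Lemma gTF_itg e y : 0 < e -> Itg (fun z=> gT z*Fk T K e z y) /\
 `|Int (fun z=> gT z*Fk T K e z y)| <= rho*kmax n L.
Proof.
move=> e0; have [I1 _ _ _] := Fk_Int n0 G y (ltW Kp) e0 gT_cont gT_bnd.
split=> //; have /andP[h1 h2] := Fk_bound n0 G y (ltW Kp) e0 gT_cont gT_bnd.
by rewrite ger0_norm.
Qed.

Lemma LS_We e y : 0 < e -> LS S (We e) y =
 Int (fun z=> gT z*Pk S T K e z y)-Int (fun z=> gT z*Fk T K e z y).
Proof.
move=> e0; rewrite /We (LS_int S y gT_itg gT_far (hk_psmv e0)).
have [I1 _] := gTP_itg y (ltW e0); have [I2 _] := gTF_itg y e0.
rewrite -IntB //; apply: eq_Int=> z.
by rewrite (LS_H G) // mulrBr.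
Qed.

Lemma LS_cont_all w : smooth w -> continuous (LS S w).
Proof.
move=> sw; apply: (@contSum R V _ _ (fun i p=> \sum_j S p i j * pd i (pd j w) p))=> i.
apply: (@contSum R V _ _ (fun j p=> S p i j * pd i (pd j w) p))=> j.
apply: (@contM _ _ (fun p=> S p i j)); first by move=> x; exact: (ge_Sc G).
by apply: smooth_cont; exact: smooth_pd (smooth_pd _ sw).
Qed.
Let CW : R := rho*(Cp n L*K*Cg)+rho*kmax n L.

Lemma LS_We_bnd e y : 0 < e -> `|LS S (We e) y| <= CW.
Proof.
move=> e0; rewrite LS_We //; have [_ h1] := gTP_itg y (ltW e0); have [_ h2] := gTF_itg y e0.
by apply: le_trans (ler_normB _ _) _; apply: lerD.
Qed.

Lemma fLS_itg e : 0 < e -> Itg (fun y=> f y*LS S (We e) y).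
Proof.
move=> e0; apply: (@Itg_le _ _ _ (fun y=> CW * `|f y|)).
- apply: measurable_funM; first exact: Itg_meas.
 by apply: cont_meas; apply: LS_cont_all; exact: We_smooth.
- by apply: ItgZ; exact: Itg_abs.
- by move=> y; rewrite normrM mulrC ler_wpM2r // LS_We_bnd.
Qed.

(** The formal limit for e -> 0 of the pairing of [f] with the operator on the kernel at z: the
    error kernel remains, and the source turns into the mass [kap (T z)] at z. *)
Definition hK (z : V) : R := Int (fun y=> f y*Pk S T K 0 z y)-kap (T z)*f z.

(** Forms close in ratio have masses close in ratio; [kap_cmp] in both directions gives a two-sided
    ratio bound, and this yields continuity directly. *)
Lemma kap_cont : continuous (fun z=> kap (T z)).
Proof.
move=> z; have L1 := ge_L G.
have p z' : posl L (T z') by exact: (ge_posl G).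
pose d (z' : V) : R := m%:R^+2*(L * `|z-z'|)*L.
have d0 z' : 0 <= d z' by rewrite !mulr_ge0 ?(ltW Lp).
have near z' x : qf (T z) x x <= (1+d z')*qf (T z') x x /\ qf (T z') x x <= (1+d z')*qf (T z) x x.
 split; first exact: (@qf_near _ _ n0 L (T z) (T z') (L * `|z-z'|) x Lp (p z') (ge_Tlip G z z')).
 by apply: (@qf_near _ _ n0 L (T z') (T z) (L * `|z-z'|) x Lp (p z))=> i j; rewrite distrC; exact: (ge_Tlip G).
have k1 z' : kap (T z') <= (1+d z')^+n.+1*kap (T z).
 by apply: (kap_cmp n0 L1 (p z) (p z') (d0 z'))=> x; exact: (near z' x).1.
have k2 z' : kap (T z) <= (1+d z')^+n.+1*kap (T z').
 by apply: (kap_cmp n0 L1 (p z') (p z) (d0 z'))=> x; exact: (near z' x).2.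
have cd : (fun z'=> (1+d z')^+n.+1) @ z --> (1 : R).
 have cu : continuous (fun z'=> (1+d z')^+n.+1).
 apply: contX; apply: (@contD _ _ (fun _ : V=> 1)); first by move=> x; exact: cst_continuous.
 have c1 (a : R) : continuous (fun _ : V=> a) by move=> x; exact: cst_continuous.
 have cn : continuous (fun z' : V=> `|z-z'|).
 move=> x; apply: (@continuous_comp _ _ _ (fun x : V=> z-x) (fun x : V=> `|x|)); last exact: norm_continuous.
 by apply: continuousB; [exact: cst_continuous|exact: cvg_id].
 apply: (@contM _ _ (fun z' : V=> m%:R^+2*(L * `|z-z'|)) (fun _=> L))=> //.
 by apply: (@contM _ _ (fun _ : V=> m%:R^+2))=> //; exact: contM.
 have := cu z; rewrite /continuous_at (_ : (1+d z)^+n.+1 = 1) //.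
 by rewrite /d subrr normr0 !(mulr0, mul0r) addr0 expr1n.
have pos z' : 0 < (1+d z')^+n.+1 by rewrite exprn_gt0 // ltr_wpDr.
suff : (fun z'=> kap (T z')) @ z --> kap (T z) by [].
apply: (ratio_cvg cd)=> z'.
by rewrite k1 ler_pdivrMr // mulrC k2.
Qed.

Lemma kap_bnd z : 0 < kap (T z) <= kmax n L.
Proof.
have [h _] := kap_le n0 (ge_L G) (ge_posl G z); rewrite h andbT.
apply: lt_le_trans (kap_ge n0 (ge_L G) (ge_posl G z) (ge_Tb G z)).
exact: (kmin_gt0 n0 (ltW Lp)).
Qed.

Lemma fub_P0 : [/\ Itg (fun y=> f y*Int (fun z=> gT z*Pk S T K 0 z y)),
 Itg (fun z=> gT z*Int (fun y=> f y*Pk S T K 0 z y)) &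
 Int (fun y=> f y*Int (fun z=> gT z*Pk S T K 0 z y)) = Int (fun z=> gT z*Int (fun y=> f y*Pk S T K 0 z y))].
Proof.
have [||J1 J2 J3 _] := @fub_kernel _ _ f gT (Pk S T K 0) (rho*(Cp n L*K*Cg)) If (cont_meas gT_cont).
- exact: (measurable_Pk0 n0 G K).
- by move=> y; exact: (gTP_abs y (lexx 0)).
- by split; [exact: J1|exact: J2|exact: J3].
Qed.

(** For fixed y both parts of [LS S (We e)] converge, the error part under the bound [gk] and the
    source part by [Fk_cvg]. A bound uniform in e and y carries the limit through the integral
    against [f], and Fubini returns the average over the pole. *)
Lemma weak_cvg (e_ : nat -> R) : (forall j, 0 < e_ j) -> e_ j @[j --> \oo] --> (0 : R) ->
 Itg (fun z=> gT z*hK z) /\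
 Int (fun y=> f y*LS S (We (e_ j)) y) @[j --> \oo] --> Int (fun z=> gT z*hK z).
Proof.
move=> e0 ec.
have [J1 J2 J3] := fub_P0.
have mgT : measT gT by exact: cont_meas gT_cont.
have I1 : Itg (fun z=> gT z*(kap (T z)*f z)).
 apply: (@Itg_le _ _ _ (fun z=> rho*kmax n L * `|f z|)); last 2 first.
 - by apply: ItgZ; exact: Itg_abs.
 - move=> z; have /andP[a1 a2] := gT_bnd z; have /andP[/ltW b1 b2] := kap_bnd z.
 rewrite normrM (normrM (kap _)) (ger0_norm a1) (ger0_norm b1) mulrA.
 by apply: ler_wpM2r; [exact: normr_ge0|exact: (ler_pM a1 b1 a2 b2)].
 apply: (measurable_funM mgT); apply: measurable_funM; [|exact: Itg_meas].
 exact: (cont_meas kap_cont).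
have hE z : gT z*hK z = gT z*Int (fun y=> f y*Pk S T K 0 z y)-gT z*(kap (T z)*f z).
 by rewrite mulrBr.
have Ih : Itg (fun z=> gT z*hK z).
 by rewrite (_ : (fun z=> _) = (fun z=> gT z*Int (fun y=> f y*Pk S T K 0 z y)-gT z*(kap (T z)*f z))); [exact: ItgB|exact/funext].
split; [exact: Ih|].
pose lim y := f y*Int (fun z=> gT z*Pk S T K 0 z y)-gT y*(kap (T y)*f y).
have Il : Itg lim by exact: ItgB.
have -> : Int (fun z=> gT z*hK z) = Int lim.
 apply: (etrans (eq_Int hE)); apply: (etrans (IntB J2 I1)); apply: (etrans _ (esym (IntB J1 I1))).
 exact: (congr1 (fun t : R=> t-Int (fun z=> gT z*(kap (T z)*f z))) (esym J3)).
apply: (proj2 (@Int_dct _ _ (fun j y=> f y*LS S (We (e_ j)) y) lim (fun y=> CW * `|f y|) _ _ _ _ (Itg_meas Il))).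
- by move=> j; apply: Itg_meas; exact: fLS_itg.
- by apply: ItgZ; exact: Itg_abs.
- by move=> j y; rewrite normrM mulrC; apply: ler_wpM2r; [exact: normr_ge0|exact: (LS_We_bnd y (e0 j))].
apply: aeW=> y.
have -> : lim y = f y*(Int (fun z=> gT z*Pk S T K 0 z y)-gT y*kap (T y)).
 by rewrite /lim; ring.
apply: cvgM; first exact: cvg_cst.
rewrite (_ : (fun j=> LS S (We (e_ j)) y) = (fun j=> Int (fun z=> gT z*Pk S T K (e_ j) z y)-Int (fun z=> gT z*Fk T K (e_ j) z y))); last first.
 by apply/funext=> j; exact: LS_We.
apply: cvgB; last exact: (@Fk_cvg _ _ n0 _ _ _ G K e_ gT rho y (ltW Kp) e0 ec (@gT_cont) gT_bnd).
have [gI _] := gk_z y.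
apply: (proj2 (@Int_dct _ _ (fun j z=> gT z*Pk S T K (e_ j) z y) (fun z=> gT z*Pk S T K 0 z y)
 (fun z=> rho*(Cp n L*K*gk (L/K) (y-z))) _ _ _ _ _)).
- by move=> j; apply: (measurable_funM mgT); exact: (Pk_meas_z y (ltW (e0 j))).
- by apply: ItgZ; exact: ItgZ.
- move=> j z; have /andP[a1 a2] := gT_bnd z; rewrite normrM (ger0_norm a1).
 apply: (ler_pM a1 (normr_ge0 _) a2).
 exact: (Pk_bound n0 G KK z y (ltW (e0 j))).
- apply: aeW=> z; apply: cvgM; first exact: cvg_cst.
 have [->|yz] := eqVneq y z.
 rewrite (Pk_diag n0 G K z (lexx 0)) (_ : (fun j=> _) = (fun=> 0)); first exact: cvg_cst.
 by apply/funext=> j; rewrite (Pk_diag n0 G K z (ltW (e0 j))).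
 by apply: (Pk_cvg G (z_ := fun=> z) ec); [exact: cvg_cst|exact: (sk_gt0 G)].
- by apply: (measurable_funM mgT); exact: (Pk_meas_z y (lexx 0)).
Qed.
End withg.
End Weak.
Section AeInt.
Variables (R : realType) (m : nat).
Implicit Types f g : 'rV[R]_m -> R.

Lemma ae_Int f g : measT f -> measT g -> (AE x, f x = g x) -> Int f = Int g.
Proof.
move=> mf mg h; rewrite /Int /Rintegral; congr fine; apply: ae_eq_integral=> //.
- exact/EFinP.
- exact/EFinP.
by apply: filterS h=> x h _; rewrite h.
Qed.

Lemma Int_le_ae f g : Itg f -> Itg g -> (AE x, f x <= g x) -> Int f <= Int g.
Proof.
move=> If Ig h; have mf := Itg_meas If; have mg := Itg_meas Ig.
have Im : Itg (fun x=> Num.max (f x) (g x)).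
 apply: (@Itg_le _ _ _ (fun x=> `|f x| + `|g x|)); [exact: measurable_maxr|exact: (ItgD (Itg_abs If) (Itg_abs Ig))|].
 by move=> x; case: (leP (f x) (g x))=> _; rewrite ?lerDl ?lerDr.
have -> : Int g = Int (fun x=> Num.max (f x) (g x)).
 apply: (ae_Int mg (Itg_meas Im)); apply: filterS h=> x h.
 by rewrite max_r.
by apply: Int_le=> // x; rewrite le_max lexx.
Qed.
End AeInt.

Lemma Itg_ext (R : realType) m (f g : 'rV[R]_m -> R) : (forall x, f x = g x) -> Itg g -> Itg f.
Proof. by move=> h; rewrite (_ : f = g) //; apply/funext. Qed.

Lemma skn_le (R : realType) n (L x s : R) : (0 < n)%N -> 0 < x -> x <= 1 -> 0 < L -> 0 < s -> x <= L*sqrt s ->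
 s ^- n*sqrt s <= L^+(n+n).-1*sqrt x ^- (n+n+(n+n)).-1.
Proof.
move=> n0 x0 x1 L0 s0 h.
have u0 : 0 < sqrt s by rewrite sqrtr_gt0.
have v0 : 0 < sqrt x by rewrite sqrtr_gt0.
have mp : (0 < n+n)%N by rewrite addn_gt0 n0.
have E1 : s ^- n*sqrt s = sqrt s ^- (n+n).-1.
 have e1 : s^+n = sqrt s^+(n+n).-1*sqrt s.
 by rewrite -exprSr prednK // addnn -mul2n exprM sqr_sqrtr // ltW.
 by rewrite e1 invfM -mulrA mulVf ?mulr1 // gt_eqF.
rewrite E1; apply: (@le_trans _ _ (L^+(n+n).-1*x ^- (n+n).-1)).
 rewrite -[leLHS]mul1r ler_pdivrMr ?exprn_gt0 // mulrAC -exprMn ler_pdivlMr ?exprn_gt0 // mul1r.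
 apply: lerXn2r; [pos|pos|exact: h].
apply: ler_wpM2l; first pos.
rewrite lef_pV2 ?posrE ?exprn_gt0 // -[in leRHS](sqr_sqrtr (ltW x0)) -exprM.
apply: ler_wiXn2l; rewrite ?sqrtr_ge0 //; first by rewrite -sqrtr1 ler_wsqrtr.
by rewrite mul2n -addnn; case: (n+n)%N mp=> // k _; rewrite addnS.
Qed.

Section Lin.
Variables (R : realType) (n : nat).
Notation m := (n+n)%N.
Notation V := (pt R n).
Implicit Types w : V -> R.

Lemma smooth_lin a b w1 w2 : smooth w1 -> smooth w2 -> smooth (fun y=> a*w1 y+b*w2 y).
Proof.
move=> s1 s2; apply: (@psmv_smooth _ _ R^o (fun _ y=> a*w1 y+b*w2 y) 0).
by apply: psm_add; (apply: psm_mul; [exact: psm_cst|exact: smooth_psmv]).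
Qed.

Lemma pd_lin a b w1 w2 i : smooth w1 -> smooth w2 ->
 pd i (fun y=> a*w1 y+b*w2 y) = (fun y=> a * pd i w1 y+b * pd i w2 y).
Proof.
move=> s1 s2; apply/funext=> y; rewrite /pd.
have d1 : derivable w1 y (delta_mx 0 i : V) by have [h _] := s1 1%N; exact: (h [::]).
have d2 : derivable w2 y (delta_mx 0 i : V) by have [h _] := s2 1%N; exact: (h [::]).
have h1 : derivable (a *: w1) y (delta_mx 0 i : V) by exact: derivableZ.
have h2 : derivable (b *: w2) y (delta_mx 0 i : V) by exact: derivableZ.
have := deriveD h1 h2; rewrite deriveZ // deriveZ //; exact.
Qed.

Lemma LS_lin (S : V -> 'M[R]_m) a b w1 w2 y : smooth w1 -> smooth w2 ->
 LS S (fun y=> a*w1 y+b*w2 y) y = a*LS S w1 y+b*LS S w2 y.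
Proof.
move=> s1 s2; rewrite /LS !mulr_sumr -big_split /=; apply: eq_bigr=> i _.
rewrite !mulr_sumr -big_split /=; apply: eq_bigr=> j _.
rewrite (pd_lin a b j s1 s2) (pd_lin a b i (smooth_pd j s1) (smooth_pd j s2)).
by move: (S y i j) (pd i (pd j w1) y) (pd i (pd j w2) y)=> s p q; ring.
Qed.

Lemma LS_bnd S T L w C : @gell R n S T L -> smooth w -> compact C -> supp C w -> exists2 B, 0 < B & forall y, `|LS S w y| <= B.
Proof.
move=> G sw cC sC; have [B B0 hB] := cpt_bounded cC (fun y _=> @LS_cont_all _ _ _ _ _ G _ sw y).
exists B=> // y; have [hy|hy] := pselect (C y); first exact: hB.
by rewrite (LS_supp _ cC sC) // normr0 ltW.
Qed.

Lemma Itg_fLS S T L f w C : @gell R n S T L -> Itg f -> smooth w -> compact C -> supp C w -> Itg (fun y=> f y*LS S w y).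
Proof.
move=> G If sw cC sC; have [B B0 hB] := LS_bnd G sw cC sC.
apply: (@Itg_le _ _ _ (fun y=> B * `|f y|)); [|by apply: ItgZ; exact: Itg_abs|].
 apply: measurable_funM; first exact: Itg_meas.
 by apply: cont_meas; exact: (@LS_cont_all _ _ _ _ _ G _ sw).
by move=> y; rewrite normrM mulrC; apply: ler_wpM2r.
Qed.

Definition subC S (C : set V) (f : V -> R) := forall w, smooth w -> (forall y, 0 <= w y) -> supp C w ->
 0 <= Int (fun y=> f y*LS S w y).

Lemma subC_le S T L C f w1 w2 : @gell R n S T L -> Itg f -> compact C -> subC S C f ->
 smooth w1 -> smooth w2 -> supp C w1 -> supp C w2 -> (forall y, w1 y <= w2 y) ->
 Int (fun y=> f y*LS S w1 y) <= Int (fun y=> f y*LS S w2 y).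
Proof.
move=> G If cC sf s1 s2 c1 c2 h.
have I1 := Itg_fLS G If s1 cC c1; have I2 := Itg_fLS G If s2 cC c2.
pose w y := 1*w2 y+(-1)*w1 y.
have E y : f y*LS S w y = f y*LS S w2 y-f y*LS S w1 y.
 by rewrite (LS_lin S 1 (-1) y s2 s1) mul1r mulN1r mulrBr.
have e : Int (fun y=> f y*LS S w y) = Int (fun y=> f y*LS S w2 y)-Int (fun y=> f y*LS S w1 y).
 exact: (etrans (eq_Int E) (IntB I2 I1)).
rewrite -subr_ge0 -e; apply: (sf w (smooth_lin 1 (-1) s2 s1)).
 by move=> y; rewrite /w mul1r mulN1r subr_ge0.
by move=> y hy; rewrite /w c1 // c2 // !mulr0 addr0.
Qed.

Lemma LS_scale S a w y : smooth w -> LS S (fun y=> a*w y) y = a*LS S w y.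
Proof.
move=> sw; have := LS_lin S a 0 y sw sw; rewrite mul0r addr0=> <-.
by congr (LS S _ y); apply/funext=> x; rewrite mul0r addr0.
Qed.

Lemma smooth_scale a w : smooth w -> smooth (fun y=> a*w y).
Proof.
move=> sw; rewrite (_ : (fun y=> _) = (fun y=> a*w y+0*w y)); first exact: smooth_lin.
by apply/funext=> x; rewrite mul0r addr0.
Qed.
End Lin.

(** * The mean inequality and the size of its defect *)

Section Weak2.
Variables (R : realType) (n : nat) (n0 : (0 < n)%N).
Notation m := (n+n)%N.
Notation V := (pt R n).
Variables (S T : V -> 'M[R]_m) (L : R) (G : gell S T L) (K rho : R) (c : V) (f : V -> R) (KK : K0 n L <= K) (rho0 : 0 < rho) (LK : L/K <= rho) (If : Itg f).

Let Kp : 0 < K. Proof. by apply: lt_le_trans KK; apply: lt_le_trans ltr01 (K0_ge n0 G).2. Qed.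
Let Lp : 0 < L. Proof. exact: lt_le_trans ltr01 (ge_L G). Qed.

Definition Me (e : R) (z : V) : R := Int (fun y=> f y*LS S (hk K e (T z) z) y).

Lemma LSH_meas e : 0 < e -> measT (fun q : V*V=> LS S (hk K e (T q.1) q.1) q.2).
Proof.
move=> e0; rewrite (_ : (fun q : V*V=> _) = (fun q=> Pk S T K e q.1 q.2-Fk T K e q.1 q.2)); last first.
 by apply/funext=> q; rewrite (LS_H G).
apply: measurable_funB; apply: cont_meas2.
 exact: (@Pk_cont2 _ _ _ _ _ G K e e0).
exact: (@Fk_cont2 _ _ _ _ _ G K e e0).
Qed.

Lemma Me_weak (g : V -> R) e : continuous g -> (forall x, 0 <= g x <= 1) -> 0 < e ->
 Itg (fun z=> gT rho c g z*Me e z) /\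
 Int (fun z=> gT rho c g z*Me e z) = Int (fun y=> f y*LS S (We T K rho c g e) y).
Proof.
move=> cg g01 e0.
have mg : measT (gT rho c g) by exact: (cont_meas (@gT_cont _ _ rho c g cg)).
have H y : Itg (fun z=> gT rho c g z*LS S (hk K e (T z) z) y) /\
 Int (fun z=> `|gT rho c g z*LS S (hk K e (T z) z) y|) <= rho*(Cp n L*K*Cg n L K)+rho*kmax n L.
 have [i1 h1] := @gTP_abs _ _ n0 _ _ _ G K rho c KK rho0 g cg g01 e y (ltW e0).
 have [i2 h2] := @gTF_itg _ _ n0 _ _ _ G K rho c KK rho0 g cg g01 e y e0.
 have E z : gT rho c g z*LS S (hk K e (T z) z) y = gT rho c g z*Pk S T K e z y-gT rho c g z*Fk T K e z y.
 by rewrite (LS_H G) // mulrBr.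
 have I : Itg (fun z=> gT rho c g z*LS S (hk K e (T z) z) y).
 exact: (Itg_ext E (ItgB i1 i2)).
 split; first exact: I.
 have p z : 0 <= gT rho c g z*Fk T K e z y.
 have /andP[a1 _] := @gT_bnd _ _ rho c rho0 g g01 z; apply: mulr_ge0=> //.
 exact: (phik_ge0 _ _ _ Lp (ge_posl G z)).
 have J : Int (fun z=> `|gT rho c g z*LS S (hk K e (T z) z) y|) <=
 Int (fun z=> `|gT rho c g z*Pk S T K e z y| + gT rho c g z*Fk T K e z y).
 apply: Int_le; [exact: Itg_abs|exact: (ItgD (Itg_abs i1) i2)|].
 move=> z; rewrite E; apply: (le_trans (ler_normB _ _)); rewrite lerD2l ger0_norm //; exact: p.
 apply: (le_trans J); rewrite (IntD (Itg_abs i1) i2); apply: lerD; first exact: h1.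
 exact: (le_trans (ler_norm _) h2).
have [J1 J2 J3 _] := @fub_kernel _ _ f _ (fun z y=> LS S (hk K e (T z) z) y) _ If mg (LSH_meas e0) H.
split; first exact: J2.
rewrite -J3; apply: eq_Int=> y.
have [i1 _] := @gTP_itg _ _ n0 _ _ _ G K rho c KK rho0 g cg g01 e y (ltW e0).
have [i2 _] := @gTF_itg _ _ n0 _ _ _ G K rho c KK rho0 g cg g01 e y e0.
rewrite (@LS_We _ _ n0 _ _ _ G K rho c KK rho0 g cg g01 e y e0) -(IntB i1 i2); congr (_*_).
by apply: eq_Int=> z; rewrite (LS_H G z y Kp e0) mulrBr.
Qed.
Let theta := tent c rho.
Let cst1 : continuous (fun _ : V=> 1 : R). Proof. by move=> x; exact: cst_continuous. Qed.
Let one01 (x : V) : 0 <= (1 : R) <= 1. Proof. lra. Qed.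
Let e_ (e1 : R) (j : nat) := e1*j.+2%:R^-1.

Lemma e_cvg e1 : e_ e1 j @[j --> \oo] --> (0 : R).
Proof.
rewrite -(mulr0 e1); apply: cvgM; first exact: cvg_cst.
have h := @cvg_harmonic R; apply/cvgrPdist_lt=> e e0.
move/cvgrPdist_lt: h=> /(_ _ e0)[N _ hN]; exists N=> // j /= Nj.
have := hN j.+1 (leqW Nj); exact.
Qed.

Lemma hK_theta : Itg (fun z=> theta z*hK S T K f z).
Proof.
have ep j : 0 < e_ 1 j by rewrite /e_ mul1r.
have [h _] := @weak_cvg _ _ n0 _ _ _ G K rho c f KK rho0 If (fun=> 1) (@cst1) one01 _ ep (@e_cvg 1).
by apply: Itg_ext h=> z; rewrite /gT mul1r.
Qed.

(* Comparison with all regularised potentials passes to the limit weakly, against [g*theta]. *)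
Lemma weak_cmp (s : R) (x : V -> R) e1 : 0 < e1 -> Itg (fun z=> theta z*x z) ->
 (forall e, 0 < e -> e < e1 -> (AE z, `|c-z| < rho -> s*x z <= s*Me e z)) ->
 AE z, `|c-z| < rho -> s*x z <= s*hK S T K f z.
Proof.
move=> e1p Ix h.
have Ih : Itg (fun z=> s*(theta z*hK S T K f z-theta z*x z)) by apply: ItgZ; exact: (ItgB hK_theta Ix).
have : AE z, 0 <= s*(theta z*hK S T K f z-theta z*x z).
 apply: (ae_ge0_of_cont Ih)=> g cg g01.
 have ep j : 0 < e_ e1 j by rewrite mulr_gt0 //.
 have el j : e_ e1 j < e1 by rewrite gtr_pMr // invf_lt1 // ltr1n.
 have [I1 lim] := @weak_cvg _ _ n0 _ _ _ G K rho c f KK rho0 If g cg g01 _ ep (@e_cvg e1).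
 have Igx : Itg (fun z=> gT rho c g z*x z).
 apply: (Itg_le _ (Itg_abs Ix)).
 apply: (@eq_measurable_fun _ _ _ _ setT (fun z=> g z*(theta z*x z))); last first.
 by apply: measurable_funM; [exact: cont_meas|exact: Itg_meas].
 by move=> z _; rewrite mulrA.
 move=> z; rewrite /gT -mulrA normrM -[leRHS]mul1r; apply: ler_wpM2r=> //.
 by have /andP[a b] := g01 z; rewrite ger0_norm.
 have E z : g z*(s*(theta z*hK S T K f z-theta z*x z)) =
 s*(gT rho c g z*hK S T K f z-gT rho c g z*x z) by rewrite /gT -/theta; ring.
 rewrite (eq_Int E) (IntZ _ (ItgB I1 Igx)) (IntB I1 Igx).
 have key j : s*Int (fun z=> gT rho c g z*x z) <= s*Int (fun y=> f y*LS S (We T K rho c g (e_ e1 j)) y).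
 have [J1 <-] := Me_weak cg g01 (ep j).
 rewrite -(IntZ s Igx) -(IntZ s J1); apply: Int_le_ae; [exact: ItgZ|exact: ItgZ|].
 apply: filterS (h _ (ep j) (el j))=> z hz.
 have [zr|zr] := ltP `|c-z| rho; last by rewrite (gT_out _ zr) !mul0r.
 have /andP[a1 _] := @gT_bnd _ _ rho c rho0 g g01 z.
 rewrite !(mulrCA s); apply: ler_wpM2l=> //; exact: hz.
 rewrite mulrBr subr_ge0; apply: (cvgr_to_ge (cvgM (cvg_cst s) lim)).
 by apply: nearW=> j; exact: key.
apply: filterS=> z hz zr.
have t0 : 0 < theta z by rewrite /theta tent_in ?subr_gt0 // ltW.
by move: hz; rewrite -mulrBr mulrCA pmulr_rge0 // mulrBr subr_ge0.
Qed.

Lemma hK_ge0 : subC S (Cb c (2*rho)) f -> AE z, `|c-z| < rho -> 0 <= hK S T K f z.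
Proof.
move=> sf; have := @weak_cmp 1 (fun=> 0) 1 ltr01.
have I0 : Itg (fun z=> theta z*0) by apply: (@Itg_ext _ _ _ (fun=> 0)); [move=> z; rewrite mulr0|exact: Itg0].
move=> /(_ I0) H; have {}H := H _; have {}H : AE z, `|c-z| < rho -> 1*0 <= 1*hK S T K f z.
 apply: H=> e ep _; apply: aeW=> z zr; rewrite !mul1r; apply: sf.
 - exact: (psmv_smooth z (hk_psmv n0 G KK ep)).
 - by move=> y; exact: (hk_ge0 n0 G KK).
 move=> y /negP; rewrite -ltNge=> hy; apply: (hk0 n0 G KK); apply: (le_trans LK).
 have := ler_distD z c y; rewrite [`|z-y|]distrC; lra.
by apply: filterS H=> z H zr; have := H zr; rewrite !mul1r.
Qed.

Lemma Pk_ae : AE z, `|c-z| < rho -> Itg (fun y=> f y*Pk S T K 0 z y).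
Proof.
have mg : measT (gT rho c (fun=> 1)) by exact: (cont_meas (@gT_cont _ _ rho c _ (@cst1))).
have [||_ _ _ J] := @fub_kernel _ _ f (gT rho c (fun=> 1)) (Pk S T K 0) (rho*(Cp n L*K*Cg n L K)) If mg.
- exact: (measurable_Pk0 n0 G K).
- by move=> y; exact: (@gTP_abs _ _ n0 _ _ _ G K rho c KK rho0 _ (@cst1) one01 0 y (lexx 0)).
apply: filterS J=> z h zr; apply: h.
by rewrite /gT mul1r gt_eqF // tent_in ?subr_gt0 // ltW.
Qed.

Definition Weps : R := rho*(2/K*L^+m.-1*Cg n L K).

(** The factor 1/K of [FK_bound] together with the integrability of [gk] makes the averaged
    potential small for large K, uniformly in e. *)
Lemma We_small (g : V -> R) e y : continuous g -> (forall x, 0 <= g x <= 1) -> 0 < e ->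
 We T K rho c g e y <= Weps.
Proof.
move=> cg g01 e0.
have [I1 I2] := gk_z n0 G KK y.
have hp : psmv (fun z=> hk K e (T z) z) := hk_psmv n0 G KK e0.
have mg : measT (gT rho c g) by exact: (cont_meas (@gT_cont _ _ rho c g cg)).
pose h z := gT rho c g z*hk K e (T z) z y.
have Ih : Itg h := Itg_param (@gT_itg _ _ rho c g cg) (@gT_far _ _ rho c g) y hp.
have mh := Itg_meas Ih.
have mi : measT (\1_(~` [set y]) : V -> R).
 apply: measurable_indic; apply: open_meas; apply: closed_openC.
 exact: (@accessible_closed_set1 _ (hausdorff_accessible (@norm_hausdorff _ _))).
have E1 z : z != y -> (\1_(~` [set y]) : V -> R) z = 1.
 by move=> zy; rewrite indicE mem_set //= => zy'; move: zy; rewrite zy' eqxx.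
(* The bound by [gk] may fail at z = y, where [gk] is 0 by convention; the point is removed as a
   null set. *)
have E : Int h = Int (fun z=> h z*\1_(~` [set y]) z).
 apply: (Int_off_point (y := y) (m_gt0 n0) mh); first exact: measurable_funM.
 by move=> z zy; rewrite E1 // mulr1.
pose M := rho*(2/K*L^+m.-1).
have M0 : 0 <= M by rewrite !mulr_ge0 ?(ltW rho0) ?exprn_ge0 ?(ltW Lp) // invr_ge0 ltW.
have -> : We T K rho c g e y = Int h by [].
have IM : Itg (fun z : V=> M*gk (L/K) (y-z)) by exact: ItgZ.
have bnd z : `|h z*\1_(~` [set y]) z| <= M*gk (L/K) (y-z).
 have g0 : 0 <= gk (L/K) (y-z) by exact: gk_ge0.
 have [->|zy] := eqVneq z y.
 rewrite indicE memNset /=; last pos.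
 by rewrite mulr0 normr0 mulr_ge0 // gk_ge0.
 rewrite E1 // mulr1 /h normrM /M -mulrA.
 have /andP[a1 a2] := @gT_bnd _ _ rho c rho0 g g01 z.
 rewrite (ger0_norm a1); apply: (ler_pM a1 (normr_ge0 _) a2).
 rewrite ger0_norm; last exact: (hk_ge0 n0 G KK).
 have [zr|zr] := ltP `|y-z| (L/K); last first.
 by rewrite (hk0 n0 G KK) // mulr_ge0 // mulr_ge0 ?exprn_ge0 ?(ltW Lp) // mulr_ge0 // invr_ge0 ltW.
 have s0 : 0 < sk T e z y by exact: (sk_gt0e G).
 have x0 : 0 < `|y-z| by rewrite normr_gt0 subr_eq0 eq_sym.
 have x1 : `|y-z| < 1.
 apply: (lt_le_trans zr); rewrite ler_pdivrMr // mul1r; exact: (le_trans (K0_ge n0 G).1 KK).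
 have h1 : hk K e (T z) z y <= 2/K*(sk T e z y ^- n*sqrt (sk T e z y)).
 exact: (FK_bound n0 Kp s0).
 apply: (le_trans h1); rewrite -[leRHS]mulrA; apply: ler_wpM2l; first pos.
 rewrite /gk zr; exact: (skn_le n0 x0 (ltW x1) Lp s0 (skL G e z y)).
rewrite E; apply: (le_trans (ler_norm _)).
have Ih1 : Itg (fun z=> h z*\1_(~` [set y]) z) by apply: (Itg_le (measurable_funM mh mi) IM bnd).
apply: (le_trans (Int_abs Ih1)); apply: (le_trans (Int_le (Itg_abs Ih1) IM bnd)).
by rewrite (IntZ _ I1) /Weps mulrA -/M; exact: ler_wpM2l.
Qed.

(** The potential lies below [Weps] times a cutoff that is 1 on its support, and pairing with a
    subsolution is monotone in the test function. The cutoff does not depend on K while [Weps] tends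
    to 0, so the defect disappears as K grows. *)
Lemma hK_small : subC S (Cb c (4*rho)) f ->
 Int (fun z=> theta z*hK S T K f z) <= Weps*Int (fun y=> f y*LS S (cutoff c (2*rho)) y).
Proof.
move=> sf.
have ep j : 0 < e_ 1 j by rewrite /e_ mul1r.
have [I1 lim] := @weak_cvg _ _ n0 _ _ _ G K rho c f KK rho0 If (fun=> 1) (@cst1) one01 _ ep (@e_cvg 1).
rewrite (_ : (fun z=> theta z*_) = (fun z=> gT rho c (fun=> 1) z*hK S T K f z)); last first.
 by apply/funext=> z; rewrite /gT mul1r.
have r20 : 0 < 2*rho by rewrite mulr_gt0.
have sc : supp (Cb c (4*rho)) (cutoff c (2*rho)).
 by rewrite (_ : 4*rho = 2*(2*rho)); [exact: supp_cutoff|ring].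
have Ic := Itg_fLS G If (smooth_cutoff c (2*rho)) (@compact_cball _ _ c (4*rho)) sc.
apply: (cvgr_to_le lim); apply: nearW=> j.
have sW : smooth (We T K rho c (fun=> 1) (e_ 1 j)) by exact: (We_smooth n0 G rho c KK (@cst1) (ep j)).
have IW := fLS_itg n0 G c KK rho0 If (@cst1) one01 (ep j).
have sc2 := smooth_cutoff c (2*rho).
have E y : f y*LS S (fun y=> Weps*cutoff c (2*rho) y) y = Weps*(f y*LS S (cutoff c (2*rho)) y).
 by rewrite (LS_scale S Weps y sc2) mulrCA.
rewrite -(IntZ Weps Ic) -(eq_Int E).
apply: (subC_le G If (@compact_cball _ _ c (4*rho)) sf sW (smooth_scale Weps sc2)).
- move=> y hy; apply: (We_supp n0 G KK LK)=> hy'; apply: hy; apply: (le_trans hy').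
 lra.
- by move=> y hy; rewrite sc // mulr0.
- move=> y; have Wb := @We_small (fun=> 1) (e_ 1 j) y (@cst1) one01 (ep j).
 have [hy|hy] := pselect (Cb c (2*rho) y); first by rewrite cutoff1 // mulr1.
 rewrite (We_supp n0 G KK LK) // mulr_ge0 //; last by have /andP[] := cutoff_bnd c (2*rho) y.
 exact: (le_trans (We_ge0 n0 G c KK rho0 one01 y (ep j)) Wb).
Qed.
End Weak2.

(** * The essential upper limit *)

Section Hat.
Variables (R : realType) (m : nat).
Notation V := 'rV[R]_m.
Implicit Types f : V -> R.

Definition ubd f (z : V) (r t : R) := AE y, `|z-y| < r -> f y <= t.

(* The essential limsup of [f] at [z]. *)
Definition hat f (z : V) : \bar R := ereal_inf [set t%:E | t in [set t | exists2 r, 0 < r & ubd f z r t]].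

Lemma hat_le f z r t : 0 < r -> ubd f z r t -> (hat f z <= t%:E)%E.
Proof. by move=> r0 h; apply: ereal_inf_lbound; exists t=> //; exists r. Qed.

Lemma hat_lt f z M : (hat f z < M)%E -> exists r t, [/\ 0 < r, ubd f z r t & (t%:E < M)%E].
Proof.
by move=> /ereal_inf_lt[_ /= [t [r r0 ht] <-]] tM; exists r, t.
Qed.

Lemma le_hat f z (s : \bar R) : (forall r t, 0 < r -> ubd f z r t -> (s <= t%:E)%E) -> (s <= hat f z)%E.
Proof. by move=> h; apply: le_ereal_inf_tmp=> _ [t [r r0 ht] <-]; exact: h ht. Qed.

Lemma ubd_near f z r t z' : ubd f z r t -> `|z-z'| < r -> ubd f z' (r - `|z-z'|) t.
Proof.
move=> h zz; apply: filterS h=> y h hy; apply: h.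
by apply: le_lt_trans (ler_distD z' z y) _; rewrite -ltrBrDl.
Qed.

Lemma hat_usc f z M : (hat f z < M)%E -> \forall z' \near z, (hat f z' < M)%E.
Proof.
move=> /hat_lt[r [t [r0 ht tM]]]; apply: filterS (nbhsx_ballx z _ r0)=> z' /ballP hz.
by apply: le_lt_trans tM; apply: (hat_le _ (ubd_near ht hz)); rewrite subr_gt0.
Qed.

Lemma hat_meas f : measT (hat f).
Proof.
apply: (measurability _ (ErealGenInftyO.measurableE R))=> _ [_ [x ->] <-].
rewrite setTI; apply: open_meas; rewrite openE=> z /=; rewrite in_itv /= => hz.
by apply: filterS (hat_usc hz)=> z' /=; rewrite in_itv.
Qed.

(** Countably many conditions, one for each rational cube and rational level, hold together almost
    everywhere. A value of f above an essential bound near z would violate one of them. *)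
Lemma hat_ge f : AE z, ((f z)%:E <= hat f z)%E.
Proof.
pose P (i : nat) (z : V) := forall k q, unpickle i = Some (k, q) :> option (nat*rat) -> @ratcube R m k z ->
 (AE y, @ratcube R m k y -> f y <= ratr q) -> f z <= ratr q.
have h i : AE z, P i z.
 rewrite /P; case E : (unpickle i : option (nat*rat))=> [[k q]|]; last by apply: aeW.
 have [H|H] := pselect (AE y, @ratcube R m k y -> f y <= ratr q).
 by apply: filterS H=> z h k' q' [<- <-] /h.
 by apply: aeW=> z k' q' [<- <-] _ /H.
have := ae_foralln h; apply: filterS=> z hz.
apply: le_hat=> r t r0 ht; rewrite lee_fin leNgt; apply/negP=> tf.
have [q] := rat_in_itvoo tf; rewrite in_itv /= => /andP[tq qf].
have ob : open (ball z r) by exact: ball_open.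
have : ball z r z by exact: ballxx.
rewrite (open_ratcubes ob)=> -[k /= kz zk].
have := hz (pickle (k, q)) k q (pickleK _) zk; rewrite leNgt qf=> H.
suff : false by []; apply: H; apply: filterS ht=> y hy yk; apply: le_trans (ltW tq); apply: hy.
by apply/ballP; exact: kz.
Qed.
End Hat.

(** * Subsolutions agree with their essential upper limit *)

Section LemR.
Variables (R : realType) (n : nat) (n0 : (0 < n)%N).
Notation m := (n+n)%N.
Notation V := (pt R n).
Variables (S T : V -> 'M[R]_m) (L : R) (G : gell S T L) (rho : R) (c : V) (f : V -> R) (rho0 : 0 < rho) (If : Itg f) (f0 : forall y, f y <= 0) (sf : subC S (Cb c (4*rho)) f).

Let sf2 : subC S (Cb c (2*rho)) f.
Proof.
move=> w sw w0 cw; apply: sf=> // y hy; apply: cw=> hy'; apply: hy; apply: (le_trans hy').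
by rewrite ler_pM2r // ler_nat.
Qed.

Section K.
Variable K : R.
Hypotheses (KK : K0 n L <= K) (LK : L/K <= rho).

Lemma sub_mean_ae : AE z, `|c-z| < rho ->
 Itg (fun y=> f y*Pk S T K 0 z y) /\ kap (T z)*f z <= Int (fun y=> f y*Pk S T K 0 z y).
Proof.
have h1 := hK_ge0 n0 G KK rho0 LK If sf2; have h2 := Pk_ae n0 G c KK rho0 If.
apply: filterS2 h1 h2=> z h1 h2 zr; split; first exact: h2.
by rewrite -subr_ge0; exact: h1.
Qed.

(** Extended-valued, so that it is meaningful at every z; the pairing is known to be integrable for
    almost every z only. *)
Definition PK (z : V) : \bar R := (\int[lebn R m]_y (- f y*Pk S T K 0 z y)%:E)%E.

Let P0 z y : 0 <= - f y*Pk S T K 0 z y.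
Proof. by rewrite mulr_ge0 ?oppr_ge0 //; exact: (Pk0_ge0 n0 G KK). Qed.

Lemma PK_meas z : measT (fun y=> (- f y*Pk S T K 0 z y)%:E).
Proof.
apply/EFinP; apply: measurable_funM; last exact: (Pk_meas_y n0 G K z (lexx 0)).
exact: (measurable_funN (Itg_meas If)).
Qed.

Lemma PK_Itg z : Itg (fun y=> f y*Pk S T K 0 z y) -> PK z = (- Int (fun y=> f y*Pk S T K 0 z y))%:E.
Proof.
move=> I; rewrite /PK -mulN1r -(IntZ (-1) I) -Int_EFin; last exact: ItgZ.
by apply: eq_integral=> y _; rewrite mulNr mulN1r.
Qed.

(** Since s is below the essential limsup, there are points z_j -> z outside the exceptional null
    set with f z_j > s. The kernels converge off z, and Fatou, available because f <= 0 and the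
    kernel is nonnegative, carries the mean inequality to z itself. *)
Lemma PK_le z s : `|c-z| < rho -> (s%:E < hat f z)%E -> (PK z <= (kap (T z) * - s)%:E)%E.
Proof.
move=> zr sh; apply/lee_addgt0Pr=> e e0; rewrite -EFinD.
have ck : continuous (fun z=> kap (T z) * - s).
 by apply: contM; [exact: (@kap_cont _ _ n0 _ _ _ G)|move=> x; exact: cst_continuous].
have [d0 d00 hd] : exists2 d, 0 < d & forall z', `|z-z'| < d -> kap (T z') * - s < kap (T z) * - s+e /\ `|c-z'| < rho.
 have /(@cvgrPdist_lt _ _ _ (nbhs z) _ _ _) /(_ e e0) hk := ck z.
 have [d /= dp hd] : nbhs_ball z [set z' | `|kap (T z) * - s-kap (T z') * - s| < e].
 by apply/nbhs_ballP.
 exists (Num.min d (rho - `|c-z|)); first by rewrite lt_min dp subr_gt0.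
 move=> z'; rewrite lt_min=> /andP[h1 h2]; split.
 by have := hd z' ((ballP _ _ _).2 h1); rewrite /= ltr_norml=> /andP[hh _]; lra.
 by apply: le_lt_trans (ler_distD z c z') _; rewrite -ltrBrDl.
have ex (j : nat) : exists z', [/\ `|z-z'| < Num.min d0 j.+1%:R^-1, s < f z' &
 `|c-z'| < rho -> Itg (fun y=> f y*Pk S T K 0 z' y) /\ kap (T z')*f z' <= Int (fun y=> f y*Pk S T K 0 z' y)].
 apply: contrapT=> hn; have : (hat f z <= s%:E)%E; last by rewrite leNgt sh.
 apply: (@hat_le _ _ _ _ (Num.min d0 j.+1%:R^-1)); first by rewrite lt_min d00 invr_gt0 ltr0n.
 apply: filterS sub_mean_ae=> y hy zy; rewrite leNgt; apply/negP=> sy.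
 by apply: hn; exists y.
pose zj j := sval (cid (ex j)).
have zc : zj j @[j --> \oo] --> z.
 apply/(@cvgrPdist_lt _ _ _ \oo _)=> d dp.
 have /cvgrPdist_lt/(_ d dp)[N _ hN] := @cvg_harmonic R.
 exists N=> // j /hN /=; rewrite sub0r normrN ger0_norm ?invr_ge0 // => hj.
 rewrite /zj; case: cid=> z' [/= h _ _]; move: h; rewrite lt_min=> /andP[_ h].
 exact: lt_trans h hj.
have PB j : (PK (zj j) <= (kap (T z) * - s+e)%:E)%E.
 rewrite /zj; case: cid=> z' [/= h sz hz]; move: h; rewrite lt_min=> /andP[/hd[h1 h2] _].
 have [I hI] := hz h2; rewrite (PK_Itg I) lee_fin; apply: (le_trans _ (ltW h1)).
 rewrite mulrN lerN2; apply: le_trans hI; have /andP[k0 _] := kap_bnd n0 G z'.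
 by rewrite ler_pM2l // ltW.
have F := fatou (lebn R m) measurableT (fun j=> PK_meas (zj j)) (fun j y _=> (P0 (zj j) y : (0 <= (_)%:E)%E)).
apply: (@le_trans _ _ (\int[lebn R m]_y limn_einf (fun j=> (- f y*Pk S T K 0 (zj j) y)%:E))%E).
 rewrite le_eqVlt; apply/orP; left; apply/eqP; apply: ae_eq_integral=> //.
 - exact: PK_meas.
 - apply: (emeasurable_fun_cvg (fun k y=> einfs (fun j=> (- f y*Pk S T K 0 (zj j) y)%:E) k)).
 by move=> k; apply: measurable_fun_einfs=> j; exact: PK_meas.
 by move=> y _; rewrite limn_einf_lim; exact: is_cvg_einfs.
 exists [set z]; split; [|exact: lebn_point (m_gt0 n0)|].
 rewrite -[X in measurable X]setCK; apply: measurableC; apply: open_meas; apply: closed_openC.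
 exact: (@accessible_closed_set1 _ (hausdorff_accessible (@norm_hausdorff _ _))).
 move=> y /= hy; apply: contrapT=> /eqP yz; apply: hy=> _; apply: esym.
 refine (proj1 (_ : limn_einf _ = _ /\ True)); split=> //; refine (fst (cvg_limn_einf_sup _)).
 apply: cvg_EFin; first by apply: nearW.
 apply: cvgM; first exact: cvg_cst.
 by apply: (Pk_cvg G (e_ := fun=> 0) (cvg_cst _) zc); exact: (sk_gt0 G).
apply: (le_trans F); rewrite limn_einf_lim; apply: lime_le; first exact: is_cvg_einfs.
apply: nearW=> j; apply: le_trans (PB j); apply: ereal_inf_lbound; exists j=> //=.
Qed.

Lemma PK_le_fine z : `|c-z| < rho -> hat f z \is a fin_num -> (PK z <= (kap (T z) * - fine (hat f z))%:E)%E.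
Proof.
move=> zr hf; have /andP[k0 _] := kap_bnd n0 G z.
apply/lee_addgt0Pr=> e e0; rewrite -EFinD.
have := @PK_le z (fine (hat f z)-e/kap (T z)) zr.
rewrite -{2}(fineK hf) lte_fin gtrBl divr_gt0 // => /(_ isT) h; apply: (le_trans h).
by rewrite opprB mulrDr addrC mulrCA divff ?mulr1 // gt_eqF.
Qed.
End K.

Lemma hat_le0 z : (hat f z <= 0)%E.
Proof. by apply: (@hat_le _ _ f z 1 0)=> //; apply: aeW=> y _; exact: f0. Qed.
Let theta := tent c rho.
Let x (z : V) : R := theta z*(kap (T z)*Num.max 0 (fine (hat f z)-f z)).

Let x0 z : 0 <= x z.
Proof.
have /andP[k0 _] := kap_bnd n0 G z; have /andP[t0 _] := tent_bnd c z (ltW rho0).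
by rewrite mulr_ge0 // mulr_ge0 ?(ltW k0) // le_max lexx.
Qed.
Let mx : measT x.
Proof.
apply: measurable_funM; first exact: (cont_meas (@cont_tent _ _ c rho)).
apply: measurable_funM; first exact: (cont_meas (@kap_cont _ _ n0 _ _ _ G)).
apply: measurable_maxr; first exact: measurable_cst.
apply: measurable_funB; last exact: (Itg_meas If).
exact: (measT_comp (@fine_measurable R setT measurableT) (@hat_meas _ _ f)).
Qed.
Let xh K : K0 n L <= K -> L/K <= rho -> AE z, setT z -> ((x z)%:E <= (`|theta z*hK S T K f z|)%:E)%E.
Proof.
move=> KK LK; apply: filterS2 (hat_ge f) (sub_mean_ae KK LK)=> z h1 h2 _; rewrite lee_fin.
have [zr|zr] := ltP `|c-z| rho; last by rewrite /x /theta tent_out // !mul0r.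
have /andP[t0 _] := tent_bnd c z (ltW rho0).
have [I hI] := h2 zr; have /andP[k0 _] := kap_bnd n0 G z.
have hf : hat f z \is a fin_num by rewrite fin_numElt (lt_le_trans _ h1) ?ltNyr //= (le_lt_trans (hat_le0 z)) //.
have := PK_le_fine KK LK zr hf; rewrite (PK_Itg I) lee_fin mulrN lerN2=> h3.
have d0 : 0 <= fine (hat f z)-f z by rewrite subr_ge0 -lee_fin fineK.
rewrite normrM (ger0_norm t0) /x; apply: ler_wpM2l=> //.
rewrite max_r // mulrBr; apply: (le_trans _ (ler_norm _)).
by rewrite lerB.
Qed.

(** For every large K the weighted gap between [hat f] and [f] lies below theta times [hK], whose
    integral is at most A/K. The gap does not involve K, hence it is zero. *)
Lemma hat_ae : AE z, `|c-z| < rho -> hat f z = (f z)%:E.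
Proof.
pose Lam := Int (fun y=> f y*LS S (cutoff c (2*rho)) y).
have L0 : 0 < L by exact: lt_le_trans ltr01 (ge_L G).
pose A := rho*(2*L^+m.-1*(2^+(3 * m)*sqrt rho)) * `|Lam|.
have bnd K : K0 n L <= K -> L/K <= rho -> (\int[lebn R m]_z (x z)%:E <= (A/K)%:E)%E.
 move=> KK LK; have K0 : 0 < K by apply: lt_le_trans KK; apply: lt_le_trans ltr01 (K0_ge n0 G).2.
 have Ith := hK_theta n0 G c KK rho0 If.
 apply: (@le_trans _ _ (\int[lebn R m]_z (`|theta z*hK S T K f z|)%:E)%E).
 apply: (ae_ge0_le_integral measurableT _ _ _ _ (xh KK LK)).
 - by move=> z _; rewrite lee_fin.
 - by apply/EFinP.
 - pos.
 - by apply/EFinP; exact: (Itg_meas (Itg_abs Ith)).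
 have -> : (\int[lebn R m]_z (`|theta z*hK S T K f z|)%:E = \int[lebn R m]_z (theta z*hK S T K f z)%:E)%E.
 apply: ae_eq_integral=> //.
 - by apply/EFinP; exact: (Itg_meas (Itg_abs Ith)).
 - by apply/EFinP; exact: (Itg_meas Ith).
 apply: filterS (hK_ge0 n0 G KK rho0 LK If sf2)=> z hz _.
 have [zr|zr] := ltP `|c-z| rho; last by rewrite /theta tent_out // !mul0r normr0.
 have /andP[t0 _] := tent_bnd c z (ltW rho0).
 by rewrite ger0_norm // mulr_ge0 //; exact: hz.
 rewrite (Int_EFin Ith) lee_fin; apply: (le_trans (hK_small n0 G KK rho0 LK If sf)).
 apply: (@le_trans _ _ (Weps n L K rho * `|Lam|)).
 apply: ler_wpM2l; last exact: ler_norm.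
 rewrite /Weps /Cg !mulr_ge0 ?exprn_ge0 ?sqrtr_ge0 ?(ltW rho0) ?(ltW L0) // invr_ge0 ltW //.
 rewrite [leRHS](_ : _ = rho*(2*L^+m.-1*(2^+(3 * m)*sqrt rho))/K * `|Lam|); last by rewrite mulrAC.
 apply: ler_wpM2r; first exact: normr_ge0.
 have sq : sqrt (L/K) <= sqrt rho by rewrite ler_wsqrtr.
 have -> : Weps n L K rho = rho*(2*L^+m.-1*(2^+(3 * m)*sqrt (L/K)))/K.
 by rewrite /Weps /Cg; move: (2^+(3 * m)) (L^+m.-1) (sqrt (L/K)) (K^-1)=> a b d e; ring.
 rewrite ler_pM2r ?invr_gt0 // ler_pM2l // ler_pM2l ?ler_pM2l ?exprn_gt0 // mulr_gt0 // exprn_gt0 //.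
have I0 : (\int[lebn R m]_z (x z)%:E = 0)%E.
 apply/eqP; rewrite eq_le integral_ge0 ?andbT; last by move=> z _; rewrite lee_fin.
 apply/lee_addgt0Pr=> e e0; rewrite add0e.
 have A0 : 0 <= A by rewrite !mulr_ge0 ?exprn_ge0 ?(ltW rho0) ?(ltW L0).
 pose K := Num.max (K0 n L) (L/rho)+A/e.
 have Ae : 0 <= A/e by rewrite divr_ge0 // ltW.
 have K1 : K0 n L <= K by rewrite /K; apply: (@le_trans _ _ (Num.max (K0 n L) (L/rho))); rewrite ?le_max ?lexx // lerDl.
 have K2 : L/rho <= K by rewrite /K; apply: (@le_trans _ _ (Num.max (K0 n L) (L/rho))); rewrite ?le_max ?lexx ?orbT // lerDl.
 have Kp : 0 < K by apply: lt_le_trans K1; apply: lt_le_trans ltr01 (K0_ge n0 G).2.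
 apply: (le_trans (bnd K K1 _)); first by rewrite ler_pdivrMr // mulrC -ler_pdivrMr.
 rewrite lee_fin ler_pdivrMr // mulrC -ler_pdivrMr // /K.
 have M0 : 0 < Num.max (K0 n L) (L/rho) by rewrite lt_max; apply/orP; left; apply: lt_le_trans ltr01 (K0_ge n0 G).2.
 lra.
have mE : measT (EFin \o x) by exact/EFinP.
have := (ae_eq_integral_abs (lebn R m) measurableT mE).1.
rewrite (_ : (fun z=> _) = (fun z=> (x z)%:E)); last by apply/funext=> z /=; rewrite ger0_norm.
move=> /(_ I0) H; apply: filterS2 H (hat_ge f)=> z h1 h2 zr.
have {}h1 : x z = 0 by have := h1 I=> -[].
have hf : hat f z \is a fin_num by rewrite fin_numElt (lt_le_trans _ h2) ?ltNyr //= (le_lt_trans (hat_le0 z)) //.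
apply/eqP; rewrite eq_le h2 andbT -(fineK hf) lee_fin leNgt; apply/negP=> fz.
have /andP[k0 _] := kap_bnd n0 G z.
have t0 : 0 < theta z by rewrite /theta tent_in ?subr_gt0 // ltW.
have : 0 < x z by rewrite mulr_gt0 // mulr_gt0 // lt_max subr_gt0 fz orbT.
lra.
Qed.
End LemR.

(** * Smooth approximation of the coefficients *)

Section Approx.
Variables (R : realType).

Lemma unif_cont k (h : 'rV[R]_k -> R) C : compact C -> continuous h -> supp C h -> forall t, 0 < t ->
 exists2 d, 0 < d & forall y z, `|y-z| < d -> `|h y-h z| <= t.
Proof.
move=> cC ch sh t t0.
pose P (d : R) (y : 'rV[R]_k) := forall z, `|y-z| < d -> `|h y-h z| <= t.
have : \forall d \near (0 : R)^'+, C `<=` P d.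
 apply: ((compact_near_coveringP C).1 cC)=> x Cx.
 have t20 : 0 < t/2 by rewrite divr_gt0.
 have /cvgrPdist_lt/(_ _ t20) := ch x; move=> /nbhs_ballP[r /= r0 hr].
 have r20 : 0 < r/2 by rewrite divr_gt0.
 exists (ball x (r/2), [set d | d < r/2]); first split=> /=.
 - exact: nbhsx_ballx.
 - exact: nbhs_right_lt.
 move=> [y d] /= [/ballP xy dr] z yz.
 have h1 : `|h x-h y| < t/2 by apply: hr; apply/ballP; apply: lt_le_trans xy _; lra.
 have h2 : `|h x-h z| < t/2.
 by apply: hr; apply/ballP; apply: le_lt_trans (ler_distD y x z) _; lra.
 apply: ltW; apply: le_lt_trans (ler_distD (h x) (h y) (h z)) _; rewrite distrC; lra.
move=> H; have [d [d0 hd]] : exists d, 0 < d /\ C `<=` P d.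
 near (0 : R)^'+ => d; exists d; split; first pos.
 by near: d.
exists d=> // y z yz; have [Cy|Cy] := pselect (C y); first exact: hd.
have [Cz|Cz] := pselect (C z); first by rewrite distrC; apply: (hd z)=> //; rewrite distrC.
by rewrite sh // (sh z) // subrr normr0 ltW.
Unshelve. all: by end_near. Qed.

Lemma psmv_cutoffz k r : psmv (fun z y : 'rV[R]_k=> cutoff z r y).
Proof.
apply: (@psm_prod _ _ _ _ _ _ _ (fun i (z y : 'rV[R]_k)=> chi ((y 0 i-z 0 i)^+2/r^+2)))=> i.
have pu : psmv (fun (z y : 'rV[R]_k)=> (y 0 i-z 0 i)^+2/r^+2).
 have pc : psmv (fun (z y : 'rV[R]_k)=> y 0 i-z 0 i).
 by apply: psm_sub; [exact: psmv_coord|apply: psm_param; exact: coord_continuous].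
 rewrite (_ : (fun _ _=> _) = (fun (z y : 'rV[R]_k)=> (y 0 i-z 0 i)*(y 0 i-z 0 i)*(r^+2)^-1)) //.
 by apply: psm_mul; [exact: psm_mul|exact: psm_cst].
have p1 : psmv (fun (z y : 'rV[R]_k)=> bt 0 (4-(y 0 i-z 0 i)^+2/r^+2)).
 apply: (@psm_comp _ _ _ _ _ setT (bt 0) _ (@smooth1_bt R 0))=> //.
 by apply: psm_sub=> //; exact: psm_cst.
apply: psm_mul=> //.
apply: (@psm_comp _ _ _ _ _ (@pos R) (fun t : R=> t ^- 1) _ (@smooth1_invn R 1)).
 apply: psm_add=> //; apply: (@psm_comp _ _ _ _ _ setT (bt 0) _ (@smooth1_bt R 0))=> //.
 by apply: psm_sub=> //; exact: psm_cst.
by move=> x y _; exact: chi_den.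
Qed.

Lemma cutoff_sym k (y z : 'rV[R]_k) r : cutoff z r y = cutoff y r z.
Proof. by rewrite /cutoff; apply: eq_bigr=> i _; rewrite -(sqrrN (z 0 i-y 0 i)) opprB. Qed.

Lemma cutoff_shift k (y z : 'rV[R]_k) r : cutoff y r z = cutoff 0 r (z-y).
Proof. by rewrite /cutoff; apply: eq_bigr=> i _; rewrite !mxE subr0. Qed.

Lemma cutoff_cont k (c : 'rV[R]_k) r : continuous (cutoff c r).
Proof.
have /cont_slice[_ h] := psmv_continuous (psmv_cutoff R^o c r).
by move=> x; exact: (h (0 : R^o) x).
Qed.

Lemma cutoff_itg k (c : 'rV[R]_k) r : 0 < r -> Itg (cutoff c r).
Proof. by move=> r0; apply: (cont_Itg (@compact_cball _ _ c (2*r)) (@cutoff_cont _ c r)); exact: supp_cutoff. Qed.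

Lemma cutoff_mass k r : 0 < r -> 0 < Int (cutoff (0 : 'rV[R]_k) r).
Proof.
move=> r0; have mb : measurable (ball (0 : 'rV[R]_k) r) by apply: open_meas; exact: ball_open.
have mi : measT (\1_(ball (0 : 'rV[R]_k) r) : 'rV[R]_k -> R) by [].
have I1 : Itg (\1_(ball (0 : 'rV[R]_k) r) : 'rV[R]_k -> R).
 apply: (Itg_le mi (cutoff_itg 0 r0))=> x; rewrite indicE.
 case: (boolP (x \in _))=> [|_]; last by rewrite normr0; have /andP[] := cutoff_bnd 0 r x.
 by rewrite inE=> /ballP h; rewrite cutoff1 ?normr1 // ltW.
have le : Int (\1_(ball (0 : 'rV[R]_k) r) : 'rV[R]_k -> R) <= Int (cutoff (0 : 'rV[R]_k) r).
 apply: (Int_le I1 (cutoff_itg 0 r0))=> x; rewrite indicE.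
 case: (boolP (x \in _))=> [|_]; last by have /andP[] := cutoff_bnd 0 r x.
 by rewrite inE=> /ballP h; rewrite cutoff1 // ltW.
apply: lt_le_trans le; have := Int_EFin I1; rewrite integral_indic // setIT.
move=> H; have := lebn_ball (0 : 'rV[R]_k) r0; move=> H'; have := etrans (esym H') H=> -[<-].
pos.
Qed.

Lemma smooth_approx n (h : pt R n -> R) C t : compact C -> continuous h -> supp C h -> 0 < t ->
 exists2 hs, smooth hs & forall y, `|hs y-h y| <= t.
Proof.
move=> cC ch sh t0; have [d d0 hd] := unif_cont cC ch sh t0.
pose r := d/3; have r0 : 0 < r by rewrite divr_gt0.
pose M := Int (cutoff (0 : pt R n) r); have M0 : 0 < M by exact: cutoff_mass.
have Ih : Itg h := cont_Itg cC ch sh.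
have [B B0 hB] := compact_box cC.
have hf z : B+1 <= `|z| -> h z = 0.
 by move=> hz; apply: sh=> /hB hz'; have := le_trans hz hz'; rewrite gerDl ler10.
have ps := @psmv_int _ _ _ _ _ Ih hf R^o _ (psmv_cutoffz _ r).
have sm := psmv_smooth (0 : R^o) ps.
exists (fun y=> M^-1*Int (fun z=> h z*cutoff z r y)); first exact: smooth_scale.
move=> y.
have Ic : Itg (fun z=> cutoff z r y).
 by apply: (Itg_ext (fun z=> cutoff_sym y z r)); exact: cutoff_itg.
have I1 : Itg (fun z=> h z*cutoff z r y) := Itg_param Ih hf y (psmv_cutoffz _ r).
have E : Int (fun z=> cutoff z r y) = M.
 rewrite (eq_Int (fun z=> cutoff_sym y z r)) (eq_Int (fun z=> cutoff_shift y z r)).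
 by rewrite (@Int_shift _ _ (- y) (cutoff 0 r)) //; exact: (Itg_meas (cutoff_itg 0 r0)).
have -> : M^-1*Int (fun z=> h z*cutoff z r y)-h y = M^-1*Int (fun z=> h z*cutoff z r y-h y*cutoff z r y).
 by rewrite (IntB I1 (ItgZ _ Ic)) (IntZ _ Ic) E mulrBr (mulrCA M^-1) mulVf ?mulr1 // gt_eqF.
rewrite normrM ger0_norm ?invr_ge0 ?(ltW M0) // ler_pdivrMl // -E.
have I2 := ItgB I1 (ItgZ (h y) Ic).
apply: (le_trans (Int_abs I2)); rewrite mulrC -(IntZ t Ic).
apply: (Int_le (Itg_abs I2) (ItgZ t Ic))=> z; rewrite -mulrBl normrM.
have /andP[c0 _] := cutoff_bnd z r y; rewrite (ger0_norm c0).
have [zy|zy] := ltP `|z-y| d; first by apply: ler_wpM2r=> //; exact: hd.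
rewrite cutoff0 ?mulr0 //; apply: le_trans zy; rewrite /r; lra.
Qed.
End Approx.

Lemma smooth_cst (R : realType) n (a : R) : smooth (fun _ : pt R n=> a).
Proof. by apply: (@psmv_smooth _ _ R^o (fun _ _=> a) 0); exact: psm_cst. Qed.

Section Seqs.
Variables (R : realType) (n : nat) (n0 : (0 < n)%N).
Notation m := (n+n)%N.
Notation V := (pt R n).
Variables (S T : V -> 'M[R]_m) (L : R) (G : gell S T L) (c : V) (r : R) (r0 : 0 < r).

Definition sq (x : V) : R := \sum_i x 0 i^+2.

Lemma sq_ge x : `|x|^+2 <= sq x.
Proof.
have sq0 i : 0 <= x 0 i^+2 by exact: sqr_ge0.
have s0 : 0 <= sq x by exact: sumr_ge0.
suff h : `|x| <= sqrt (sq x) by rewrite -(sqr_sqrtr s0) lerXn2r ?nnegrE.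
apply: norm_le_coord; first exact: sqrtr_ge0.
move=> i; rewrite -sqrtr_sqr ler_wsqrtr // /sq (bigD1 i) //= lerDl; exact: sumr_ge0.
Qed.

Lemma sq_le x : sq x <= m%:R * `|x|^+2.
Proof.
have -> : m%:R * `|x|^+2 = \sum_(i < m) `|x|^+2 by rewrite sumr_const card_ord mulr_natl.
apply: ler_sum=> i _; rewrite -real_normK ?num_real // lerXn2r ?nnegrE //; exact: coord_norm.
Qed.

Lemma qfDm (M N : 'M[R]_m) x : qf (M+N) x x = qf M x x+qf N x x.
Proof.
rewrite /qf -big_split; apply: eq_bigr=> i _; rewrite -big_split; apply: eq_bigr=> j _.
by rewrite !mxE !mulrDl.
Qed.

Lemma qf_scal (a : R) x : qf (a%:M : 'M[R]_m) x x = a*sq x.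
Proof.
rewrite /qf /sq mulr_sumr; apply: eq_bigr=> i _; rewrite (bigD1 i) //= big1 ?addr0.
 by rewrite !mxE eqxx mulrA.
by move=> j ji; rewrite !mxE eq_sym (negbTE ji) !mul0r.
Qed.

(** A kernel frozen at the variable y must be smooth in y, while [T] is only Lipschitz. Adding 2t
    times the identity to an approximation with error t makes the error one-sided, between t and 3t,
    so that suitable choices form a monotone sequence. *)
Lemma approx_T t : 0 < t -> t <= 1 -> exists Q : V -> 'M[R]_m, [/\ (forall i j, smooth (fun y=> Q y i j)),
 (forall y i j, Q y i j = Q y j i), (forall y x, 0 <= qf (Q y) x x),
 (forall y i j, `|c-y| <= r -> `|Q y i j-T y i j| <= 3*t) &
 (forall y x, `|c-y| <= r -> qf (T y) x x+t*sq x <= qf (Q y) x x <= qf (T y) x x+3*t*sq x)].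
Proof.
move=> t0 t1; have m1 : 1 <= m%:R :> R by rewrite ler1n (m_gt0 n0).
pose d := t/m%:R^+2; have d0 : 0 < d by rewrite divr_gt0 // exprn_gt0 // (lt_le_trans ltr01).
have dt : d <= t by rewrite ler_pdivrMr ?exprn_gt0 ?(lt_le_trans ltr01) // ler_peMr ?(ltW t0) // expr_ge1 //.
have ex i j : exists hs, smooth hs /\ forall y, `|hs y-cutoff c r y*T y i j| <= d.
 have [||hs sh hh] := @smooth_approx R n (fun y=> cutoff c r y*T y i j) (Cb c (2*r)) d (@compact_cball _ _ c (2*r)) _ _ d0.
 - apply: contM; first exact: cutoff_cont.
 by move=> x; exact: (ge_Tc G).
 - by move=> y hy; rewrite supp_cutoff // mul0r.
 - by exists hs.
pose hs i j := sval (cid (ex i j)).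
have hs1 i j : smooth (hs i j) by rewrite /hs; case: cid=> f [].
have hs2 i j y : `|hs i j y-cutoff c r y*T y i j| <= d by rewrite /hs; case: cid=> f [] /= _; exact.
pose Q0 y : 'M[R]_m := \matrix_(i, j) (2^-1*hs i j y+2^-1*hs j i y).
have Q0d y i j : `|Q0 y i j-cutoff c r y*T y i j| <= d.
 have -> : Q0 y i j-cutoff c r y*T y i j = 2^-1*(hs i j y-cutoff c r y*T y i j)+2^-1*(hs j i y-cutoff c r y*T y j i).
 by rewrite mxE (ge_Tsym G y j i); field.
 apply: (le_trans (ler_normD _ _)); rewrite !normrM ger0_norm ?invr_ge0 //.
 by have := hs2 i j y; have := hs2 j i y; lra.
pose Q y : 'M[R]_m := Q0 y+(2*t)%:M.
have qd y x : `|qf (Q0 y) x x-cutoff c r y*qf (T y) x x| <= t*sq x.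
 have -> : qf (Q0 y) x x-cutoff c r y*qf (T y) x x = qf (Q0 y-cutoff c r y *: T y) x x.
 rewrite qfDm; congr (_+_); rewrite /qf mulr_sumr -sumrN; apply: eq_bigr=> i _.
 by rewrite mulr_sumr -sumrN; apply: eq_bigr=> j _; rewrite !mxE; ring.
 apply: (le_trans (qf_bound (B := d) _ _ _)); first by move=> i j; rewrite !mxE; have := Q0d y i j; rewrite mxE.
 rewrite /d mulrCA divff ?mulr1; last by rewrite expf_neq0 // gt_eqF // (lt_le_trans ltr01).
 by rewrite -mulrA ler_pM2l // sq_ge.
have sq0 x : 0 <= sq x by apply: sumr_ge0=> i _; exact: sqr_ge0.
exists Q; split.
- move=> i j; rewrite (_ : (fun y=> _) = (fun y=> 1*(2^-1*hs i j y+2^-1*hs j i y)+(2*t *+ (i == j))*(1 : R))).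
 apply: smooth_lin; first exact: smooth_lin.
 exact: smooth_cst.
 by apply/funext=> y; rewrite !mxE mul1r mulr1.
- by move=> y i j; rewrite !mxE (eq_sym i) (addrC (2^-1*hs i j y)).
- move=> y x; rewrite qfDm qf_scal; have := qd y x; rewrite ler_norml=> /andP[h _].
 have : 0 <= cutoff c r y*qf (T y) x x.
 by rewrite mulr_ge0 ?(ge_Tge0 G) //; have /andP[] := cutoff_bnd c r y.
 have := mulr_ge0 (ltW t0) (sq0 x); move: h; lra.
- move=> y i j yr; have := Q0d y i j; rewrite cutoff1 // mul1r=> h.
 have -> : Q y i j-T y i j = (Q0 y i j-T y i j)+2*t *+ (i == j) by rewrite !mxE; ring.
 apply: (le_trans (ler_normD _ _)).
 have : `|2*t *+ (i == j)| <= 2*t.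
 by case: (i == j); rewrite ?ger0_norm // mulr_ge0 // ltW.
 lra.
move=> y x yr; rewrite qfDm qf_scal; have := qd y x; rewrite cutoff1 // mul1r ler_norml=> /andP[h1 h2].
by apply/andP; split; move: h1 h2; rewrite -!mulrA; lra.
Qed.

Lemma approx_b t : 0 < t -> exists b : V -> R, smooth b /\
 forall y, `|c-y| <= r -> (kap (T y))^-1-3*t <= b y <= (kap (T y))^-1-t.
Proof.
move=> t0.
have ck : continuous (fun y=> (kap (T y))^-1).
 apply: contV; first exact: (@kap_cont _ _ n0 _ _ _ G).
 by move=> y; have /andP[h _] := kap_bnd n0 G y; rewrite gt_eqF.
have [||hs sh hh] := @smooth_approx R n (fun y=> cutoff c r y*(kap (T y))^-1) (Cb c (2*r)) t (@compact_cball _ _ c (2*r)) _ _ t0.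
- by apply: contM; [exact: cutoff_cont|exact: ck].
- by move=> y hy; rewrite supp_cutoff // mul0r.
exists (fun y=> 1*hs y+(- 2*t)*(1 : R)); split.
 apply: smooth_lin=> //; exact: smooth_cst.
move=> y yr; have := hh y; rewrite cutoff1 // !mul1r ler_norml=> /andP[h1 h2].
lra.
Qed.
End Seqs.
Lemma bern (R : realType) (k : nat) (d : R) : 0 <= d -> (1+d)^+k*(1-k%:R * d) <= 1.
Proof.
move=> d0; elim: k=> [|k IH]; first lra.
apply: le_trans IH; rewrite exprSr -mulrA; apply: ler_wpM2l; first pos.
have k0 : 0 <= k%:R :> R by [].
rewrite -natr1; have := mulr_ge0 k0 (sqr_ge0 d); have := sqr_ge0 d; rewrite expr2; nra.
Qed.

(** * Kernels frozen at the pole against kernels frozen at the variable *)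

Section Compare.
Variables (R : realType) (n : nat) (n0 : (0 < n)%N).
Notation m := (n+n)%N.
Notation V := (pt R n).

(** [C0c] bounds the relative change of the form over a distance L sqrt s, per unit of sqrt s. [Cc]
    counts it n+2 times, n+1 for the ratio of the masses and once for the argument, and [Ac] is the
    increment required by [FK_compare]. *)
Definition C0c (L : R) : R := m%:R^+2*L^+3.
Definition Cc (L : R) : R := n.+2%:R*C0c L.
Definition Ac (L : R) : R := Cc L+2 * n.+1%:R*Cc L.

Variables (S T : V -> 'M[R]_m) (L : R) (G : gell S T L).

Let L1 := ge_L G.
Let L0 : 0 < L. Proof. exact: lt_le_trans ltr01 L1. Qed.

Lemma C0_ge0 : 0 <= C0c L.
Proof. pos. Qed.

Lemma Cc_ge : n.+1%:R*C0c L+C0c L = Cc L /\ 0 <= Cc L /\ C0c L <= Cc L /\ n.+1%:R*C0c L <= Cc L.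
Proof.
have h := C0_ge0; have E : n.+1%:R*C0c L+C0c L = Cc L by rewrite /Cc -[n.+2%:R]natr1 mulrDl mul1r.
have p : 0 <= n.+1%:R*C0c L by rewrite mulr_ge0.
lra.
Qed.

Definition dd (x : V) : R := m%:R^+2*(L * `|x|)*L.

Lemma dd_ge0 x : 0 <= dd x.
Proof. pos. Qed.

Lemma dd_le x s : `|x| <= L*s -> dd x <= C0c L*s.
Proof.
move=> h; rewrite /dd /C0c (_ : m%:R^+2*L^+3*s = m%:R^+2*(L*(L*s))*L); last first.
 lra.
by rewrite ler_pM2r //; apply: ler_wpM2l; [rewrite exprn_ge0|rewrite ler_pM2l].
Qed.

Lemma qf_dd z z' v : qf (T z) v v <= (1+dd (z-z'))*qf (T z') v v.
Proof. exact: (@qf_near _ _ n0 L (T z) (T z') (L * `|z-z'|) v L0 (ge_posl G z') (ge_Tlip G z z')). Qed.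

Lemma kap_dd z z' : kap (T z') <= (1+dd (z-z'))^+n.+1*kap (T z).
Proof. by apply: (kap_cmp n0 L1 (ge_posl G z) (ge_posl G z') (dd_ge0 _))=> x; exact: qf_dd. Qed.

Lemma ddC x y : dd (x-y) = dd (y-x).
Proof. by rewrite /dd distrC. Qed.

Lemma posl_sqrt (Q : 'M[R]_m) x (s : R) : posl L Q -> qf Q x x <= s -> `|x| <= L*sqrt s.
Proof.
move=> p h; have q0 := qf_ge0 x L0 p; have s0 : 0 <= s by exact: le_trans h.
rewrite -(@ler_pXn2r _ 2) ?nnegrE ?mulr_ge0 ?sqrtr_ge0 ?(ltW L0) // exprMn sqr_sqrtr //.
apply: (le_trans (p x)); apply: (@le_trans _ _ (L*s)); first by rewrite ler_pM2l.
by apply: ler_wpM2r=> //; rewrite ler_peMl // ltW.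
Qed.

(** The ratio of the masses costs a factor (1+d)^(n+1), where d is the relative change of the form;
    the factor 1 - Cc sqrt s gained in [FK_compare] compensates it through [bern]. *)
Lemma cmp_up K K1 z y (Q : 'M[R]_m) b e e1 : 0 < K1 -> K1+Ac L <= K -> 0 < e -> e <= e1 ->
 (forall v, qf (T y) v v <= qf Q v v) -> 0 <= b -> b <= (kap (T y))^-1 ->
 kap (T z)*(b*FK n K (qf Q (y-z) (y-z)+e1^+2)) <= FK n K1 (qf (T z) (y-z) (y-z)+e^+2).
Proof.
move=> K10 KK e0 ee hQ b0 hb; have [C1 [C2 [C3 C4]]] := Cc_ge.
have A0 : 0 <= 2 * n.+1%:R*Cc L by rewrite mulr_ge0.
have K0 : 0 < K by move: KK A0; rewrite /Ac; lra.
have CK : Cc L <= K by move: KK A0; rewrite /Ac; lra.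
have e10 : 0 < e1 := lt_le_trans e0 ee.
have qT := ge_Tge0 G; have qQ v : 0 <= qf Q v v := le_trans (qT y v) (hQ v).
set x := y-z; set s1 := qf Q x x+e1^+2; set s2 := qf (T z) x x+e^+2.
have s10 : 0 < s1 by rewrite ltr_wpDl ?exprn_gt0.
have s20 : 0 < s2 by rewrite ltr_wpDl ?exprn_gt0.
have u0 : 0 < sqrt s1 by rewrite sqrtr_gt0.
have /andP[k0 _] := kap_bnd n0 G z; have /andP[k1 _] := kap_bnd n0 G y.
have F2 : 0 <= FK n K1 s2 by exact: FK_ge0.
have [h|h] := leP 1 (K*sqrt s1).
 rewrite FK0 ?mulr0 ?mulr0 // -(sqr_sqrtr (ltW s10)) -exprVn lerXn2r ?nnegrE ?invr_ge0 ?(ltW K0) ?(ltW u0) //.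
 by rewrite -[leLHS]mul1r ler_pdivrMr // mulrC.
have cs : Cc L*sqrt s1 <= 1 by apply: le_trans (ltW h); apply: ler_wpM2r=> //; exact: ltW.
have hx : `|x| <= L*sqrt s1.
 apply: (posl_sqrt (ge_posl G y)); apply: (le_trans (hQ x)); rewrite /s1 lerDl; exact: sqr_ge0.
have d0 := dd_ge0 x; have dl := dd_le hx.
have ss : s2 <= s1*(1+Cc L*sqrt s1).
 have h1 : qf (T z) x x <= (1+dd x)*qf Q x x.
 apply: (le_trans (qf_dd z y x)); rewrite ddC -/x; apply: ler_wpM2l; [exact: addr_ge0|exact: hQ].
 have h2 : dd x <= Cc L*sqrt s1 by apply: (le_trans dl); apply: ler_wpM2r=> //; exact: ltW.
 have h3 : e^+2 <= e1^+2 by rewrite lerXn2r ?nnegrE // ltW.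
 have h4 : 0 <= e1^+2 by exact: sqr_ge0.
 rewrite mulrC; apply: (@le_trans _ _ ((1+dd x)*s1)).
 rewrite /s2 /s1 mulrDr; apply: lerD=> //; apply: (le_trans h3).
 by rewrite ler_peMl // lerDl.
 by apply: ler_wpM2r; [exact: ltW|rewrite lerD2l].
have F1 := FK_compare n0 C2 K10 KK s10 s20 ss cs.
have kb : kap (T z)*b <= (1+dd x)^+n.+1.
 apply: (@le_trans _ _ (kap (T z)*(kap (T y))^-1)); first by rewrite ler_pM2l.
 by rewrite ler_pdivrMr //; exact: kap_dd.
rewrite mulrA; apply: (@le_trans _ _ ((1+dd x)^+n.+1*((1-Cc L*sqrt s1)*FK n K1 s2))).
 have b0' : 0 <= kap (T z)*b by rewrite mulr_ge0 // ltW.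
 exact: (ler_pM b0' (FK_ge0 n K0 s10) kb F1).
rewrite mulrA -[leRHS]mul1r; apply: ler_wpM2r=> //.
apply: le_trans (bern n.+1 d0); apply: ler_wpM2l; first pos.
rewrite lerD2l lerN2; apply: (@le_trans _ _ (n.+1%:R*(C0c L*sqrt s1))); first by apply: ler_wpM2l.
by rewrite mulrA; apply: ler_wpM2r=> //; exact: ltW.
Qed.

(** Converse of [cmp_up], with the larger constant on the kernel frozen at the pole. Near the pole
    only sqrt s >= e is available, so the smoothing error t has to be small against e, once for the
    argument and once for the mass. *)
Lemma cmp_low K K1 z y (Q : 'M[R]_m) b e t : 0 < K -> L <= K1 -> K+Ac L <= K1 -> 0 < e -> 0 < t ->
 t^+2+3*t * m%:R <= e^+2 -> 3*t*kmax n L <= C0c L*e ->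
 (forall v, 0 <= qf Q v v) -> (forall v, qf Q v v <= qf (T y) v v+3*t*sq v) -> (kap (T y))^-1-3*t <= b -> 0 <= b ->
 FK n K1 (qf (T z) (y-z) (y-z)+e^+2) <= kap (T z)*(b*FK n K (qf Q (y-z) (y-z)+t^+2)).
Proof.
move=> K0 LK1 KK e0 t0 te tk Q0 hQ hb b0; have [C1 [C2 [C3 C4]]] := Cc_ge.
have A0 : 0 <= 2 * n.+1%:R*Cc L by rewrite mulr_ge0.
have K10 : 0 < K1 by exact: lt_le_trans LK1.
have CK : Cc L <= K1 by move: KK A0; rewrite /Ac; lra.
have qT := ge_Tge0 G.
set x := y-z; set s1 := qf (T z) x x+e^+2; set s2 := qf Q x x+t^+2.
have s10 : 0 < s1 by rewrite ltr_wpDl ?exprn_gt0.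
have s20 : 0 < s2 by rewrite ltr_wpDl ?exprn_gt0.
have u0 : 0 < sqrt s1 by rewrite sqrtr_gt0.
have /andP[k0 kz] := kap_bnd n0 G z; have /andP[k1 _] := kap_bnd n0 G y.
have F2 : 0 <= FK n K s2 by exact: FK_ge0.
have hx : `|x| <= L*sqrt s1.
 apply: (posl_sqrt (ge_posl G z)); rewrite /s1 lerDl; exact: sqr_ge0.
have d0 := dd_ge0 x; have dl := dd_le hx.
have eu : e <= sqrt s1.
 by rewrite -[leLHS](ger0_norm (ltW e0)) -sqrtr_sqr ler_wsqrtr // lerDr.
have kb : 1-Cc L*sqrt s1 <= kap (T z)*b.
 apply: (@le_trans _ _ (kap (T z)*((kap (T y))^-1-3*t))); last by rewrite ler_pM2l.
 have h1 : 1-n.+1%:R * dd x <= kap (T z)*(kap (T y))^-1.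
 rewrite ler_pdivlMr //; have := kap_dd z y; rewrite ddC -/x=> h1.
 have p0 : 0 < (1+dd x)^+n.+1 by rewrite exprn_gt0 // ltr_wpDr.
 rewrite -(ler_pM2l p0); apply: le_trans h1; rewrite mulrA -[leRHS]mul1r.
 by rewrite ler_pM2r //; exact: bern.
 have h2 : kap (T z)*(3*t) <= C0c L*sqrt s1.
 apply: (@le_trans _ _ (C0c L*e)); last by apply: ler_wpM2l=> //; exact: C0_ge0.
 by apply: le_trans tk; rewrite mulrC ler_pM2l // mulr_gt0.
 have h3 : n.+1%:R * dd x <= n.+1%:R*(C0c L*sqrt s1) by apply: ler_wpM2l.
 rewrite mulrBr -C1 mulrDl -mulrA; lra.
have [h|h] := leP 1 (K1*sqrt s1).
 rewrite FK0 //; first by rewrite mulr_ge0 ?(ltW k0) // mulr_ge0.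
 rewrite -(sqr_sqrtr (ltW s10)) -exprVn lerXn2r ?nnegrE ?invr_ge0 ?(ltW K10) ?(ltW u0) //.
 by rewrite -[leLHS]mul1r ler_pdivrMr // mulrC.
have cs : Cc L*sqrt s1 <= 1 by apply: le_trans (ltW h); apply: ler_wpM2r=> //; exact: ltW.
have x1 : `|x| <= 1.
 apply: (le_trans hx); apply: le_trans (ltW h); apply: ler_wpM2r=> //; exact: ltW.
have ss : s2 <= s1*(1+Cc L*sqrt s1).
 have h1 : qf Q x x <= (1+dd x)*qf (T z) x x+3*t * m%:R.
 apply: (le_trans (hQ x)); apply: lerD; first exact: qf_dd.
 apply: ler_wpM2l; first pos.
 apply: (le_trans (sq_le x)); rewrite -[leRHS]mulr1; apply: ler_wpM2l=> //.
 by rewrite expr_le1.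
 have h2 : dd x <= Cc L*sqrt s1 by apply: (le_trans dl); apply: ler_wpM2r=> //; exact: ltW.
 rewrite mulrC; apply: (@le_trans _ _ ((1+dd x)*s1)).
 rewrite /s2 /s1 mulrDr; have := mulr_ge0 d0 (sqr_ge0 e); move: h1 te; lra.
 by apply: ler_wpM2r; [exact: ltW|rewrite lerD2l].
have F1 := FK_compare n0 C2 K0 KK s10 s20 ss cs.
apply: (le_trans F1); rewrite mulrA; exact: ler_wpM2r.
Qed.

(** Here y is the pole and the operator acts in z, so [kerk_est] applies with the constant matrix
    [Q]; its entries are bounded by 4L, namely L for [T] and 3e <= 3L for the error. Only the source
    can be negative, and its first moment lets w be replaced by w y. *)
Lemma W_low K e (Q : 'M[R]_m) y (w : V -> R) M : K0 n (4*L) <= K -> 0 < e ->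
 (forall i j, Q i j = Q j i) -> (forall i j, `|Q i j-T y i j| <= 3*e) -> e <= 1 ->
 (forall v, qf (T y) v v <= qf Q v v) -> continuous w -> 0 <= M -> (forall z, 0 <= w z) ->
 (forall z, w z <= w y+M * `|z-y|) -> Itg (fun z=> w z*LS S (hk K e Q y) z) ->
 - ((1+8*C2 n (4*L)*e)*(w y*kap Q+M*(kmax n (4*L)*e))) <= Int (fun z=> w z*LS S (hk K e Q y) z).
Proof.
move=> KK e0 Qs Qd e1 hQ cw M0 w0 wM Iw.
have L41 : 1 <= 4*L by move: L1; lra.
have LL4 : L <= 4*L by move: L1; lra.
have L40 : 0 < 4*L by move: L1; lra.
have Kp : 0 < K.
 apply: lt_le_trans KK; rewrite /K0 mulr_gt0 ?ltr_pwDl // mulr_gt0 // /C2 mulr_gt0 ?exprn_gt0 //.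
 by rewrite mulr_gt0 // exprn_gt0 // ltr0n (m_gt0 n0).
have pQ : posl (4*L) Q.
 move=> v; apply: (le_trans (ge_posl G y v)); apply: ler_pM; [exact: ltW|exact: (ge_Tge0 G)|exact: LL4|exact: hQ].
have qQ v : 0 <= qf Q v v := qf_ge0 v L40 pQ.
have [I1 I2 I3 I4] := phik_Int n0 y (ltW Kp) e0 L41 pQ.
set c8 := 1+8*C2 n (4*L)*e.
have c0 : 0 <= c8 by rewrite /c8 addr_ge0 // !mulr_ge0 ?exprn_ge0 // ltW.
have E z : LS S (hk K e Q y) z = kerk K e (S z) Q (z-y)-phik K e Q (z-y).
 by rewrite (@LS_hk R n S K e Q y z Kp e0 Qs qQ) addrK.
have low z : - (c8 * phik K e Q (z-y)) <= LS S (hk K e Q y) z.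
 rewrite E; have s0 : 0 < qf Q (z-y) (z-y)+e^+2 by rewrite ltr_wpDl // exprn_gt0.
 have [] := @kerk_est _ _ n0 (S z) Q (T z) (z-y) (4*L) K e L41 (ge_inv G z) Qs _ _ _ (pQ _) KK (ltW e0) s0=> //.
 - by move=> i j; apply: (le_trans (ge_Sb G z i j)).
 - move=> i j; rewrite -(subrK (T y i j) (Q i j)); apply: (le_trans (ler_normD _ _)).
 by have := Qd i j; have := ge_Tb G y i j; move: e1 L1; lra.
 move=> i j; rewrite (_ : Q i j-T z i j = (Q i j-T y i j)+(T y i j-T z i j)); last lra.
 apply: (le_trans (ler_normD _ _)); have h1 := Qd i j; have h2 := ge_Tlip G y z i j.
 rewrite distrC in h2; have h3 : 0 <= L * `|z-y| by rewrite mulr_ge0 // ltW.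
 have h4 : 1*e <= L*e by rewrite ler_pM2r.
 rewrite (distrC y z) in h2.
 by rewrite mulrDr; move: h1 h2 h3 h4; rewrite (distrC (T z i j)) -!mulrA; lra.
have Ib : Itg (fun z=> c8*(w y * phik K e Q (z-y)+M*(phik K e Q (z-y) * `|z-y|))).
 by apply: ItgZ; apply: ItgD; exact: ItgZ.
have Ib' : Itg (fun z=> -1*(c8*(w y * phik K e Q (z-y)+M*(phik K e Q (z-y) * `|z-y|)))) by exact: ItgZ.
apply: (@le_trans _ _ (Int (fun z=> -1*(c8*(w y * phik K e Q (z-y)+M*(phik K e Q (z-y) * `|z-y|)))))).
 rewrite (IntZ _ Ib) (IntZ c8 (ItgD (ItgZ _ I1) (ItgZ _ I3))).
 rewrite (IntD (ItgZ _ I1) (ItgZ _ I3)) (IntZ _ I1) (IntZ _ I3) mulN1r lerN2.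
 by apply: ler_wpM2l=> //; apply: lerD; apply: ler_wpM2l.
apply: (Int_le Ib' Iw)=> z; rewrite mulN1r.
have p0 : 0 <= phik K e Q (z-y) by exact: (phik_ge0 _ _ _ L40 pQ).
apply: (@le_trans _ _ (w z * - (c8 * phik K e Q (z-y)))); last by apply: ler_wpM2l.
rewrite mulrN lerN2 mulrCA; apply: ler_wpM2l=> //.
apply: (@le_trans _ _ ((w y+M * `|z-y|) * phik K e Q (z-y))); first by apply: ler_wpM2r.
lra.
Qed.
End Compare.

Lemma far_dist (R : realType) k (c z y : 'rV[R]_k) (a b r : R) : `|c-z| <= a -> a+r <= b -> b < `|c-y| -> r <= `|y-z|.
Proof. by move=> h1 h2 h3; have := ler_distD z c y; rewrite (distrC z y); lra. Qed.

Lemma far_dist6 (R : realType) k (c z y : 'rV[R]_k) (rho : R) : 0 < rho -> `|c-z| < 6*rho -> 8*rho < `|c-y| -> rho <= `|y-z|.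
Proof. by move=> h0 h1 h2; apply: (far_dist (ltW h1) _ h2); lra. Qed.

Lemma qf_sub_sym (R : realType) k (M : 'M[R]_k) (y z : 'rV[R]_k) : qf M (y-z) (y-z) = qf M (z-y) (z-y).
Proof. by rewrite -(opprB z y) -scaleN1r qfZ mulrNN !mul1r. Qed.

(** * Enlarging a subsolution by a potential *)

Section PStep.
Variables (R : realType) (n : nat) (n0 : (0 < n)%N).
Notation m := (n+n)%N.
Notation V := (pt R n).
Variables (S T : V -> 'M[R]_m) (L : R) (G : gell S T L) (K1 rho : R) (c : V) (f : V -> R) (K1a : K0 n (4*L) <= K1) (K1b : K0 n L <= K1) (K1L : L/K1 <= rho) (rho0 : 0 < rho) (If : Itg f) (f0 : forall y, f y <= 0) (sf : subC S (Cb c (8*rho)) f).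
Hypothesis SA : forall g w, smooth g -> smooth w -> supp (Cb c (8*rho)) g ->
 Int (fun y=> g y*LS S w y) = Int (fun y=> w y*LS S g y).

(** The kernel frozen at the variable has the constant [K] and lies between two kernels frozen at
    the pole, with constants [K1] above and [K2] below, each one comparison step away. *)
Let K := K1+Ac n L.
Let K2 := K+Ac n L.
Let L1 := ge_L G.
Let L0 : 0 < L. Proof. exact: lt_le_trans ltr01 L1. Qed.
Let K1p : 0 < K1. Proof. by apply: lt_le_trans K1b; apply: lt_le_trans ltr01 (K0_ge n0 G).2. Qed.
Let LK1 : L <= K1. Proof. exact: (le_trans (K0_ge n0 G).1 K1b). Qed.

Lemma Ac_ge0 : 0 <= Ac n L.
Proof. by have [_ [h _]] := Cc_ge G; rewrite addr_ge0 // mulr_ge0. Qed.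
Let K1K : K1 <= K. Proof. by rewrite lerDl Ac_ge0. Qed.
Let KK2 : K <= K2. Proof. by rewrite lerDl Ac_ge0. Qed.
Let Kp : 0 < K. Proof. exact: lt_le_trans K1K. Qed.
Let K2p : 0 < K2. Proof. exact: lt_le_trans KK2. Qed.
Let km := kmin n L.
Let kM := kmax n L.
Let km0 : 0 < km. Proof. exact: (kmin_gt0 n0 (ltW L0)). Qed.

Lemma kap_bounds z : km <= kap (T z) <= kM.
Proof.
have /andP[_ h] := kap_bnd n0 G z; rewrite h andbT.
exact: (kap_ge n0 L1 (ge_posl G z) (ge_Tb G z)).
Qed.
Let kM0 : 0 < kM. Proof. by have /andP[h1 h2] := kap_bounds 0; apply: lt_le_trans km0 (le_trans h1 h2). Qed.

(** The ratio 4 gives 3 tau (k+1) <= tau k, so the one-sided intervals of [approx_T] and [approx_b]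
    are ordered: [Q k] decreases and [b k] increases. The first factor keeps 3 tau below 1/kM, so
    that [b k] is nonnegative. *)
Definition tau (k : nat) : R := Num.min 1 (3*kM)^-1*4 ^- k.

Lemma tau_gt0 k : 0 < tau k.
Proof. by rewrite mulr_gt0 // lt_min ltr01 invr_gt0 mulr_gt0. Qed.

Lemma tauS k : 3*tau k.+1 <= tau k.
Proof.
have h : 0 < tau k := tau_gt0 k.
have -> : tau k.+1 = tau k/4 by rewrite /tau (exprSr 4 k) (invfM (4^+k)) mulrA.
lra.
Qed.

Lemma tau_le k : tau k <= 1 /\ 3*tau k <= kM^-1.
Proof.
have q0 : 0 < (3*kM)^-1 by rewrite invr_gt0; apply: mulr_gt0=> //; exact: kM0.
have h : tau k <= Num.min 1 (3*kM)^-1.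
 rewrite /tau ler_piMr //; first by rewrite le_min ler01 (ltW q0).
 by rewrite -exprVn; apply: exprn_ile1; rewrite // invf_le1 // ler1n.
move: h; rewrite le_min=> /andP[h1 h2]; split=> //.
apply: (@le_trans _ _ (3*(3*kM)^-1)); first lra.
lra.
Qed.

Lemma tau_cvg : tau k @[k --> \oo] --> (0 : R).
Proof.
rewrite -(mulr0 (Num.min 1 (3*kM)^-1)); apply: cvgM; first exact: cvg_cst.
rewrite (_ : (fun k=> 4 ^- k) = (fun k=> 4^-1^+k) :> (nat -> R)); last by apply/funext=> k; rewrite exprVn.
by apply: cvg_expr; rewrite ger0_norm // invf_lt1 // ltr1n.
Qed.
Let r4 : 0 < 4*rho. Proof. pos. Qed.
Let r2 : 0 < 2*rho. Proof. pos. Qed.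

Definition Q k : V -> 'M[R]_m := sval (cid (approx_T n0 G c r4 (tau_gt0 k) (tau_le k).1)).
Definition b k : V -> R := sval (cid (approx_b n0 G c r4 (tau_gt0 k))).

Lemma Qsm k i j : smooth (fun y=> Q k y i j). Proof. by rewrite /Q; case: cid=> q []. Qed.
Lemma Qsym k y i j : Q k y i j = Q k y j i. Proof. by rewrite /Q; case: cid=> q []. Qed.
Lemma Qge0 k y x : 0 <= qf (Q k y) x x. Proof. by rewrite /Q; case: cid=> q []. Qed.
Lemma Qd k y i j : `|c-y| <= 4*rho -> `|Q k y i j-T y i j| <= 3*tau k.
Proof. by rewrite /Q; case: cid=> q [] /= _ _ _ h _; exact: h. Qed.
Lemma Qcmp k y x : `|c-y| <= 4*rho -> qf (T y) x x+tau k*sq x <= qf (Q k y) x x <= qf (T y) x x+3*tau k*sq x.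
Proof. by rewrite /Q; case: cid=> q [] /= _ _ _ _ h; exact: h. Qed.
Lemma bsm k : smooth (b k). Proof. by rewrite /b; case: cid=> q []. Qed.
Lemma bcmp k y : `|c-y| <= 4*rho -> (kap (T y))^-1-3*tau k <= b k y <= (kap (T y))^-1-tau k.
Proof. by rewrite /b; case: cid=> q [] /= _ h; exact: h. Qed.

Lemma sq_ge0 (x : V) : 0 <= sq x. Proof. by apply: sumr_ge0=> i _; exact: sqr_ge0. Qed.

Lemma Qge k y x : `|c-y| <= 4*rho -> qf (T y) x x <= qf (Q k y) x x.
Proof.
move=> h; have /andP[h1 _] := Qcmp k x h; apply: le_trans h1; rewrite lerDl.
by rewrite mulr_ge0 ?sq_ge0 // ltW // tau_gt0.
Qed.

Lemma Qdec k y x : `|c-y| <= 4*rho -> qf (Q k.+1 y) x x <= qf (Q k y) x x.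
Proof.
move=> h; have /andP[h1 _] := Qcmp k x h; have /andP[_ h2] := Qcmp k.+1 x h.
apply: (le_trans h2); apply: le_trans h1; rewrite lerD2l; apply: ler_wpM2r; [exact: sq_ge0|exact: tauS].
Qed.

Lemma b_ge0 k y : `|c-y| <= 4*rho -> 0 <= b k y.
Proof.
move=> h; have /andP[h1 _] := bcmp k h; apply: le_trans h1; rewrite subr_ge0.
apply: (le_trans (tau_le k).2); have /andP[k1 k2] := kap_bounds y.
by rewrite lef_pV2 ?posrE // (lt_le_trans km0).
Qed.

Lemma b_le k y : `|c-y| <= 4*rho -> b k y <= (kap (T y))^-1.
Proof. by move=> h; have /andP[_ h1] := bcmp k h; apply: (le_trans h1); rewrite gerBl ltW // tau_gt0. Qed.

Lemma b_inc k y : `|c-y| <= 4*rho -> b k y <= b k.+1 y.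
Proof.
move=> h; have /andP[_ h1] := bcmp k h; have /andP[h2 _] := bcmp k.+1 h.
by apply: (le_trans h1); apply: le_trans h2; rewrite lerD2l lerN2 tauS.
Qed.

Definition eta : V -> R := cutoff c (2*rho).
Definition F k z y : R := FK n K (qf (Q k y) (y-z) (y-z)+tau k^+2).
(** Matrix and normalisation are taken at y. As a function of z it is therefore a constant times a
    kernel with frozen matrix, which allows the operator to act in z; as a function of y it is a
    nonnegative test function that increases with k. *)
Definition A k z y : R := eta y*(b k y*F k z y).

Lemma eta_out y : ~ (`|c-y| <= 4*rho) -> eta y = 0.
Proof. by move=> h; apply: (supp_cutoff r2); rewrite /Cb /= mulrA (_ : 2*2 = 4 :> R) //; ring. Qed.
Lemma eta_bnd y : 0 <= eta y <= 1. Proof. exact: cutoff_bnd. Qed.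

Lemma arg_gt0 k z y : 0 < qf (Q k y) (y-z) (y-z)+tau k^+2.
Proof. by rewrite ltr_wpDl ?Qge0 // exprn_gt0 // tau_gt0. Qed.

Lemma F_ge0 k z y : 0 <= F k z y. Proof. exact: (FK_ge0 n Kp (arg_gt0 k z y)). Qed.

Lemma A_ge0 k z y : 0 <= A k z y.
Proof.
have /andP[e0 _] := eta_bnd y; have [h|h] := pselect (`|c-y| <= 4*rho).
 by rewrite mulr_ge0 // mulr_ge0 ?b_ge0 ?F_ge0.
by rewrite /A eta_out // mul0r.
Qed.

Lemma A_inc k z y : A k z y <= A k.+1 z y.
Proof.
have /andP[e0 _] := eta_bnd y; have [h|h] := pselect (`|c-y| <= 4*rho); last by rewrite /A eta_out // !mul0r.
apply: ler_wpM2l=> //; apply: ler_pM; [exact: b_ge0|exact: F_ge0|exact: b_inc|].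
apply: (FK_decr n Kp (arg_gt0 _ _ _)); apply: lerD; first exact: Qdec.
rewrite lerXn2r ?nnegrE ?(ltW (tau_gt0 _)) //.
by have := tauS k; have := tau_gt0 k.+1; lra.
Qed.

Lemma A_psm k : psmv (A k).
Proof.
apply: psm_mul; first exact: (psmv_cutoff _ c (2*rho)).
apply: psm_mul; first exact: (smooth_psmv _ (bsm k)).
apply: (@psm_comp _ _ _ _ _ _ (FK n K) _ (smooth1_FK n Kp)); last first.
 by move=> z y _; exact: arg_gt0.
apply: psm_add; last exact: psm_cst.
have pc i : psmv (fun (z : V) (y : V)=> (y-z) 0 i).
 rewrite (_ : (fun z y=> _) = (fun (z : V) (y : V)=> y 0 i-z 0 i)); last first.
 by apply/funext=> x; apply/funext=> y; rewrite !mxE.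
 by apply: psm_sub; [exact: psmv_coord|apply: psm_param; exact: coord_continuous].
apply: psm_sum=> i; apply: psm_sum=> j; apply: psm_mul; last exact: pc.
by apply: psm_mul; [exact: (smooth_psmv _ (Qsm k i j))|exact: pc].
Qed.

Lemma A_smooth k z : smooth (A k z). Proof. exact: (psmv_smooth z (A_psm k)). Qed.

Lemma A_supp k z : supp (Cb c (4*rho)) (A k z).
Proof. by move=> y hy; rewrite /A eta_out // mul0r. Qed.

Lemma F_far k z y : `|c-y| <= 4*rho -> L/K1 <= `|y-z| -> F k z y = 0.
Proof.
move=> h hy; apply: FK0=> //.
have h1 : qf (T y) (y-z) (y-z) <= qf (Q k y) (y-z) (y-z)+tau k^+2.
 by apply: (le_trans (Qge k (y-z) h)); rewrite lerDl sqr_ge0.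
have h2 := posl_sqrt G (ge_posl G y) h1.
have s0 := arg_gt0 k z y; have u0 : 0 <= sqrt (qf (Q k y) (y-z) (y-z)+tau k^+2) by [].
rewrite -(sqr_sqrtr (ltW s0)) -exprVn lerXn2r ?nnegrE ?invr_ge0 ?(ltW Kp) //.
rewrite -(ler_pM2l L0); apply: le_trans h2; apply: le_trans hy.
by rewrite ler_pM2l // lef_pV2.
Qed.

Lemma A_far k z y : 5*rho <= `|c-z| -> A k z y = 0.
Proof.
move=> hz; have [h|h] := pselect (`|c-y| <= 4*rho); last by rewrite /A eta_out // mul0r.
rewrite /A F_far ?mulr0 //; apply: (le_trans K1L).
by have := ler_distD y c z; lra.
Qed.

Definition LA k z y : R := LS S (A k z) y.

Lemma LA_cont k : continuous (fun q : V*V=> LA k q.1 q.2).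
Proof.
apply: (@contSum R _ _ _ (fun i (q : V*V)=> \sum_j S q.2 i j * pd i (pd j (A k q.1)) q.2))=> i.
apply: (@contSum R _ _ _ (fun j (q : V*V)=> S q.2 i j * pd i (pd j (A k q.1)) q.2))=> j.
apply: (@contM _ _ (fun q : V*V=> S q.2 i j)).
 move=> q; apply: (@continuous_comp _ _ _ (fun q : V*V=> q.2) (fun p=> S p i j)); [exact: cvg_snd|exact: (ge_Sc G)].
exact: (psmv_continuous (psmv_pd i (psmv_pd j (A_psm k)).1).1).
Qed.

Lemma LA_supp k z : supp (Cb c (4*rho)) (LA k z).
Proof. by apply: LS_supp; [exact: compact_cball|exact: A_supp]. Qed.

Lemma LA_far k z y : 5*rho <= `|c-z| -> LA k z y = 0.
Proof.
move=> h; rewrite /LA (_ : A k z = fun=> 0); last by apply/funext=> x; exact: A_far.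
rewrite /LS big1 // => i _; rewrite big1 // => j _.
by rewrite (_ : pd j _ = fun=> 0) ?pd0 ?mulr0 //; apply/funext=> x; exact: pd0.
Qed.

(** A smooth approximation of the function to be added to [f]. It is nonnegative because [A] is an
    admissible test function, and increasing in k because [A] is. *)
Definition vk k z : R := Int (fun y=> f y*LA k z y).

Lemma LA_fub k (g : V -> R) Cg : compact Cg -> continuous g -> supp Cg g ->
 Itg (fun z=> g z * vk k z) /\
 Int (fun y=> f y*Int (fun z=> g z*LA k z y)) = Int (fun z=> g z * vk k z).
Proof.
move=> cC cg sg; have Ig := cont_Itg cC cg sg.
have [r1 r10 hr1] := compact_box cC.
have [r2' r20' hr2] := compact_box (@compact_cball _ _ c (4*rho)).
have [B hB] := cont_bounded2 (r1+r2') (LA_cont (k := k)).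
have mg := Itg_meas Ig.
have bd z y : `|g z*LA k z y| <= B * `|g z|.
 have [Cz|Cz] := pselect (Cg z); last by rewrite sg // mul0r normr0 mulr0.
 rewrite normrM mulrC; apply: ler_wpM2r=> //.
 have [Cy|Cy] := pselect (Cb c (4*rho) y).
 by apply: hB; [rewrite (le_trans (hr1 _ Cz)) // lerDl ltW|rewrite (le_trans (hr2 _ Cy)) // lerDr ltW].
 rewrite (@LA_supp k z y Cy) normr0; apply: le_trans (hB z c _ _); first exact: normr_ge0.
 by rewrite (le_trans (hr1 _ Cz)) // lerDl ltW.
 by apply: (le_trans (hr2 c _)); rewrite ?lerDr ?(ltW r10) // /= subrr normr0 ltW.
have IB : Itg (fun z=> B * `|g z|) by apply: ItgZ; exact: Itg_abs.
have mLA : measT (fun q : V*V=> LA k q.1 q.2) := cont_meas2 (LA_cont (k := k)).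
have H y : Itg (fun z=> g z*LA k z y) /\ Int (fun z=> `|g z*LA k z y|) <= Int (fun z=> B * `|g z|).
 have I : Itg (fun z=> g z*LA k z y).
 apply: (Itg_le _ IB (fun z=> bd z y)); apply: measurable_funM=> //.
 exact: (measT_comp mLA (measurable_pair2 y)).
 by split=> //; apply: (Int_le (Itg_abs I) IB)=> z; exact: bd.
by have [_ J2 J3 _] := @fub_kernel _ _ f g (LA k) _ If mg mLA H; split; [exact: J2|exact: J3].
Qed.

Lemma vk_far k z : 5*rho <= `|c-z| -> vk k z = 0.
Proof. by move=> h; rewrite /vk -[RHS](@Int0 R m); apply: eq_Int=> y; rewrite LA_far // mulr0. Qed.

Lemma vk_itg k : Itg (vk k).
Proof.
have r5 : 0 < 5*rho by rewrite mulr_gt0.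
have [I _] := LA_fub k (@compact_cball _ _ c (2*(5*rho))) (@cutoff_cont _ _ c (5*rho)) (supp_cutoff r5).
apply: Itg_ext I=> z; have [h|h] := leP `|c-z| (5*rho); first by rewrite cutoff1 // mul1r.
by rewrite vk_far ?mulr0 // ltW.
Qed.

Lemma sub48 w : supp (Cb c (4*rho)) w -> supp (Cb c (8*rho)) w.
Proof.
move=> h y hy; apply: h=> hy'; apply: hy; apply: (le_trans hy').
by rewrite ler_pM2r // ler_nat.
Qed.

Lemma vk_ge0 k z : 0 <= vk k z.
Proof. by apply: sf; [exact: A_smooth|exact: A_ge0|apply: sub48; exact: A_supp]. Qed.

Lemma vk_inc k z : vk k z <= vk k.+1 z.
Proof.
apply: (subC_le G If (@compact_cball _ _ c (8*rho)) sf); try exact: A_smooth.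
- by apply: sub48; exact: A_supp.
- by apply: sub48; exact: A_supp.
- by move=> y; exact: A_inc.
Qed.

Lemma kvk_le k z e : 0 < e -> e < tau k -> `|c-z| < 6*rho -> kap (T z) * vk k z <= Me S T K1 f e z.
Proof.
move=> e0 et zr; have sA : smooth (A k z) by exact: A_smooth.
have IA := Itg_fLS G If sA (@compact_cball _ _ c (4*rho)) (@A_supp k z).
rewrite /vk -(IntZ _ IA).
have E y : kap (T z)*(f y*LS S (A k z) y) = f y*LS S (fun y=> kap (T z)*A k z y) y.
 by rewrite (LS_scale S (kap (T z)) y sA) mulrCA.
rewrite (eq_Int E) /Me.
have /andP[k0 _] := kap_bnd n0 G z.
apply: (subC_le G If (@compact_cball _ _ c (8*rho)) sf).
- exact: smooth_scale.
- exact: (psmv_smooth z (hk_psmv n0 G K1b e0)).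
- by move=> y hy; rewrite (sub48 (@A_supp k z) hy) mulr0.
- move=> y /negP; rewrite -ltNge=> hy; apply: (hk0 n0 G K1b); apply: (le_trans K1L).
 exact: (far_dist6 rho0 zr hy).
move=> y; have h0 := hk_ge0 n0 G K1b z y e0; have [h|h] := pselect (`|c-y| <= 4*rho); last first.
 by rewrite /A eta_out // mul0r mulr0.
have cu := cmp_up n0 G z K1p (lexx _) e0 (ltW et) (fun v=> Qge k v h) (b_ge0 k h) (b_le k h).
apply: le_trans cu; apply: ler_wpM2l; first exact: ltW.
have /andP[e1 e2] := eta_bnd y; rewrite /A -[leRHS]mul1r; apply: ler_wpM2r=> //.
by rewrite mulr_ge0 ?b_ge0 ?F_ge0.
Qed.

(** In the weak limit kap vk is at most [hK], the pairing with the error kernel minus kap f, and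
    that pairing is nonpositive. Hence adding vk keeps f nonpositive. *)
Lemma vk_le k : AE z, vk k z <= - f z.
Proof.
have r6 : 0 < 6*rho by rewrite mulr_gt0.
have L6 : L/K1 <= 6*rho by apply: (le_trans K1L); rewrite ler_peMl ?(ltW rho0) // ler1n.
have Ix : Itg (fun z=> tent c (6*rho) z*(kap (T z) * vk k z)).
 apply: (@Itg_le _ _ _ (fun z=> 6*rho*kM * `|vk k z|)).
 - apply: measurable_funM; first exact: (cont_meas (@cont_tent _ _ c (6*rho))).
 apply: measurable_funM; first exact: (cont_meas (@kap_cont _ _ n0 _ _ _ G)).
 exact: (Itg_meas (vk_itg k)).
 - by apply: ItgZ; apply: Itg_abs; exact: vk_itg.
 move=> z; have /andP[t0 t1] := tent_bnd c z (ltW r6).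
 have /andP[k0 k1] := kap_bnd n0 G z.
 rewrite normrM (normrM (kap _)) (ger0_norm t0) (ger0_norm (ltW k0)) mulrA.
 by apply: ler_wpM2r; [exact: normr_ge0|exact: (ler_pM t0 (ltW k0) t1 k1)].
have H := @weak_cmp _ _ n0 _ _ _ G K1 (6*rho) c f K1b r6 If 1 (fun z=> kap (T z) * vk k z) (tau k) (tau_gt0 k) Ix.
have {}H : AE z, `|c-z| < 6*rho -> 1*(kap (T z) * vk k z) <= 1*hK S T K1 f z.
 by apply: H=> e e0 et; apply: aeW=> z zr; rewrite !mul1r; exact: kvk_le.
apply: filterS H=> z H; have [zr|zr] := ltP `|c-z| (6*rho); last first.
 rewrite vk_far ?oppr_ge0 //; apply: le_trans zr; lra.
have {H} := H zr; rewrite !mul1r /hK=> H; have /andP[k0 _] := kap_bnd n0 G z.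
rewrite -(ler_pM2l k0) mulrN; apply: (le_trans H); rewrite gerDr.
have := @Int_ge0 R m (fun y=> -1*(f y*Pk S T K1 0 z y)) _.
have [I|I] := pselect (Itg (fun y=> f y*Pk S T K1 0 z y)); last first.
 rewrite (Int_nitg _ I) //; apply: measurable_funM; first exact: (Itg_meas If).
 exact: (Pk_meas_y n0 G K1 z (lexx 0)).
rewrite (IntZ _ I) mulN1r oppr_ge0; apply=> y.
by rewrite mulN1r oppr_ge0 mulr_le0_ge0 //; exact: (Pk0_ge0 n0 G K1b).
Qed.

(** The bound of [vk_le] holds almost everywhere only; the minimum makes the sequence bounded at
    every point, so that its limit exists everywhere. *)
Definition uk k z : R := Num.min (vk k z) (- f z).

Lemma uk_bnd k z : 0 <= uk k z <= - f z.
Proof. by rewrite le_min vk_ge0 oppr_ge0 f0 ge_min lexx orbT. Qed.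

Lemma uk_inc k z : uk k z <= uk k.+1 z.
Proof. by rewrite le_min !ge_min vk_inc lexx !orbT. Qed.

Lemma uk_cvg z : cvgn (fun k=> uk k z).
Proof.
apply: nondecreasing_is_cvgn; first by apply/nondecreasing_seqP=> k; exact: uk_inc.
by exists (- f z)=> _ [k _ <-]; have /andP[] := uk_bnd k z.
Qed.

Definition v z : R := limn (fun k=> uk k z).

Lemma uk_le_v k z : uk k z <= v z.
Proof.
apply: nondecreasing_cvgn_le; last exact: uk_cvg.
by apply/nondecreasing_seqP=> j; exact: uk_inc.
Qed.

Lemma v_bnd z : 0 <= v z <= - f z.
Proof.
apply/andP; split; first by apply: le_trans (uk_le_v 0 z); have /andP[] := uk_bnd 0 z.
by apply: limr_le; [exact: uk_cvg|apply: nearW=> k; have /andP[] := uk_bnd k z].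
Qed.

Lemma uk_meas k : measT (uk k).
Proof. by apply: measurable_minr; [exact: (Itg_meas (vk_itg k))|exact: (measurable_funN (Itg_meas If))]. Qed.

Lemma v_meas : measT v.
Proof. by apply: (@measurable_fun_cvg _ _ _ _ (fun k z=> uk k z))=> [k|z _]; [exact: uk_meas|exact: uk_cvg]. Qed.

Lemma v_itg : Itg v.
Proof.
apply: (Itg_le v_meas (Itg_abs If))=> z; have /andP[h1 h2] := v_bnd z.
by rewrite (ger0_norm h1) (ler0_norm (f0 z)).
Qed.

Lemma v_supp : supp (Cb c (5*rho)) v.
Proof.
move=> z /negP; rewrite -ltNge=> /ltW h; apply/eqP; rewrite eq_le; have /andP[-> _] := v_bnd z.
rewrite andbT; apply: limr_le; [exact: uk_cvg|apply: nearW=> k].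
by rewrite /uk vk_far // ge_min lexx.
Qed.

Section Test.
Variables (w : V -> R) (Cw : set V) (sw : smooth w) (w0 : forall y, 0 <= w y) (cCw : compact Cw) (suw : supp Cw w).

(** Fubini moves the operator on [w] over to f: pairing [vk k] with [LS S w] is pairing [f] with
    [LS S (Wk k)]. *)
Definition Wk k y : R := Int (fun z=> LS S w z*A k z y).

Let cLw := @LS_cont_all _ _ _ _ _ G _ sw.
Let sLw : supp Cw (LS S w). Proof. exact: LS_supp. Qed.
Let ILw : Itg (LS S w). Proof. exact: (cont_Itg cCw cLw sLw). Qed.
Let far : exists B, forall z : V, B <= `|z| -> LS S w z = 0.
Proof.
have [B B0 hB] := compact_box cCw; exists (B+1)=> z hz; apply: sLw=> /hB hz'.
lra.
Qed.

Lemma Wk_smooth k : smooth (Wk k).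
Proof.
have [B hB] := far.
exact: (psmv_smooth (0 : R^o) (@psmv_int _ _ _ _ _ ILw hB R^o _ (A_psm k))).
Qed.

Lemma Wk_supp k : supp (Cb c (4*rho)) (Wk k).
Proof.
move=> y hy; rewrite /Wk -[RHS](@Int0 R m); apply: eq_Int=> z.
by rewrite (@A_supp k z y hy) mulr0.
Qed.

Lemma Wk_vk k : Int (fun z=> vk k z*LS S w z) = Int (fun y=> f y*LS S (Wk k) y).
Proof.
have [B hB] := far.
have [_ J] := LA_fub k cCw cLw sLw.
have E z : vk k z*LS S w z = LS S w z * vk k z := mulrC _ _.
have E2 y : LS S (Wk k) y = Int (fun z=> LS S w z*LA k z y) := LS_int S y ILw hB (A_psm k).
exact: (etrans (eq_Int E) (etrans (esym J) (eq_Int (fun y=> congr1 ( *%R (f y)) (esym (E2 y)))))).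
Qed.

Lemma w_lip : exists2 M, 0 < M & (forall z, w z <= M) /\ (forall y z, w z <= w y+M * `|z-y|).
Proof.
have [B1 B10 hB1] := cpt_bounded cCw (fun x _=> smooth_cont sw (x := x)).
have [B2 B20 hB2] := cpt_boundedF cCw (fun j x _=> smooth_cont (smooth_pd j sw) (x := x)).
have p1 z : `|w z| <= B1.
 have [h|h] := pselect (Cw z); [exact: hB1|by rewrite suw // normr0 ltW].
have p2 j z : `|pd j w z| <= B2.
 have [h|h] := pselect (Cw z); [exact: hB2|by rewrite (supp_pd j cCw suw h) normr0 ltW].
have mp : 0 <= m%:R :> R by [].
exists (B1+m%:R*B2); first by rewrite ltr_pwDl // mulr_ge0 // ltW.
split=> [z|y z].
 by apply: (le_trans (ler_norm _)); apply: (le_trans (p1 z)); rewrite lerDl mulr_ge0 // ltW.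
have r0 : 0 < `|y-z| + 1 by [].
have := @lip_cube _ _ w y z (`|y-z| + 1) B2 (ltW B20) _ _.
have h1 q i : ball y (`|y-z| + 1) q -> derivable w q (delta_mx 0 i : V) /\ `|pd i w q| <= B2.
 by move=> _; split=> //; have [h _] := sw 1%N; exact: (h [::]).
have h2 : ball y (`|y-z| + 1) z by apply/ballP; rewrite ltrDl.
move=> /(_ h1 h2); rewrite (distrC y z) (distrC (w y))=> h.
have := le_trans (ler_norm _) h; rewrite lerBlDl=> h3; apply: (le_trans h3); rewrite lerD2l.
by apply: ler_wpM2r=> //; rewrite lerDr ltW.
Qed.

Lemma hk_sym k z y : F k z y = hk K (tau k) (Q k y) y z.
Proof.
by rewrite /hk qf_sub_sym.
Qed.

(** For fixed y self-adjointness in z turns [Wk k y] into eta b times the pairing of w with the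
    operator on the kernel frozen at y. [W_low] bounds this below by about -w y, since b times the
    mass is at most 1. So w + Wk is nonnegative up to a multiple of tau. *)
Lemma Wk_low : exists2 E, 0 < E & forall k y, - (eta y*(w y+E*tau k)) <= Wk k y.
Proof.
have [M M0 [wM wl]] := w_lip.
pose c8 := 8*C2 n (4*L); have c80 : 0 <= c8 by rewrite ?mulr_ge0 // ltW.
pose k4 := kmax n (4*L).
have L41 : 1 <= 4*L by move: L1; lra.
have k40 : 0 <= k4.
 have L40 : 0 < 4*L by move: L1; lra.
 rewrite /k4 /kmax mulr_ge0 // ?mulr_ge0 ?exprn_ge0 ?(ltW L40) //.
 by apply: Int_ge0=> x; exact: dom_ge0.
have p1 : 0 <= c8*M by rewrite mulr_ge0 // ltW.
have p2 : 0 <= (1+c8)*(M*k4/km).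
 by apply: mulr_ge0; [exact: addr_ge0|rewrite mulr_ge0 ?invr_ge0 ?(ltW km0) // mulr_ge0 // ltW].
exists (1+c8*M+(1+c8)*(M*k4/km))=> [|k y].
 lra.
have /andP[e0 _] := eta_bnd y.
have [h|h] := pselect (`|c-y| <= 4*rho); last by rewrite (@Wk_supp k y h) eta_out // mul0r.
have b0 := b_ge0 k h; have t0 := tau_gt0 k; have t1 := (tau_le k).1.
have qQ := Qge0 k y.
have shk : smooth (hk K (tau k) (Q k y) y) by apply: smooth_hk.
have suk : supp (Cb c (8*rho)) (hk K (tau k) (Q k y) y).
 move=> z /negP; rewrite -ltNge=> hz; rewrite -hk_sym F_far //; apply: (le_trans K1L).
 rewrite distrC; apply: (far_dist6 rho0 _ hz); apply: (le_lt_trans h).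
 by rewrite ltr_pM2r // ltr_nat.
have E1 : Wk k y = eta y*(b k y*Int (fun z=> w z*LS S (hk K (tau k) (Q k y) y) z)).
 rewrite -(SA shk sw suk).
 have I1 : Itg (fun z=> hk K (tau k) (Q k y) y z*LS S w z).
 apply: (cont_Itg cCw); first by apply: contM; [exact: smooth_cont|exact: cLw].
 by move=> z hz; rewrite (sLw hz) mulr0.
 rewrite mulrA -(IntZ _ I1); apply: eq_Int=> z.
 by rewrite /A hk_sym; move: (LS S w z) (eta y) (b k y) (hk _ _ _ _ _)=> p q r s; ring.
have Iw : Itg (fun z=> w z*LS S (hk K (tau k) (Q k y) y) z).
 apply: (cont_Itg cCw); last by move=> z hz; rewrite suw // mul0r.
 apply: contM; first exact: smooth_cont.
 exact: (@LS_cont_all _ _ _ _ _ G _ shk).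
have lo := @W_low _ _ n0 _ _ _ G K (tau k) (Q k y) y w M (le_trans K1a K1K) t0 (Qsym k y) (fun i j=> Qd k i j h) t1
 (fun x=> Qge k x h) (smooth_cont sw) (ltW M0) w0 (wl y) Iw.
rewrite E1 -mulrN; apply: ler_wpM2l=> //.
have bk : b k y*kap (Q k y) <= 1.
 have pT := ge_posl G y; have /andP[kp _] := kap_bnd n0 G y.
 have pQ : posl (4*L) (Q k y).
 move=> x; apply: (le_trans (pT x)); apply: ler_pM; [exact: ltW|exact: (ge_Tge0 G)| |exact: Qge].
 lra.
 have pT4 : posl (4*L) (T y).
 move=> x; apply: (le_trans (pT x)); apply: ler_wpM2r; first exact: (ge_Tge0 G).
 lra.
 have := @kap_cmp _ _ n0 (4*L) (T y) (Q k y) 0 L41 pT4 pQ (lexx 0) _.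
 rewrite addr0 expr1n mul1r=> hk1.
 have {}hk1 : kap (Q k y) <= kap (T y) by apply: hk1=> x; rewrite mul1r; exact: Qge.
 apply: (@le_trans _ _ ((kap (T y))^-1*kap (T y))); last by rewrite mulVf // gt_eqF.
 apply: (@le_trans _ _ (b k y*kap (T y))); first exact: ler_wpM2l.
 by rewrite ler_pM2r //; exact: b_le.
have bk2 : b k y <= km^-1.
 apply: (le_trans (b_le k h)); have /andP[h1 h2] := kap_bounds y.
 by rewrite lef_pV2 ?posrE // (lt_le_trans km0).
rewrite -/c8 -/k4 in lo.
have lo2 : - (b k y*((1+c8*tau k)*(w y*kap (Q k y)+M*(k4*tau k)))) <=
 b k y*Int (fun z=> w z*LS S (hk K (tau k) (Q k y) y) z).
 by rewrite -mulrN; apply: ler_wpM2l.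
apply: le_trans lo2; rewrite lerN2.
have wy := w0 y; have wMy := wM y.
have a1 : w y*(b k y*kap (Q k y)) <= w y by rewrite -[leRHS]mulr1; apply: ler_wpM2l.
have a2 : M*(k4*tau k)*b k y <= M*(k4*tau k)*km^-1.
 by apply: ler_wpM2l=> //; apply: mulr_ge0; [exact: ltW|rewrite mulr_ge0 // ltW].
have a3 : (1+c8*tau k)*(M*(k4*tau k)*km^-1) <= (1+c8)*(M*k4/km)*tau k.
 rewrite [leRHS](_ : _ = (1+c8)*(M*(k4*tau k)*km^-1)); last by move: km^-1=> q; ring.
 apply: ler_wpM2r; last by rewrite lerD2l ler_piMr.
 by rewrite mulr_ge0 ?invr_ge0 ?(ltW km0) // mulr_ge0 ?(ltW M0) // mulr_ge0 // ltW.
have a4 : c8*tau k*w y <= c8*M*tau k by rewrite mulrAC; apply: ler_wpM2r; [exact: ltW|apply: ler_wpM2l].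
have c0 : 0 <= 1+c8*tau k by rewrite addr_ge0 // mulr_ge0 // ltW.
have a5 : (1+c8*tau k)*(w y*(b k y*kap (Q k y))+M*(k4*tau k)*b k y) <=
 (1+c8*tau k)*(w y+M*(k4*tau k)*km^-1) by apply: ler_wpM2l=> //; exact: lerD.
rewrite [leLHS](_ : _ = (1+c8*tau k)*(w y*(b k y*kap (Q k y))+M*(k4*tau k)*b k y)); last first.
 by move: (b k y) (kap _) (tau k)=> p q s; ring.
apply: (le_trans a5); move: a3 a4 t0.
move: ((1+c8)*(M*k4/km)) (M*(k4*tau k)/km)=> p q a3 a4 t0.
by rewrite mulrDr (mulrDl 1) mul1r !(mulrDl _ _ (tau k)) mul1r; lra.
Qed.

(** The function w + W + e eta is a nonnegative test function for f; as e -> 0 this will say that f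
    + v is again a subsolution. *)
Lemma v_test e : 0 < e -> exists W, [/\ smooth W, supp (Cb c (4*rho)) W,
 (forall y, 0 <= w y+W y+e*eta y) & `|Int (fun z=> v z*LS S w z)-Int (fun y=> f y*LS S W y)| <= e].
Proof.
move=> e0; have [E E0 hE] := Wk_low.
have [B B0 hB] := LS_bnd G sw cCw suw.
have lim : Int (fun z=> uk k z*LS S w z) @[k --> \oo] --> Int (fun z=> v z*LS S w z).
 apply: (proj2 (@Int_dct _ _ (fun k z=> uk k z*LS S w z) (fun z=> v z*LS S w z) (fun z=> B * `|f z|) _ _ _ _ _)).
 - by move=> k; apply: (measurable_funM (uk_meas k)); exact: (Itg_meas ILw).
 - by apply: ItgZ; exact: Itg_abs.
 - move=> k z; have /andP[u0 u1] := uk_bnd k z; rewrite normrM mulrC.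
 by rewrite (ger0_norm u0) (ler0_norm (f0 z)); apply: ler_pM.
 - by apply: aeW=> z; apply: cvgM; [exact: uk_cvg|exact: cvg_cst].
 - by apply: (measurable_funM v_meas); exact: (Itg_meas ILw).
have c1 : \forall k \near \oo, `|Int (fun z=> v z*LS S w z)-Int (fun z=> uk k z*LS S w z)| < e.
 by move/cvgrPdist_lt: lim=> /(_ e e0).
have eE : 0 < e/E by rewrite divr_gt0.
have c2 : \forall k \near \oo, tau k < e/E.
 move/cvgrPdist_lt: tau_cvg=> /(_ _ eE); apply: filterS=> k.
 by rewrite sub0r normrN ger0_norm // ltW // tau_gt0.
have [k [k1 k2]] : exists k, `|Int (fun z=> v z*LS S w z)-Int (fun z=> uk k z*LS S w z)| < e /\ tau k < e/E.
 by near \oo=> k; exists k; split; near: k.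
exists (Wk k); split; [exact: Wk_smooth|exact: Wk_supp| |].
 move=> y; have h := hE k y; have /andP[h0 h1] := eta_bnd y; have wy := w0 y.
 have t2 : E*tau k <= e by rewrite mulrC -ler_pdivlMr // ltW.
 have t3 : eta y*(E*tau k) <= e*eta y by rewrite mulrC; exact: ler_wpM2r.
 have t4 : eta y*w y <= w y by rewrite -[leRHS]mul1r; exact: ler_wpM2r.
 lra.
have E' : Int (fun z=> vk k z*LS S w z) = Int (fun z=> uk k z*LS S w z).
 apply: ae_Int.
 - by apply: (measurable_funM (Itg_meas (vk_itg k))); exact: (Itg_meas ILw).
 - by apply: (measurable_funM (uk_meas k)); exact: (Itg_meas ILw).
 by apply: filterS (vk_le k)=> z hz; rewrite /uk min_l.
have E2 : Int (fun y=> f y*LS S (Wk k) y) = Int (fun z=> uk k z*LS S w z) := etrans (esym (Wk_vk k)) E'.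
exact: (eq_ind_r (fun t=> `|Int (fun z=> v z*LS S w z)-t| <= e) (ltW k1) E2).
Unshelve. all: by end_near. Qed.
End Test.

(** For each e an index k with tau k small against e makes [cmp_low] applicable, so kap v dominates
    the potential with constant K2, whose weak limit is the pairing minus kap f. *)
Lemma v_mean : AE z, `|c-z| < rho ->
 Int (fun y=> f y*Pk S T K2 0 z y) <= kap (T z)*(f z+v z).
Proof.
have K2b : K0 n L <= K2 by exact: (le_trans K1b (le_trans K1K KK2)).
have LK2 : L/K2 <= rho.
 apply: le_trans K1L; rewrite ler_pM2l // lef_pV2 ?posrE //; exact: (le_trans K1K KK2).
have Ix : Itg (fun z=> tent c rho z*(kap (T z) * v z)).
 apply: (@Itg_le _ _ _ (fun z=> rho*kM * `|v z|)).
 - apply: measurable_funM; first exact: (cont_meas (@cont_tent _ _ c rho)).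
 apply: measurable_funM; first exact: (cont_meas (@kap_cont _ _ n0 _ _ _ G)).
 exact: v_meas.
 - by apply: ItgZ; apply: Itg_abs; exact: v_itg.
 move=> z; have /andP[t0 t1] := tent_bnd c z (ltW rho0).
 have /andP[k0 k1] := kap_bnd n0 G z.
 rewrite normrM (normrM (kap _)) (ger0_norm t0) (ger0_norm (ltW k0)) mulrA.
 by apply: ler_wpM2r; [exact: normr_ge0|exact: (ler_pM t0 (ltW k0) t1 k1)].
(* The sign s = -1 turns [weak_cmp] around, because the limit has to be bounded from above here. *)
have H := @weak_cmp _ _ n0 _ _ _ G K2 rho c f K2b rho0 If (-1) (fun z=> kap (T z) * v z) 1 ltr01 Ix.
have {}H : AE z, `|c-z| < rho -> -1*(kap (T z) * v z) <= -1*hK S T K2 f z.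
 apply: H=> e e0 _.
 have C00 : 0 < C0c n L by rewrite mulr_gt0 ?exprn_gt0 // ltr0n (m_gt0 n0).
 have p1 : 0 < e^+2/(1+3 * m%:R) by rewrite divr_gt0 ?exprn_gt0 //.
 have k3 : 0 < 3*kM by apply: mulr_gt0=> //; exact: kM0.
 have p2 : 0 < C0c n L*e/(3*kM) by exact: (divr_gt0 (mulr_gt0 C00 e0) k3).
 have [k [k1 k2]] : exists k, tau k < e^+2/(1+3 * m%:R) /\ tau k < C0c n L*e/(3*kM).
 have t1 : \forall k \near \oo, tau k < e^+2/(1+3 * m%:R).
 move/cvgrPdist_lt: tau_cvg=> /(_ _ p1); apply: filterS=> k.
 by rewrite sub0r normrN ger0_norm // ltW // tau_gt0.
 have t2 : \forall k \near \oo, tau k < C0c n L*e/(3*kM).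
 move/cvgrPdist_lt: tau_cvg=> /(_ _ p2); apply: filterS=> k.
 by rewrite sub0r normrN ger0_norm // ltW // tau_gt0.
 by near \oo=> k; exists k; split; near: k.
 have t0 := tau_gt0 k; have [t1 _] := tau_le k.
 have te : tau k^+2+3*tau k * m%:R <= e^+2.
 move: k1; rewrite ltr_pdivlMr ?ltr_pwDl ?mulr_ge0 // => k1.
 have : tau k^+2 <= tau k by rewrite ler_piMl // ltW.
 lra.
 have tk : 3*tau k*kM <= C0c n L*e.
 by move: k2; rewrite (ltr_pdivlMr _ _ k3)=> /ltW; rewrite mulrA (mulrC (tau k)).
 apply: filterS (vk_le k)=> z hz zr; rewrite !mulN1r lerN2.
 have /andP[kz _] := kap_bnd n0 G z.
 have vv : kap (T z) * vk k z <= kap (T z) * v z.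
 by rewrite ler_pM2l //; apply: le_trans (uk_le_v k z); rewrite /uk min_l.
 apply: le_trans vv; have sA : smooth (A k z) by exact: A_smooth.
 have IA := Itg_fLS G If sA (@compact_cball _ _ c (4*rho)) (@A_supp k z).
 rewrite /vk -(IntZ _ IA).
 have E y : kap (T z)*(f y*LS S (A k z) y) = f y*LS S (fun y=> kap (T z)*A k z y) y.
 by rewrite (LS_scale S (kap (T z)) y sA) mulrCA.
 rewrite (eq_Int E) /Me.
 apply: (subC_le G If (@compact_cball _ _ c (8*rho)) sf).
 - exact: (psmv_smooth z (hk_psmv n0 G K2b e0)).
 - exact: smooth_scale.
 - move=> y /negP; rewrite -ltNge=> hy; apply: (hk0 n0 G K2b); apply: (le_trans LK2).
 by apply: (far_dist6 rho0 _ hy); apply: (lt_le_trans zr); rewrite ler_peMl ?(ltW rho0) // ler1n.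
 - by move=> y hy; rewrite (sub48 (@A_supp k z) hy) mulr0.
 move=> y; have [hy|hy] := leP (L/K2) `|y-z|.
 by rewrite (hk0 n0 G K2b) // mulr_ge0 ?(ltW kz) ?A_ge0.
 have cy : `|c-y| <= 2*rho.
 by have := ler_distD z c y; rewrite (distrC z y)=> h; move: hy LK2 zr h; lra.
 have h : `|c-y| <= 4*rho by move: cy rho0; lra.
 rewrite /A /eta cutoff1 // mul1r.
 have /andP[bl _] := bcmp k h.
 apply: (cmp_low n0 G z Kp (le_trans LK1 (le_trans K1K KK2)) (lexx _) e0 t0 te tk (Qge0 k y) _ bl (b_ge0 k h)).
 by move=> x; have /andP[] := Qcmp k x h.
apply: filterS H=> z hz zr; have := hz zr; rewrite !mulN1r lerN2 /hK=> h.
lra.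
Unshelve. all: by end_near. Qed.
End PStep.

(** * Extending the coefficients from a cube *)

Section Clamp.
Variables (R : realType) (n : nat).
Notation m := (n+n)%N.
Notation V := (pt R n).

(** A retraction onto the cube, 1-Lipschitz for the sup norm. Composition with it makes the
    coefficients global and leaves the operator unchanged on test functions supported in the cube.
    The cube of radius 4r required in [D] below contains the balls in which [elliptic] grants
    Lipschitz bounds. *)
Definition clamp (c : V) (r : R) (p : V) : V := \row_i Num.max (c 0 i-r) (Num.min (c 0 i+r) (p 0 i)).

Lemma clamp_in c r p : 0 <= r -> Cb c r (clamp c r p).
Proof.
move=> r0; apply: norm_le_coord=> // i; rewrite !mxE ler_norml.
by case: (leP (c 0 i+r) (p 0 i))=> h; case: (leP (c 0 i-r))=> h'; apply/andP; split; lra.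
Qed.

Lemma clamp_id c r p : Cb c r p -> clamp c r p = p.
Proof.
move=> h; apply/rowP=> i; rewrite mxE.
have := le_trans (coord_norm (c-p) i) h; rewrite !mxE ler_norml=> /andP[h1 h2].
by rewrite min_r ?max_r //; lra.
Qed.

Lemma clamp_lip c r p q : `|clamp c r p-clamp c r q| <= `|p-q|.
Proof.
apply: norm_le_coord=> // i; have := coord_norm (p-q) i; rewrite !mxE.
move: `|p-q| => d; rewrite !ler_norml=> /andP[h1 h2].
move: (p 0 i) (q 0 i) (c 0 i) h1 h2=> a b x h1 h2.
case: (leP (x+r) a)=> h; case: (leP (x+r) b)=> h';
 repeat (match goal with |- context [Num.max ?u ?v]=> case: (leP u v)=> ? end); apply/andP; split; lra.
Qed.

Variables (D : set V) (S T : V -> 'M[R]_m) (L : R) (eL : elliptic D S T L) (c : V) (r : R) (r0 : 0 < r) (cD : Cb c (4*r) `<=` D).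

Definition cl (M : V -> 'M[R]_m) p := M (clamp c r p).

Let inD p : D (clamp c r p).
Proof.
by apply: cD; apply: (le_trans (clamp_in c p (ltW r0))); rewrite ler_peMl ?(ltW r0) // (ler_nat R 1 4).
Qed.
Let bD p : ball (clamp c r p) (3*r) `<=` D.
Proof.
move=> q /ballP h; apply: cD; apply: (le_trans (ler_distD (clamp c r p) c q)).
have h1 : `|c-clamp c r p| <= r by exact: (clamp_in c p (ltW r0)).
lra.
Qed.
Let bq p q : ball (clamp c r p) (3*r) (clamp c r q).
Proof.
apply/ballP; apply: (le_lt_trans (ler_distD c _ _)).
have h1 : `|c-clamp c r p| <= r by exact: (clamp_in c p (ltW r0)).
have h2 : `|c-clamp c r q| <= r by exact: (clamp_in c q (ltW r0)).
rewrite (distrC _ c); move: h1 h2 r0; lra.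
Qed.

Lemma gell_clamp : gell (cl S) (cl T) L.
Proof.
have L1 := el_L eL; have L0 : 0 <= L by lra.
have lip (M : V -> 'M[R]_m) : (forall p r p' i j, ball p r `<=` D -> ball p r p' -> `|M p i j-M p' i j| <= L * `|p-p'|) ->
 forall p p' i j, `|cl M p i j-cl M p' i j| <= L * `|p-p'|.
 move=> h p p' i j; apply: (le_trans (h _ _ _ i j (@bD p) (bq p p'))).
 by apply: ler_wpM2l=> //; exact: clamp_lip.
split=> //.
- move=> i j; apply: (@lip_cont _ _ _ L)=> p p'; exact: (lip S (el_Slip eL)).
- by move=> p i j; exact: (el_Sb eL).
- by move=> p i j; exact: (el_Tb eL).
- by move=> p; exact: (el_inv eL).
- by move=> p i j; exact: (el_Tsym eL).
- by move=> p x; exact: (el_Tpos eL).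
- exact: (lip T (el_Tlip eL)).
Qed.

Lemma LS_clamp w y : supp (Cb c r) w -> LS (cl S) w y = LS S w y.
Proof.
move=> sw; have [h|h] := pselect (Cb c r y).
 by rewrite /LS /cl clamp_id.
by rewrite !(LS_supp _ (@compact_cball _ _ c r) sw).
Qed.

Lemma SA_clamp g w : smooth g -> smooth w -> supp (Cb c r) g ->
 Int (fun y=> g y*LS (cl S) w y) = Int (fun y=> w y*LS (cl S) g y).
Proof.
move=> sg sw cg.
have cC : Cb c r `<=` D by move=> y h; apply: cD; apply: (le_trans h); rewrite ler_peMl ?(ltW r0) // (ler_nat R 1 4).
have := LS_selfadj eL (@compact_cball _ _ c r) cC sw sg cg.
have E y : w y*LS (cl S) g y = w y*LS S g y by rewrite LS_clamp.
move=> E2; apply: (etrans _ (etrans (esym E2) (esym (eq_Int E)))); apply: eq_Int=> y; have [h|h] := pselect (Cb c r y).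
 by rewrite /LS /cl clamp_id.
by rewrite (cg y h) !mul0r.
Qed.
End Clamp.

(** * Two-sided bounds for the error kernel *)

Section KernelBounds.
Variables (R : realType) (n : nat) (n0 : (0 < n)%N).
Notation m := (n+n)%N.
Notation V := (pt R n).
Variables (S T : V -> 'M[R]_m) (L : R) (G : gell S T L).

(** The sharp order |x|^(1-m) of the error kernel, as a power of sqrt |x|; [gk] is half a power more
    singular. *)
Definition kk (r : R) (x : V) : R := if `|x| < r then sqrt `|x| ^- (m+m).-2 else 0.

Lemma kk_ge0 r x : 0 <= kk r x.
Proof. by rewrite /kk; case: ifP=> // _; rewrite sqrtr_ge0. Qed.

Lemma measurable_kk r : measT (kk r).
Proof.
apply: measurable_fun_ifT; first exact: measurable_normlt.
 apply: (@measurable_invn _ _ _ (fun x : V=> sqrt `|x|)).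
 - by have := m_gt0 n0; case: n n0=> // k _ _; rewrite !addnS.
 - by apply: cont_meas; exact: sqrtn_cont.
 - pos.
exact: measurable_cst.
Qed.

Definition Cp2 (l : R) : R := (2*C2 n l*(1+m%:R)+48*(1+C2 n l)) * l^+m.-1.

Let L1 := ge_L G.
Let L0 : 0 < L. Proof. exact: lt_le_trans ltr01 L1. Qed.

Lemma C2_ge0 : 0 <= C2 n L.
Proof. pos. Qed.

Lemma Cp2_ge0 : 0 <= Cp2 L.
Proof.
have h := C2_ge0; rewrite /Cp2 mulr_ge0 ?exprn_ge0 ?(ltW L0) //.
have h1 : 0 <= m%:R :> R by [].
apply: addr_ge0; [apply: mulr_ge0; [exact: mulr_ge0|exact: addr_ge0]|apply: mulr_ge0=> //; exact: addr_ge0].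
Qed.

Lemma sn_half (s : R) : 0 < s -> s ^- n*sqrt s = sqrt s ^- m.-1.
Proof.
move=> s0; have u0 : 0 < sqrt s by rewrite sqrtr_gt0.
have mp : (0 < m)%N by rewrite addn_gt0 n0.
have e1 : s^+n = sqrt s^+m.-1*sqrt s.
 by rewrite -exprSr prednK // addnn -mul2n exprM sqr_sqrtr // ltW.
by rewrite e1 invfM -mulrA mulVf ?mulr1 // gt_eqF.
Qed.

Lemma Pk_up K z y : K0 n L <= K -> `|Pk S T K 0 z y| <= Cp2 L*K*kk (L/K) (y-z).
Proof.
move=> KK; have Kp : 0 < K by apply: lt_le_trans KK; apply: lt_le_trans ltr01 (K0_ge n0 G).2.
have [->|yz] := eqVneq y z.
 by rewrite (Pk_diag n0 G) // normr0 mulr_ge0 ?kk_ge0 // mulr_ge0 ?Cp2_ge0 // ltW.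
have s0 := sk_gt0 G 0 yz; have [h _ _] := Pk_est n0 G KK (lexx 0) s0.
have [xr|xr] := ltP `|y-z| (L/K); last first.
 have := Pk_bound n0 G KK z y (lexx 0).
 rewrite /gk /kk ltNge xr /=; rewrite !mulr0; exact.
apply: (le_trans h); rewrite /kk xr /Cp2.
have x0 : 0 < `|y-z| by rewrite normr_gt0 subr_eq0.
have v0 : 0 < sqrt `|y-z| by rewrite sqrtr_gt0.
have u0 : 0 < sqrt (sk T 0 z y) by rewrite sqrtr_gt0.
rewrite (sn_half s0).
have e1 : sqrt `|y-z| ^- (m+m).-2 = `|y-z| ^- m.-1.
 rewrite -[in RHS](sqr_sqrtr (ltW x0)) -exprM; congr (_ ^-1); congr (_^+_).
 by rewrite mul2n -addnn; have := m_gt0 n0; case: (n+n)%N=> // k _; rewrite addnS.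
rewrite e1; set a := (_+_ : R); rewrite -!mulrA.
have a0 : 0 <= a.
 have h1 := C2_ge0; rewrite /a; apply: addr_ge0; [apply: mulr_ge0; [exact: mulr_ge0|exact: addr_ge0]|apply: mulr_ge0=> //; exact: addr_ge0].
apply: ler_wpM2l=> //; rewrite (mulrCA (L^+_)); apply: ler_wpM2l; first exact: ltW.
rewrite -[leLHS]mul1r ler_pdivrMr ?exprn_gt0 // mulrAC -exprMn ler_pdivlMr ?exprn_gt0 // mul1r.
by apply: lerXn2r; rewrite ?nnegrE ?mulr_ge0 ?(ltW x0) ?(ltW L0) ?(ltW u0) //; exact: (skL G).
Qed.

(** Within a small multiple of 1/K of the pole, [bt 2] is at least e^(-2) and the singular factor at
    least K^(m-1). The kernel is bounded below there, so a mean value controls an ordinary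
    integral. *)
Lemma Pk_low K z y : K0 n L <= K -> y != z -> K*(m%:R*L) * `|y-z| <= 1/2 ->
 K^+m*(expR (- 2)/4) <= Pk S T K 0 z y.
Proof.
move=> KK yz hK; have Kp : 0 < K by apply: lt_le_trans KK; apply: lt_le_trans ltr01 (K0_ge n0 G).2.
have s0 := sk_gt0 G 0 yz; have [_ h _] := Pk_est n0 G KK (lexx 0) s0.
have u0 : 0 < sqrt (sk T 0 z y) by rewrite sqrtr_gt0.
have q0 := ge_Tge0 G z (y-z).
have sE : sk T 0 z y = qf (T z) (y-z) (y-z) by rewrite /sk expr0n addr0.
apply: le_trans (h _); last lra.
have us : sqrt (sk T 0 z y) <= m%:R*L * `|y-z|.
 have p0 : 0 <= m%:R*L * `|y-z| by rewrite !mulr_ge0 // ltW.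
 rewrite -[leRHS](ger0_norm p0) -sqrtr_sqr ler_wsqrtr // sE.
 apply: (le_trans (ler_norm _)); apply: (le_trans (qf_bound _ _ (ge_Tb G z))).
 move: `|y-z| (normr_ge0 (y-z))=> a a0.
 rewrite (_ : (m%:R*L*a)^+2 = m%:R^+2*L*a*a*L); last lra.
 by rewrite ler_peMr // !mulr_ge0 // ltW.
have uK : K*sqrt (sk T 0 z y) <= 1/2.
 by apply: le_trans hK; rewrite -mulrA; apply: ler_wpM2l=> //; exact: ltW.
rewrite (sn_half s0); set u := sqrt _ in u0 us uK *.
have b2 : expR (- 2) <= bt 2 (1-K*u).
 have t0 : 1/2 <= 1-K*u by lra.
 have t1 : 1-K*u <= 1 by have := mulr_gt0 Kp u0; lra.
 have tp : 0 < 1-K*u by lra.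
 rewrite /bt tp -[leLHS]mul1r; apply: ler_pM; [by []|exact: expR_ge0| |].
 by rewrite invf_ge1 ?exprn_gt0 // exprn_ile1 // ltW.
 rewrite ler_expR lerN2 -[leRHS]invrK lef_pV2 ?posrE ?invr_gt0 //; lra.
have mp : (0 < m)%N by exact: m_gt0.
have pw : K^+m.-1 <= u ^- m.-1.
 rewrite -exprVn; apply: lerXn2r; rewrite ?nnegrE ?invr_ge0 ?(ltW u0) ?(ltW Kp) //.
 by rewrite -[leRHS]mul1r ler_pdivlMr //; lra.
have E : K^+m*(expR (- 2)/4) = K/4*K^+m.-1*expR (- 2).
 by rewrite -[in K^+m](prednK mp) exprS; move: (expR (- 2)) (K^+m.-1)=> p q; field.
have K4 : 0 <= K/4 by rewrite divr_ge0 // ltW.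
rewrite E; apply: ler_pM; [pos|exact: expR_ge0|exact: ler_wpM2l|exact: b2].
Qed.
End KernelBounds.

Section SingComp.
Variable R : realType.
Implicit Types A B C : R.

Lemma sing_sum (i j : nat) A B : 0 < A -> 0 < B -> A ^- i*B ^- j <= A ^- (i+j)+B ^- (i+j).
Proof.
move=> A0 B0; have p k X : 0 < X -> 0 < X ^- k by move=> X0; rewrite invr_gt0 exprn_gt0.
have [h|h] := leP A B.
 apply: (@le_trans _ _ (A ^- (i+j))); last by rewrite lerDl ltW // p.
 rewrite exprD invfM; apply: ler_wpM2l; first by rewrite ltW // p.
 by rewrite lef_pV2 ?posrE ?exprn_gt0 // lerXn2r ?nnegrE // ltW.
apply: (@le_trans _ _ (B ^- (i+j))); last by rewrite lerDr ltW // p.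
rewrite exprD invfM; apply: ler_wpM2r; first by rewrite ltW // p.
by rewrite lef_pV2 ?posrE ?exprn_gt0 // lerXn2r ?nnegrE ?ltW.
Qed.

(* Composing two weakly singular kernels gains one power (of the square root of the distance). *)
Lemma sing_comp (p b : nat) A B C : (0 < b)%N -> (b <= p.+1)%N -> 0 < A -> 0 < B -> 0 < C ->
 C^+2 <= A^+2+B^+2 ->
 A ^- p*B ^- b <= 2^+b.-1*C ^- b.-1*(A ^- p.+1+B ^- p.+1).
Proof.
move=> b0 bp A0 B0 C0 h.
have half X : 0 < X -> C/2 <= X -> X ^- b.-1 <= 2^+b.-1*C ^- b.-1.
 move=> X0 hX; rewrite -[2]invrK exprVn -invfM -exprMn mulrC.
 have C20 : 0 < C/2 by rewrite divr_gt0.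
 by rewrite lef_pV2 ?posrE ?exprn_gt0 //; apply: lerXn2r=> //; rewrite nnegrE ltW.
have p0 k X : 0 < X -> 0 <= X ^- k by move=> X0; rewrite invr_ge0 exprn_ge0 // ltW.
have [hB|hB] := leP (C/2) B.
 have -> : A ^- p*B ^- b = B ^- b.-1*(A ^- p*B ^- 1).
 by rewrite -{1}(prednK b0) exprSr invfM expr1 mulrCA.
 apply: ler_pM; [exact: p0|by rewrite mulr_ge0 ?p0|exact: half|].
 by have := sing_sum p 1 A0 B0; rewrite addn1.
have hA : C/2 <= A.
 rewrite leNgt; apply/negP=> hA; suff : A^+2+B^+2 < C^+2 by rewrite ltNge h.
 by rewrite !expr2; nra.
have e : A ^- p = A ^- b.-1*A ^- (p.+1-b).
 by rewrite -invfM -exprD; congr (_ ^-1); congr (_^+_); lia.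
rewrite e -mulrA.
apply: ler_pM; [exact: p0|by rewrite mulr_ge0 ?p0|exact: half|].
have -> : p.+1 = (p.+1-b+b)%N by lia.
by rewrite addnK; exact: sing_sum.
Qed.
End SingComp.
Section AeTools.
Variables (R : realType) (m : nat).
Notation V := 'rV[R]_m.

(** Around each point of [D] some rational cube carries the property almost everywhere, and there
    are countably many such cubes. *)
Lemma ae_local (D : set V) (P : V -> Prop) : open D ->
 (forall z, D z -> exists2 r, 0 < r & (AE y, `|z-y| < r -> P y)) ->
 AE y, D y -> P y.
Proof.
move=> oD h.
pose Q (k : nat) (y : V) := (AE y, @ratcube R m k y -> P y) -> @ratcube R m k y -> P y.
have hQ k : AE y, Q k y.
 rewrite /Q; have [H|H] := pselect (AE y, @ratcube R m k y -> P y).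
 by apply: filterS H=> y H _.
 by apply: aeW=> y /H.
have := ae_foralln hQ; apply: filterS=> y hy Dy.
have [r r0 hr] := h y Dy; have ob : open (ball y r) by exact: ball_open.
have : ball y r y by exact: ballxx.
rewrite (open_ratcubes ob)=> -[k /= kz yk]; apply: (hy k)=> //.
by apply: filterS hr=> x hx xk; apply: hx; apply/ballP; exact: kz.
Qed.

Lemma hat_ext (f g : V -> R) z r : 0 < r -> (AE y, `|z-y| < r -> f y = g y) -> hat f z = hat g z.
Proof.
move=> r0; wlog suff : f g/(AE y, `|z-y| < r -> f y = g y) -> (hat f z <= hat g z)%E.
 move=> H h; apply/eqP; rewrite eq_le (H f g h) /=; apply: H.
 by apply: filterS h=> y h yr; rewrite h.
move=> h; apply: le_hat=> s t s0 ht; apply: (@hat_le _ _ _ _ (Num.min r s)); first by rewrite lt_min r0.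
by apply: filterS2 h ht=> y h ht; rewrite lt_min=> /andP[yr ys]; rewrite h //; exact: ht.
Qed.

Lemma abs_Int (g : V -> R) : measT g -> ((`|Int g|)%:E <= \int[lebn R m]_y (`|g y|)%:E)%E.
Proof.
move=> mg; have [I|I] := pselect (Itg g).
 by rewrite (Int_EFin (Itg_abs I)) lee_fin Int_abs.
by rewrite (Int_nitg mg I) normr0; apply: integral_ge0=> y _; rewrite lee_fin.
Qed.

Lemma Itg_ae (f g : V -> R) : measT f -> Itg g -> (AE x, f x = g x) -> Itg f.
Proof.
move=> mf Ig h; have [mg hg] := (ItgP g).1 Ig; apply/ItgP; split=> //.
rewrite (_ : (\int[lebn R m]_x (`|f x|)%:E = \int[lebn R m]_x (`|g x|)%:E)%E) //.
apply: ae_eq_integral=> //.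
- by apply/EFinP; apply: measT_comp.
- by apply/EFinP; apply: measT_comp.
by apply: filterS h=> x hx _; rewrite hx.
Qed.
End AeTools.

Lemma LS_cst (R : realType) n (S : pt R n -> 'M[R]_(n+n)) (a : R) y : LS S (fun _ : pt R n=> a) y = 0.
Proof.
have d0 (x : R) k : pd k (fun _ : pt R n=> x) = fun=> 0 by apply/funext=> q; exact: derive_cst.
rewrite /LS; apply: big1=> i _; apply: big1=> j _.
by rewrite !d0 mulr0.
Qed.

Lemma one_step_lin (R : realFieldType) (p q r e s : R) : 0 <= p+q+e*s -> - e <= r-q ->
 - (e*(1+s)) <= p+r.
Proof. lra. Qed.

(** * Subsolutions on an open set and their improvement *)

Section Global.
Variables (R : realType) (n : nat) (n0 : (0 < n)%N).
Notation m := (n+n)%N.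
Notation V := (pt R n).
Variables (D : set V) (S T : V -> 'M[R]_m) (L : R) (eL : elliptic D S T L).

Let oD := el_open eL.
Let L1 := el_L eL.
Let L0 : 0 < L. Proof. exact: lt_le_trans ltr01 L1. Qed.

Definition loc (h : V -> R) := measT h /\
 forall C, compact C -> C `<=` D -> Itg (fun y=> h y*\1_C y).
Definition dsub (h : V -> R) := forall w C, smooth w -> (forall y, 0 <= w y) -> compact C -> C `<=` D -> supp C w ->
 0 <= Int (fun y=> h y*LS S w y).

Lemma compact_meas (C : set V) : compact C -> measurable C.
Proof.
move=> /(compact_closed (@norm_hausdorff _ _)) cC; rewrite -[C]setCK; apply: measurableC.
by apply: open_meas; exact: closed_openC.
Qed.

Lemma meas_indic (C : set V) : compact C -> measT (\1_C : V -> R).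
Proof. by move=> cC; apply: measurable_indic; exact: compact_meas. Qed.

Section Test.
Variables (w : V -> R) (C : set V) (sw : smooth w) (cC : compact C) (CD : C `<=` D) (sC : supp C w).

Lemma LSd_cont : continuous (LS S w). Proof. exact: (LS_cont eL cC CD sw sC). Qed.

Lemma LSd_itg : Itg (LS S w). Proof. exact: (cont_Itg cC LSd_cont (LS_supp S cC sC)). Qed.

Lemma LSd_bnd : exists2 B, 0 < B & forall y, `|LS S w y| <= B.
Proof.
have [B B0 hB] := cpt_bounded cC (fun x _=> LSd_cont (x := x)); exists B=> // y.
by have [h|h] := pselect (C y); [exact: hB|rewrite (LS_supp S cC sC h) normr0 ltW].
Qed.

Lemma Itg_dLS h : loc h -> Itg (fun y=> h y*LS S w y).
Proof.
move=> [mh hh]; have [B B0 hB] := LSd_bnd.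
apply: (@Itg_le _ _ _ (fun y=> B * `|h y*\1_C y|)).
- by apply: (measurable_funM mh); exact: (Itg_meas LSd_itg).
- by apply: ItgZ; apply: Itg_abs; exact: hh.
move=> y; rewrite indicE; have [Cy|Cy] := pselect (C y).
 by rewrite mem_set // mulr1 normrM mulrC; apply: ler_wpM2r.
by rewrite (LS_supp S cC sC Cy) memNset // !mulr0 normr0 mulr0.
Qed.

Lemma LSd_int0 : Int (LS S w) = 0.
Proof.
have H := LS_selfadj eL cC CD (smooth_cst n (1 : R)) sw sC.
have E y : 1*LS S w y = LS S w y by rewrite mul1r.
have E0 y : w y*LS S (fun _ : V=> 1) y = 0 by rewrite LS_cst mulr0.
exact: (etrans (esym (eq_Int E)) (etrans H (etrans (eq_Int E0) (@Int0 R m)))).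
Qed.
End Test.

(** The global results want an integrable nonpositive function: h - M is restricted to a cube, and
    the minimum with 0 changes only a null set once h <= M holds there almost everywhere. *)
Definition locf (h : V -> R) (C : set V) (M : R) (y : V) : R := Num.min (h y-M) 0*\1_C y.

Lemma locf_le0 h C M y : locf h C M y <= 0.
Proof. by rewrite mulr_le0_ge0 // ge_min lexx orbT. Qed.

Lemma locf_meas h C M : loc h -> compact C -> measT (locf h C M).
Proof.
move=> [mh _] cC; apply: measurable_funM; last exact: meas_indic.
apply: measurable_minr; last exact: measurable_cst.
by apply: measurable_funB=> //; exact: measurable_cst.
Qed.

Lemma indic_itg (C : set V) : compact C -> Itg (\1_C : V -> R).
Proof.
move=> cC; have [r r0 hr] := compact_box cC.
apply: (@Itg_supp _ _ _ 1 (r+1) (meas_indic cC)); first pos.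
- by move=> x; rewrite indicE; case: (x \in C); rewrite ?normr1 ?normr0.
move=> x hx; rewrite indicE memNset // => /hr h; have := le_trans hx h; lra.
Qed.

Lemma locf_itg h C M : loc h -> compact C -> C `<=` D -> Itg (locf h C M).
Proof.
move=> lh cC CD; apply: (@Itg_le _ _ _ (fun y=> `|h y*\1_C y| + `|M|*\1_C y)); first exact: locf_meas.
 by apply: ItgD; [apply: Itg_abs; exact: (lh.2 C)|apply: ItgZ; exact: indic_itg].
move=> y; rewrite /locf indicE; case: (y \in C)=> /=; last by rewrite !mulr0 addr0.
rewrite !mulr1; case: (leP (h y-M) 0)=> _; first exact: ler_normB.
by rewrite normr0.
Qed.

(** The operator on a test function has integral 0, by self-adjointness against the constant 1, so
    subtracting [M] does not affect the pairing. *)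
Lemma locf_sub h c r M : 0 < r -> Cb c (4*r) `<=` D -> loc h -> dsub h ->
 (AE y, Cb c r y -> h y <= M) -> subC (cl c r S) (Cb c r) (locf h (Cb c r) M).
Proof.
move=> r0 cD lh dh hM w sw w0 sC.
have cC : compact (Cb c r) by exact: compact_cball.
have CD : Cb c r `<=` D.
 by move=> y hy; apply: cD; apply: (le_trans hy); rewrite ler_peMl ?(ltW r0) // (ler_nat R 1 4).
have lf := locf_itg M lh cC CD.
have I1 := Itg_dLS sw cC CD sC lh; have I2 := LSd_itg sw cC CD sC.
have E y : locf h (Cb c r) M y*LS (cl c r S) w y = locf h (Cb c r) M y*LS S w y by rewrite LS_clamp.
rewrite (eq_Int E).
have E2 : Int (fun y=> locf h (Cb c r) M y*LS S w y) = Int (fun y=> h y*LS S w y-M*LS S w y).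
 apply: ae_Int.
 - by apply: measurable_funM; [exact: (Itg_meas lf)|exact: (Itg_meas I2)].
 - by apply: measurable_funB; [exact: (Itg_meas I1)|exact: (Itg_meas (ItgZ M I2))].
 apply: filterS hM=> y hy; rewrite -mulrBl /locf indicE.
 have [Cy|Cy] := pselect (Cb c r y); last by rewrite (LS_supp S cC sC Cy) !mulr0.
 by rewrite mem_set // mulr1 min_l // subr_le0; exact: hy.
rewrite E2 (IntB I1 (ItgZ M I2)) (IntZ M I2) (LSd_int0 sw cC CD sC) mulr0 subr0.
exact: dh sw w0 cC CD sC.
Qed.

Lemma locf_eq h c r M y : h y <= M -> Cb c r y -> locf h (Cb c r) M y = h y-M.
Proof. by move=> h1 h2; rewrite /locf indicE mem_set // mulr1 min_l // subr_le0. Qed.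

Lemma open_Cb z : D z -> exists2 e, 0 < e & Cb z e `<=` D.
Proof.
move=> Dz; have /nbhs_ballP[e /= e0 he] : nbhs z D by exact: open_nbhs_nbhs.
exists (e/2); first pos.
move=> y hy; apply: he; apply/ballP; apply: (le_lt_trans hy); move: e0; lra.
Qed.

Lemma hat_ae_D h : loc h -> dsub h -> (forall y, h y <= 0) -> AE y, D y -> hat h y = (h y)%:E.
Proof.
move=> lh dh h0; apply: (ae_local oD)=> z Dz; have [e e0 he] := open_Cb Dz.
pose rho := e/16; have rho0 : 0 < rho by rewrite divr_gt0.
have r0 : 0 < 4*rho by rewrite mulr_gt0.
have cD : Cb z (4*(4*rho)) `<=` D.
 by rewrite (_ : 4*(4*rho) = e); [exact: he|rewrite /rho; field].
have G := gell_clamp eL r0 cD.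
have CD : Cb z (4*rho) `<=` D.
 by move=> y hy; apply: cD; apply: (le_trans hy); rewrite ler_peMl ?(ltW r0) // (ler_nat R 1 4).
have cC : compact (Cb z (4*rho)) by exact: compact_cball.
have sf := locf_sub r0 cD lh dh (aeW _ (fun y _=> h0 y)).
have H := hat_ae n0 G rho0 (locf_itg 0 lh cC CD) (@locf_le0 h _ 0) sf.
exists rho=> //; apply: filterS H=> y H zy.
have fE x : Cb z (4*rho) x -> locf h (Cb z (4*rho)) 0 x = h x by move=> hx; rewrite locf_eq ?subr0.
have yC : Cb z (4*rho) y by apply: (le_trans (ltW zy)); rewrite ler_peMl ?(ltW rho0) // (ler_nat R 1 4).
rewrite -(fE _ yC) -(H zy); apply: (@hat_ext _ _ _ _ _ (rho - `|z-y|)); first lra.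
apply: aeW=> x hx; rewrite fE //; apply: (le_trans (ler_distD y z x)).
lra.
Qed.

(** A single threshold for the kernels frozen at the pole (bound L), those frozen at the variable
    (bound 4L), and the truncation radius. *)
Definition Kb : R := Num.max (K0 n (4*L)) (Num.max (K0 n L) L).
Definition C1 : R := Cp2 n L*(Kb+2*Ac n L)/kmin n L.

Lemma Kb_ge : [/\ K0 n (4*L) <= Kb, K0 n L <= Kb, L <= Kb & 1 <= Kb].
Proof.
have h : L <= Kb by rewrite !le_max lexx !orbT.
by rewrite /Kb !le_max !lexx ?orbT; split=> //; move: L1; rewrite ?orbT=> h'; apply/orP; right; apply/orP; right.
Qed.

(* One improvement step: outside a null set the new function dominates the mean of the old one. *)
Lemma one_step h c rho M : 0 < rho -> rho <= 1 -> Cb c (32*rho) `<=` D -> loc h -> dsub h ->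
 (AE y, Cb c (8*rho) y -> h y <= M) ->
 exists h', [/\ loc h', dsub h', (forall y, h y <= h' y), (forall y, ~ Cb c (5*rho) y -> h' y = h y) &
 (AE y, Cb c (8*rho) y -> h' y <= M) /\
 (AE z, `|c-z| < rho ->
 ((M-h' z)%:E <= (C1/rho)%:E*\int[lebn R m]_y (kk rho (y-z)*Num.max (M-h y) 0)%:E)%E)].
Proof.
move=> rho0 rho1 cD lh dh hM.
have r0 : 0 < 8*rho by rewrite mulr_gt0.
have cD' : Cb c (4*(8*rho)) `<=` D.
 by rewrite (_ : 4*(8*rho) = 32*rho); [exact: cD|ring].
have G := gell_clamp eL r0 cD'.
have CD : Cb c (8*rho) `<=` D.
 by move=> y hy; apply: cD'; apply: (le_trans hy); rewrite ler_peMl ?(ltW r0) // (ler_nat R 1 4).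
have cC : compact (Cb c (8*rho)) by exact: compact_cball.
have [Kb1 Kb2 Kb3 Kb4] := Kb_ge.
have Kbp : 0 < Kb := lt_le_trans ltr01 Kb4.
(* Truncation at a distance of order [rho]; since rho <= 1, this constant is also above the
   threshold [Kb]. *)
pose K1 := Kb/rho.
have KbK : Kb <= K1 by rewrite ler_pdivlMr // ler_piMr // ltW.
have K1p : 0 < K1 := lt_le_trans Kbp KbK.
have LK1 : L/K1 <= rho.
 by rewrite ler_pdivrMr // mulrC divfK // gt_eqF.
pose f := locf h (Cb c (8*rho)) M.
have If : Itg f := locf_itg M lh cC CD.
have f0 y : f y <= 0 by exact: locf_le0.
have sf := locf_sub r0 cD' lh dh hM.
have SA g w := @SA_clamp _ _ _ _ _ _ eL _ _ r0 cD' g w.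
pose vv := v n0 G K1 c f rho0.
have vb := v_bnd n0 G (le_trans Kb2 KbK) rho0 If f0 sf.
have vs : supp (Cb c (5*rho)) vv := v_supp n0 G (le_trans Kb2 KbK) LK1 rho0 If f0 sf.
have Iv : Itg vv := v_itg n0 G (le_trans Kb2 KbK) LK1 rho0 If f0 sf.
have C58 y : Cb c (5*rho) y -> Cb c (8*rho) y.
 by move=> hy; apply: (le_trans hy); rewrite ler_pM2r // ler_nat.
have lh' : loc (fun y=> h y+vv y).
 split; first by apply: measurable_funD; [exact: lh.1|exact: (Itg_meas Iv)].
 move=> C cC' C'D; have I1 := lh.2 C cC' C'D.
 apply: (@Itg_le _ _ _ (fun y=> `|h y*\1_C y| + `|vv y|)).
 - apply: measurable_funM; last exact: meas_indic.
 by apply: measurable_funD; [exact: lh.1|exact: (Itg_meas Iv)].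
 - by apply: ItgD; exact: Itg_abs.
 move=> y; rewrite mulrDl; apply: (le_trans (ler_normD _ _)); rewrite lerD2l normrM ler_piMr //.
 by rewrite indicE; case: (y \in C); rewrite ?normr1 ?normr0.
exists (fun y=> h y+vv y); split=> //.
- move=> w C sw w0 cC' C'D sC.
 have I1 := Itg_dLS sw cC' C'D sC lh; have I2 := LSd_itg sw cC' C'D sC.
 have Iv2 : Itg (fun y=> vv y*LS S w y).
 have [B B0 hB] := LSd_bnd sw cC' C'D sC.
 apply: (@Itg_le _ _ _ (fun y=> B * `|vv y|)).
 - by apply: measurable_funM; [exact: (Itg_meas Iv)|exact: (Itg_meas I2)].
 - by apply: ItgZ; exact: Itg_abs.
 by move=> y; rewrite normrM mulrC; apply: ler_wpM2r.
 have E y : (h y+vv y)*LS S w y = h y*LS S w y+vv y*LS S w y by rewrite mulrDl.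
 rewrite (eq_Int E) (IntD I1 Iv2).
 have sE : smooth (eta rho c) by exact: smooth_cutoff.
 have E4 : 2*(2*rho) = 4*rho by ring.
 have C48 y : Cb c (4*rho) y -> Cb c (8*rho) y.
 by move=> hy; apply: (le_trans hy); rewrite ler_pM2r // ler_nat.
 have sE4 : supp (Cb c (4*rho)) (eta rho c) by rewrite -E4; apply: supp_cutoff; rewrite mulr_gt0.
 have C4D : Cb c (4*rho) `<=` D by move=> y /C48/CD.
 have cC4 : compact (Cb c (4*rho)) by exact: compact_cball.
 have Ie := Itg_dLS sE cC4 C4D sE4 lh.
 pose Lam := Int (fun y=> h y*LS S (eta rho c) y).
 (* Testing h with w + W + e eta gives the inequality for h + vv up to an error linear in e; the
    constant does not depend on e, so e may tend to 0. *)
 have key e : 0 < e -> - (e*(1+Lam)) <= Int (fun y=> h y*LS S w y)+Int (fun y=> vv y*LS S w y).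
 move=> e0; have [W [sW cW Wp hW]] := v_test n0 G (le_trans Kb1 KbK) (le_trans Kb2 KbK) LK1 rho0 If f0 sf SA sw w0 cC' sC e0.
 have IW := Itg_dLS sW cC4 C4D cW lh; have IW2 := LSd_itg sW cC4 C4D cW.
 have q1 : Int (fun z=> vv z*LS (cl c (8*rho) S) w z) = Int (fun z=> vv z*LS S w z).
 apply: eq_Int=> z; have [hz|hz] := pselect (Cb c (8*rho) z).
 by rewrite /LS /cl clamp_id.
 by rewrite (vs z) ?mul0r // => /C58.
 have q2 : Int (fun y=> f y*LS (cl c (8*rho) S) W y) = Int (fun y=> h y*LS S W y).
 have c8W : supp (Cb c (8*rho)) W by move=> y hy; apply: cW=> /C48.
 have E3 y : f y*LS (cl c (8*rho) S) W y = f y*LS S W y by rewrite LS_clamp.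
 apply: (etrans (eq_Int E3)).
 have E5 : Int (fun y=> f y*LS S W y) = Int (fun y=> h y*LS S W y-M*LS S W y).
 apply: ae_Int.
 - by apply: measurable_funM; [exact: (Itg_meas If)|exact: (Itg_meas IW2)].
 - by apply: measurable_funB; [exact: (Itg_meas IW)|exact: (Itg_meas (ItgZ M IW2))].
 apply: filterS hM=> y hy; rewrite -mulrBl; have [Cy|Cy] := pselect (Cb c (8*rho) y).
 by rewrite /f locf_eq //; exact: hy.
 by rewrite (LS_supp S (@compact_cball _ _ c (8*rho)) c8W Cy) !mulr0.
 rewrite E5 (IntB IW (ItgZ M IW2)) (IntZ M IW2) (LSd_int0 sW cC4 C4D cW).
 have idM (X : R) : X-M*0 = X by rewrite mulr0 subr0.
 exact: idM.
 have q3 := eq_ind _ (fun t=> `|t-_| <= e) hW _ q1.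
 have q4 := eq_ind _ (fun t=> `|_-t| <= e) q3 _ q2.
 pose C' := C `|` Cb c (4*rho).
 have cC'' : compact C' by exact: compactU.
 have C''D : C' `<=` D by move=> y [/C'D|/C4D].
 pose w2 y := 1*(1*w y+1*W y)+e*eta rho c y.
 have s1 := smooth_lin 1 1 sw sW.
 have s2 : smooth w2 := smooth_lin 1 e s1 sE.
 have w20 y : 0 <= w2 y by rewrite /w2 !mul1r; exact: Wp.
 have w2s : supp C' w2.
 move=> y hy; have a1 : w y = 0 by apply: sC=> hy'; apply: hy; left.
 have a2 : W y = 0 by apply: cW=> hy'; apply: hy; right.
 have a3 : eta rho c y = 0 by apply: sE4=> hy'; apply: hy; right.
 by rewrite /w2 a1 a2 a3 !mulr0 !addr0 mulr0.
 have := dh w2 C' s2 w20 cC'' C''D w2s.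
 have E6 y : h y*LS S w2 y = (h y*LS S w y+h y*LS S W y)+e*(h y*LS S (eta rho c) y).
 rewrite /w2 (LS_lin S 1 e y s1 sE) (LS_lin S 1 1 y sw sW).
 by move: (h y) (LS S w y) (LS S W y) (LS S _ y)=> p q r s; ring.
 move=> h0.
 have h1 := eq_ind _ (fun t=> 0 <= t) h0 _ (etrans (eq_Int E6) (etrans (IntD (ItgD I1 IW) (ItgZ e Ie)) (f_equal2 +%R (IntD I1 IW) (IntZ e Ie)))).
 move: q4; rewrite ler_norml=> /andP[h2 h3].
 exact: (one_step_lin h1 h2).
 move: key; move: (Int _+Int _)=> X key; rewrite leNgt; apply/negP=> X0.
 have s0 : 0 < 1 + `|1+Lam| by [].
 have e0 : 0 < - X/2/(1 + `|1+Lam|) by rewrite divr_gt0 // divr_gt0 // oppr_gt0.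
 have := key _ e0; apply/negP; rewrite -ltNge ltrNr.
 apply: (@le_lt_trans _ _ (- X/2/(1 + `|1+Lam|)*(1 + `|1+Lam|))).
 by apply: ler_wpM2l; [exact: ltW|apply: (le_trans (ler_norm _)); rewrite lerDr].
 by rewrite divfK ?gt_eqF //; lra.
- by move=> y; rewrite lerDl; have /andP[] := vb y.
- by move=> y hy; rewrite (vs y hy) addr0.
split.
 apply: filterS hM=> y hy Cy; have /andP[_ h2] := vb y; have h1 := hy Cy.
 by move: h2; rewrite /f locf_eq // -/vv; lra.
have mean := v_mean n0 G (le_trans Kb2 KbK) LK1 rho0 If f0 sf.
apply: filterS2 mean hM=> z hz hMz zr.
have Cz : Cb c (8*rho) z by apply: (le_trans (ltW zr)); rewrite ler_peMl ?(ltW rho0) // (ler_nat R 1 8).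
have {}hz := hz zr; have fz : f z = h z-M by rewrite /f locf_eq //; exact: hMz.
set K2 := K1+Ac n L+Ac n L in hz.
have A0 := Ac_ge0 G.
have K2a : K0 n L <= K2 by rewrite /K2; apply: (le_trans Kb2); apply: (le_trans KbK); rewrite -addrA lerDl addr_ge0.
have K2p : 0 < K2 by apply: (lt_le_trans K1p); rewrite /K2 -addrA lerDl addr_ge0.
have km0 := kmin_gt0 n0 (ltW L0).
have /andP[k1 k2] := kap_bounds n0 G z.
have mg : measT (fun y=> f y*Pk (cl c (8*rho) S) (cl c (8*rho) T) K2 0 z y).
 by apply: measurable_funM; [exact: (Itg_meas If)|exact: (Pk_meas_y n0 G K2 z (lexx 0))].
have aI := abs_Int mg.
have B : (kmin n L*(M-(h z+vv z)) <= `|Int (fun y=> f y*Pk (cl c (8*rho) S) (cl c (8*rho) T) K2 0 z y)|).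
 have q0 : 0 <= M-(h z+vv z) by have /andP[_ h2] := vb z; move: h2; rewrite fz -/vv; lra.
 apply: (@le_trans _ _ (kap (cl c (8*rho) T z)*(M-(h z+vv z)))); first exact: ler_wpM2r.
 rewrite -normrN; apply: (le_trans _ (ler_norm _)); rewrite lerNr.
 apply: (le_trans hz); rewrite fz -/vv -mulrN; apply: ler_wpM2l; last by lra.
 exact: (le_trans (ltW km0) k1).
have mk : measT (fun y : V=> kk rho (y-z)*Num.max (M-h y) 0).
 apply: measurable_funM; last first.
 apply: measurable_maxr; last exact: measurable_cst.
 by apply: measurable_funB; [exact: measurable_cst|exact: lh.1].
 have mkk := measurable_kk n0 rho.
 apply: (measT_comp mkk); apply: meas_coords=> i.
 rewrite (_ : (fun q : V=> _) = (fun q : V=> q 0 i-z 0 i)); last by apply/funext=> q; rewrite !mxE.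
 by apply: measurable_funB; [exact: measurable_coord|exact: measurable_cst].
have lk0 : 0 <= C1/rho.
 rewrite divr_ge0 ?(ltW rho0) // /C1 divr_ge0 ?(ltW km0) //; apply: mulr_ge0; first exact: (Cp2_ge0 G).
 pos.
rewrite -ge0_integralZl_EFin //; last 2 first.
- by move=> y _; rewrite lee_fin mulr_ge0 ?kk_ge0 // le_max lexx orbT.
- exact/EFinP.
have kE : ((M-(h z+vv z))%:E = (kmin n L)^-1%:E*(kmin n L*(M-(h z+vv z)))%:E)%E.
 by rewrite -EFinM mulrA mulVf ?mul1r // gt_eqF.
rewrite kE; apply: (@le_trans _ _ ((kmin n L)^-1%:E*(\int[lebn R m]_y (`|f y*Pk (cl c (8*rho) S) (cl c (8*rho) T) K2 0 z y|)%:E))%E).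
 apply: lee_wpmul2l; first by rewrite lee_fin invr_ge0 ltW.
 by apply: le_trans aI; rewrite lee_fin.
rewrite -ge0_integralZl_EFin //; last 2 first.
- by apply/EFinP; apply: measT_comp.
- by rewrite invr_ge0 ltW.
apply: ge0_le_integral=> //.
- by move=> y _; rewrite lee_fin mulr_ge0 // invr_ge0 ltW.
- apply: measurable_funeM; apply/EFinP; exact: measT_comp.
- apply: measurable_funeM; exact/EFinP.
move=> y _; rewrite -!EFinM lee_fin normrM.
have fy : `|f y| <= Num.max (M-h y) 0.
 rewrite ler0_norm // /f /locf indicE; case: (y \in _); rewrite ?mulr1 ?mulr0 ?oppr0 ?le_max ?lexx ?orbT //.
 by case: (leP (h y-M) 0)=> q; rewrite ?oppr0 ?lexx ?orbT // opprB lexx.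
have Py : `|Pk (cl c (8*rho) S) (cl c (8*rho) T) K2 0 z y| <= Cp2 n L*((Kb+2*Ac n L)/rho)*kk rho (y-z).
 apply: (le_trans (Pk_up n0 G z y K2a)).
 have K2le : K2 <= (Kb+2*Ac n L)/rho.
 have AA : Ac n L <= Ac n L/rho by rewrite ler_pdivlMr // ler_piMr.
 have -> : (Kb+2*Ac n L)/rho = Kb/rho+Ac n L/rho+Ac n L/rho by move: (Ac n L) rho^-1=> p q; ring.
 exact: (lerD (lerD (lexx _) AA) AA).
 have kkle : kk (L/K2) (y-z) <= kk rho (y-z).
 have LK2 : L/K2 <= rho.
 by apply: le_trans LK1; rewrite ler_pM2l // lef_pV2 // /K2 -addrA lerDl addr_ge0.
 rewrite /kk; case: ltP=> q; first by rewrite (lt_le_trans q LK2).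
 by case: ifP=> // _; rewrite sqrtr_ge0.
 have c0 := Cp2_ge0 G.
 apply: ler_pM; [pos|exact: kk_ge0|exact: ler_wpM2l|exact: kkle].
apply: (@le_trans _ _ ((kmin n L)^-1*(Num.max (M-h y) 0*(Cp2 n L*((Kb+2*Ac n L)/rho)*kk rho (y-z))))).
 apply: ler_wpM2l; first by rewrite invr_ge0 ltW.
 by apply: ler_pM.
rewrite /C1 le_eqVlt; apply/orP; left; apply/eqP.
by move: (kmin n L)^-1 rho^-1 (kk _ _) (Num.max _ _)=> p q r s; ring.
Qed.
End Global.

(** * Iterating weakly singular kernels *)

Section Iter.
Variables (R : realType) (m : nat) (m2 : (1 < m)%N).
Notation V := 'rV[R]_m.

Let m0 : (0 < m)%N. Proof. exact: ltn_trans m2. Qed.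
Let mm : ((m+m).-2.+1 = (m+m).-1)%N. Proof. by case: m m2=> [|[|k]]. Qed.

Definition sj (b : nat) (r : R) (x : V) : R := if `|x| < r then sqrt `|x| ^- b else 0.

Lemma sj_ge0 b r x : 0 <= sj b r x.
Proof. by rewrite /sj; case: ifP=> // _; rewrite sqrtr_ge0. Qed.

Lemma measurable_sj b r : measT (sj b r).
Proof.
apply: measurable_fun_ifT; [exact: measurable_normlt| |exact: measurable_cst].
case: b=> [|b].
 by rewrite (_ : (fun x=> _) = cst 1); [exact: measurable_cst|apply/funext=> x; rewrite invr1].
apply: (@measurable_invn _ _ _ (fun x : V=> sqrt `|x|)).
- by [].
- by apply: cont_meas; exact: sqrtn_cont.
- pos.
Qed.

Lemma measurable_sj2 b r : measT (fun q : V*V=> sj b r (q.2-q.1)).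
Proof.
apply: (measT_comp (measurable_sj b r)); apply: meas_coords=> i.
rewrite (_ : (fun q : V*V=> _) = (fun q=> q.2 0 i-q.1 0 i)); last by apply/funext=> q; rewrite !mxE.
apply: measurable_funB.
 exact: (measT_comp (@measurable_coord R m i) measurable_snd).
exact: (measT_comp (@measurable_coord R m i) measurable_fst).
Qed.

Lemma sj_comp b r s (y z w : V) : (0 < b)%N -> (b <= (m+m).-1)%N -> y != z ->
 sj (m+m).-2 r (w-z)*sj b s (y-w) <=
 2^+b.-1*sqrt `|y-z| ^- b.-1*(gk r (w-z)+gk s (w-y)).
Proof.
move=> b0 bm yz; have p0 : (0 < (m+m).-2)%N by case: m m2=> [|[|k]] // _; rewrite addnS.
have C0 : 0 < sqrt `|y-z| by rewrite sqrtr_gt0 normr_gt0 subr_eq0.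
have R0 : 0 <= 2^+b.-1*sqrt `|y-z| ^- b.-1*(gk r (w-z)+gk s (w-y)).
 by rewrite !mulr_ge0 ?addr_ge0 ?gk_ge0 //.
have [wz|wz] := eqVneq w z.
 by rewrite {1}wz subrr /sj normr0 sqrtr0 expr0n gtn_eqF //= invr0; case: ifP; rewrite mul0r.
have [wy|wy] := eqVneq w y.
 by rewrite {2}wy subrr {2}/sj normr0 sqrtr0 expr0n gtn_eqF //= invr0; case: ifP; rewrite mulr0.
rewrite {1}/sj; case: ltP=> zr; last lra.
rewrite /sj; case: ltP=> yr; last lra.
rewrite /gk zr (distrC w y) yr -mm.
apply: sing_comp=> //; rewrite ?sqrtr_gt0 ?normr_gt0 ?subr_eq0 ?mm // 1?eq_sym //.
by rewrite !sqr_sqrtr // [leRHS]addrC ler_distD.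
Qed.

Lemma sj_conv b r s (y z : V) : 0 < r -> 0 < s -> (0 < b)%N -> (b <= (m+m).-1)%N -> y != z ->
 (\int[lebn R m]_w (sj (m+m).-2 r (w-z)*sj b s (y-w))%:E <=
 (2^+b.-1*sqrt `|y-z| ^- b.-1*(2^+(3 * m)*(sqrt r+sqrt s)))%:E)%E.
Proof.
move=> r0 s0 b0 bm yz.
have [I1 J1] := gk_itg m0 r0; have [I2 J2] := gk_itg m0 s0.
set c := 2^+b.-1*_.
have c0 : 0 <= c by rewrite mulr_ge0 //.
have K1 : Itg (fun w=> gk r (w-z)) by exact: Itg_shift.
have K2 : Itg (fun w=> gk s (w-y)) by exact: Itg_shift.
apply: (@le_trans _ _ (\int[lebn R m]_w (c*(gk r (w-z)+gk s (w-y)))%:E)%E).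
 apply: ge0_le_integral=> //.
 - by move=> w _; rewrite lee_fin mulr_ge0 // sj_ge0.
 - apply/EFinP; apply: measurable_funM.
 exact: (measT_comp (measurable_sj2 _ r) (measurable_pair1 z)).
 exact: (measT_comp (measurable_sj2 b s) (measurable_pair2 y)).
 - by apply/EFinP; exact: (Itg_meas (ItgZ c (ItgD K1 K2))).
 by move=> w _; rewrite lee_fin; exact: sj_comp.
rewrite (Int_EFin (ItgZ c (ItgD K1 K2))) lee_fin (IntZ c (ItgD K1 K2)) (IntD K1 K2).
rewrite (@Int_shift _ _ (- z) (gk r)); last exact: Itg_meas.
rewrite (@Int_shift _ _ (- y) (gk s)); last exact: Itg_meas.
by apply: ler_wpM2l=> //; rewrite mulrDr lerD.
Qed.

Implicit Types q : V -> \bar R.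
Variables (c : V) (rho : R) (rho0 : 0 < rho).

Definition good q := [/\ measT q, (forall x, (0 <= q x)%E) & forall x, ~ (`|c-x| < 2*rho) -> q x = 0%E].

(** [sj_conv] gains one power of sqrt |y-z| and a factor sqrt rho. All functions live in the ball of
    radius 2 rho, so differences stay below 4 rho, the cut kept during the iteration. *)
Lemma iter_step q q0 q' b (a A : R) : good q0 -> good q -> good q' -> 0 <= a -> 0 <= A ->
 (0 < b)%N -> (b <= (m+m).-1)%N ->
 (AE z, (q z <= A%:E*\int[lebn R m]_y ((sj b (4*rho) (y-z))%:E*q0 y))%E) ->
 (AE z, (q' z <= a%:E*\int[lebn R m]_w ((sj (m+m).-2 rho (w-z))%:E*q w))%E) ->
 AE z, (q' z <= (a*(A*(2^+b.-1*(2^+(3 * m)*(3*sqrt rho)))))%:E *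
 \int[lebn R m]_y ((sj b.-1 (4*rho) (y-z))%:E*q0 y))%E.
Proof.
move=> [m1 p1 s1] [m2' p2 s2] [m3 p3 s3] a0 A0 b0 bm hq hq'.
have r4 : 0 < 4*rho by rewrite mulr_gt0.
pose B := 2^+b.-1*(2^+(3 * m)*(3*sqrt rho)).
have B0 : 0 <= B by rewrite !mulr_ge0.
have mI : measT (fun w : V=> \int[lebn R m]_y ((sj b (4*rho) (y-w))%:E*q0 y))%E.
 apply: (@measurable_int2 R _ _ _ _ (lebn R m) (fun q : V*V=> ((sj b (4*rho) (q.2-q.1))%:E*q0 q.2)%E)).
 apply: emeasurable_funM; first by apply/EFinP; exact: measurable_sj2.
 exact: (measT_comp m1 measurable_snd).
have I0 w : (0 <= \int[lebn R m]_y ((sj b (4*rho) (y-w))%:E*q0 y))%E.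
 by apply: integral_ge0=> y _; rewrite mule_ge0 // lee_fin sj_ge0.
have msz b' r z : measT (fun w : V=> (sj b' r (w-z))%:E).
 by apply/EFinP; exact: (measT_comp (measurable_sj2 b' r) (measurable_pair1 z)).
apply: filterS hq'=> z hz.
have [zc|zc] := pselect (`|c-z| < 2*rho); last first.
 rewrite s3 //; apply: mule_ge0; first pos.
 by apply: integral_ge0=> y _; rewrite mule_ge0 // lee_fin sj_ge0.
apply: (le_trans hz); rewrite EFinM -muleA; apply: lee_wpmul2l; first pos.
apply: (@le_trans _ _ (\int[lebn R m]_w ((sj (m+m).-2 rho (w-z))%:E*(A%:E*\int[lebn R m]_y ((sj b (4*rho) (y-w))%:E*q0 y))))%E).
 apply: (@ae_ge0_le_integral _ _ _ (lebn R m) setT measurableT).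
 - by move=> w _; rewrite mule_ge0 // lee_fin sj_ge0.
 - by apply: emeasurable_funM.
 - by move=> w _; rewrite mule_ge0 ?lee_fin ?sj_ge0 // mule_ge0.
 - by apply: emeasurable_funM=> //; apply: measurable_funeM.
 by apply: filterS hq=> w hw _; apply: lee_wpmul2l=> //; rewrite lee_fin sj_ge0.
pose H (p : V*V) : \bar R := ((sj (m+m).-2 rho (p.1-z))%:E*((sj b (4*rho) (p.2-p.1))%:E*q0 p.2))%E.
have mH : measT H.
 apply: emeasurable_funM; first exact: (measT_comp (msz _ rho z) measurable_fst).
 apply: emeasurable_funM; first by apply/EFinP; exact: measurable_sj2.
 exact: (measT_comp m1 measurable_snd).
have H0 p : (0 <= H p)%E by rewrite mule_ge0 ?lee_fin ?sj_ge0 // mule_ge0 // lee_fin sj_ge0.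
have -> : (\int[lebn R m]_w ((sj (m+m).-2 rho (w-z))%:E*(A%:E*\int[lebn R m]_y ((sj b (4*rho) (y-w))%:E*q0 y))))%E =
 (A%:E*\int[lebn R m]_w \int[lebn R m]_y H (w, y))%E.
 rewrite -ge0_integralZl //; last 2 first.
 - exact: (@measurable_int2 R _ _ _ _ (lebn R m) H mH).
 - by move=> w _; apply: integral_ge0=> y _.
 apply: eq_integral=> w _; rewrite muleCA; congr (_*_)%E.
 have mw := msz b (4*rho) w.
 rewrite -ge0_integralZl //; last 3 first.
 - by apply: emeasurable_funM.
 - by move=> y _; rewrite mule_ge0 // lee_fin sj_ge0.
 - by rewrite lee_fin sj_ge0.
rewrite EFinM -muleA; apply: lee_wpmul2l; first pos.
rewrite (@fubini_tonelli _ _ _ _ R (lebn R m) (lebn R m) H mH H0).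
rewrite -/B -ge0_integralZl //; last 2 first.
- by apply: emeasurable_funM.
- by move=> y _; rewrite mule_ge0 // lee_fin sj_ge0.
apply: (@ae_ge0_le_integral _ _ _ (lebn R m) setT measurableT).
- by move=> y _; apply: integral_ge0.
- exact: (@measurable_fun_fubini_tonelli_G _ _ _ _ R (lebn R m) H mH H0).
- by move=> y _; rewrite mule_ge0 // mule_ge0 // lee_fin sj_ge0.
- by apply: measurable_funeM; apply: emeasurable_funM.
have nz : AE y, y != z.
 exists [set z]; split; [|exact: lebn_point m0|].
 rewrite -[X in measurable X]setCK; apply: measurableC; apply: open_meas; apply: closed_openC.
 exact: (@accessible_closed_set1 _ (hausdorff_accessible (@norm_hausdorff _ _))).
 by move=> y /= hy; apply: contrapT=> /eqP yz; apply: hy.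
apply: filterS nz=> y yz _.
have [yc|yc] := pselect (`|c-y| < 2*rho); last first.
 rewrite (s1 y yc) !mule0; rewrite /H (_ : (fun x=> _) = cst 0%E) ?integral0 //.
 by apply/funext=> w /=; rewrite (s1 y yc) !mule0.
have -> : (\int[lebn R m]_x H (x, y) = q0 y*\int[lebn R m]_w (sj (m+m).-2 rho (w-z)*sj b (4*rho) (y-w))%:E)%E.
 rewrite -ge0_integralZl //.
 - by apply: eq_integral=> w _; rewrite /H muleA muleC.
 - apply/EFinP; apply: measurable_funM.
 exact: (measT_comp (measurable_sj2 _ rho) (measurable_pair1 z)).
 exact: (measT_comp (measurable_sj2 b _) (measurable_pair2 y)).
 - by move=> w _; rewrite lee_fin mulr_ge0 // sj_ge0.
rewrite muleA muleC; apply: lee_wpmul2r=> //.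
apply: (le_trans (sj_conv rho0 r4 b0 bm yz)); rewrite -EFinM lee_fin.
have yz4 : `|y-z| < 4*rho.
 by apply: (le_lt_trans (ler_distD c y z)); rewrite (distrC y c); move: yc zc; lra.
have s4 : sqrt (4*rho) = 2*sqrt rho.
 by rewrite sqrtrM // (_ : 4 = 2^+2) ?sqrtr_sqr ?ger0_norm //; ring.
rewrite /sj yz4 s4 /B le_eqVlt; apply/orP; left; apply/eqP.
lra.
Qed.

(** The first kernel is weakened from order 2m-2 to 2m-1, so that it fits the count: after 2m steps
    the order is 0, the kernel is at most 1, and the plain integral of [q 0] remains. *)
Lemma iter_all (q : nat -> V -> \bar R) (a : R) : 0 <= a -> (forall j, good (q j)) ->
 (forall j, (AE z, (q j.+1 z <= a%:E*\int[lebn R m]_w ((sj (m+m).-2 rho (w-z))%:E*q j w))%E)) ->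
 AE z, (q (m+m)%N z <= ((a*(2^+(5 * m)*(3*sqrt rho)))^+(m+m))%:E*\int[lebn R m]_y q 0%N y)%E.
Proof.
move=> a0 gq hq; pose X := a*(2^+(5 * m)*(3*sqrt rho)).
have X0 : 0 <= X by rewrite !mulr_ge0.
have s0 : 0 <= sqrt rho by [].
have H j : (j < m+m)%N -> AE z, (q j.+1 z <= (X^+j.+1)%:E *
 \int[lebn R m]_y ((sj (m+m-j.+1) (4*rho) (y-z))%:E*q 0%N y))%E.
 elim: j=> [_|j IH jm].
 have [g1 g2 g3] := gq 0%N; apply: filterS (hq 0%N)=> z hz; apply: (le_trans hz).
 have aX : a*sqrt rho <= X^+1.
 rewrite expr1 /X; apply: ler_wpM2l=> //; rewrite mulrA ler_peMl //.
 have : 1 <= 2^+(5 * m) :> R by apply: exprn_ege1; rewrite ler1n.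
 lra.
 apply: (@le_trans _ _ ((a*sqrt rho)%:E*\int[lebn R m]_y ((sj (m+m-1) (4*rho) (y-z))%:E*q 0%N y))%E); last first.
 apply: lee_wpmul2r; last pos.
 by apply: integral_ge0=> y _; rewrite mule_ge0 // lee_fin sj_ge0.
 rewrite EFinM -muleA; apply: lee_wpmul2l; first pos.
 have ms b r : measT (fun w : V=> (sj b r (w-z))%:E).
 by apply/EFinP; exact: (measT_comp (measurable_sj2 b r) (measurable_pair1 z)).
 rewrite -ge0_integralZl //; last 2 first.
 - by apply: emeasurable_funM.
 - by move=> y _; rewrite mule_ge0 // lee_fin sj_ge0.
 apply: ge0_le_integral=> //.
 - by move=> y _; rewrite mule_ge0 // lee_fin sj_ge0.
 - by apply: emeasurable_funM.
 - by apply: measurable_funeM; apply: emeasurable_funM.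
 move=> y _; rewrite muleA; apply: lee_wpmul2r=> //; rewrite -EFinM lee_fin.
 rewrite /sj subn1 -mm; case: (ltP `|y-z| rho)=> yr; last first.
 by case: ifP=> _; rewrite //.
 rewrite (_ : `|y-z| < 4*rho); last by apply: (lt_le_trans yr); rewrite ler_peMl ?(ltW rho0) // (ler_nat R 1 4).
 have [->|yz] := eqVneq y z.
 have p0 : (0 < (m+m).-2)%N by case: m m2=> [|[|k]] // _; rewrite addnS.
 by rewrite subrr normr0 sqrtr0 !expr0n gtn_eqF //= invr0.
 have v0 : 0 < sqrt `|y-z| by rewrite sqrtr_gt0 normr_gt0 subr_eq0.
 rewrite exprS invfM mulrA ler_peMl // ?invr_ge0 ?exprn_ge0 ?sqrtr_ge0 //.
 by rewrite ler_pdivlMr // mul1r ler_wsqrtr // ltW.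
 have b0 : (0 < m+m-j.+1)%N by rewrite subn_gt0.
 have bm : (m+m-j.+1 <= (m+m).-1)%N by rewrite -subn1 leq_sub2l.
 have Xj : 0 <= X^+j.+1 by exact: exprn_ge0.
 have := iter_step (gq 0%N) (gq j.+1) (gq j.+2) a0 Xj b0 bm (IH (ltnW jm)) (hq j.+1).
 have e1 : ((m+m-j.+1).-1 = m+m-j.+2)%N by rewrite -subnS.
 rewrite e1; apply: filterS=> z hz; apply: (le_trans hz); apply: lee_wpmul2r.
 by have [_ g2 _] := gq 0%N; apply: integral_ge0=> y _; rewrite mule_ge0 // lee_fin sj_ge0.
 rewrite lee_fin (exprS X j.+1) [leRHS]mulrC mulrCA; apply: ler_wpM2l=> //.
 rewrite /X; apply: ler_wpM2l=> //; rewrite mulrA; apply: ler_wpM2r; first pos.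
 rewrite -exprD; apply: ler_weXn2l; first lra.
 by move: jm; lia.
have j0 : ((m+m).-1 < m+m)%N by rewrite ltn_predL addn_gt0 m0.
have := H _ j0; rewrite prednK ?addn_gt0 ?m0 // subnn; apply: filterS=> z hz; apply: (le_trans hz).
have [g1 g2 g3] := gq 0%N.
apply: lee_wpmul2l; first pos.
apply: ge0_le_integral=> //.
- by move=> y _; rewrite mule_ge0 // lee_fin sj_ge0.
- apply: emeasurable_funM=> //.
 by apply/EFinP; exact: (measT_comp (measurable_sj2 _ _) (measurable_pair1 z)).
move=> y _; rewrite -[leRHS]mul1e; apply: lee_wpmul2r=> //; rewrite lee_fin /sj expr0 invr1.
by case: ifP.
Qed.
End Iter.

(** * Between [alpha_sh] and weak subsolutions *)

Section Bridge.
Variables (R : realType) (n : nat) (n0 : (0 < n)%N).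
Notation m := (n+n)%N.
Notation V := (pt R n).
Variables (D : set V) (a : coef_form R n) (L : R).
Let S := Smx a.
Let T p := invmx (Smx a p).
Hypothesis eL : elliptic D S T L.

Let oD := el_open eL.
Let mD : measurable D. Proof. exact: open_meas. Qed.
Let m0 : (0 < m)%N. Proof. by rewrite addn_gt0 n0. Qed.

Lemma enorm_le (x : V) : enorm x <= m%:R * `|x|.
Proof.
have p0 : 0 <= m%:R * `|x| by [].
rewrite /enorm -[leRHS]ger0_norm // -sqrtr_sqr ler_wsqrtr //.
apply: (@le_trans _ _ (m%:R * `|x|^+2)).
 by apply: sum_le_const=> i; rewrite -[leLHS]real_normK ?num_real // ler_pXn2r ?nnegrE // coord_norm.
rewrite exprMn; apply: ler_wpM2r; first exact: exprn_ge0.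
by rewrite -natrX ler_nat leq_pmulr.
Qed.

Definition zero_ext (u : V -> \bar R) (p : V) : \bar R := if `[< D p >] then u p else 0%E.
(** A real representative on the whole space: 0 outside [D] and where [u] is infinite, the latter
    being a null subset of [D] by local integrability. *)
Definition fin_ext (u : V -> \bar R) (p : V) : R := fine (zero_ext u p).

Lemma zero_extT u p : D p -> zero_ext u p = u p. Proof. by move=> h; rewrite /zero_ext asboolT. Qed.
Lemma zero_extF u p : ~ D p -> zero_ext u p = 0%E. Proof. by move=> h; rewrite /zero_ext asboolF. Qed.

Lemma zero_ext_meas (D' : set V) u : D `<=` D' -> borel_fun D' u -> measT (zero_ext u).
Proof.
move=> DD' bu; apply: measurable_fun_if=> //.
- apply: (@measurable_fun_bool _ _ _ _ true); rewrite (_ : _ @^-1` _ = D) ?setTI //.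
 by apply/seteqP; split=> p /= /asboolP.
- move=> _ B mB; rewrite setTI (_ : (fun _=> _) @^-1` _ = D); last by apply/seteqP; split=> p /= /asboolP.
 have h : measurable (D' `&` u @^-1` B) by exact: bu.
 by rewrite (_ : D `&` _ = D `&` (D' `&` u @^-1` B)); [exact: measurableI|rewrite setIA (setIidl DD')].
Qed.

Lemma leb_test (D' : set V) (u : V -> \bar R) (h w : V -> R) (C : set V) : D `<=` D' ->
 measT (zero_ext u) -> loc D h -> (AE y, D y -> u y = (h y)%:E) ->
 smooth w -> compact C -> C `<=` D -> supp C w ->
 leb_int (fun p=> if `[< D' p >] then u p*(Lop a w p)%:E else 0)%E = (Int (fun y=> h y*LS S w y))%:E.
Proof.
move=> DD' mu lh uh sw cC CD sC; rewrite /leb_int.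
have -> : (fun p=> if `[< D' p >] then u p*(Lop a w p)%:E else 0)%E = (fun p=> zero_ext u p*(LS S w p)%:E)%E.
 apply/funext=> p; rewrite LopE //; have [Dp|Dp] := pselect (D p).
 by rewrite zero_extT // asboolT //; exact: DD'.
 rewrite (LS_supp S cC sC); last by move=> /CD.
 by rewrite !mule0; case: ifP.
have mG : measT (fun p=> zero_ext u p*(LS S w p)%:E)%E.
 by apply: emeasurable_funM=> //; apply/EFinP; exact: (Itg_meas (LSd_itg eL sw cC CD sC)).
have Ih := Itg_dLS eL sw cC CD sC lh.
have aeG : ae_eq (lebn R m) setT (fun p=> zero_ext u p*(LS S w p)%:E)%E (EFin \o (fun p=> h p*LS S w p)).
 apply: filterS uh=> p hp _ /=; have [Dp|Dp] := pselect (D p).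
 by rewrite zero_extT // hp.
 rewrite (LS_supp S cC sC); last by move=> /CD.
 by rewrite mule0 mulr0.
have IG : (lebn R m).-integrable setT (fun p=> zero_ext u p*(LS S w p)%:E)%E.
 apply/integrableP; split=> //; have /integrableP[m1 h1] := Ih; apply: le_lt_trans h1.
 apply: ae_ge0_le_integral=> //; [exact: measT_comp|exact: measT_comp|].
 by apply: filterS aeG=> p hp I; rewrite hp.
rewrite iintE // -Int_EFin //; apply: ae_eq_integral=> //.
exact: (measurable_int _ Ih).
Qed.

(** [D'] may exceed [D]; this serves the defining function of the domain, which is given on a
    neighbourhood of the closure. *)
Lemma loc_of_sh (D' : set V) (u : V -> \bar R) : D `<=` D' -> L1loc D' u ->
 (forall w, test_fun D' w -> (0 <= leb_int (fun p=> if `[< D' p >] then u p*(Lop a w p)%:E else 0))%E) ->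
 [/\ loc D (fin_ext u), dsub D S (fin_ext u) & (AE y, D y -> u y = (fin_ext u y)%:E)].
Proof.
move=> DD' [bu Lu] tu; have mu := zero_ext_meas DD' bu.
have IC C : compact C -> C `<=` D -> (lebn R m).-integrable setT (fun p=> (\1_C p)%:E*zero_ext u p)%E.
 move=> cC CD; apply/integrableP; split.
 by apply: emeasurable_funM=> //; apply/EFinP; exact: meas_indic.
 have := Lu C cC (subset_trans CD DD'); rewrite /leb_int.
 have E p : ((\1_C p)%:E * `|u p| = `|(\1_C p)%:E*zero_ext u p|)%E.
 rewrite indicE; have [Cp|Cp] := pselect (C p).
 by rewrite mem_set // !mul1e zero_extT //; exact: CD.
 by rewrite memNset // !mul0e abse0.
 rewrite (_ : (fun p=> _) = (fun p=> `|(\1_C p)%:E*zero_ext u p|)%E); last exact/funext.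
 rewrite iintE_ge0 //; apply: measT_comp=> //.
 by apply: emeasurable_funM=> //; apply/EFinP; exact: meas_indic.
have lh : loc D (fin_ext u).
 split; first by apply: (measT_comp (fine_measurable measurableT)).
 move=> C cC CD; have := integrable_fin_num _ (IC C cC CD).
 have /integrableP[m1 h1] := IC C cC CD; move=> _.
 apply/ItgP; split.
 by apply: measurable_funM; [exact: (measT_comp (fine_measurable measurableT))|exact: meas_indic].
 apply: (le_lt_trans _ h1); apply: ge0_le_integral=> //.
 - apply/EFinP; apply: measT_comp=> //.
 by apply: measurable_funM; [exact: (measT_comp (fine_measurable measurableT))|exact: meas_indic].
 - exact: measT_comp.
 move=> x _; rewrite indicE; case: (x \in C); rewrite ?mulr0 ?normr0 ?mul0e ?abse0 //.
 by rewrite mulr1 mul1e /fin_ext; case: (zero_ext u x)=> [r| |] //=; rewrite ?leey.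
have uh : AE y, D y -> u y = (fin_ext u y)%:E.
 apply: (ae_local oD)=> z Dz; have [e e0 he] := open_Cb eL Dz; exists e=> //.
 have := integrable_ae measurableT (IC _ (@compact_cball _ _ z e) he).
 apply: filterS=> y hy ye; have Cy : Cb z e y by exact: ltW.
 have := hy I; rewrite indicE mem_set // mul1e=> fy.
 by rewrite /fin_ext fineK // zero_extT //; exact: he.
split=> // w C sw w0 cC CD sC.
rewrite -lee_fin -(leb_test DD' mu lh uh sw cC CD sC); apply: tu; split=> //; split=> //.
by exists C; split=> //; exact: subset_trans DD'.
Qed.

Lemma ereal_mid (x y : \bar R) : (x < y)%E -> exists t : R, (x < t%:E < y)%E.
Proof.
case: x=> [x| |]; case: y=> [y| |] // xy.
- by exists ((x+y)/2); rewrite !lte_fin; move: xy; rewrite lte_fin; lra.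
- by exists (x+1); rewrite lte_fin ltry andbT; lra.
- by exists (y-1); rewrite ltNyr lte_fin; lra.
- by exists 0; rewrite ltNyr ltry.
Qed.

Lemma near_Cb (P : V -> Prop) (z : V) : (\forall y \near z, P y) -> exists2 r, 0 < r & forall y, `|z-y| < r -> P y.
Proof. by move=> /nbhs_ballP[r /= r0 hr]; exists r=> // y hy; apply: hr; apply/ballP. Qed.

Lemma null_borelP (N : set V) : null_borel N <-> measurable N /\ lebn R m N = 0%E.
Proof.
have E : measurable N -> leb_int (fun p=> (\1_N p)%:E) = lebn R m N.
 move=> mN; rewrite /leb_int iintE_ge0 ?integral_indic ?setIT //.
 by apply/EFinP; exact: measurable_indic.
by split=> -[mN]; [rewrite E|rewrite -E].
Qed.

(** Strong upper semicontinuity means that [u] is determined by its values off any null set: an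
    essential bound t near z gives a set of full measure on which u <= t. Plain upper semicontinuity
    gives the other inequality. Competitors can thus be modified through their representatives. *)
Lemma member_hat u : alpha_sh a D u -> (forall z, D z -> (u z < 0)%E) -> (exists2 z, D z & u z != -oo%E) ->
 [/\ loc D (fin_ext u), dsub D S (fin_ext u), forall y, fin_ext u y <= 0 &
 forall z, D z -> u z = hat (fin_ext u) z].
Proof.
move=> [h|[Lu [uu su] tu]] un [z0 Dz0 uz0]; first by rewrite h // in uz0.
have [lh dh uh] := loc_of_sh (@subset_refl _ D) Lu tu.
have h0 y : fin_ext u y <= 0.
 rewrite /fin_ext; have [Dy|Dy] := pselect (D y); last by rewrite zero_extF.
 by rewrite zero_extT //; have := un y Dy; case: (u y)=> [r| |] //; rewrite lte_fin=> /ltW.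
split=> // z Dz; apply/eqP; rewrite eq_le; apply/andP; split.
 apply: le_hat=> r t r0 ht; rewrite leNgt; apply/negP=> tu'.
 have [N [mN N0 hN]] : (lebn R m).-negligible (~` [set y | (D y -> u y = (fin_ext u y)%:E) /\ (`|z-y| < r -> fin_ext u y <= t)]).
 by apply: filterS2 uh ht=> y.
 have fA : full_measure_near [set y | (u y <= t%:E)%E] z.
 have [e e0 he] := near_Cb (open_nbhs_nbhs (conj oD Dz)).
 exists (ball z (Num.min r e)), N; split.
 - by apply: nbhsx_ballx; rewrite lt_min r0.
 - exact/null_borelP.
 move=> y [/ballP]; rewrite lt_min=> /andP[y1 y2] /= Ny.
 have [h1 h2] : (D y -> u y = (fin_ext u y)%:E) /\ (`|z-y| < r -> fin_ext u y <= t).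
 by apply: contrapT=> h; apply: Ny; exact: hN.
 by rewrite h1 ?lee_fin; [exact: h2|exact: he].
 have [y [/= y1 _]] := su z Dz _ fA t tu' 1 ltr01.
 by apply/negP; rewrite -leNgt.
rewrite leNgt; apply/negP=> /ereal_mid[t /andP[ut th]].
have [_ /(_ t ut) nt] := uu z Dz.
have [r r0 hr] := near_Cb (filterI nt (open_nbhs_nbhs (conj oD Dz))).
move: th; apply/negP; rewrite -leNgt; apply: (hat_le r0); apply: filterS uh=> y uy yr.
have [yt Dy] := hr y yr; by rewrite -lee_fin -uy //; apply: ltW.
Qed.

(** [hat h] equals [h] almost everywhere by [hat_ae_D], so the integral conditions persist, and an
    essential limsup is strongly upper semicontinuous. This turns a modified representative back
    into a competitor. *)
Lemma hat_alpha_sh h : loc D h -> dsub D S h -> (forall y, h y <= 0) -> alpha_sh a D (hat h).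
Proof.
move=> lh dh h0; right; have hh := hat_ae_D n0 eL lh dh h0.
have bh : borel_fun D (hat h).
 move=> B mB; have mh : measurable (hat h @^-1` B) by rewrite -[X in measurable X]setTI; exact: (hat_meas h).
 have mDh : measurable (D `&` hat h @^-1` B) by exact: measurableI.
 exact: mDh.
have sh z : D z -> forall r t, 0 < r -> (AE y, `|z-y| < r -> D y -> (hat h y <= t%:E)%E) ->
 (hat h z <= t%:E)%E.
 move=> Dz r t r0 ht; have [e e0 he] := near_Cb (open_nbhs_nbhs (conj oD Dz)).
 have re : 0 < Num.min r e by rewrite lt_min r0.
 apply: (hat_le re); apply: filterS2 hh ht=> y h1 h2; rewrite lt_min=> /andP[y1 y2].
 by rewrite -lee_fin -h1; [apply: h2=> //; exact: he|exact: he].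
split.
- split=> // C cC CD; have IC := lh.2 C cC CD.
 rewrite /leb_int iintE_ge0; last 2 first.
 - apply: emeasurable_funM; first by apply/EFinP; exact: meas_indic.
 by apply: measT_comp=> //; exact: hat_meas.
 - pos.
 have /integrableP[m1 h1] := IC; apply: le_lt_trans h1; apply: ae_ge0_le_integral=> //.
 - apply: emeasurable_funM; first by apply/EFinP; exact: meas_indic.
 by apply: measT_comp=> //; exact: hat_meas.
 - exact: measT_comp.
 apply: filterS hh=> y hy _; rewrite /= indicE; have [Cy|Cy] := pselect (C y).
 by rewrite mem_set // mul1e mulr1 hy //; exact: CD.
 by rewrite memNset // mul0e mulr0.
- split.
 move=> z Dz; split; first by apply: (@le_lt_trans _ _ 0%E)=> //; apply: (@hat_le _ _ h z 1 0)=> //; apply: aeW=> y _; exact: h0.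
 by move=> M hM; exact: hat_usc.
 move=> z Dz A [W [N [nW /null_borelP[mN N0] WA]]] M Mh r r0; apply: contrapT=> H.
 have [e e0 he] := near_Cb nW.
 have re : 0 < Num.min (r/(m%:R+1)) e by rewrite lt_min divr_gt0 //.
 move: Mh; apply/negP; rewrite -leNgt; apply: (sh z Dz _ _ re).
 have aN : (AE y, ~ N y) by exists N; split=> // y /= /contrapT.
 apply: filterS aN=> y Ny; rewrite lt_min=> /andP[y1 y2] Dy; rewrite leNgt; apply/negP=> My.
 apply: H; exists y; split=> //; first by apply: WA; split=> //; exact: he.
 apply: (le_lt_trans (enorm_le _)); rewrite distrC; move: y1; rewrite ltr_pdivlMr ?ltr_wpDl // => y1.
 by apply: le_lt_trans y1; rewrite mulrC ler_wpM2l // lerDl.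
move=> w [sw [w0 [C [cC CD sC]]]].
rewrite (leb_test (@subset_refl _ D) (zero_ext_meas (@subset_refl _ D) bh) lh hh sw cC CD sC) lee_fin.
exact: (dh w C).
Qed.

Lemma hat_lb h (z : V) r (t : R) : 0 < r -> (AE y, `|z-y| < r -> t <= h y) -> (t%:E <= hat h z)%E.
Proof.
move=> r0 ht; apply: le_hat=> s t' s0 ht'; rewrite lee_fin leNgt; apply/negP=> tt.
have rs : 0 < Num.min r s by rewrite lt_min r0.
have B0 : lebn R m (ball z (Num.min r s)) = 0%E.
 have mB : measurable (ball z (Num.min r s)) by apply: open_meas; exact: ball_open.
 apply/(negligibleP _ mB).
 apply: negligibleS (negligibleU ht ht')=> y /ballP; rewrite lt_min=> /andP[y1 y2].
 have [h1|h1] := leP t (h y); [right=> /= /(_ y2); move: tt h1; lra|left=> /= /(_ y1); move: h1; lra].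
have := lebn_ball z rs; rewrite B0=> /esym/eqP; rewrite eqe gt_eqF // exprn_gt0 //.
pos.
Qed.

Lemma hat_cont h (z : V) : {for z, continuous h} -> hat h z = (h z)%:E.
Proof.
move=> ch; apply/eqP; rewrite eq_le; apply/andP; split.
 apply/lee_addgt0Pr=> e e0; rewrite -EFinD.
 have /(@cvgrPdist_lt _ _ _ (nbhs z) _ _ _) /(_ e e0) /near_Cb[r r0 hr] := ch.
 apply: (hat_le r0); apply: aeW=> y yr; have := hr y yr; rewrite distrC ltr_norml=> /andP[]; lra.
apply/lee_subgt0Pr=> e e0; rewrite -EFinB.
have /(@cvgrPdist_lt _ _ _ (nbhs z) _ _ _) /(_ e e0) /near_Cb[r r0 hr] := ch.
by apply: (hat_lb r0); apply: aeW=> y yr; have := hr y yr; rewrite ltr_norml=> /andP[]; lra.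
Qed.

Lemma hat_mono h g (z : V) r : 0 < r -> (AE y, `|z-y| < r -> h y <= g y) -> (hat h z <= hat g z)%E.
Proof.
move=> r0 hg; apply: le_hat=> s t s0 ht; apply: (@hat_le _ _ _ _ (Num.min r s)); first by rewrite lt_min r0.
apply: filterS2 hg ht=> y h1 h2; rewrite lt_min=> /andP[y1 y2]; exact: le_trans (h1 y1) (h2 y2).
Qed.

Lemma hat_subc h (z : V) (b : R) : hat (fun y=> h y-b) z = (hat h z-b%:E)%E.
Proof.
apply/eqP; rewrite eq_le; apply/andP; split.
 rewrite leeBrDr //; apply: le_hat=> r t r0 ht; rewrite -leeBrDr // -EFinB; apply: (hat_le r0).
 by apply: filterS ht=> y ht yr; rewrite lerD2r ht.
apply: le_hat=> r t r0 ht; rewrite leeBlDr // -EFinD; apply: (hat_le r0).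
by apply: filterS ht=> y ht yr; rewrite -lerBlDr ht.
Qed.

Lemma loc_ae h g : loc D h -> measT g -> (AE y, g y = h y) -> loc D g.
Proof.
move=> [mh Ih] mg gh; split=> // C cC CD; apply: (@Itg_ae _ _ _ _ _ (Ih C cC CD)).
 by apply: measurable_funM=> //; exact: meas_indic.
by apply: filterS gh=> y ->.
Qed.

Lemma dsub_ae h g : loc D h -> dsub D S h -> measT g -> (AE y, g y = h y) -> dsub D S g.
Proof.
move=> lh dh mg gh w C sw w0 cC CD sC; have h1 := dh w C sw w0 cC CD sC.
have mL := Itg_meas (LSd_itg eL sw cC CD sC).
have e : Int (fun y=> g y*LS S w y) = Int (fun y=> h y*LS S w y).
 apply: ae_Int; [exact: (measurable_funM mg mL)|exact: (measurable_funM lh.1 mL)|].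
 by apply: filterS gh=> y ->.
exact: (eq_ind_r (fun t=> 0 <= t) h1 e).
Qed.

Lemma loc_scale h (b : R) : loc D h -> loc D (fun y=> b*h y).
Proof.
move=> [mh Ih]; split; first by apply: measurable_funM=> //; exact: measurable_cst.
move=> C cC CD; have E y : b*h y*\1_C y = b*(h y*\1_C y) by rewrite mulrA.
exact: (Itg_ext E (ItgZ b (Ih C cC CD))).
Qed.

Lemma dsub_scale h (b : R) : 0 <= b -> loc D h -> dsub D S h -> dsub D S (fun y=> b*h y).
Proof.
move=> b0 lh dh w C sw w0 cC CD sC; have I := Itg_dLS eL sw cC CD sC lh.
have E y : b*h y*LS S w y = b*(h y*LS S w y) by rewrite mulrA.
have h1 := dh w C sw w0 cC CD sC.
exact: (eq_ind_r (fun t=> 0 <= t) (mulr_ge0 b0 h1) (etrans (eq_Int E) (IntZ b I))).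
Qed.

Lemma loc_subc h (b : R) : loc D h -> loc D (fun y=> h y-b).
Proof.
move=> [mh Ih]; split; first by apply: measurable_funB=> //; exact: measurable_cst.
move=> C cC CD; have E y : (h y-b)*\1_C y = h y*\1_C y-b*\1_C y by rewrite mulrBl.
exact: (Itg_ext E (ItgB (Ih C cC CD) (ItgZ b (indic_itg cC)))).
Qed.

Lemma dsub_subc h (b : R) : loc D h -> dsub D S h -> dsub D S (fun y=> h y-b).
Proof.
move=> lh dh w C sw w0 cC CD sC; have I := Itg_dLS eL sw cC CD sC lh.
have I1 := LSd_itg eL sw cC CD sC.
have E y : (h y-b)*LS S w y = h y*LS S w y-b*LS S w y by rewrite mulrBl.
have h1 := dh w C sw w0 cC CD sC.
have e1 := LSd_int0 eL sw cC CD sC.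
have e2 : Int (fun y=> h y*LS S w y)-b*Int (LS S w) = Int (fun y=> h y*LS S w y).
 by rewrite e1 mulr0 subr0.
exact: (eq_ind_r (fun t=> 0 <= t) h1 (etrans (eq_Int E) (etrans (IntB I (ItgZ b I1)) (etrans (f_equal2 (fun p q=> p-q) (erefl _) (IntZ b I1)) e2)))).
Qed.
End Bridge.

(** * Harnack step for a subsolution *)

Section HarnackLocal.
Variables (R : realType) (n : nat) (n0 : (0 < n)%N).
Notation m := (n+n)%N.
Notation V := (pt R n).
Variables (D : set V) (S T : V -> 'M[R]_m) (L : R) (eL : elliptic D S T L).

Let L1 := el_L eL.
Let L0 : 0 < L. Proof. exact: lt_le_trans ltr01 L1. Qed.
Let m0 : (0 < m)%N. Proof. by rewrite addn_gt0 n0. Qed.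
Let m2 : (1 < m)%N. Proof. by case: n n0=> // k _; rewrite addnS. Qed.
Let mR : 1 <= m%:R :> R. Proof. by rewrite ler1n. Qed.
Let mR0 : 0 < m%:R :> R. Proof. exact: lt_le_trans ltr01 mR. Qed.

Lemma Cb_le (c : V) (r s : R) y : r <= s -> Cb c r y -> Cb c s y.
Proof. by move=> rs h; exact: le_trans rs. Qed.

Definition deficit (c : V) (r M : R) (h : V -> R) (y : V) : R := if `|c-y| < r then Num.max (M-h y) 0 else 0.

Lemma deficit_ge0 c r M h y : 0 <= deficit c r M h y.
Proof. by rewrite /deficit; case: ifP=> // _; rewrite le_max lexx orbT. Qed.

Lemma deficit_meas c r M h : measT h -> measT (deficit c r M h).
Proof.
move=> mh; apply: measurable_fun_ifT; last exact: measurable_cst.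
 apply: (@measurable_fun_bool _ _ _ _ true); rewrite setTI.
 rewrite (_ : _ @^-1` _ = ball c r); last by apply/seteqP; split=> y /ballP.
 by apply: open_meas; exact: ball_open.
apply: measurable_maxr; last exact: measurable_cst.
by apply: measurable_funB; [exact: measurable_cst|exact: mh].
Qed.

(** With K = 1/(8 m L rho) the hypothesis of [Pk_low] holds up to distance 4 rho, and the kernel has
    range L/K = 8 m L^2 rho. [Lam] is sixteen times this range over rho, which leaves the room that
    [locf_sub] and [clamp] ask for. [Ca] collects K^(-m), the lower bound of the kernel and the
    mass. *)
Definition Ca : R := (8 * m%:R*L)^+m*(4*expR 2)*kmax n L.
Definition Lam : R := 128 * m%:R*L^+2.

Lemma Ca_ge0 : 0 <= Ca.
Proof.
apply: mulr_ge0; first pos.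
rewrite /kmax !mulr_ge0 ?exprn_ge0 ?Int_dom_ge0 //; exact: ltW.
Qed.

(* The kernel [Pk] at scale [128 m L^2 rho] is bounded below by a multiple of [rho^-m] on the ball of radius [2 rho]. *)
Lemma mass_bound h c rho M z1 : 0 < rho -> K0 n L*(8 * m%:R*L*rho) <= 1 -> Cb c (Lam*rho) `<=` D ->
 loc D h -> dsub D S h -> (AE y, Cb c (Lam*rho) y -> h y <= M) ->
 `|c-z1| < 2*rho -> hat h z1 \is a fin_num ->
 (\int[lebn R m]_y (deficit c (2*rho) M h y)%:E <= (Ca*rho^+m*(M-fine (hat h z1)))%:E)%E.
Proof.
move=> rho0 rK cD lh dh hM z1r hf.
pose R1 := 8 * m%:R*L^+2*rho.
have q0 : 0 < 8 * m%:R*L*rho by rewrite !mulr_gt0.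
pose K := (8 * m%:R*L*rho)^-1.
have K00 : 0 < K by rewrite invr_gt0.
have KK : K0 n L <= K by rewrite -[leRHS]mul1r ler_pdivlMr.
have R10 : 0 < R1 by rewrite !mulr_gt0.
have LK : L/K <= R1 by rewrite /K invrK /R1 le_eqVlt; apply/orP; left; apply/eqP; ring.
have rR : 8*rho <= R1.
 rewrite /R1; apply: ler_wpM2r; first exact: ltW.
 rewrite -mulrA ler_peMr // -[leLHS]mulr1; apply: ler_pM=> //.
 exact: exprn_ege1.
have r0 : 0 < 4*R1 by rewrite mulr_gt0.
have e16 : 4*(4*R1) = Lam*rho by rewrite /R1 /Lam; ring.
have cD' : Cb c (4*(4*R1)) `<=` D by rewrite e16.
have G := gell_clamp eL r0 cD'.
have C4 : Cb c (4*R1) `<=` Cb c (Lam*rho).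
 by move=> y; apply: Cb_le; rewrite -e16; move: R10; lra.
have cC : compact (Cb c (4*R1)) by exact: compact_cball.
have CD : Cb c (4*R1) `<=` D by move=> y /C4 /cD.
have hM' : (AE y, Cb c (4*R1) y -> h y <= M) by apply: filterS hM=> y hy /C4.
have [kp km] : (forall z, 0 < kap (cl c (4*R1) T z)) /\ (forall z, kap (cl c (4*R1) T z) <= kmax n L).
 by split=> z; have /andP[] := kap_bnd n0 G z.
pose f := locf h (Cb c (4*R1)) M.
have If : Itg f := locf_itg M lh cC CD.
have f0 y : f y <= 0 by exact: locf_le0.
have sf : subC (cl c (4*R1) S) (Cb c (4*R1)) f := locf_sub eL r0 cD' lh dh hM'.
have z1R : `|c-z1| < R1 by move: z1r rR rho0; lra.
have hE : hat f z1 = (hat h z1-M%:E)%E.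
 rewrite -hat_subc; apply: (@hat_ext _ _ _ _ _ R1)=> //; apply: filterS hM'=> y hy yr.
 have Cy : Cb c (4*R1) y.
 by apply: (le_trans (ler_distD z1 c y)); move: yr z1R R10; lra.
 by rewrite /f locf_eq //; exact: hy.
have hff : hat f z1 \is a fin_num by rewrite hE fin_numB hf.
have := PK_le_fine n0 G R10 If f0 sf KK LK z1R hff.
set X := PK _ _ _ _ _=> hX.
have fE : - fine (hat f z1) = M-fine (hat h z1) by rewrite hE fineB // opprB.
have Mh : 0 <= M-fine (hat h z1).
 rewrite -fE oppr_ge0 -lee_fin fineK //; exact: (hat_le0 f0).
have X1 : (X <= (kmax n L*(M-fine (hat h z1)))%:E)%E.
 by apply: (le_trans hX); rewrite lee_fin fE; apply: ler_wpM2r.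
pose k1 := K^+m*(expR (- 2)/4).
have k10 : 0 < k1 by rewrite mulr_gt0 ?exprn_gt0 //.
have k1E : Ca*rho^+m*(M-fine (hat h z1)) = k1^-1*(kmax n L*(M-fine (hat h z1))).
 have -> : k1^-1 = (8 * m%:R*L*rho)^+m*(4*expR 2).
 by rewrite /k1 expRN exprVn -!invfM invrK (mulrC (expR 2)).
 rewrite (exprMn m (8 * m%:R*L) rho) /Ca.
 by move: (_^+m) (expR 2) (kmax _ _) (rho^+m)=> p q r s; ring.
have main : ((k1%:E*\int[lebn R m]_y (deficit c (2*rho) M h y)%:E) <= X)%E.
 rewrite -ge0_integralZl_EFin //; last 3 first.
 - by move=> y _; rewrite lee_fin deficit_ge0.
 - by apply/EFinP; exact: deficit_meas lh.1.
 - exact: ltW.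
 have PKm := PK_meas n0 G If K z1.
 apply: ae_ge0_le_integral=> //.
 - by move=> y _; rewrite mule_ge0 ?lee_fin ?deficit_ge0 // ltW.
 - by apply: measurable_funeM; apply/EFinP; exact: deficit_meas lh.1.
 - by move=> y _; rewrite lee_fin mulr_ge0 ?oppr_ge0 //; exact: (Pk0_ge0 n0 G KK).
 exists [set z1]; split; [|exact: lebn_point m0|].
 by apply: compact_meas; exact: compact_set1.
 move=> y /= hy; apply: contrapT=> yz; apply: hy=> _; rewrite -EFinM lee_fin.
 have P0 := Pk0_ge0 n0 G KK z1 y.
 rewrite /deficit; case: ifP=> yr; last by rewrite mulr0 mulr_ge0 // oppr_ge0.
 have Cy : Cb c (4*R1) y by rewrite /Cb /=; move: yr rR rho0; lra.
 have -> : - f y = Num.max (M-h y) 0.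
 rewrite /f /locf indicE mem_set // mulr1.
 by case: (leP (h y-M) 0)=> q; rewrite ?oppr0 ?opprB; case: leP=> //; move: q; lra.
 rewrite mulrC; apply: ler_wpM2l; first by rewrite le_max lexx orbT.
 apply: (Pk_low n0 G KK); first by apply/eqP.
 have yz4 : `|y-z1| <= 4*rho.
 by apply: (le_trans (ler_distD c y z1)); rewrite (distrC y c); move: yr z1r; lra.
 apply: (@le_trans _ _ (K*(m%:R*L)*(4*rho))).
 by apply: ler_wpM2l=> //; rewrite !mulr_ge0 // ltW.
 rewrite /K le_eqVlt; apply/orP; left; apply/eqP; field.
 by apply/and3P; split; rewrite -?natrD; exact: lt0r_neq0.
rewrite k1E EFinM; apply: (@le_trans _ _ (k1^-1%:E*(k1%:E*\int[lebn R m]_y (deficit c (2*rho) M h y)%:E))%E).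
 by rewrite muleA -EFinM mulVf ?mul1e // gt_eqF.
by apply: lee_wpmul2l; [rewrite lee_fin invr_ge0 ltW|exact: le_trans X1].
Qed.

(** The power 2m counts the iterations; the inner 2^(2m) is the loss from the smallest radius
    rho/2^(2m), and the remaining factor comes from [iter_all]. *)
Definition Cd : R := (2^+(m+m) * `|C1 n L|*(2^+(5 * m)*3))^+(m+m).

Lemma Cd_ge0 : 0 <= Cd.
Proof. pos. Qed.

(** Each use of [one_step] halves the radius and bounds the gap below M on the smaller ball by a
    singular integral of the previous gap; after 2m halvings [iter_all] leaves the integral of the
    initial gap. *)
Lemma iterated_step h c rho M : 0 < rho -> rho <= 1 -> Cb c (32*rho) `<=` D ->
 loc D h -> dsub D S h -> (AE y, Cb c (8*rho) y -> h y <= M) ->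
 exists h', [/\ loc D h', dsub D S h', (forall y, ~ Cb c (5*rho) y -> h' y = h y),
 (AE y, Cb c (8*rho) y -> h' y <= M) &
 (AE z, `|c-z| < rho/2^+(m+m) ->
 ((M-h' z)%:E <= (Cd/rho^+m)%:E*\int[lebn R m]_y (deficit c (2*rho) M h y)%:E)%E)].
Proof.
move=> rho0 rho1 cD lh dh hM.
pose rj (j : nat) := rho/2^+j.
have rj0 j : 0 < rj j by rewrite divr_gt0 //.
have rjS j : 2*rj j.+1 = rj j by rewrite /rj exprS invfM mulrCA (mulrA 2) divff ?mul1r.
have rjle j : rj j <= rho by rewrite ler_pdivrMr // ler_peMr ?(ltW rho0) // exprn_ege1 // ler1n.
pose P (g : V -> R) := [/\ loc D g, dsub D S g, (forall y, ~ Cb c (5*rho) y -> g y = h y) &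
 (AE y, Cb c (8*rho) y -> g y <= M)].
pose Q (j : nat) (g g' : V -> R) := AE z, `|c-z| < rj j ->
 ((M-g' z)%:E <= (C1 n L/rj j)%:E*\int[lebn R m]_y (kk (rj j) (y-z)*Num.max (M-g y) 0)%:E)%E.
have step (jx : nat * {g | P g}) : exists y : {g | P g}, Q jx.1 (sval jx.2) (sval y).
 case: jx=> j [g Pg] /=; have [lg dg gh gM] := Pg.
 have cDj : Cb c (32*rj j) `<=` D by move=> y hy; apply: cD; apply: Cb_le hy; rewrite ler_pM2l.
 have gMj : AE y, Cb c (8*rj j) y -> g y <= M.
 by apply: filterS gM=> y hy Cy; apply: hy; apply: Cb_le Cy; rewrite ler_pM2l.
 have [g' [lg' dg' _ gg' [gM' gQ]]] := one_step n0 eL (rj0 j) (le_trans (rjle j) rho1) cDj lg dg gMj.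
 suff Pg' : P g' by exists (exist _ g' Pg').
 split=> //.
 move=> y hy; rewrite gg' ?gh // => Cy; apply: hy; apply: Cb_le Cy; by rewrite ler_pM2l.
 apply: filterS2 gM gM'=> y h1 h2 Cy; have [Cj|Cj] := pselect (Cb c (8*rj j) y); first exact: h2.
 rewrite gg'; first exact: h1.
 by move=> C5; apply: Cj; apply: Cb_le C5; rewrite ler_pM2r // ler_nat.
have [F hF] := choice step.
have Ph : P h by [].
pose s := fix s (j : nat) : {g | P g} := if j is i.+1 then F (i, s i) else exist _ h Ph.
have sQ j : Q j (sval (s j)) (sval (s j.+1)) := hF (j, s j).
have sP j : P (sval (s j)) := svalP (s j).
(* Set to zero beyond index 2m, because [iter_all] asks for the recursion at every index with one
   constant. *)
pose q (j : nat) (y : V) : \bar R := if (j <= m+m)%N then (deficit c (2*rj j) M (sval (s j)) y)%:E else 0%E.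
pose a := 2^+(m+m) * `|C1 n L|/rho.
have a0 : 0 <= a by rewrite divr_ge0 ?(ltW rho0) //.
have gq j : good c rho (q j).
 rewrite /q; case: (j <= m+m)%N; last pos.
 split.
 - by apply/EFinP; apply: deficit_meas; have [[]] := sP j.
 - by move=> x; rewrite lee_fin deficit_ge0.
 move=> x hx; rewrite /deficit ifN //; apply/negP=> hx'; apply: hx.
 by apply: (lt_le_trans hx'); rewrite ler_pM2l.
have qs j : AE z, (q j.+1 z <= a%:E*\int[lebn R m]_w ((sj (m+m).-2 rho (w-z))%:E*q j w))%E.
 have I0 z : (0 <= a%:E*\int[lebn R m]_w ((sj (m+m).-2 rho (w-z))%:E*q j w))%E.
 rewrite mule_ge0 ?lee_fin //; apply: integral_ge0=> w _; rewrite mule_ge0 ?lee_fin ?sj_ge0 //.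
 by have [_ g2 _] := gq j.
 have [jm|jm] := leqP j.+1 (m+m); last by apply: aeW=> z; rewrite {1}/q leqNgt jm.
 apply: filterS (sQ j)=> z hz; rewrite {1}/q jm /deficit rjS; case: ifP=> zr; last exact: I0.
 rewrite EFin_max ge_max I0 andbT; apply: (le_trans (hz zr)).
 have [lg _ _ _] := sP j.
 have mq : measT (q j) by have [] := gq j.
 have mz : measT (fun w : V=> w-z).
 apply: meas_coords=> i.
 rewrite (_ : (fun q : V=> _) = (fun q : V=> q 0 i-z 0 i)); last by apply/funext=> w; rewrite !mxE.
 by apply: measurable_funB; [exact: measurable_coord|exact: measurable_cst].
 have mk r : measT (fun w : V=> kk r (w-z)) := measT_comp (measurable_kk n0 r) mz.
 have c1a : C1 n L/rj j <= a.
 apply: (@le_trans _ _ (`|C1 n L|/rj j)); first by rewrite ler_wpM2r ?ler_norm // invr_ge0 ltW.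
 have -> : `|C1 n L|/rj j = 2^+j*(`|C1 n L|/rho) by rewrite /rj invfM invrK; move: (rho^-1) (2^+j)=> u v; ring.
 rewrite /a -[leRHS]mulrA; apply: ler_wpM2r; first pos.
 by rewrite ler_weXn2l ?ler1n // ltnW.
 apply: (@le_trans _ _ (a%:E*\int[lebn R m]_y (kk (rj j) (y-z)*Num.max (M-sval (s j) y) 0)%:E)%E).
 apply: lee_wpmul2r; last pos.
 by apply: integral_ge0=> w _; rewrite lee_fin mulr_ge0 ?kk_ge0 // le_max lexx orbT.
 apply: lee_wpmul2l; first pos.
 apply: ge0_le_integral=> //.
 - by move=> w _; rewrite lee_fin mulr_ge0 ?kk_ge0 // le_max lexx orbT.
 - apply/EFinP; apply: measurable_funM=> //; apply: measurable_maxr; last exact: measurable_cst.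
 by apply: measurable_funB; [exact: measurable_cst|exact: lg.1].
 - by apply: emeasurable_funM=> //; apply/EFinP; exact: (mk rho).
 move=> w _; rewrite /q (ltnW jm) -EFinM lee_fin /kk /sj /deficit.
 case: (ltP `|w-z| (rj j))=> wr; last first.
 by rewrite mul0r mulr_ge0 //; [case: ifP=> // _; rewrite invr_ge0 exprn_ge0 // sqrtr_ge0|case: ifP=> // _; rewrite le_max lexx orbT].
 have cw : `|c-w| < 2*rj j.
 by apply: (le_lt_trans (ler_distD z c w)); rewrite (distrC z w); move: wr zr; lra.
 by rewrite (lt_le_trans wr (rjle j)) cw.
exists (sval (s (m+m)%N)); have [lg dg gh gM] := sP (m+m)%N; split=> //.
have := iter_all m2 rho0 a0 gq qs.
apply: filterS=> z hz zr; move: hz.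
rewrite /q leqnn leq0n /deficit -/(rj (m+m)%N) (lt_le_trans zr); last first.
 by rewrite -/(rj (m+m)%N); move: (rj0 (m+m)%N); lra.
rewrite EFin_max ge_max=> /andP[+ _]=> h1; apply: (le_trans h1).
have r0E : rj 0%N = rho by rewrite /rj divr1.
rewrite r0E; apply: lee_wpmul2r.
 by apply: integral_ge0=> y _; rewrite lee_fin deficit_ge0.
rewrite lee_fin le_eqVlt; apply/orP; left; apply/eqP.
have -> : a*(2^+(5 * m)*(3*sqrt rho)) = (2^+(m+m) * `|C1 n L|*(2^+(5 * m)*3))*(sqrt rho/rho).
 by rewrite /a; move: (2^+(m+m)) (2^+(5 * m))=> u v; ring.
rewrite exprMn /Cd; congr (_*_).
rewrite addnn -mul2n exprM [X in X^+m](_ : _ = rho^-1) ?exprVn //.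
by rewrite exprMn sqr_sqrtr ?(ltW rho0) // mulrA divff ?mul1r // gt_eqF.
Qed.

Definition Ch : R := 1+Cd*Ca.

Lemma Ch_ge1 : 1 <= Ch.
Proof. by rewrite lerDl mulr_ge0 ?Ca_ge0 ?Cd_ge0. Qed.

(** [mass_bound] estimates the integral of the gap by the gap at the single point z1, and
    [iterated_step] estimates the gap of the raised function near c by that integral; the powers of
    rho cancel. *)
Lemma harnack_step h c rho M z1 : 0 < rho -> rho <= 1 -> K0 n L*(8 * m%:R*L*rho) <= 1 -> Cb c (Lam*rho) `<=` D ->
 loc D h -> dsub D S h -> (AE y, Cb c (Lam*rho) y -> h y <= M) ->
 `|c-z1| < 2*rho -> hat h z1 \is a fin_num ->
 exists h', [/\ loc D h', dsub D S h', (forall y, ~ Cb c (5*rho) y -> h' y = h y),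
 (AE y, Cb c (8*rho) y -> h' y <= M) &
 (AE z, `|c-z| < rho/2^+(m+m) -> M-Ch*(M-fine (hat h z1)) <= h' z)].
Proof.
move=> rho0 rho1 rK cD lh dh hM z1r hf.
have LL : 32*rho <= Lam*rho.
 rewrite ler_pM2r // /Lam -mulrA -[leLHS]mulr1; apply: ler_pM=> //; first lra.
 by apply: (le_trans mR); rewrite ler_peMr // exprn_ege1.
have C32 y : Cb c (32*rho) y -> Cb c (Lam*rho) y by exact: Cb_le.
have C8 y : Cb c (8*rho) y -> Cb c (Lam*rho) y.
 by move=> hy; apply: C32; apply: Cb_le hy; rewrite ler_pM2r // ler_nat.
have hM8 : (AE y, Cb c (8*rho) y -> h y <= M) by apply: filterS hM=> y hy /C8.
have mb := mass_bound rho0 rK cD lh dh hM z1r hf.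
have [h' [lh' dh' hh' hM' hz]] := iterated_step rho0 rho1 (fun y hy=> cD y (C32 y hy)) lh dh hM8.
exists h'; split=> //; apply: filterS hz=> z hz zr.
have Mh : 0 <= M-fine (hat h z1).
 rewrite subr_ge0 -lee_fin fineK //; apply: (@hat_le _ _ _ _ rho)=> //; apply: filterS hM=> y hy yr.
 apply: hy; apply: C8; apply: (le_trans (ler_distD z1 c y)); move: yr z1r rho0; lra.
have Cd0 : 0 <= Cd/rho^+m.
 pos.
have := le_trans (hz zr) (lee_wpmul2l _ mb); rewrite lee_fin=> /(_ Cd0).
rewrite -EFinM lee_fin; have -> : Cd/rho^+m*(Ca*rho^+m*(M-fine (hat h z1))) = Cd*Ca*(M-fine (hat h z1)).
 have := lt0r_neq0 (exprn_gt0 m rho0); move: (rho^+m) Cd Ca=> p q r p0; field; exact: p0.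
by rewrite /Ch mulrDl mul1r; move: Mh; lra.
Qed.
End HarnackLocal.

Lemma powR_between (R : realType) (k g : R) : 0 < k < 1 -> g < 1 -> exists2 al : R, 0 < al <= 1 & g <= k `^ al.
Proof.
move=> /andP[k0 k1] g1; pose g' := Num.max g (1/2).
have g'0 : 0 < g' by rewrite lt_max; apply/orP; right; rewrite divr_gt0.
have g'1 : g' < 1 by rewrite gt_max g1; lra.
have lk : ln k < 0 by rewrite -(ln1 R) ltr_ln ?posrE.
have lg : ln g' < 0 by rewrite -(ln1 R) ltr_ln ?posrE.
pose a0 := ln g'/ln k.
have a00 : 0 < a0 by rewrite /a0 -mulrNN mulr_gt0 ?oppr_gt0 ?invr_lt0.
exists (Num.min a0 1); first by rewrite lt_min a00 ltr01 ge_min lexx orbT.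
apply: (@le_trans _ _ g'); first by rewrite le_max lexx.
have -> : g' = expR (a0 * ln k) by rewrite divfK ?lt_eqF // lnK //.
by rewrite /powR gt_eqF // ler_expR ler_wnM2r ?(ltW lk) // ge_min lexx.
Qed.

Lemma pow_bracket (R : realType) (k t : R) : 0 < k < 1 -> 0 < t <= 1 -> exists j, k^+j.+1 < t <= k^+j.
Proof.
move=> /andP[k0 k1] /andP[t0 t1].
have ex : exists j, k^+j < t.
 have : (fun j=> k^+j) @ \oo --> (0 : R) by apply: cvg_expr; rewrite gtr0_norm.
 move=> /(@cvgrPdist_lt _ _ _ \oo _ _ _) /(_ t t0) [N _ hN]; exists N.
 by have := hN N (leqnn N); rewrite sub0r normrN gtr0_norm // exprn_gt0.
case: (ex_minnP ex)=> -[|j] hj mj; first lra.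
exists j; rewrite hj /= leNgt; apply/negP=> h; have := mj j h; by rewrite ltnn.
Qed.

(** * Oscillation of the envelope away from [K] *)

Section Oscillation.
Variables (R : realType) (n : nat) (n0 : (0 < n)%N).
Notation m := (n+n)%N.
Notation V := (pt R n).
Variables (D : set V) (a : coef_form R n) (L : R).
Let S := Smx a.
Let T p := invmx (Smx a p).
Hypothesis eL : elliptic D S T L.
Variables (K : set V) (psi W : V -> R) (KD : K `<=` D) (hW : forall z, D z -> omega_alpha a K D psi z = (W z)%:E).

Let L1 := el_L eL.
Let L0 : 0 < L. Proof. exact: lt_le_trans ltr01 L1. Qed.
Let mR : 1 <= m%:R :> R. Proof. by rewrite ler1n addn_gt0 n0. Qed.
Let C1g : 1 <= Ch n L. Proof. exact: (Ch_ge1 eL). Qed.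

Lemma Lam_ge : 32 <= Lam n L.
Proof.
rewrite /Lam -mulrA -[leLHS]mulr1; apply: ler_pM=> //; first lra.
by apply: (le_trans mR); rewrite ler_peMr ?exprn_ege1.
Qed.

(** A competitor nearly optimal at z1 is raised near c. It is unchanged off the ball of radius 5
    rho, hence near [K], so it is still a competitor and the envelope at z2 lies above it.
    Extremality turns the one-sided estimate for subsolutions into a two-point inequality for
    [W]. *)
Lemma omega_harnack c rho M z1 z2 : 0 < rho -> rho <= 1 -> K0 n L*(8 * m%:R*L*rho) <= 1 ->
 Cb c (Lam n L*rho) `<=` D -> (forall y, K y -> ~ Cb c (Lam n L*rho) y) -> M <= 0 ->
 (forall y, Cb c (Lam n L*rho) y -> W y <= M) ->
 `|c-z1| < 2*rho -> `|c-z2| < rho/2^+(m+m) -> M-W z2 <= Ch n L*(M-W z1).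
Proof.
move=> rho0 rho1 rK cD cK M0 hM z1r z2r; apply/ler_addgt0Pr=> e' e'0.
(* Used twice: as the gap to the supremum at z1, which is amplified by [Ch], and as the constant
   subtracted to make the competitor strictly negative. *)
pose e := e'/(Ch n L+1); have Cp : 0 < Ch n L+1 by move: C1g; lra.
have e0 : 0 < e by rewrite divr_gt0.
have L32 := Lam_ge.
have C8 : 8*rho < Lam n L*rho by rewrite ltr_pM2r //; move: L32; lra.
have p20 : 1 <= 2^+(m+m) :> R by rewrite exprn_ege1 // ler1n.
have rr : rho/2^+(m+m) <= rho by rewrite ler_pdivrMr // ler_peMr // ltW.
have Dz1 : D z1 by apply: cD; apply: ltW; apply: (lt_trans z1r); move: C8 rho0; lra.
have Dz2 : D z2 by apply: cD; apply: ltW; apply: (lt_le_trans z2r); move: C8 rho0 rr; lra.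
have : ((W z1-e)%:E < omega_alpha a K D psi z1)%E by rewrite hW // lte_fin; move: e0; lra.
move=> /ereal_sup_gt[_ [u [ua un uK] <-]] uz1.
have uW z : D z -> (u z <= (W z)%:E)%E by move=> Dz; rewrite -hW //; apply: ereal_sup_ubound; exists u.
have ne : exists2 z, D z & u z != -oo%E by exists z1=> //; apply: contraTneq uz1=> ->; rewrite -leNgt leNye.
have [lh dh h0 uh] := member_hat eL ua un ne.
set h := fin_ext D u in lh dh h0 uh.
have hf : hat h z1 \is a fin_num.
 rewrite -uh // fin_numE; have := un z1 Dz1; move: uz1; by case: (u z1).
pose t := fine (hat h z1); have tE : t%:E = u z1 by rewrite fineK // uh.
have tW : t <= W z1 by rewrite -lee_fin tE; exact: uW.
have tM : t <= M by apply: (le_trans tW); apply: hM; apply: ltW; apply: (lt_trans z1r); move: C8 rho0; lra.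
have hM' : AE y, Cb c (Lam n L*rho) y -> h y <= M.
 have := hat_ae_D n0 eL lh dh h0; apply: filterS=> y hy Cy; have Dy := cD y Cy.
 rewrite -lee_fin -hy // -uh //; apply: (le_trans (uW y Dy)); rewrite lee_fin; exact: hM.
have [h' [lh' dh' hh' hM8 hz]] := harnack_step n0 eL rho0 rho1 rK cD lh dh hM' z1r hf.
(* The raised function is nonpositive almost everywhere only; truncation at 0 changes a null set and
   gives the sign at every point. *)
have h'0 : AE y, Num.min (h' y) 0 = h' y.
 apply: filterS hM8=> y hy; apply: min_l; have [Cy|Cy] := pselect (Cb c (8*rho) y).
 by apply: (le_trans (hy Cy)).
 by rewrite hh' // => C5; apply: Cy; apply: Cb_le C5; rewrite ler_pM2r // ler_nat.
have mg : measT (fun y=> Num.min (h' y) 0).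
 by apply: measurable_minr; [exact: lh'.1|exact: measurable_cst].
have lg := loc_ae lh' mg h'0; have dg := dsub_ae eL lh' dh' mg h'0.
pose g y := Num.min (h' y) 0-e.
have ge y : g y <= - e by rewrite lerBlDr addNr ge_min lexx orbT.
have g0 y : g y <= 0 by apply: (le_trans (ge y)); move: e0; lra.
have ua' : alpha_sh a D (hat g) := hat_alpha_sh n0 eL (loc_subc e lg) (dsub_subc eL e lg dg) g0.
have Ug : U_class a K D psi (hat g).
 split=> //.
 move=> z _; apply: (@le_lt_trans _ _ (- e)%:E); last by rewrite lte_fin; move: e0; lra.
 by apply: (@hat_le _ _ _ _ rho)=> //; apply: aeW=> y _; exact: ge.
 (* The value of [hat] at z depends on a neighbourhood of z: the ball of radius rho about a point of
    [K] misses the ball of radius 5 rho, as [Lam] exceeds 8. *)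
 move=> z Kz; apply: le_trans (uK z Kz); rewrite uh; last exact: KD.
 apply: (hat_mono rho0); apply: aeW=> y zy; rewrite /g hh'.
 by apply: (@le_trans _ _ (Num.min (h y) 0)); [move: e0; lra|rewrite ge_min lexx].
 move=> C5; apply: (cK z Kz); apply: (le_trans (ler_distD y c z)); rewrite (distrC y z).
 by move: C5 zy C8 rho0; rewrite /Cb /=; lra.
have gW : (hat g z2 <= (W z2)%:E)%E by rewrite -hW //; apply: ereal_sup_ubound; exists (hat g).
have Ct : 0 <= Ch n L*(M-t) by rewrite mulr_ge0 ?subr_ge0 //; move: C1g; lra.
have gl : ((M-Ch n L*(M-t)-e)%:E <= hat g z2)%E.
 have r0 : 0 < rho/2^+(m+m) - `|c-z2| by rewrite subr_gt0.
 apply: (hat_lb r0); apply: filterS hz=> y hy zy; rewrite /g lerD2r le_min; apply/andP; split.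
 by apply: hy; apply: (le_lt_trans (ler_distD z2 c y)); move: zy; lra.
 by move: M0 Ct; lra.
have := le_trans gl gW; rewrite lee_fin.
have : W z1-e < t by rewrite -lte_fin tE.
have ee : e*(Ch n L+1) = e' by rewrite divfK // gt_eqF.
have : Ch n L*(M-t) <= Ch n L*(M-W z1)+Ch n L*e -> M-Ch n L*(M-t)-e <= W z2 ->
 M-W z2 <= Ch n L*(M-W z1)+e' by rewrite -ee; lra.
move=> fin ht; apply: fin; rewrite -mulrDr; apply: ler_wpM2l; first by move: C1g; lra.
by move: ht; lra.
Qed.

Hypothesis W0 : forall z, D z -> W z <= 0.

(** [rmax] makes rho = r/Lam at most 1 and small enough for [mass_bound]; [kos] places the smaller
    cube inside the ball of radius rho/2^(2m), with a factor 2 for strictness; [gos] is the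
    resulting decay factor. *)
Definition rmax : R := Lam n L/(1 + `|K0 n L*(8 * m%:R*L)|).
Definition kos : R := (2*(2^+(m+m)*Lam n L))^-1.
Definition gos : R := 1-(Ch n L)^-1.

Let Lp : 0 < Lam n L. Proof. by apply: lt_le_trans Lam_ge. Qed.

Lemma rmax_gt0 : 0 < rmax. Proof. pos. Qed.

Lemma kos_bnd : 0 < kos < 1.
Proof.
have p20 : 1 <= 2^+(m+m) :> R by rewrite exprn_ege1 // ler1n.
have h : 1 < 2*(2^+(m+m)*Lam n L).
 apply: (@lt_le_trans _ _ (2*(1*32))); first by lra.
 by apply: ler_wpM2l=> //; apply: ler_pM=> //; exact: Lam_ge.
by rewrite invr_gt0 invf_lt1 (lt_trans ltr01 h).
Qed.

Lemma gos_bnd : 0 <= gos < 1.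
Proof.
have C0 : 0 < Ch n L := lt_le_trans ltr01 C1g.
by rewrite subr_ge0 invf_le1 // C1g gtrBl invr_gt0.
Qed.

(** With M the supremum on the large cube, Harnack gives M - W y >= (M - W w)/Ch for all pairs in
    the small cube. Hence W y - W w <= (1 - 1/Ch)(M - W w), and M - W w is at most A. *)
Lemma osc_step c r A : 0 < r -> r <= rmax -> Cb c r `<=` D -> (forall y, K y -> ~ Cb c r y) ->
 (forall y w, Cb c r y -> Cb c r w -> W y-W w <= A) ->
 forall y w, Cb c (kos*r) y -> Cb c (kos*r) w -> W y-W w <= gos*A.
Proof.
move=> r0 rm cD cK hA y w Cy Cw.
pose rho := r/Lam n L; have rho0 : 0 < rho by rewrite divr_gt0.
have rE : Lam n L*rho = r by rewrite mulrC divfK // gt_eqF.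
have X0 := normr_ge0 (K0 n L*(8 * m%:R*L)).
have rX : rho*(1 + `|K0 n L*(8 * m%:R*L)|) <= 1.
 rewrite -ler_pdivlMr ?ltr_pwDl // /rho ler_pdivrMr // mul1r mulrC; exact: rm.
have rho1 : rho <= 1.
 by apply: le_trans rX; rewrite ler_peMr ?(ltW rho0) // lerDl.
have rK : K0 n L*(8 * m%:R*L*rho) <= 1.
 apply: le_trans rX; rewrite mulrA mulrC; apply: ler_wpM2l; first exact: ltW.
 by apply: (le_trans (ler_norm _)); rewrite lerDr.
have cc : Cb c r c by rewrite /Cb /= subrr normr0 ltW.
have hs : has_sup [set W x | x in Cb c r].
 split; first by exists (W c), c.
 by exists 0=> _ [x Cx <-]; exact: W0 (cD _ Cx).
pose M := sup [set W x | x in Cb c r].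
have WM x : Cb c r x -> W x <= M by move=> Cx; apply: sup_upper_bound=> //; exists x.
have M0 : M <= 0 by apply: ge_sup; [exact: hs.1|move=> _ [x Cx <-]; exact: W0 (cD _ Cx)].
have k2 : kos*r < rho/2^+(m+m).
 have e1 : kos*r = rho/2^+(m+m)/2.
 by rewrite /kos /rho !invfM; move: (2^+(m+m))^-1 (Lam n L)^-1=> p q; ring.
 by rewrite e1 gtr_pMr ?divr_gt0 ?exprn_gt0 //; lra.
have p20 : 1 <= 2^+(m+m) :> R by rewrite exprn_ege1 // ler1n.
have rr : rho/2^+(m+m) <= rho by rewrite ler_pdivrMr // ler_peMr // ltW.
have kr : kos*r <= r by rewrite ler_piMl ?(ltW r0) //; have /andP[_ /ltW] := kos_bnd.
have y2 : `|c-y| < 2*rho by move: Cy k2 rr rho0; rewrite /Cb /=; lra.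
have w2 : `|c-w| < rho/2^+(m+m) by exact: (le_lt_trans Cw).
have cD' : Cb c (Lam n L*rho) `<=` D by rewrite rE.
have cK' x : K x -> ~ Cb c (Lam n L*rho) x by rewrite rE; exact: cK.
have WM' x : Cb c (Lam n L*rho) x -> W x <= M by rewrite rE; exact: WM.
have := omega_harnack rho0 rho1 rK cD' cK' M0 WM' y2 w2=> H.
have MA : M-W w <= A.
 have Cw' : Cb c r w := Cb_le kr Cw.
 rewrite lerBlDr; apply: ge_sup; first exact: hs.1.
 by move=> _ [x Cx <-]; rewrite -lerBlDr; exact: hA.
have C0 : 0 < Ch n L := lt_le_trans ltr01 C1g.
have H2 : (Ch n L)^-1*(M-W w) <= M-W y by rewrite mulrC ler_pdivrMr // mulrC.
have /andP[g0 _] := gos_bnd.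
have := ler_wpM2l g0 MA; rewrite /gos mulrBl mul1r; move: H2; lra.
Qed.

Lemma osc_iter k c r A : 0 < r -> r <= rmax -> Cb c r `<=` D -> (forall y, K y -> ~ Cb c r y) ->
 (forall y w, Cb c r y -> Cb c r w -> W y-W w <= A) ->
 forall y w, Cb c (kos^+k*r) y -> Cb c (kos^+k*r) w -> W y-W w <= gos^+k*A.
Proof.
have /andP[k0 k1] := kos_bnd.
elim: k r A=> [|k IH] r A r0 rm cD cK hA y w; first by rewrite !expr0 !mul1r; exact: hA.
have kr : kos*r <= r by rewrite ler_piMl // ltW.
rewrite !exprSr -!mulrA; apply: IH.
- pos.
- exact: le_trans rm.
- by move=> x Cx; apply: cD; exact: Cb_le Cx.
- by move=> x Kx Cx; apply: (cK x Kx); exact: Cb_le Cx.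
exact: osc_step.
Qed.

(** The exponent satisfies gos <= kos^al, so the geometric decay at the scale kos^j r comparable to
    |z-w| becomes a power of |z-w|/r, with constants independent of r. *)
Lemma interior_holder B : 0 < B -> (forall z, D z -> - B <= W z) -> exists Ci al : R, [/\ 0 < Ci, 0 < al <= 1 &
 forall z w r, 0 < r -> r <= rmax -> Cb z r `<=` D -> (forall y, K y -> ~ Cb z r y) -> `|z-w| <= r ->
 `|W z-W w| <= Ci*(`|z-w|/r) `^ al].
Proof.
move=> B0 WB; have kb := kos_bnd; have /andP[k0 k1] := kb; have /andP[g0 g1] := gos_bnd.
have [al al01 gk] := powR_between kb g1; have /andP[al0 al1] := al01.
exists (kos `^ (- al)*B), al; split=> //; first by rewrite mulr_gt0 // powR_gt0.
move=> z w r r0 rm cD cK zw.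
have [->|zn] := eqVneq z w; first by rewrite !subrr normr0 mulr_ge0 ?powR_ge0 // mulr_ge0 ?powR_ge0 // ltW.
pose t := `|z-w|/r.
have t01 : 0 < t <= 1 by rewrite divr_gt0 ?normr_gt0 ?subr_eq0 // ler_pdivrMr // mul1r.
have [j /andP[tj jt]] := pow_bracket kb t01.
have Cz : Cb z r z by rewrite /Cb /= subrr normr0 ltW.
have hA y x : Cb z r y -> Cb z r x -> W y-W x <= B.
 by move=> /cD Dy /cD Dx; have := W0 Dy; have := WB x Dx; lra.
have hj := osc_iter (k := j) r0 rm cD cK hA.
have Czj : Cb z (kos^+j*r) z by rewrite /Cb /= subrr normr0 mulr_ge0 ?exprn_ge0 // ltW.
have Cwj : Cb z (kos^+j*r) w by rewrite /Cb /= -ler_pdivrMr.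
have h1 : `|W z-W w| <= gos^+j*B.
 by rewrite ler_norml; have := hj _ _ Czj Cwj; have := hj _ _ Cwj Czj; lra.
apply: (le_trans h1); rewrite mulrAC; apply: ler_wpM2r; first exact: ltW.
apply: (@le_trans _ _ ((kos `^ al)^+j)); first by rewrite lerXn2r ?nnegrE ?powR_ge0.
rewrite -powR_mulrn ?powR_ge0 // -powRrM mulrC powRrM powR_mulrn ?(ltW k0) //.
have ht : kos^+j <= t/kos by rewrite ler_pdivlMr // -exprSr ltW.
have t0 : 0 <= t by case/andP: t01=> /ltW.
apply: (@le_trans _ _ ((t/kos) `^ al)).
 by apply: ge0_ler_powR; rewrite ?nnegrE ?exprn_ge0 ?divr_ge0 // ltW.
have ke : kos^-1 `^ al = kos `^ (- al) by rewrite -powR_inv1 ?(ltW k0) // -powRrM mulN1r.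
have ki : 0 <= kos^-1 by rewrite invr_ge0 ltW.
by rewrite (powRM _ t0 ki) ke mulrC.
Qed.
End Oscillation.

(** * Boundary behaviour and distances *)

Section Geometry.
Variables (R : realType) (n : nat).
Notation m := (n+n)%N.
Notation V := (pt R n).

Lemma compact_thicken (A O : set V) : compact A -> open O -> A `<=` O ->
 exists2 e : R, 0 < e & forall x y, A x -> `|x-y| < e -> O y.
Proof.
move=> cA oO AO.
have H : \forall e \near (0 : R)^'+, A `<=` (fun x : V=> forall y, `|x-y| < e -> O y).
 apply: ((compact_near_coveringP A).1 cA)=> x Ax.
 have [d d0 hd] := near_Cb (open_nbhs_nbhs (conj oO (AO x Ax))).
 have d2 : 0 < d/2 by rewrite divr_gt0.
 exists (ball x (d/2), [set e : R | e < d/2])=> /=.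
 by split; [exact: nbhsx_ballx|exact: nbhs_right_lt].
 move=> [x' e] /= [/ballP hx he] y hy; apply: hd.
 by apply: (le_lt_trans (ler_distD x' x y)); move: hx hy he; lra.
have [e [e0 he]] : exists e : R, 0 < e /\ A `<=` (fun x : V=> forall y, `|x-y| < e -> O y).
 near (0 : R)^'+ => e; exists e; split; first by near: e; exact: nbhs_right_gt.
 by near: e.
by exists e=> // x y Ax; exact: he.
Unshelve. all: by end_near. Qed.

Lemma thicken_compact (A : set V) (e : R) : compact A -> compact [set p | exists2 x, A x & `|x-p| <= e].
Proof.
move=> cA; have cB := @compact_cball _ _ (0 : V) e.
have -> : [set p | exists2 x, A x & `|x-p| <= e] =
 (fun q : V*V=> q.1+q.2) @` (A `*` [set x | `|0-x| <= e]).
 apply/seteqP; split=> [p [x Ax xp]|_ [[x y] [Ax /= xy] <-]].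
 exists (x, p-x); last by rewrite /= addrC subrK.
 by split=> //=; rewrite sub0r opprB.
 by exists x=> //; rewrite opprD addNKr -sub0r.
apply: continuous_compact; last exact: compact_setX.
apply: continuous_subspaceT=> q.
by apply: cvgD; [exact: cvg_fst|exact: cvg_snd].
Qed.

(** Take the infimum of the parameters at which the segment from z to y is outside [D]. The boundary
    condition on the defining function concerns closure points only, while y is any point
    outside. *)
Lemma exit_point (D : set V) z y : open D -> D z -> ~ D y ->
 exists zeta, [/\ closure D zeta, ~ D zeta & `|z-zeta| <= `|z-y|].
Proof.
move=> oD Dz Dy; pose g (t : R) : V := z+t *: (y-z).
have gd s t : `|g s-g t| = `|s-t| * `|y-z|.
 by rewrite /g opprD addrACA subrr add0r -scalerBl normrZ.
pose E := [set t : R | 0 <= t <= 1 /\ ~ D (g t)].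
have E1 : E 1 by split; [rewrite ler01 lexx|rewrite /g scale1r addrC subrK].
have hi : has_inf E by split; [exists 1|exists 0=> t [/andP[]]].
pose s := inf E.
have s0 : 0 <= s by apply: lb_le_inf; [exists 1|move=> t [/andP[]]].
have s1 : s <= 1 by apply: ge_inf=> //; exact: hi.2.
have yz0 : 0 < `|y-z| by rewrite normr_gt0 subr_eq0; apply/eqP=> yz; apply: Dy; rewrite yz.
have nD : ~ D (g s).
 move=> Ds; have [d d0 hd] := near_Cb (open_nbhs_nbhs (conj oD Ds)).
 have dd : 0 < d / `|y-z| by rewrite divr_gt0.
 have [t Et ts] := inf_adherent dd hi; have st : s <= t by apply: ge_inf; [exact: hi.2|].
 have [t01 Dt] := Et; apply: Dt; apply: hd.
 by rewrite gd -ltr_pdivlMr // distrC ger0_norm ?subr_ge0 // ltrBlDl.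
have sp : 0 < s.
 rewrite lt_neqAle s0 andbT; apply/eqP=> e0; apply: nD.
 by rewrite /g -e0 scale0r addr0.
exists (g s); split=> //.
 move=> B /near_Cb[d d0 hd].
 have dd : 0 < Num.min s (d / `|y-z|) by rewrite lt_min sp divr_gt0.
 pose t := s-Num.min s (d / `|y-z|)/2.
 have m1 : Num.min s (d / `|y-z|) <= s by rewrite ge_min lexx.
 have m2 : Num.min s (d / `|y-z|) <= d / `|y-z| by rewrite ge_min lexx orbT.
 have t0 : 0 <= t by rewrite /t; move: m1 sp; lra.
 have ts : t < s by rewrite /t; move: dd; lra.
 have Dt : D (g t).
 apply: contrapT=> nDt; have : s <= t by apply: ge_inf; [exact: hi.2|split=> //; rewrite t0 (le_trans (ltW ts))].
 by move: ts; lra.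
 exists (g t); split=> //; apply: hd; rewrite gd -ltr_pdivlMr //.
 rewrite ger0_norm ?subr_ge0 ?(ltW ts) // /t; move: dd m2; lra.
have g0 : g 0 = z by rewrite /g scale0r addr0.
by have := gd 0 s; rewrite g0 sub0r normrN ger0_norm // => ->; rewrite (distrC z y) ler_piMl.
Qed.

Lemma dist_le (z : V) (K : set V) w : K w -> dist z K <= enorm (z-w).
Proof.
move=> Kw; apply: ge_inf; last by exists w.
by exists 0=> _ [x _ <-]; rewrite /enorm sqrtr_ge0.
Qed.

Lemma dist_ge0 (z : V) (K : set V) : 0 <= dist z K.
Proof.
have [[w Kw]|K0] := pselect (K !=set0).
 by apply: lb_le_inf; [exists (enorm (z-w)), w|move=> _ [x _ <-]; rewrite /enorm sqrtr_ge0].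
rewrite /dist (_ : [set _ | _ in K] = set0) ?inf0 //.
by apply/seteqP; split=> [t [x Kx _]|t //]; apply: K0; exists x.
Qed.

Lemma enorm_cont (z : V) : continuous (fun w : V=> enorm (z-w)).
Proof.
suff c : continuous (fun w : V=> sqnorm (z-w)).
 by move=> w; exact: (continuous_comp (c w) (@sqrt_continuous _ _)).
apply: contSum=> i.
rewrite (_ : (fun _=> _) = (fun w : V=> (z 0 i-w 0 i)*(z 0 i-w 0 i))); last first.
 by apply/funext=> x; rewrite !mxE expr2.
have c1 : continuous (fun x : V=> z 0 i-x 0 i).
 by apply: contB; [move=> x; exact: cst_continuous|exact: coord_continuous].
exact: contM.
Qed.

Lemma dist_attained (z : V) (K : set V) : compact K -> K !=set0 -> exists2 p, K p & enorm (z-p) = dist z K.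
Proof.
move=> cK K0.
have [p pK hp] := compact_EVT_min K0 cK (continuous_subspaceT (@enorm_cont z)).
have Kp : K p by rewrite inE in pK.
exists p=> //; apply/eqP; rewrite eq_le (dist_le _ Kp) andbT.
by apply: lb_le_inf; [exists (enorm (z-p)), p|move=> _ [x Kx <-]; apply: hp; rewrite inE].
Qed.

(** The first derivatives of rho are bounded on a compact neighbourhood of the closure. Continuity
    and the boundary limit force rho = 0 at exit points, so -rho is at most a multiple of the
    distance to the complement. *)
Lemma regular_boundary (a : coef_form R n) (U D : set V) : (0 < n)%N -> strongly_alpha_regular a U D ->
 exists rho : V -> R, [/\ forall z, D z -> rho z < 0,
 (exists Dp, [/\ D `<=` Dp, (forall z, Dp z -> {for z, continuous rho}) & alpha_sh a Dp (fun z=> (rho z)%:E)]),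
 (exists2 B, 0 < B & forall z, D z -> `|rho z| <= B) &
 exists C e : R, [/\ 0 < C, 0 < e & forall z y, D z -> ~ D y -> `|z-y| < e -> - rho z <= C * `|z-y|]].
Proof.
move=> n0 [[oD _ _ bD] [Dp [rho [[oDp clD _] [C2 sh _ neg bdry]]]]].
have DDp : D `<=` Dp by apply: subset_trans clD; exact: subset_closure.
have C1 : Ck 1 Dp rho.
 have [c1 c2] := C2; split=> s hs.
 by move=> i p; apply: c1; exact: ltn_trans hs _.
 by move=> p; apply: c2; exact: leq_trans hs _.
have cD := bounded_closure_compact bD.
have [e e0 he] := compact_thicken cD oDp clD.
have cE := thicken_compact (e := e/2) cD.
pose E := [set p : V | exists2 x, closure D x & `|x-p| <= e/2].
have EDp : E `<=` Dp.
 by move=> p [x Dx xp]; apply: (he x)=> //; apply: (le_lt_trans xp); rewrite gtr_pMr //; lra.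
exists rho; split=> //.
- exists Dp; split=> // z /(Ck1P C1) [] //.
- have [B B0 hB] := cpt_bounded cD (fun x Dx=> let: And3 h _ _ := Ck1P C1 (clD x Dx) in h).
 by exists B=> // z Dz; apply: hB; exact: subset_closure.
have [B B0 hB] := cpt_boundedF (f := fun (i : 'I_m) q=> pd i rho q) cE
 (fun i x Ex=> let: And3 _ _ h := Ck1P C1 (EDp _ Ex) in h i).
exists (m%:R*B+1), (e/2); split.
- by rewrite ltr_wpDl // mulr_ge0 // ltW.
- by rewrite divr_gt0.
move=> z y Dz Dy zy; have [x [clx nDx zx]] := exit_point oD Dz Dy.
have rx : rho x = 0.
 apply/eqP; rewrite -normr_le0; apply/ler_addgt0Pr=> d d0; rewrite add0r.
 have d2 : 0 < d/2 by rewrite divr_gt0.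
 have [f [f0 hf]] := bdry x clx nDx _ d2.
 have [cx _ _] := Ck1P C1 (clD x clx).
 have /(@cvgrPdist_lt _ _ _ (nbhs x) _ _ _) /(_ _ d2) nx := cx.
 have nb : nbhs x (ball x (f/(m%:R+1))) by apply: nbhsx_ballx; rewrite divr_gt0 // ltr_wpDl.
 have [w [Dw [w1 /ballP w2]]] := clx _ (filterI nx nb).
 have := hf w Dw; rewrite (le_lt_trans (enorm_le n0 _)); last first.
 rewrite distrC; move: w2; rewrite ltr_pdivlMr ?ltr_wpDl // => w2; apply: le_lt_trans w2.
 by rewrite mulrC ler_wpM2l // lerDl.
 move=> /(_ isT) h2; have := ler_normD (rho x-rho w) (rho w); rewrite subrK.
 by move: w1 h2=> /=; lra.
have zx2 : `|z-x| < e/2 := le_lt_trans zx zy.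
have hl := @lip_cube _ _ rho z x (e/2) B (ltW B0).
have : `|rho z-rho x| <= m%:R*B * `|z-x|.
 apply: hl; last exact/ballP.
 move=> q i /ballP zq; have Eq : E q by exists z; [exact: subset_closure|exact: ltW].
 by have [_ h _] := Ck1P C1 (EDp _ Eq); split=> //; exact: hB.
rewrite rx subr0=> h; apply: (@le_trans _ _ (m%:R*B * `|z-x|)).
 by apply: le_trans h; rewrite -normrN ler_norm.
by apply: ler_pM=> //; [rewrite mulr_ge0 // ltW|rewrite lerDl].
Qed.
End Geometry.

(** * From local estimates to a global Hölder bound *)

Section Glue.
Variables (R : realType) (n : nat).
Notation m := (n+n)%N.
Notation V := (pt R n).

Lemma pow_le (s b x : R) : 0 < s <= 1 -> b <= x -> s `^ x <= s `^ b.
Proof. by move=> s01 bx; exact: ger_powR. Qed.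

Lemma powR_scale (x c s l b : R) : 0 < s <= 1 -> 0 <= x -> 0 <= c -> x <= c*s -> b <= l -> 0 < l ->
 x `^ l <= c `^ l*s `^ b.
Proof.
move=> s01 x0 c0 xc bl l0; have /andP[s0 _] := s01; apply: (@le_trans _ _ ((c*s) `^ l)).
 by apply: ge0_ler_powR; rewrite ?nnegrE ?mulr_ge0 // ltW.
by rewrite powRM ?(ltW s0) //; apply: ler_wpM2l; [exact: powR_ge0|exact: pow_le].
Qed.

Lemma dist_chain (w1 p1 w2 p2 a b c : R) : `|w1-p1| <= a -> `|w2-p2| <= b -> `|p1-p2| <= c -> `|w1-w2| <= a+b+c.
Proof. by rewrite !ler_norml; lra. Qed.

Lemma norm_chain (p1 p2 z w : V) (a s : R) : `|z-p1| <= a*s -> `|w-p2| <= 2*a*s -> `|z-w| <= s -> 1 <= a -> 0 <= s ->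
 `|p1-p2| <= 4*a*s.
Proof.
move=> h1 h2 h3 a1 s0; apply: (le_trans (ler_distD z p1 p2)); rewrite (distrC p1 z).
have := ler_distD w z p2; have : s <= a*s by rewrite ler_peMl.
by move: h1 h2 h3; rewrite -!mulrA; lra.
Qed.

(** Put s = sqrt |z-w|. If the cube of radius s about z lies in [D] and misses [K], the interior
    bound applies with |z-w|/s = s. Otherwise z and w are within 2s of a common point outside [D] or
    in [K], and the boundary estimate or the estimate near [K] serves both. All bounds are powers of
    s, whence the exponent b/2. *)
Lemma holder_glue (D K : set V) (W psi : V -> R) (B rm Ci al Cb' eb Ck' ek lam Cp lp : R) : (0 < n)%N ->
 0 < B -> (forall z, D z -> - B <= W z <= 0) ->
 0 < rm -> 0 <= Ci -> 0 < al <= 1 ->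
 (forall z w r, 0 < r -> r <= rm -> Cb z r `<=` D -> (forall y, K y -> ~ Cb z r y) -> `|z-w| <= r ->
 `|W z-W w| <= Ci*(`|z-w|/r) `^ al) ->
 0 <= Cb' -> 0 < eb -> (forall z y, D z -> ~ D y -> `|z-y| < eb -> - W z <= Cb' * `|z-y|) ->
 0 <= Ck' -> 0 < ek -> 0 < lam <= 1 ->
 (forall z y, D z -> K y -> `|z-y| < ek -> exists p, [/\ K p, enorm (z-p) <= enorm (z-y) &
 `|W z-psi p| <= Ck'*enorm (z-y) `^ lam]) ->
 0 <= Cp -> 0 < lp <= 1 -> (forall z w, K z -> K w -> `|psi z-psi w| <= Cp*enorm (z-w) `^ lp) ->
 exists C be : R, [/\ 0 < C, 0 < be <= 1 & forall z w, D z -> D w -> `|W z-W w| <= C*enorm (z-w) `^ be].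
Proof.
move=> n0 B0 WB rm0 Ci0 /andP[al0 al1] hin Cb0 eb0 hb Ck0 ek0 /andP[l0 l1] hk Cp0 /andP[p0 p1] hp.
pose b := Num.min al (Num.min lam lp).
have b0 : 0 < b by rewrite !lt_min al0 l0 p0.
have ba : b <= al by rewrite /b ge_min lexx.
have bl : b <= lam by rewrite /b !ge_min lexx orbT.
have bp : b <= lp by rewrite /b !ge_min lexx !orbT.
have b1 : b <= 1 by exact: le_trans ba al1.
(* Below this scale the local estimates apply up to distance 2s, hence the thirds; above it the
   oscillation bound B is enough. *)
pose s0 := Num.min 1 (Num.min rm (Num.min (eb/3) (ek/3))).
have s00 : 0 < s0 by rewrite !lt_min ltr01 rm0 !divr_gt0.
have s01 : s0 <= 1 by rewrite /s0 ge_min lexx.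
have s0r : s0 <= rm by rewrite /s0 !ge_min lexx orbT.
have s0b : s0 <= eb/3 by rewrite /s0 !ge_min lexx !orbT.
have s0k : s0 <= ek/3 by rewrite /s0 !ge_min lexx !orbT.
have mR : 1 <= m%:R :> R by rewrite ler1n addn_gt0 n0.
pose N : R := 4 * m%:R^+2.
have N0 : 0 <= N by rewrite mulr_ge0 // exprn_ge0.
pose C := B/s0+Ci+2*Cb'+Ck' * m%:R `^ lam+Ck'*(2 * m%:R) `^ lam+Cp*N `^ lp.
have Bs : 0 < B/s0 by rewrite divr_gt0.
have t1 : 0 <= Ck' * m%:R `^ lam by rewrite mulr_ge0 ?powR_ge0.
have t2 : 0 <= Ck'*(2 * m%:R) `^ lam by rewrite mulr_ge0 ?powR_ge0.
have t3 : 0 <= Cp*N `^ lp by rewrite mulr_ge0 ?powR_ge0.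
have Cp' : 0 < C by rewrite /C; move: Bs Ci0 Cb0 t1 t2 t3; lra.
exists C, (b/2); split=> //; first by rewrite divr_gt0 //=; move: b1; lra.
move=> z w Dz Dw.
have [->|zw] := eqVneq z w.
 by rewrite subrr normr0 mulr_ge0 ?powR_ge0 // ltW.
have zw0 : 0 < `|z-w| by rewrite normr_gt0 subr_eq0.
pose s := sqrt `|z-w|; have s_0 : 0 < s by rewrite sqrtr_gt0.
have ss : s^+2 = `|z-w| by rewrite sqr_sqrtr // ltW.
suff H : `|W z-W w| <= C*s `^ b.
 apply: (le_trans H); apply: ler_wpM2l; first exact: ltW.
 rewrite mulrC powRrM powR12_sqrt ?sqrtr_ge0 //.
 rewrite /s; apply: ge0_ler_powR; rewrite ?nnegrE ?sqrtr_ge0 ?(ltW b0) //.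
 by rewrite ler_wsqrtr // norm_le_enorm.
have sb0 : 0 <= s `^ b by exact: powR_ge0.
have /andP[Wz1 Wz2] := WB z Dz; have /andP[Ww1 Ww2] := WB w Dw.
have CC x : 0 <= x -> x <= C -> `|W z-W w| <= x*s `^ b -> `|W z-W w| <= C*s `^ b.
 by move=> x0 xC h; apply: (le_trans h); exact: ler_wpM2r.
have [big|small] := leP s0 s.
 apply: (CC (B/s0)); [exact: ltW|by rewrite /C; move: Ci0 Cb0 t1 t2 t3; lra|].
 have hs : s0 <= s `^ b.
 have [s1|s1] := leP 1 s.
 by apply: (le_trans s01); rewrite -(powRr0 s); apply: ler_powR=> //; exact: ltW.
 by apply: (le_trans big); rewrite -{1}(powRr1 (ltW s_0)); apply: pow_le=> //; rewrite s_0 ltW.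
 apply: (@le_trans _ _ B); first by rewrite ler_norml; move: Wz1 Wz2 Ww1 Ww2; lra.
 by rewrite mulrAC ler_pdivlMr //; apply: ler_wpM2l=> //; exact: ltW.
have s1 : s <= 1 by apply: ltW; exact: lt_le_trans small s01.
have s01' : 0 < s <= 1 by rewrite s_0.
have zws : `|z-w| <= s by rewrite -ss expr2 ler_piMl ?(ltW s_0).
have sb : s <= s `^ b by rewrite -{1}(powRr1 (ltW s_0)); exact: pow_le.
have [ins|] := pselect (Cb z s `<=` D /\ forall y, K y -> ~ Cb z s y).
 apply: (CC Ci)=> //; first by rewrite /C; move: Bs Cb0 t1 t2 t3; lra.
 have := hin z w s s_0 (ltW (lt_le_trans small s0r)) ins.1 ins.2 zws.
 rewrite -ss expr2 mulfK ?gt_eqF // => h; apply: (le_trans h); apply: ler_wpM2l=> //; exact: pow_le.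
move=> /not_andP[/existsNP[y /not_implyP[zy nDy]]|/existsNP[y /not_implyP[Ky /contrapT zy]]].
 apply: (CC (2*Cb')); [by rewrite mulr_ge0|by rewrite /C; move: Bs Ci0 t1 t2 t3; lra|].
 have wy : `|w-y| <= 2*s.
 by apply: (le_trans (ler_distD z w y)); rewrite (distrC w z); move: zws zy; rewrite /Cb /=; lra.
 have h1 : - W z <= Cb'*s.
 apply: (le_trans (hb z y Dz nDy _)); last exact: ler_wpM2l.
 by apply: (le_lt_trans zy); move: small s0b s00; lra.
 have h2 : - W w <= Cb'*(2*s).
 apply: (le_trans (hb w y Dw nDy _)); last exact: ler_wpM2l.
 by apply: (le_lt_trans wy); move: small s0b s00; lra.
 have h3 : Cb'*s <= Cb'*s `^ b by exact: ler_wpM2l.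
 by rewrite ler_norml; move: h1 h2 h3 Wz2 Ww2; rewrite -!mulrA (mulrCA Cb' 2); lra.
have wy : `|w-y| <= 2*s.
 by apply: (le_trans (ler_distD z w y)); rewrite (distrC w z); move: zws zy; rewrite /Cb /=; lra.
have ezy : enorm (z-y) <= m%:R*s by apply: (le_trans (enorm_le n0 _)); exact: ler_wpM2l.
have ewy : enorm (w-y) <= 2 * m%:R*s.
 by apply: (le_trans (enorm_le n0 _)); rewrite (mulrC 2) -mulrA; apply: ler_wpM2l.
(* The points of [K] attached to z and to w may differ; they are at distance of order s, and the
   Hölder continuity of psi joins them. *)
have [pz [Kz dz hz]] : exists p, [/\ K p, enorm (z-p) <= enorm (z-y) & `|W z-psi p| <= Ck'*enorm (z-y) `^ lam].
 by apply: hk=> //; apply: (le_lt_trans zy); move: small s0k s00; lra.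
have [pw [Kw dw hw]] : exists p, [/\ K p, enorm (w-p) <= enorm (w-y) & `|W w-psi p| <= Ck'*enorm (w-y) `^ lam].
 by apply: hk=> //; apply: (le_lt_trans wy); move: small s0k s00; lra.
have e0 (x : V) : 0 <= enorm x by rewrite /enorm sqrtr_ge0.
have m20 : 0 <= 2 * m%:R :> R by rewrite mulr_ge0.
have h1 : `|W z-psi pz| <= Ck' * m%:R `^ lam*s `^ b.
 apply: (le_trans hz); rewrite -mulrA; apply: (ler_wpM2l Ck0).
 exact: (powR_scale s01' (e0 _) (ler0n _ _) ezy bl l0).
have h2 : `|W w-psi pw| <= Ck'*(2 * m%:R) `^ lam*s `^ b.
 apply: (le_trans hw); rewrite -mulrA; apply: (ler_wpM2l Ck0).
 exact: (powR_scale s01' (e0 _) m20 ewy bl l0).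
have pp : enorm (pz-pw) <= N*s.
 have q1 := le_trans (le_trans (norm_le_enorm (z-pz)) dz) ezy.
 have q2 := le_trans (le_trans (norm_le_enorm (w-pw)) dw) ewy.
 have q3 := norm_chain q1 q2 zws mR (ltW s_0).
 apply: (le_trans (enorm_le n0 _)); rewrite /N.
 have -> : 4 * m%:R^+2*s = m%:R*(4 * m%:R*s) by ring.
 exact: ler_wpM2l.
have h3 : `|psi pz-psi pw| <= Cp*N `^ lp*s `^ b.
 apply: (le_trans (hp _ _ Kz Kw)); rewrite -mulrA; apply: (ler_wpM2l Cp0).
 exact: (powR_scale s01' (e0 _) N0 pp bp p0).
apply: (le_trans (dist_chain h1 h2 h3)); rewrite -mulrDl -mulrDl.
by apply: ler_wpM2r=> //; rewrite /C; move: Bs Ci0 Cb0; lra.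
Qed.
End Glue.

Lemma holder_bounded (R : realType) n (K : set (pt R n)) (psi : pt R n -> R) : (0 < n)%N -> compact K -> holder_real K psi ->
 exists2 B, 0 < B & forall z, K z -> - B <= psi z.
Proof.
move=> n0 cK [C [lam [C0 /andP[l0 _] H]]]; have [[w Kw]|K0] := pselect (K !=set0); last first.
 by exists 1=> // z Kz; exfalso; apply: K0; exists z.
have [r r0 hr] := compact_box cK.
exists (`|psi w| + C*((n+n)%:R*(r+r)) `^ lam+1).
 by rewrite ltr_wpDl // addr_ge0 // mulr_ge0 ?powR_ge0 // ltW.
move=> z Kz; have q0 : 0 <= (n+n)%:R*(r+r) by rewrite mulr_ge0 // addr_ge0 // ltW.
have : `|psi z-psi w| <= C*((n+n)%:R*(r+r)) `^ lam.
 apply: (le_trans (H z w Kz Kw)); apply: ler_wpM2l; first exact: ltW.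
 apply: ge0_ler_powR; rewrite ?nnegrE ?sqrtr_ge0 ?(ltW l0) //.
 apply: (le_trans (enorm_le n0 _)); apply: ler_wpM2l=> //.
 by apply: (le_trans (ler_normB _ _)); apply: lerD; exact: hr.
have := ler_norm (- psi w); rewrite normrN ler_norml=> h1 /andP[h2 h3]; move: h1 h2; lra.
Qed.

(** A bound for 1/f on the compact set keeps f away from 0. *)
Lemma compact_neg (R : realType) n (K : set (pt R n)) (f : pt R n -> R) : compact K ->
 (forall z, K z -> {for z, continuous f}) -> (forall z, K z -> f z < 0) ->
 exists2 c, 0 < c & forall z, K z -> f z <= - c.
Proof.
move=> cK cf f0.
have ci z : K z -> {for z, continuous (fun y=> (f y)^-1)}.
 by move=> Kz; apply: cvgV (cf z Kz); exact: ltr0_neq0 (f0 z Kz).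
have [B B0 hB] := cpt_bounded cK ci.
exists B^-1; first pos.
move=> z Kz; have := hB z Kz; rewrite normfV ltr0_norm ?f0 // => h.
by rewrite lerNr -[- f z]invrK lef_pV2 ?posrE // invr_gt0 oppr_gt0 f0.
Qed.

Theorem theorem1p3 (R : realType) (n : nat) (U : set (pt R n)) (a : coef_form R n)
  (D K : set (pt R n)) (psi : pt R n -> R) :
  (0 < n)%N -> open U -> form_C1 U a -> form_closed U a -> form_strictly_positive U a ->
  strongly_alpha_regular a U D ->
  compact K -> K `<=` D ->
  holder_real K psi -> (forall z, K z -> psi z < 0) ->
  (exists psit : pt R n -> \bar R,
     [/\ alpha_sh a D psit, (forall z, D z -> (psit z < 0)%E) &
         forall z, K z -> psit z = (psi z)%:E]) ->
  (holder_ereal D (omega_alpha a K D psi) <->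
   exists (C lam : R) (V : set (pt R n)),
     [/\ 0 < C, 0 < lam <= 1, open V, K `<=` V &
      forall z w, V z -> D z -> K w -> enorm (z - w) = dist z K ->
        (`|omega_alpha a K D psi z - (psi w)%:E| <= (C * dist z K `^ lam)%:E)%E]).
Proof.
move=> n0 oU aC1 acl apos reg cK KD psiH psi0 [psit [sht negt eqt]].
(* The given extension of psi is itself a competitor, so the envelope attains psi on [K]. *)
have omK z : K z -> omega_alpha a K D psi z = (psi z)%:E.
 move=> Kz; apply/eqP; rewrite eq_le; apply/andP; split.
 by apply: ge_ereal_sup=> _ [u [_ _ uK] <-]; exact: uK.
 rewrite -(eqt z Kz); apply: ereal_sup_ubound; exists psit=> //.
 by split=> // w Kw; rewrite eqt.
have [[oD _ [z0 Dz0] bdD] [Dp' [_ [[_ clD DpU] _]]]] := reg.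
split.
 (* With omega = psi on [K], the Hölder bound between z and a nearest point of [K] is the claim, on
    the neighbourhood [D]. *)
 move=> [fin [C [lam [C0 l01 H]]]]; exists C, lam, D; split=> // z w _ Dz Kw zw.
 by rewrite -(omK w Kw) -zw; apply: H=> //; exact: KD.
move=> [C [lam [Vn [C0 l01 oV KV H]]]].
have [L eL] := smx_elliptic n0 oD oU (subset_trans clD DpU) bdD aC1 acl apos.
have [rho [negr [Dp [DDp crho shr]] [Br Br0 hBr] [Cr [er [Cr0 er0 hr]]]]] := regular_boundary n0 reg.
have [Bp Bp0 hBp] := holder_bounded n0 cK psiH.
have [c c0 hc] := compact_neg cK (fun z Kz=> crho z (DDp z (KD z Kz))) (fun z Kz=> negr z (KD z Kz)).
(* On [K] one has M rho <= -Bp <= psi, so M rho is a competitor: a finite lower barrier for omega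
   that vanishes at the boundary. *)
pose M := Bp/c; have M0 : 0 < M by rewrite divr_gt0.
pose h y := M*fin_ext D (fun z=> (rho z)%:E) y.
have [lh dh] : loc D (fin_ext D (fun z=> (rho z)%:E)) /\ dsub D (Smx a) (fin_ext D (fun z=> (rho z)%:E)).
 have [bad|[Lr _ tr]] := shr; first by have := bad z0 (DDp z0 Dz0).
 by have [] := loc_of_sh eL DDp Lr tr.
have feE z : D z -> fin_ext D (fun z=> (rho z)%:E) z = rho z by move=> Dz; rewrite /fin_ext zero_extT.
have h0 y : h y <= 0.
 rewrite /h mulr_ge0_le0 ?(ltW M0) //; have [Dy|Dy] := pselect (D y); first by rewrite feE // ltW // negr.
 by rewrite /fin_ext zero_extF.
have hE z : D z -> hat h z = (M*rho z)%:E.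
 move=> Dz; rewrite hat_cont /h ?feE //.
 apply: (@near_continuous _ _ _ (fun y=> M*rho y)).
 by apply: filterS (open_nbhs_nbhs (conj oD Dz))=> y Dy; rewrite feE.
 by apply: continuousM; [exact: cst_continuous|exact: crho (DDp z Dz)].
have Uh : U_class a K D psi (hat h).
 split.
 - exact: (hat_alpha_sh n0 eL (loc_scale M lh) (dsub_scale eL (ltW M0) lh dh) h0).
 - by move=> z Dz; rewrite hE // lte_fin pmulr_rlt0 // negr.
 move=> z Kz; rewrite hE ?lee_fin; last exact: KD.
 apply: (le_trans _ (hBp z Kz)); have -> : - Bp = M * - c by rewrite mulrN divfK // gt_eqF.
 by rewrite ler_pM2l // hc.
have om_lb z : D z -> ((M*rho z)%:E <= omega_alpha a K D psi z)%E.
 by move=> Dz; rewrite -hE //; apply: ereal_sup_ubound; exists (hat h).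
have om_ub z : D z -> (omega_alpha a K D psi z <= 0)%E.
 by move=> Dz; apply: ge_ereal_sup=> _ [u [_ un _] <-]; apply: ltW; exact: un.
pose W z := fine (omega_alpha a K D psi z).
have hW z : D z -> omega_alpha a K D psi z = (W z)%:E.
 move=> Dz; rewrite /W fineK // fin_numE; have := om_lb z Dz; have := om_ub z Dz.
 by case: (omega_alpha a K D psi z).
have W_lb z : D z -> M*rho z <= W z by move=> Dz; rewrite -lee_fin -hW //; exact: om_lb.
have W0 z : D z -> W z <= 0 by move=> Dz; rewrite -lee_fin -hW //; exact: om_ub.
have B0 : 0 < M*Br by rewrite mulr_gt0.
have WB z : D z -> - (M*Br) <= W z.
 move=> Dz; apply: (le_trans _ (W_lb z Dz)); rewrite -mulrN ler_pM2l //.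
 by have := hBr z Dz; rewrite ler_norml=> /andP[].
have [Ci [al [Ci0 al01 hin]]] := interior_holder n0 eL KD hW W0 B0 WB.
have hb z y : D z -> ~ D y -> `|z-y| < er -> - W z <= M*Cr * `|z-y|.
 move=> Dz Dy zy; apply: (@le_trans _ _ (M * - rho z)); first by rewrite mulrN lerN2 W_lb.
 by rewrite -mulrA ler_pM2l //; exact: hr.
have [ek ek0 hek] := compact_thicken cK oV KV.
(* A nearest point exists by compactness of [K], so the hypothesis, stated for nearest points,
   yields an estimate in terms of the distance to any point of [K]. *)
have hk z y : D z -> K y -> `|z-y| < ek -> exists p, [/\ K p, enorm (z-p) <= enorm (z-y) &
 `|W z-psi p| <= C*enorm (z-y) `^ lam].
 move=> Dz Ky zy; have [p Kp pd] := dist_attained z cK (ex_intro _ y Ky).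
 have dy := dist_le z Ky; exists p; split=> //; first by rewrite pd.
 have Vz : Vn z by apply: (hek y)=> //; rewrite distrC.
 have := H z p Vz Dz Kp pd; rewrite hW // -EFinB abse_EFin lee_fin=> h1; apply: (le_trans h1).
 have /andP[l0 _] := l01; apply: ler_wpM2l; first exact: ltW.
 by apply: ge0_ler_powR; rewrite ?nnegrE ?dist_ge0 ?sqrtr_ge0 // ltW.
have [Cp [lp [Cp0 lp01 hp]]] := psiH.
have WB' z : D z -> - (M*Br) <= W z <= 0 by move=> Dz; rewrite WB // W0.
have MC : 0 <= M*Cr by rewrite mulr_ge0 // ltW.
have [Cf [be [Cf0 be01 Hf]]] := holder_glue n0 B0 WB' (rmax_gt0 n0 eL) (ltW Ci0) al01 hin MC er0 hb (ltW C0) ek0 l01 hk (ltW Cp0) lp01 hp.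
split; first by move=> z Dz; rewrite hW.
exists Cf, be; split=> // z w Dz Dw; rewrite !hW // -EFinB abse_EFin lee_fin; exact: Hf.
Qed.
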